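(* There exists a unique bilinear product $*$ (convolution) on $\mathcal G$ such that for every finite-dimensional real Lie algebra $\mathfrak g$ the realization map $\Re_{\mathfrak g}:(\mathcal G,* )\to(\Omega_{\mathfrak g},* )$ is a morphism of algebras, i.e. $\Re_{\mathfrak g}(\tau*\zeta)=\Re_{\mathfrak g}\tau*\Re_{\mathfrak g}\zeta$ for all $\tau,\zeta\in\mathcal G$. This product is associative, satisfies $\operatorname{Deg}(\tau*\zeta)=\operatorname{Deg}\tau+\operatorname{Deg}\zeta$ for $\operatorname{Deg}$-homogeneous $\tau,\zeta$, and satisfies the Leibniz rule $$D(\tau*\zeta)=D\tau*\zeta+(-1)^{\operatorname{Deg}\tau}\,\tau*D\zeta .$$ Moreover, $\mathcal{DTC}\subset(\mathcal G,* )$ is a convolution subalgebra.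
   Context: **The algebra $\mathcal G$.** Let $T$ be the free associative unital $\mathbb R$-algebra on $\xi,\gamma$, graded by $\deg\xi=0$, $\deg\gamma=1$, with graded commutator $[a,b]=ab-(-1)^{\deg a\deg b}ba$. Let $\mathcal A=\bigoplus_k\mathcal A_k\subset T$ be the graded Lie subalgebra generated by $\xi,\gamma$, with the differential $d$ of degree $1$ determined by $d\xi=\gamma$, $d\gamma=0$, $d[X,Y]=[dX,Y]+(-1)^{\deg X}[X,dY]$ ($\mathcal A$ is the free differential graded Lie algebra on one generator $\xi$ of degree $0$). Let $\mathcal G=\bigwedge\mathcal A$ be the graded exterior algebra: the quotient of the tensor algebra of $\mathcal A$ by the two-sided ideal generated by all $v_1\otimes v_2+(-1)^{\deg v_1\deg v_2}v_2\otimes v_1$ with $v_1,v_2\in\mathcal A$ homogeneous. It carries the additive grading $\deg$ induced from $\mathcal A$ and the wedge degree $\deg_w$ (number of wedge factors). The differential extends by $d(X\wedge Y)=dX\wedge Y+(-1)^{\deg X}X\wedge dY$; the bracket extends uniquely to $\mathcal G$ so that $[1,\cdot]=[\cdot,1]=0$, $[X\wedge Y,Z]=X\wedge[Y,Z]+(-1)^{\deg X\deg Y+\deg_wX\deg_wY}Y\wedge[X,Z]$ and $[X,Y\wedge Z]=[X,Y]\wedge Z+(-1)^{\deg Y\deg Z+\deg_wY\deg_wZ}[X,Z]\wedge Y$. The Koszul boundary operator $\partial:\mathcal G\to\mathcal G$ is the linear map with $\partial 1=0$, $\partial v=0$ and $\partial(v\wedge X)=[v,X]-v\wedge\partial X$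 for $v\in\mathcal A$, $X\in\mathcal G$. Put $\operatorname{Deg}X=\deg X-\deg_wX$, $DX=dX+(-1)^{\operatorname{Deg}X+1}\partial X$. Let $\mathcal H\subset\mathcal G$ be the span of all wedge products of elements of $\bigoplus_{j\ge1}\mathcal A_j$ (including the empty product $1$), and $\mathcal{DTC}=\{\tau\in\mathcal H:\operatorname{Deg}\tau=0,\ D\tau=0\}$. **The algebra $\Omega_{\mathfrak g}$.** For a finite-dimensional real Lie algebra $\mathfrak g$, $\Omega_{\mathfrak g}=\Omega(\mathfrak g,\bigwedge\mathfrak g)$ is the space of smooth differential forms on $\mathfrak g$ with values in $\mathbb C\otimes\bigwedge\mathfrak g$, bigraded by form degree $\deg$ and exterior degree $\deg_w$. Operations: $(\tau_1\otimes X_1)\wedge(\tau_2\otimes X_2)=(\tau_1\wedge\tau_2)\otimes(X_1\wedge X_2)$; $d(\tau\otimes X)=d\tau\otimes X$; $[\tau_1\otimes X_1,\tau_2\otimes X_2]=(\tau_1\wedge\tau_2)\otimes[X_1,X_2]$ with the Schouten–Nijenhuis bracket on $\bigwedge\mathfrak g$ (the extension of the Lie bracket of $\mathfrak g$ to $\bigwedge\mathfrak g$ by the rules $[1,\cdot]=[\cdot,1]=0$, $[X\wedge Y,Z]=X\wedge[Y,Z]+(-1)^{\deg_wX\deg_wY}Y\wedge[X,Z]$ and $[X,Y\wedge Z]=[X,Y]\wedge Z+(-1)^{\deg_wY\deg_wZ}[X,Z]\wedge Y$). The realization map $\Re_{\mathfrak g}:\mathcal G\to\Omega_{\mathfrak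 g}$ is the unique linear map preserving unit, both degrees, $\wedge$, $[\cdot,\cdot]$ and $d$ and sending $\xi$ to $\mathrm{id}\in C^\infty(\mathfrak g,\mathfrak g)$ (so $\gamma$ goes to the tautological $1$-form $d(\mathrm{id})$). **Convolution on $\Omega_{\mathfrak g}$.** For $x\in\mathfrak g$ let $x^\sharp$ be the vector field on $\mathfrak g$ with $x^\sharp|_\xi=[x,\xi]$. Let $e_1,\dots,e_n$ be a basis of $\mathfrak g$ with dual basis $e_i^*$. For $r\ge0$ put $\hat S_r(\tau\otimes\zeta)=\sum_{|K|=r}\iota_{e_K^\sharp}\tau\wedge\iota_{e_K^*}\zeta$, the sum being over subsets $K=\{k_1,\dots,k_r\}\subset\{1,\dots,n\}$, with $\iota_{e_K^\sharp}=\iota_{e_{k_1}^\sharp}\circ\cdots\circ\iota_{e_{k_r}^\sharp}$ (contraction of the form part) and $\iota_{e_K^*}=\iota_{e_{k_1}^*}\circ\cdots\circ\iota_{e_{k_r}^*}$ (contraction of the $\bigwedge\mathfrak g$ part). For $\tau$ of bidegree $(\deg,\deg_w)=(k_1,l_1)$ and $\zeta$ of bidegree $(k_2,l_2)$, $\tau*\zeta=\sum_r(-1)^{(k_2+l_2)(l_1+r)+rk_1}\hat S_r(\tau\otimes\zeta)$. (The image of $\Re_{\mathfrak g}$ consists of forms equivariant under all automorphisms of $\mathfrak g$, in particular of $\mathrm{ad}$-invariant forms $\tau$, i.e. forms with $\mathcal L_{x^\sharp}\tau=\mathrm{ad}_x\tau$ for all $x\in\mathfrak g$; the convolution preserves $\mathrm{ad}$-invariant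 forms.) *)

(* Defs.v *)
(* MathComp and MathComp-Analysis, over an arbitrary realType R. *)
From HB Require Import structures.
From mathcomp Require Import all_boot all_order all_algebra all_fingroup.
From mathcomp Require Import finmap.
From mathcomp.multinomials Require Import monalg.
From mathcomp Require Import all_classical all_reals all_analysis.
Import numFieldNormedType.Exports.
Set Implicit Arguments.
Unset Strict Implicit.
Unset Printing Implicit Defensive.
Import Order.TTheory GRing.Theory Num.Theory.
Local Open Scope classical_set_scope.
Local Open Scope quotient_scope.
Local Open Scope ring_scope.

Section ideal.
Variables (R : nzRingType) (B : lalgType R).

Inductive ideal_gen (S : set B) : B -> Prop :=
| ideal_gen0 : ideal_gen S 0
| ideal_gen_in x : S x -> ideal_gen S x
| ideal_genB x y : ideal_gen S x -> ideal_gen S y -> ideal_gen S (x - y)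
| ideal_genMl a x : ideal_gen S x -> ideal_gen S (a * x)
| ideal_genMr a x : ideal_gen S x -> ideal_gen S (x * a).

Definition ideal_pred (S : set B) : B -> bool := fun x => `[< ideal_gen S x >].

Lemma ideal_pred_zmod S : zmod_closed (ideal_pred S).
Proof.
split; first exact/asboolP/ideal_gen0.
by move=> x y /asboolP Sx /asboolP Sy; apply/asboolP/ideal_genB.
Qed.

HB.instance Definition _ S :=
  GRing.isZmodClosed.Build B (ideal_pred S) (ideal_pred_zmod S).

Definition ideal_zmod (S : set B) : zmodClosed B :=
  GRing.ZmodClosed.clone B (ideal_pred S) _.

Lemma idealP S x : reflect (ideal_gen S x) (x \in ideal_pred S).
Proof. exact: asboolP. Qed.

End ideal.

(* The hypothesis is needed because a lalgType is a nonzero ring. *)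
Definition quot_alg (R : nzRingType) (B : lalgType R) (S : set B)
    (proper : ~ ideal_gen S 1) : Type :=
  Quotient.quot (ideal_zmod S).

Section quotient_algebra.
Variables (R : nzRingType) (B : lalgType R) (S : set B).
Hypothesis proper : ~ ideal_gen S 1.
Local Notation I := (ideal_zmod S).
Local Notation Q := (quot_alg proper).

HB.instance Definition _ := GRing.Zmodule.copy Q (Quotient.quot I).

Definition quot_pi (x : B) : Q := \pi_(Quotient.quot I) x.
Definition quot_repr (x : Q) : B := generic_quotient.repr (x : Quotient.quot I).

Lemma quot_reprK x : quot_pi (quot_repr x) = x.
Proof. by rewrite /quot_pi /quot_repr reprK. Qed.

Lemma quot_piP x y : quot_pi x = quot_pi y <-> ideal_gen S (x - y).
Proof.
split=> [/eqP|Sxy]; last apply/eqP.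
  by rewrite /quot_pi -Quotient.idealrBE => /idealP.
by rewrite /quot_pi -Quotient.idealrBE; apply/idealP.
Qed.

Lemma quot_reprB x : ideal_gen S (quot_repr (quot_pi x) - x).
Proof. by apply/quot_piP; rewrite quot_reprK. Qed.

Lemma quot_piD : {morph quot_pi : x y / x + y}.
Proof. by move=> x y; rewrite /quot_pi !piE. Qed.

Definition quot_mul (x y : Q) : Q := quot_pi (quot_repr x * quot_repr y).
Definition quot_scale (a : R) (x : Q) : Q := quot_pi (a *: quot_repr x).

Lemma ideal_genD x y : ideal_gen S x -> ideal_gen S y -> ideal_gen S (x + y).
Proof.
move=> Sx Sy; rewrite -[y]opprK; apply: ideal_genB => //.
by rewrite -sub0r; apply: ideal_genB => //; apply: ideal_gen0.
Qed.

Lemma quot_piM x y : quot_mul (quot_pi x) (quot_pi y) = quot_pi (x * y).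
Proof.
apply/quot_piP; set x' := quot_repr _; set y' := quot_repr _.
rewrite (_ : _ - _ = (x' - x) * y' + x * (y' - y)); last first.
  by rewrite mulrBl mulrBr addrA subrK.
by apply: ideal_genD; [apply: ideal_genMr|apply: ideal_genMl];
  apply: quot_reprB.
Qed.

Lemma quot_piZ a x : quot_scale a (quot_pi x) = quot_pi (a *: x).
Proof.
apply/quot_piP; rewrite -scalerBr -[_ - x]mul1r scalerAl.
exact/ideal_genMl/quot_reprB.
Qed.

Let quot_ind (P : Q -> Prop) : (forall x, P (quot_pi x)) -> forall x, P x.
Proof. by move=> Ppi x; rewrite -[x]quot_reprK. Qed.

Lemma quot_mulA : associative quot_mul.
Proof. by do 3![elim/quot_ind => ?]; rewrite !quot_piM mulrA. Qed.
Lemma quot_mul1 : left_id (quot_pi 1) quot_mul.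
Proof. by elim/quot_ind => ?; rewrite quot_piM mul1r. Qed.
Lemma quot_mulr1 : right_id (quot_pi 1) quot_mul.
Proof. by elim/quot_ind => ?; rewrite quot_piM mulr1. Qed.
Lemma quot_mulDl : left_distributive quot_mul +%R.
Proof.
by do 3![elim/quot_ind => ?]; rewrite -quot_piD !quot_piM mulrDl quot_piD.
Qed.
Lemma quot_mulDr : right_distributive quot_mul +%R.
Proof.
by do 3![elim/quot_ind => ?]; rewrite -quot_piD !quot_piM mulrDr quot_piD.
Qed.
Lemma quot_1neq0 : quot_pi 1 != 0.
Proof.
have -> : 0 = quot_pi 0 by rewrite /quot_pi piE.
by apply/eqP => /quot_piP; rewrite subr0.
Qed.

HB.instance Definition _ := GRing.Zmodule_isNzRing.Build Q
  quot_mulA quot_mul1 quot_mulr1 quot_mulDl quot_mulDr quot_1neq0.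

Lemma quot_scaleA a b x :
  quot_scale a (quot_scale b x) = quot_scale (a * b) x.
Proof. by elim/quot_ind: x => x; rewrite !quot_piZ scalerA. Qed.
Lemma quot_scale1 : left_id 1 quot_scale.
Proof. by elim/quot_ind => x; rewrite quot_piZ scale1r. Qed.
Lemma quot_scaleDr : right_distributive quot_scale +%R.
Proof.
move=> a; do 2![elim/quot_ind => ?].
by rewrite -quot_piD !quot_piZ scalerDr quot_piD.
Qed.
Lemma quot_scaleDl x : {morph quot_scale^~ x : a b / a + b}.
Proof.
by elim/quot_ind: x => x a b; rewrite !quot_piZ scalerDl quot_piD.
Qed.

HB.instance Definition _ := GRing.Zmodule_isLmodule.Build R Q
  quot_scaleA quot_scale1 quot_scaleDr quot_scaleDl.

Lemma quot_scaleAl (a : R) (x y : Q) : a *: (x * y) = (a *: x) * y.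
Proof.
elim/quot_ind: x => x; elim/quot_ind: y => y.
rewrite /GRing.mul /GRing.scale /=.
by rewrite quot_piM !quot_piZ quot_piM scalerAl.
Qed.

HB.instance Definition _ := GRing.Lmodule_isLalgebra.Build R Q quot_scaleAl.

End quotient_algebra.

(* Only the data of a graded Lie algebra, as used to form its exterior algebra:
   gs_hom k is the component of degree k. *)
Record gradedSpace (R : realType) := GradedSpace {
  gs_car :> lmodType R;
  gs_hom : nat -> set gs_car;
  gs_br : gs_car -> gs_car -> gs_car }.

Section tensor_algebra.
Variables (R : realType) (V : lmodType R).
Local Notation F := {malg R[{fmonom V}]}.

Definition free_gen (v : V) : F := mkmalgU (fmu v) 1.

Definition lin_rel : set F :=
  [set z | exists a u v, z = free_gen (a *: u + v) - (a *: free_gen u + free_gen v)].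

Let counit (x : F) : R := mcoeff (mone : {fmonom V}) x.

Let counit_gen v : counit (free_gen v) = 0.
Proof.
rewrite /counit /free_gen mcoeffU; case: eqP => // /(congr1 (@fmonom_val V)).
by rewrite fmU fm1.
Qed.

Let counitM : {morph counit : x y / x * y}.
Proof. by move=> x y; rewrite /counit rmorphM. Qed.

Let lin_counit z : ideal_gen lin_rel z -> counit z = 0.
Proof.
elim=> [|x [a [u [v ->]]]|x y _ x0 _ y0|a x _ x0|a x _ x0].
- by rewrite /counit raddf0.
- by rewrite /counit raddfB raddfD/= mcoeffZ -!/(counit _) !counit_gen mulr0 addr0 subr0.
- by rewrite /counit raddfB/= -!/(counit _) x0 y0 subr0.
- by rewrite counitM x0 mulr0.
- by rewrite counitM x0 mul0r.
Qed.

Lemma lin_rel_proper : ~ ideal_gen lin_rel 1.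
Proof. by move=> /lin_counit/eqP; rewrite /counit rmorph1 oner_eq0. Qed.

Definition tensor_alg : lalgType R := quot_alg lin_rel_proper.

Definition tensor_in (v : V) : tensor_alg := quot_pi lin_rel_proper (free_gen v).

Definition tensor_counit (x : tensor_alg) : R := counit (quot_repr x).

Lemma tensor_counit_pi x : tensor_counit (quot_pi lin_rel_proper x) = counit x.
Proof.
have /lin_counit := quot_reprB lin_rel_proper x.
by rewrite /counit raddfB => /eqP; rewrite subr_eq0 => /eqP.
Qed.

Lemma tensor_counit_in v : tensor_counit (tensor_in v) = 0.
Proof. by rewrite tensor_counit_pi counit_gen. Qed.

Lemma tensor_counitB : {morph tensor_counit : x y / x - y}.
Proof.
move=> x y; rewrite -[x]quot_reprK -[y]quot_reprK.
have -> u v : quot_pi lin_rel_proper u - quot_pi lin_rel_proper v =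
    quot_pi lin_rel_proper (u - v) by rewrite /quot_pi !piE.
by rewrite !tensor_counit_pi /counit raddfB.
Qed.

Lemma tensor_counitM : {morph tensor_counit : x y / x * y}.
Proof.
move=> x y; rewrite -[x]quot_reprK -[y]quot_reprK.
have -> u v : quot_pi lin_rel_proper u * quot_pi lin_rel_proper v =
    quot_pi lin_rel_proper (u * v) by exact: quot_piM.
by rewrite !tensor_counit_pi counitM.
Qed.

Lemma tensor_counit1 : tensor_counit 1 = 1.
Proof. by rewrite [LHS]tensor_counit_pi /counit rmorph1. Qed.

End tensor_algebra.

Section graded_exterior_algebra.
Variables (R : realType) (V : gradedSpace R).

Definition ext_rel : set (tensor_alg V) :=
  [set z | exists p q u v, [/\ gs_hom p u, gs_hom q v &
    z = tensor_in u * tensor_in v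
        + (-1) ^+ (p * q) *: (tensor_in v * tensor_in u)]].

Lemma ext_rel_proper : ~ ideal_gen ext_rel 1.
Proof.
suff H z : ideal_gen ext_rel z -> tensor_counit z = 0.
  by move=> /H/eqP; rewrite tensor_counit1 oner_eq0.
elim=> [|x [p [q [u [v [_ _ ->]]]]]|x y _ x0 _ y0|a x _ x0|a x _ x0].
- by rewrite -[0]subr0 tensor_counitB subrr.
- rewrite -[X in _ + X]opprK tensor_counitB -sub0r tensor_counitB.
  rewrite -[in X in _ - X](mul1r (tensor_in v * _)) scalerAl !tensor_counitM !tensor_counit_in.
  by rewrite -[X in tensor_counit X](subrr 1) tensor_counitB !(mulr0, subrr).
- by rewrite tensor_counitB x0 y0 subr0.
- by rewrite tensor_counitM x0 mulr0.
- by rewrite tensor_counitM x0 mul0r.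
Qed.

Definition ext_alg : lalgType R := quot_alg ext_rel_proper.

Definition ext_in (v : V) : ext_alg := quot_pi ext_rel_proper (tensor_in v).

End graded_exterior_algebra.

Section linear_span.
Variables (R : realType) (E : lmodType R).

Definition lin_span (S : set E) : set E :=
  [set x | exists s : seq (R * E),
    (forall t, t \in s -> S t.2) /\ x = \sum_(t <- s) t.1 *: t.2].

Definition bilin (F H : lmodType R) (f : E -> F -> H) : Prop :=
  (forall x, linear (f x)) /\ (forall y, linear (f^~ y)).

Definition is_submodule (S : set E) : Prop :=
  S 0 /\ forall (a : R) x y, S x -> S y -> S (a *: x + y).

End linear_span.

Section exterior_operations.
Variables (R : realType) (V : gradedSpace R).
Local Notation E := (ext_alg V).
Local Notation "[ u , v ]" := (gs_br u v).

Definition bihom (p q : nat) : set E :=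
  lin_span [set X | exists s : seq (nat * V),
    [/\ forall t, t \in s -> gs_hom t.1 t.2,
        (\sum_(t <- s) t.1 = p)%N, size s = q &
        X = \prod_(t <- s) ext_in t.2]].

(* Each operation below is the unique map satisfying the rules that define it;
   the default value of [xget] is never used for the graded Lie algebras and
   linear forms considered here. *)
Definition is_ext_bracket (br : E -> E -> E) : Prop :=
  [/\ bilin br,
      forall u v : V, br (ext_in u) (ext_in v) = ext_in [u, v],
      forall X, br 1 X = 0 /\ br X 1 = 0,
      forall p1 q1 p2 q2 X Y Z, bihom p1 q1 X -> bihom p2 q2 Y ->
        br (X * Y) Z =
        X * br Y Z + (-1) ^+ (p1 * p2 + q1 * q2) *: (Y * br X Z) &
      forall p2 q2 p3 q3 X Y Z, bihom p2 q2 Y -> bihom p3 q3 Z ->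
        br X (Y * Z) =
        br X Y * Z + (-1) ^+ (p2 * p3 + q2 * q3) *: (br X Z * Y)].

Definition ext_bracket : E -> E -> E := xget (fun _ _ => 0) is_ext_bracket.

Definition is_wedge_proj (l : nat) (f : E -> E) : Prop :=
  linear f /\
  forall p q X, bihom p q X -> f X = if q == l then X else 0.

Definition wedge_proj (l : nat) : E -> E := xget (fun=> 0) (is_wedge_proj l).

(* Interior product by a linear form phi, with the sign convention in which
   iota_phi is an antiderivation acting from the left. *)
Definition is_contraction (phi : V -> R) (f : E -> E) : Prop :=
  [/\ linear f, f 1 = 0 &
      forall v X, f (ext_in v * X) = phi v *: X - ext_in v * f X].

Definition contraction (phi : V -> R) : E -> E :=
  xget (fun=> 0) (is_contraction phi).

End exterior_operations.

Section algebra_A.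
Variable R : realType.

(* The letter [false] is xi, the letter [true] is gamma. *)
Definition freeT : lalgType R := {malg R[{fmonom bool}]}.

Definition wdeg (w : {fmonom bool}) : nat := count id w.

Definition T_letter (b : bool) : freeT := mkmalgU (fmu b) 1.

(* Bilinear extension of uv - (-1)^(deg u deg v) vu from words u, v. *)
Definition T_bracket (a b : freeT) : freeT :=
  \sum_(u <- msupp a) \sum_(v <- msupp b) (mcoeff u a * mcoeff v b) *:
    (mkmalgU (mmul u v) 1 - (-1) ^+ (wdeg u * wdeg v) *: mkmalgU (mmul v u) 1).

Inductive in_A : freeT -> Prop :=
| in_A_letter b : in_A (T_letter b)
| in_A_lin (a : R) x y : in_A x -> in_A y -> in_A (a *: x + y)
| in_A_bracket x y : in_A x -> in_A y -> in_A (T_bracket x y).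

Definition A_pred : freeT -> bool := fun x => `[< in_A x >].

Lemma A_pred_submod : submod_closed A_pred.
Proof.
have A0 : in_A 0.
  by rewrite -(addNr (T_letter true)) -scaleN1r; apply: in_A_lin;
    exact: in_A_letter.
split; first exact/asboolP.
by move=> a x y /asboolP Ax /asboolP Ay; apply/asboolP/in_A_lin.
Qed.

HB.instance Definition _ :=
  GRing.isSubmodClosed.Build R freeT A_pred A_pred_submod.

Record A_carrier : Type := ACarrier { A_val : freeT; A_valP : A_pred A_val }.

HB.instance Definition _ := [isSub for A_val].
HB.instance Definition _ := [Choice of A_carrier by <:].
HB.instance Definition _ := [SubChoice_isSubLmodule of A_carrier by <:].

Lemma A_bracketP (x y : A_carrier) : A_pred (T_bracket (A_val x) (A_val y)).
Proof.
case: x y => [x /asboolP Ax] [y /asboolP Ay] /=.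
exact/asboolP/in_A_bracket.
Qed.

Definition algA : gradedSpace R := @GradedSpace R A_carrier
  (fun k x => forall w, w \in msupp (A_val x) -> wdeg w = k)
  (fun x y => ACarrier (A_bracketP x y)).

Lemma A_letterP b : A_pred (T_letter b).
Proof. exact/asboolP/in_A_letter. Qed.

Definition xi : algA := ACarrier (A_letterP false).
Definition gam : algA := ACarrier (A_letterP true).

Definition is_A_diff (f : algA -> algA) : Prop :=
  [/\ linear f,
      forall k X, gs_hom k X -> gs_hom k.+1 (f X),
      f xi = gam, f gam = 0 &
      forall k X Y, gs_hom k X ->
        f (gs_br X Y) = gs_br (f X) Y + (-1) ^+ k *: gs_br X (f Y)].

Definition A_diff : algA -> algA := xget (fun=> 0) is_A_diff.

Definition algG : lalgType R := ext_alg algA.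

Definition is_G_diff (f : algG -> algG) : Prop :=
  [/\ linear f, forall v, f (ext_in v) = ext_in (A_diff v) &
      forall p q X Y, bihom p q X ->
        f (X * Y) = f X * Y + (-1) ^+ p *: (X * f Y)].

Definition G_diff : algG -> algG := xget (fun=> 0) is_G_diff.

Definition is_koszul (f : algG -> algG) : Prop :=
  [/\ linear f, f 1 = 0, forall v, f (ext_in v) = 0 &
      forall v X,
        f (ext_in v * X) = ext_bracket (ext_in v) X - ext_in v * f X].

Definition koszul : algG -> algG := xget (fun=> 0) is_koszul.

Definition Deg_hom (k : int) : set algG :=
  lin_span [set X | exists p q, p%:Z - q%:Z = k /\ bihom p q X].

Definition is_D (f : algG -> algG) : Prop :=
  linear f /\
  forall k X, Deg_hom k X ->
    f X = G_diff X + (-1) ^ (k + 1) *: koszul X.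

Definition Dop : algG -> algG := xget (fun=> 0) is_D.

Definition A_pos : set algA :=
  lin_span [set v | exists2 j, (0 < j)%N & gs_hom j v].

Definition algH : set algG :=
  lin_span [set X | exists s : seq algA,
    (forall v, v \in s -> A_pos v) /\ X = \prod_(v <- s) ext_in v].

Definition DTC : set algG :=
  [set X | [/\ algH X, Deg_hom 0 X & Dop X = 0]].

End algebra_A.

Record lieAlgebra (R : realType) := LieAlgebra {
  lie_car :> vectType R;
  lie_br : lie_car -> lie_car -> lie_car;
  lie_brP : bilin lie_br;
  lie_alt : forall x, lie_br x x = 0;
  lie_jacobi : forall x y z,
    lie_br x (lie_br y z) + lie_br y (lie_br z x) + lie_br z (lie_br x y) = 0 }.

Section forms.
Variables (R : realType) (g : lieAlgebra R).
Local Notation n := (\dim {:g}).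

(* g placed in degree 0, so that the graded exterior algebra is the usual
   exterior algebra of g and its bracket is the Schouten-Nijenhuis bracket. *)
Definition deg0 : gradedSpace R :=
  @GradedSpace R g (fun k v => k = 0%N \/ v = 0) (@lie_br R g).

Local Notation E := (ext_alg deg0).

(* (X, Y) stands for X + iY in the complexification of the exterior algebra. *)
Local Notation EC := (E * E)%type.

Definition cplx_map (f : E -> E) (z : EC) : EC := (f z.1, f z.2).

Definition cplx_op (op : E -> E -> E) (z w : EC) : EC :=
  (op z.1 w.1 - op z.2 w.2, op z.1 w.2 + op z.2 w.1).

Definition lin_coord (x : 'rV[R]_n) : g := \sum_i x ord0 i *: (vbasis {:g})`_i.

Fixpoint Ck (k : nat) (f : 'rV[R]_n -> R) : Prop :=
  continuous f /\
  if k is k'.+1 then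
    forall v, (forall x, derivable f x v) /\ Ck k' (fun x => 'D_v f x)
  else True.

(* A function valued in a finite-dimensional space is smooth, resp. has
   directional derivative w, iff this holds after composing with every linear
   form. *)
Definition smooth (f : g -> EC) : Prop :=
  forall (phi : {linear EC -> R^o}) k, Ck k (fun x => phi (f (lin_coord x))).

Definition is_dir_derive (f : g -> EC) (v x : g) (w : EC) : Prop :=
  forall phi : {linear EC -> R^o},
    is_derive (0 : R) 1 (fun t : R => phi (f (x + t *: v))) (phi w).

Definition dir_derive (f : g -> EC) (v x : g) : EC :=
  xget 0 (is_dir_derive f v x).

(* The component of index k is a form of degree k: a function of a point and
   of k tangent vectors. *)
Definition preform : Type := forall k : nat, g -> ('I_k -> g) -> EC.

Definition is_form (w : preform) : Prop :=
  [/\ forall k x (v : 'I_k -> g) i,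
        linear (fun u => w k x (fun j => if j == i then u else v j)),
      forall k x (v : 'I_k -> g) i j, i != j -> v i = v j -> w k x v = 0 &
      forall k (v : 'I_k -> g), smooth (fun x => w k x v)].

Record form := Form { form_val :> preform; form_valP : is_form form_val }.

(* Wedge product of forms whose values are multiplied by op, normalized so that
   (a /\ b)(v, w) = op (a v) (b w) - op (a w) (b v) on 1-forms. *)
Definition form_op (op : EC -> EC -> EC) (a b : preform) : preform :=
  fun k x v => \sum_(p < k.+1) ((p`! * (k - p)`!)%:R : R)^-1 *:
    \sum_(s : 'S_k)
      let w i := v (s (cast_ord (subnKC (leq_ord p)) i)) in
      (-1) ^+ s *: op (a p x (fun i => w (lshift (k - p) i)))
                      (b (k - p)%N x (fun i => w (rshift p i))).

Definition form_wedge : preform -> preform -> preform :=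
  form_op (cplx_op *%R).

Definition form_bracket : preform -> preform -> preform :=
  form_op (cplx_op (@ext_bracket R deg0)).

Definition form_diff (w : preform) : preform := fun k =>
  match k with
  | 0 => fun _ _ => 0
  | k'.+1 => fun x v => \sum_(i < k'.+1)
      (-1) ^+ i *: dir_derive (fun y => w k' y (fun j => v (lift i j))) (v i) x
  end.

Definition preform0 (h : g -> E) : preform := fun k x _ =>
  if k is 0 then (h x, 0) else 0.

Definition form_one : preform := preform0 (fun=> 1).
Definition form_id : preform := preform0 (fun x => ext_in (x : deg0)).

Definition form_bideg (p q : nat) (w : preform) : Prop :=
  forall k x v, if k == p then bihom 0 q (w k x v).1 /\ bihom 0 q (w k x v).2
                else w k x v = 0.

Definition form_part (p q : nat) (w : preform) : preform := fun k x v =>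
  if k == p then cplx_map (wedge_proj q) (w k x v) else 0.

Definition form_iota (u : g -> g) (w : preform) : preform := fun k x v =>
  w k.+1 x (fun j => if unlift ord0 j is Some j' then v j' else u x).

Definition value_iota (phi : g -> R) (w : preform) : preform := fun k x v =>
  cplx_map (@contraction R deg0 phi) (w k x v).

Section convolution.
Variable e : n.-tuple g.

Definition S_hat (r : nat) (a b : preform) : preform := fun k x v =>
  \sum_(K : {set 'I_n} | #|K| == r)
    (form_wedge
      (foldr (fun i : 'I_n => form_iota (fun x => lie_br e`_i x)) a (enum K))
      (foldr (fun i : 'I_n => value_iota (coord e i)) b (enum K))
      : preform) k x v.

(* Forms have no components of form degree or exterior degree above n, and
   S_hat r vanishes for r > n. *)
Definition form_conv (a b : preform) : preform := fun k x v =>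
  \sum_(k1 < n.+1) \sum_(l1 < n.+1) \sum_(k2 < n.+1) \sum_(l2 < n.+1)
  \sum_(r < n.+1)
    (-1) ^+ ((k2 + l2) * (l1 + r) + r * k1) *:
      (S_hat r (form_part k1 l1 a) (form_part k2 l2 b) : preform) k x v.

End convolution.

Definition is_realization (rho : algG R -> form) : Prop :=
  (forall (a : R) X Y, rho (a *: X + Y) =
     (fun k x v => a *: (rho X : preform) k x v + (rho Y : preform) k x v)
     :> preform) /\
  (rho 1 = form_one :> preform) /\
  (forall p q X, bihom p q X -> form_bideg p q (rho X)) /\
  (forall X Y, rho (X * Y) = form_wedge (rho X) (rho Y) :> preform) /\
  (forall X Y, rho (ext_bracket X Y) =
     form_bracket (rho X) (rho Y) :> preform) /\
  (forall X, rho (G_diff X) = form_diff (rho X) :> preform) /\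
  (rho (ext_in (xi R)) = form_id :> preform).

End forms.

Section convolution_product.
Variable R : realType.

Definition is_convolution (star : algG R -> algG R -> algG R) : Prop :=
  bilin star /\
  forall (g : lieAlgebra R) (e : (\dim {:g}).-tuple g)
         (rho : algG R -> form g),
    basis_of {:g} e -> is_realization rho ->
    forall X Y, rho (star X Y) = form_conv e (rho X) (rho Y) :> preform g.

End convolution_product.

(* Main.v *)
(* A form at a fixed point is a function on lists of tangent vectors, the wedge
   product being the shuffle product.  With the signs absorbed into a twisted
   product, the convolution is obtained by applying once for each basis vector e_j
   the rule a.b + I_j(a).J_j(b), where I_j and J_j are (signed) contractions by
   e_j^# and e_j^*; its associativity is then an induction on the basis.

   Let eps = (-1)^Deg and let z in A have degree p.  In every realization
   X * z = z eps^p X - delta_z(eps^(p+1) X), where delta_z is the derivation of G,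
   of the parity of p + 1, which kills xi and maps gamma to [z, xi].  Hence X * z is
   realized by an element of G, and so is X * (z Y) by induction on the wedge degree,
   as it is (X * z) * Y up to sign and shorter products.

   The realizations are jointly faithful: over matrix Lie algebras, taking for xi and
   for the tangent vectors the matrix units along a path, an entry of the value of a
   word in xi and gamma detects that word, and contractions by such entries detect
   the elements of G.  Therefore the convolution on G is unique and inherits
   associativity.  By associativity the Leibniz rule need only be checked for X * z,
   where it amounts to [d, delta_z] = delta_(dz) - (-1)^(p+1) [z, .]. *)
Require Import Defs.
From HB Require Import structures.
From mathcomp Require Import all_boot all_order all_algebra all_fingroup.
From mathcomp Require Import finmap.
From mathcomp.multinomials Require Import monalg.
From mathcomp Require Import all_classical all_reals all_analysis.
From mathcomp Require Import ring zify.
Import numFieldNormedType.Exports.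
Set Implicit Arguments.
Unset Strict Implicit.
Unset Printing Implicit Defensive.
Import Order.TTheory GRing.Theory Num.Theory.
Local Open Scope ring_scope.
Opaque quot_mul quot_scale quot_pi.

(** The operations of the statement are chosen by [xget] among the maps obeying their defining
    rules, so each must first be shown to exist. The exterior algebra is used through one universal
    property: an action of the generators on a module that respects the relations extends. A Leibniz
    rule for D says that X acts on pairs by a triangular matrix, with X on the diagonal and D X
    below it; letting the generators act by such matrices yields derivations, contractions, the
    bracket and the boundary operator.

    It is not known beforehand that the convolution of two realized elements is realized. The
    product on G is therefore treated as a relation, tested at all points of all realizations of all
    Lie algebras at once. Associativity for forms becomes a rule that produces new instances of the
    relation, and faithfulness makes it single-valued.

    Signs depending on degrees are replaced by automorphisms such as (-1)^Deg; the identities then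
    hold between linear maps and can be checked on products of generators. *)

Section unbundled_linear.
Variables (R : nzRingType) (U W : lmodType R) (f : U -> W).
Hypothesis fl : linear f.

Lemma linf0 : f 0 = 0.
Proof.
have := fl (-1) 0 0; rewrite !scaleN1r oppr0 addr0 => E.
by rewrite E addNr.
Qed.
Lemma linfD x y : f (x + y) = f x + f y.
Proof. by rewrite -[x]scale1r fl !scale1r. Qed.
Lemma linfZ a x : f (a *: x) = a *: f x.
Proof. by rewrite -[a *: x]addr0 fl linf0 addr0. Qed.
Lemma linfN x : f (- x) = - f x.
Proof. by rewrite -scaleN1r linfZ scaleN1r. Qed.
Lemma linfB x y : f (x - y) = f x - f y.
Proof. by rewrite linfD linfN. Qed.
Lemma linf_sum (I : Type) (r : seq I) (P : pred I) (F : I -> U) :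
  f (\sum_(i <- r | P i) F i) = \sum_(i <- r | P i) f (F i).
Proof. exact: (big_morph f linfD linf0). Qed.
End unbundled_linear.

Lemma linear_comp_ub (R : nzRingType) (U W X : lmodType R) (f : W -> X) (h : U -> W) :
  linear f -> linear h -> linear (f \o h).
Proof. by move=> fl hl a u v; rewrite /= hl fl. Qed.

(** * Linear spans and bilinear maps *)

Section lin_span_theory.
Variables (R : realType) (E : lmodType R) (S : set E).

Lemma lin_span_in x : S x -> lin_span S x.
Proof.
move=> Sx; exists [:: (1, x)]; split; last by rewrite big_seq1 scale1r.
by move=> t; rewrite inE => /eqP ->.
Qed.
Lemma lin_span0 : lin_span S 0.
Proof. by exists [::]; split=> //; rewrite big_nil. Qed.
Lemma lin_spanP a x y : lin_span S x -> lin_span S y -> lin_span S (a *: x + y).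
Proof.
move=> [s [sS ->]] [t [tS ->]].
exists ([seq (a * u.1, u.2) | u <- s] ++ t); split.
  by move=> u; rewrite mem_cat => /orP[/mapP[v vs ->]|/tS//]; apply: sS vs.
rewrite big_cat big_map scaler_sumr; congr (_ + _).
by apply: eq_bigr => i _; rewrite scalerA.
Qed.
Lemma lin_spanD x y : lin_span S x -> lin_span S y -> lin_span S (x + y).
Proof. by move=> Sx Sy; rewrite -[x]scale1r; apply: lin_spanP. Qed.
Lemma lin_spanZ a x : lin_span S x -> lin_span S (a *: x).
Proof. by move=> Sx; rewrite -[_ *: _]addr0; apply/lin_spanP/lin_span0. Qed.
Lemma lin_spanN x : lin_span S x -> lin_span S (- x).
Proof. by move=> Sx; rewrite -scaleN1r; apply: lin_spanZ. Qed.
Lemma lin_spanB x y : lin_span S x -> lin_span S y -> lin_span S (x - y).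
Proof. by move=> Sx Sy; apply: lin_spanD => //; apply: lin_spanN. Qed.
Lemma lin_span_sum (I : eqType) (r : seq I) (F : I -> E) :
  (forall i, i \in r -> lin_span S (F i)) -> lin_span S (\sum_(i <- r) F i).
Proof.
elim: r => [|i r IH] H; first by rewrite big_nil; apply: lin_span0.
rewrite big_cons; apply: lin_spanD; first by apply: H; rewrite mem_head.
by apply: IH => j jr; apply: H; rewrite inE jr orbT.
Qed.

Lemma lin_span_ind (P : E -> Prop) : P 0 ->
  (forall a x y, S x -> P y -> P (a *: x + y)) -> forall x, lin_span S x -> P x.
Proof.
move=> P0 PD x [s [sS ->]]; elim: s sS => [|u s IH] sS; first by rewrite big_nil.
rewrite big_cons; apply: PD; first by apply: sS; rewrite mem_head.
by apply: IH => v vs; apply: sS; rewrite inE vs orbT.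
Qed.
End lin_span_theory.

Lemma lin_span_sub (R : realType) (E : lmodType R) (S T : set E) :
  (forall x, S x -> lin_span T x) -> forall x, lin_span S x -> lin_span T x.
Proof.
move=> ST; apply: lin_span_ind; first exact: lin_span0.
by move=> a x y /ST Tx Ty; apply: lin_spanP.
Qed.

Lemma lin_span_map (R : realType) (E F : lmodType R) (S : set E) (T : set F) f :
  linear f -> (forall x, S x -> lin_span T (f x)) ->
  forall x, lin_span S x -> lin_span T (f x).
Proof.
move=> fl ST; apply: lin_span_ind; first by rewrite (linf0 fl); apply: lin_span0.
by move=> a x y /ST Tx Ty; rewrite fl; apply: lin_spanP.
Qed.

Section bilinear_span.
Variables (R : realType) (U V W : lmodType R) (f : U -> V -> W).
Hypothesis fb : bilin f.

Lemma bilinl y : linear (f^~ y). Proof. exact: fb.2. Qed.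
Lemma bilinr x : linear (f x). Proof. exact: fb.1. Qed.
Lemma bilin0l y : f 0 y = 0. Proof. exact: (linf0 (bilinl y)). Qed.
Lemma bilin0r x : f x 0 = 0. Proof. exact: (linf0 (bilinr x)). Qed.
Lemma bilinDl x x' y : f (x + x') y = f x y + f x' y.
Proof. exact: (linfD (bilinl y)). Qed.
Lemma bilinDr x y y' : f x (y + y') = f x y + f x y'.
Proof. exact: (linfD (bilinr x)). Qed.
Lemma bilinBl x x' y : f (x - x') y = f x y - f x' y.
Proof. exact: (linfB (bilinl y)). Qed.
Lemma bilinZl a x y : f (a *: x) y = a *: f x y.
Proof. exact: (linfZ (bilinl y)). Qed.
Lemma bilinZr a x y : f x (a *: y) = a *: f x y.
Proof. exact: (linfZ (bilinr x)). Qed.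
Lemma bilinNl x y : f (- x) y = - f x y.
Proof. exact: (linfN (bilinl y)). Qed.
Lemma bilinNr x y : f x (- y) = - f x y.
Proof. exact: (linfN (bilinr x)). Qed.
Lemma bilin_suml (I : Type) (r : seq I) (P : pred I) (F : I -> U) y :
  f (\sum_(i <- r | P i) F i) y = \sum_(i <- r | P i) f (F i) y.
Proof. exact: (linf_sum (bilinl y)). Qed.
Lemma bilin_sumr (I : Type) (r : seq I) (P : pred I) (F : I -> V) x :
  f x (\sum_(i <- r | P i) F i) = \sum_(i <- r | P i) f x (F i).
Proof. exact: (linf_sum (bilinr x)). Qed.

Lemma bilin_span (S : set U) (T : set V) (S' : set W) :
  (forall x y, S x -> T y -> lin_span S' (f x y)) ->
  forall x y, lin_span S x -> lin_span T y -> lin_span S' (f x y).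
Proof.
move=> H x y Sx Ty; elim/lin_span_ind: x / Sx => [|a x x' Sx IH].
  by rewrite bilin0l; apply: lin_span0.
rewrite (bilinl y a x x'); apply: lin_spanP => //.
elim/lin_span_ind: y / Ty {IH} => [|b y y' Ty IH].
  by rewrite bilin0r; apply: lin_span0.
by rewrite (bilinr x b y y'); apply: lin_spanP => //; apply: H.
Qed.
End bilinear_span.

(** * Free, tensor and exterior algebras through their universal properties *)

Section free_module.
Variables (R : realType) (K : choiceType).
Implicit Types x y : {malg R[K]}.

Definition lext (M : lmodType R) (phi : K -> M) x : M :=
  \sum_(k <- msupp x) mcoeff k x *: phi k.

Lemma lextEw (M : lmodType R) (phi : K -> M) (d : {fset K}) x : (msupp x `<=` d)%fset ->
  lext phi x = \sum_(k <- d) mcoeff k x *: phi k.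
Proof.
move=> le; rewrite [LHS](big_fset_incl _ le) => //= k kd /mcoeff_outdom ->.
by rewrite scale0r.
Qed.

Lemma lextU (M : lmodType R) (phi : K -> M) k : lext phi (mkmalgU k 1) = phi k.
Proof. by rewrite (lextEw _ msuppU_le) big_seq_fset1 mcoeffUU scale1r. Qed.

Lemma lext_linear (M : lmodType R) (phi : K -> M) : linear (lext phi).
Proof.
move=> a x y; pose d := (msupp (a *: x + y) `|` (msupp x `|` msupp y))%fset.
rewrite !(lextEw phi (d := d)) /d ?fsubsetUl //; last 2 first.
- by rewrite fsetUA fsubsetUr.
- by rewrite fsetUCA fsubsetUl.
rewrite scaler_sumr -big_split; apply: eq_bigr => k _ /=.
by rewrite mcoeffD mcoeffZ scalerDl scalerA.
Qed.

Lemma malg_ind (P : {malg R[K]} -> Prop) : P 0 ->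
  (forall a k y, P y -> P (a *: mkmalgU k 1 + y)) -> forall x, P x.
Proof.
move=> P0 PD x; rewrite [x]monalgE; elim: (enum_fset (msupp x)) => [|k s IH].
  by rewrite big_nil.
rewrite big_cons (_ : mkmalgU k _ = mcoeff k x *: mkmalgU k 1); first exact: PD.
by apply/malgP => k'; rewrite mcoeffZ !mcoeffU mulrnAr mulr1.
Qed.

End free_module.

(* The operations of the concrete free algebras and of their quotients have huge
   normal forms, so the theory is developed over abstract algebras subject to
   specifications. *)
Definition gword (R : realType) (I : Type) (F : lalgType R) (gen : I -> F) (s : seq I) : F :=
  \prod_(i <- s) gen i.

(** An [lalgType] only provides a(xy) = (ax)y; this is the other half of the compatibility of
    scalars with products in an associative algebra. *)
Definition scale_central (R : realType) (F : lalgType R) : Prop :=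
  forall (a : R) (x y : F), a *: (x * y) = x * (a *: y).

(** The words are a basis: [free_ind] says that they span, and [free_ext], which prescribes a linear
    map on them at will, that they are independent. *)
Record free_spec (R : realType) (I : Type) (F : lalgType R) (gen : I -> F) : Prop := {
  free_scAr : scale_central F;
  free_ind : forall P : F -> Prop, P 0 ->
    (forall a s y, P y -> P (a *: gword gen s + y)) -> forall x, P x;
  free_ext : forall (M : lmodType R) (phi : seq I -> M),
    exists f : F -> M, linear f /\ forall s, f (gword gen s) = phi s }.

Lemma scale_central_words (R : realType) (I : Type) (A : lalgType R) (w : seq I -> A) :
  (forall P : A -> Prop, P 0 -> (forall a s y, P y -> P (a *: w s + y)) -> forall x, P x) ->
  (forall a s t, w s * (a *: w t) = a *: (w s * w t)) -> scale_central A.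
Proof.
move=> ind scw a x y.
elim/ind: x => [|b s x IH]; first by rewrite !mul0r scaler0.
rewrite !mulrDl scalerDr IH; congr (_ + _) => {x IH}.
elim/ind: y => [|c t y IH]; first by rewrite !(scaler0, mulr0).
rewrite !(mulrDr, scalerDr) IH -!scalerAl; congr (_ + _).
by rewrite !scalerA !scw !scalerA mulrCA mulrA.
Qed.

Section malg_free.
Variables (R : realType) (I : choiceType).
Local Notation F := {malg R[{fmonom I}]}.
Let gen (i : I) : F := mkmalgU (fmu i) 1.

Lemma gword_malg s : gword gen s = mkmalgU (FMonom s) 1.
Proof.
elim: s => [|i s IH]; first by rewrite /gword big_nil -fmoneE.
rewrite /gword big_cons -/(gword gen s) IH malgM_def fgmulUU mulr1; congr mkmalgU.
by rewrite /mmul /= fmmulE fmuE.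
Qed.

Lemma malg_scale_word (a : R) s t :
  mkmalgU (FMonom s) 1 * (a *: mkmalgU (FMonom t) 1) =
  a *: (mkmalgU (FMonom s) 1 * mkmalgU (FMonom t) 1) :> F.
Proof.
have H (c : R) (r : {fmonom I}) : c *: mkmalgU r 1 = mkmalgU r c :> F.
  apply/malgP => k; rewrite (mcoeffZ c (mkmalgU r 1) k) (mcoeffU r 1 k) (mcoeffU r c k).
  by rewrite mulrnAr mulr1.
rewrite (H a) (malgM_def (mkmalgU (FMonom s) 1) (mkmalgU (FMonom t) 1)).
by rewrite malgM_def (fgmulUU 1 a) (fgmulUU 1 1) mulr1 mul1r -(H a).
Qed.

Lemma malg_free_spec : free_spec gen.
Proof.
have ind (P : F -> Prop) : P 0 ->
    (forall a s y, P y -> P (a *: gword gen s + y)) -> forall x, P x.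
  by move=> P0 PD; apply: malg_ind => // a k y; rewrite -{1}[k]fmK -gword_malg; apply: PD.
have scw := malg_scale_word.
split=> //; last first.
  move=> M phi; exists (lext (fun w : {fmonom I} => phi w)); split; first exact: lext_linear.
  by move=> s; rewrite gword_malg lextU.
move: ind scw; set w := gword gen => ind scw.
have {scw} scw a s t : w s * (a *: w t) = a *: (w s * w t) by rewrite /w !gword_malg scw.
exact: scale_central_words ind scw.
Qed.
End malg_free.

Lemma mul_bilin (R : realType) (B : lalgType R) : scale_central B -> bilin (@GRing.mul B).
Proof.
move=> scAr; split=> [x a u v|y a u v]; first by rewrite mulrDr scAr.
by rewrite mulrDl scalerAl.
Qed.

Section free_theory.
Variables (R : realType) (I : Type) (F : lalgType R) (gen : I -> F).
Hypothesis FS : free_spec gen.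
Local Notation word := (gword gen).

Lemma gword_nil : word [::] = 1. Proof. by rewrite /gword big_nil. Qed.
Lemma gword_cons i s : word (i :: s) = gen i * word s. Proof. by rewrite /gword big_cons. Qed.
Lemma gword1 i : word [:: i] = gen i. Proof. by rewrite gword_cons gword_nil mulr1. Qed.
Lemma gword_cat s t : word (s ++ t) = word s * word t. Proof. by rewrite /gword big_cat. Qed.

Lemma word_lin_ext (M : lmodType R) (f g : F -> M) :
  linear f -> linear g -> (forall s, f (word s) = g (word s)) -> f =1 g.
Proof.
move=> fl gl H; elim/(free_ind FS) => [|a s y IH]; first by rewrite !linf0.
by rewrite fl gl H IH.
Qed.

Lemma free_mul_bilin : bilin (@GRing.mul F).
Proof. exact/mul_bilin/(free_scAr FS). Qed.

Lemma word_bilin_ext (M : lmodType R) (f g : F -> F -> M) :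
  bilin f -> bilin g -> (forall s t, f (word s) (word t) = g (word s) (word t)) ->
  forall x y, f x y = g x y.
Proof.
move=> fb gb H x y; move: x; apply: word_lin_ext; [exact: bilinl|exact: bilinl|].
by move=> s; move: y; apply: word_lin_ext; [exact: bilinr|exact: bilinr|].
Qed.

(** For each [m] the map is prescribed on words by letting the letters act in turn; linearity in [m]
    and multiplicativity then need checking on words only. *)
Lemma free_act_ex (M : lmodType R) (act : I -> M -> M) : (forall i, linear (act i)) ->
  exists Act : F -> M -> M,
   [/\ bilin Act, forall s m, Act (word s) m = foldr act m s,
       forall i m, Act (gen i) m = act i m &
       forall x y m, Act (x * y) m = Act x (Act y m)].
Proof.
move=> al.
have [Act AE] := boolp.choice (P := fun m (f : F -> M) => linear f /\ forall s, f (word s) = foldr act m s)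
  (fun m => free_ext FS (fun s => foldr act m s)).
have Al m := (AE m).1; have Aw m := (AE m).2.
have fb : bilin (fun x => Act^~ x).
  split=> [x|m]; last exact: Al.
  move=> a m m'; move: x; apply: word_lin_ext => //.
    by move=> b x y; rewrite !Al scalerDr !scalerDr !scalerA [a * b]mulrC addrACA.
  move=> s; rewrite !Aw.
  by elim: s => //= i s ->; rewrite al.
exists (fun x => Act^~ x); split=> // [i m|x y m]; first by rewrite -gword1 Aw.
move: x y; apply: word_bilin_ext.
- split=> [x a u v|y a u v]; first by rewrite (bilinr free_mul_bilin) (bilinl fb).
  by rewrite (bilinl free_mul_bilin) (bilinl fb).
- split=> [x a u v|y a u v]; last by rewrite (bilinl fb).
  by rewrite (bilinl fb) (bilinr fb).
by move=> s t; rewrite -gword_cat !Aw foldr_cat.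
Qed.
End free_theory.

Section quotient_scale.
Variables (R : realType) (B : lalgType R) (S : set B) (pr : ~ ideal_gen S 1).

Lemma quot_pi_linear : linear (quot_pi pr : B -> quot_alg pr).
Proof.
move=> a x y; rewrite quot_piD; congr (_ + _).
by rewrite -(quot_piZ pr a x).
Qed.

Lemma quot_pi_mul (x y : B) : quot_pi pr (x * y) = (quot_pi pr x : quot_alg pr) * quot_pi pr y.
Proof. by rewrite -(quot_piM pr). Qed.

Lemma quot_pi_ind (P : quot_alg pr -> Prop) :
  (forall x, P (quot_pi pr x)) -> forall x, P x.
Proof. by move=> H x; rewrite -[x]quot_reprK. Qed.

Lemma quot_pi_rel z : S z -> quot_pi pr z = 0 :> quot_alg pr.
Proof.
move=> Sz; rewrite -(linf0 quot_pi_linear); apply/(quot_piP pr).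
by rewrite subr0; apply: ideal_gen_in.
Qed.

Lemma quot_scaleAr : scale_central B -> scale_central (quot_alg pr).
Proof.
move=> H a; elim/quot_pi_ind => x; elim/quot_pi_ind => y.
by rewrite -quot_pi_mul -!(linfZ quot_pi_linear) -quot_pi_mul H.
Qed.

(** The quotient acts through representatives. The choice does not matter because the elements
    acting by zero on all of [M] absorb products on both sides, so they contain the ideal as soon as
    they contain [S]. *)
Lemma quot_act_ex (M : lmodType R) (Act : B -> M -> M) :
  (forall x, linear (Act x)) -> (forall m, linear (Act^~ m)) ->
  (forall x y m, Act (x * y) m = Act x (Act y m)) ->
  (forall x m, S x -> Act x m = 0) ->
  exists Q : quot_alg pr -> M -> M, [/\ forall x m, Q (quot_pi pr x) m = Act x m,
    bilin Q & forall x y m, Q (x * y) m = Q x (Q y m)].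
Proof.
move=> lr ll AM A0; pose Q (x : quot_alg pr) := Act (quot_repr x); exists Q.
suff QE x m : Q (quot_pi pr x) m = Act x m.
  split=> //; first split=> [x a m m'|m a].
  - by elim/quot_pi_ind: x => x; rewrite !QE lr.
  - elim/quot_pi_ind => x; elim/quot_pi_ind => y.
    by rewrite -quot_pi_linear !QE ll.
  - elim/quot_pi_ind => x; elim/quot_pi_ind => y m.
    by rewrite -quot_pi_mul !QE AM.
have I0 z : ideal_gen S z -> forall m, Act z m = 0.
  elim=> [{}m|u Su {}m|u v _ u0 _ v0 {}m|a u _ u0 {}m|a u _ u0 {}m].
  - exact: (linf0 (ll m)).
  - exact: A0.
  - by rewrite (linfB (ll m)) u0 v0 subrr.
  - by rewrite AM u0 (linf0 (lr a)).
  - by rewrite AM u0.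
apply/eqP; rewrite -subr_eq0 -(linfB (ll m)); apply/eqP.
exact/I0/quot_reprB.
Qed.
End quotient_scale.

Record tensor_spec (R : realType) (V : lmodType R) (T : lalgType R) (tin : V -> T) : Prop := {
  tensor_scAr : scale_central T;
  tensor_lin : linear tin;
  tensor_ind : forall P : T -> Prop, P 0 ->
    (forall a s y, P y -> P (a *: gword tin s + y)) -> forall x, P x;
  tensor_act_ex : forall (M : lmodType R) (act : V -> M -> M), bilin act ->
  exists Act : T -> M -> M,
   [/\ bilin Act, forall m, Act 1 m = m, forall v m, Act (tin v) m = act v m &
       forall X Y m, Act (X * Y) m = Act X (Act Y m)] }.

(** The universal property is stated for actions on modules and not for algebra morphisms, because
    most operators on the exterior algebra will be read off from an action on pairs or on functions.
    Morphisms are recovered in [ext_hom_ex]. *)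
Record ext_spec (R : realType) (V : gradedSpace R) (E : lalgType R) (inn : V -> E) : Prop := {
  ext_scAr : scale_central E;
  ext_lin : linear inn;
  ext_anticomm : forall p q (u v : V), gs_hom p u -> gs_hom q v ->
    inn u * inn v = - ((-1) ^+ (p * q) *: (inn v * inn u));
  ext_gen_ind : forall P : E -> Prop, P 0 ->
    (forall a s y, P y -> P (a *: gword inn s + y)) -> forall x, P x;
  ext_act_ex : forall (M : lmodType R) (act : V -> M -> M), bilin act ->
  (forall p q u v m, gs_hom p u -> gs_hom q v ->
     act u (act v m) + (-1) ^+ (p * q) *: act v (act u m) = 0) ->
  exists Act : E -> M -> M,
   [/\ bilin Act, forall m, Act 1 m = m, forall v m, Act (inn v) m = act v m &
       forall X Y m, Act (X * Y) m = Act X (Act Y m)] }.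

Lemma gword_pi (R : realType) (I : Type) (B : lalgType R) (S : set B) (pr : ~ ideal_gen S 1)
    (gen : I -> B) s :
  quot_pi pr (gword gen s) = gword (fun i => quot_pi pr (gen i) : quot_alg pr) s.
Proof.
elim: s => [|i s IH]; first by rewrite /gword !big_nil.
by rewrite gword_cons quot_pi_mul IH [RHS]gword_cons.
Qed.

Section tensor_of_free.
Variables (R : realType) (V : lmodType R) (F : lalgType R) (gen : V -> F).
Hypothesis FS : free_spec gen.
Let S : set F :=
  [set z | exists a u v, z = gen (a *: u + v) - (a *: gen u + gen v)]%classic.
Variable pr : ~ ideal_gen S 1.

Lemma tensor_spec_quot : tensor_spec (fun v => quot_pi pr (gen v) : quot_alg pr).
Proof.
split.
- exact: quot_scaleAr (free_scAr FS).
- move=> a u v.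
  have : quot_pi pr (gen (a *: u + v) - (a *: gen u + gen v)) = 0 :> quot_alg pr.
    by apply: quot_pi_rel; exists a, u, v.
  rewrite (linfB (quot_pi_linear pr) (gen _)) (quot_pi_linear pr a (gen u)) => /eqP.
  by rewrite subr_eq0 => /eqP.
- move=> P P0 PD; elim/quot_pi_ind => x; elim/(free_ind FS): x => [|a s y IH].
    by rewrite (linf0 (quot_pi_linear pr)).
  by rewrite (quot_pi_linear pr) gword_pi; apply: PD.
move=> M act ab.
have [A0 [fb fw g AM0]] := free_act_ex FS (bilinr ab).
have [|||x m [a [u [v ->]]]|A [AE Ab AM]] := quot_act_ex pr (Act := A0).
- exact: (bilinr fb).
- exact: (bilinl fb).
- exact: AM0.
- by rewrite (bilinBl fb) (bilinl fb m a (gen u)) !g (bilinl ab) subrr.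
exists A; split=> // [m|v m]; last by rewrite AE g.
by rewrite [A 1 m](AE 1 m) -(gword_nil gen) fw.
Qed.
End tensor_of_free.

Section ext_of_tensor.
Variables (R : realType) (V : gradedSpace R) (T : lalgType R) (tin : V -> T).
Hypothesis TS : tensor_spec tin.
Let S : set T :=
  [set z | exists p q u v, [/\ gs_hom p u, gs_hom q v &
    z = tin u * tin v + (-1) ^+ (p * q) *: (tin v * tin u)]]%classic.
Variable pr : ~ ideal_gen S 1.

Lemma ext_spec_quot : ext_spec (fun v => quot_pi pr (tin v) : quot_alg pr).
Proof.
split.
- exact: quot_scaleAr (tensor_scAr TS).
- by move=> a u v; rewrite (tensor_lin TS) (quot_pi_linear pr).
- move=> p q u v hu hv.
  have : quot_pi pr (tin u * tin v + (-1) ^+ (p * q) *: (tin v * tin u)) = 0 :> quot_alg pr.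
    by apply: quot_pi_rel; exists p, q, u, v.
  rewrite quot_piD (linfZ (quot_pi_linear pr)) !quot_pi_mul => /eqP.
  by rewrite addr_eq0 => /eqP.
- move=> P P0 PD; elim/quot_pi_ind => x; elim/(tensor_ind TS): x => [|a s y IH].
    by rewrite (linf0 (quot_pi_linear pr)).
  by rewrite (quot_pi_linear pr) gword_pi; apply: PD.
move=> M act ab rel; have [A1 [A1b A11 A1g A1M]] := tensor_act_ex TS ab.
have [|||x m [p [q [u [v [hu hv ->]]]]]|A [AE Ab AM]] := quot_act_ex pr (Act := A1).
- exact: bilinr.
- exact: bilinl.
- exact: A1M.
- by rewrite (bilinDl A1b) (bilinZl A1b) !A1M !A1g; apply: rel.
exists A; split=> // [m|v m]; last by rewrite AE A1g.
by rewrite [A 1 m](AE 1 m) A11.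
Qed.
End ext_of_tensor.

Lemma ext_alg_spec (R : realType) (V : gradedSpace R) : ext_spec (@ext_in R V).
Proof. exact: (ext_spec_quot (tensor_spec_quot (malg_free_spec R V) (@lin_rel_proper R V))). Qed.

Definition homog_spanned (R : realType) (V : gradedSpace R) : Prop :=
  forall v : V, exists s : seq (nat * V),
     (forall t, t \in s -> gs_hom t.1 t.2) /\ v = \sum_(t <- s) t.2.

Section exterior_theory.
Variables (R : realType) (V : gradedSpace R) (E : lalgType R) (inn : V -> E).
Hypotheses (ES : ext_spec inn) (hsp : homog_spanned V).

Lemma ext_mul_bilin : bilin (@GRing.mul E).
Proof. exact/mul_bilin/(ext_scAr ES). Qed.

(** The leading factor may be taken homogeneous, which is where the sign rules apply. *)
Lemma ext_ind (P : E -> Prop) : P 0 -> (forall a x y, P x -> P y -> P (a *: x + y)) -> P 1 ->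
  (forall p (v : V) X, gs_hom p v -> P X -> P (inn v * X)) -> forall X, P X.
Proof.
move=> P0 PL P1 PM; apply: (ext_gen_ind ES) => // a s y Py; apply: (PL) => //.
elim: s => [|v s IH]; first by rewrite gword_nil.
rewrite gword_cons; have [t [ht ->]] := hsp v.
rewrite (linf_sum (ext_lin ES)) mulr_suml.
elim: t ht => [|u t IHt] ht; first by rewrite big_nil.
rewrite big_cons -[_ * _]scale1r; apply: (PL).
  by apply: (PM u.1) => //; apply: ht; rewrite mem_head.
by apply: IHt => w wt; apply: ht; rewrite inE wt orbT.
Qed.

Lemma ext_lin_ind (M : lmodType R) (f g : E -> M) : linear f -> linear g -> f 1 = g 1 ->
  (forall p (v : V) X, gs_hom p v -> f X = g X -> f (inn v * X) = g (inn v * X)) -> f =1 g.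
Proof.
move=> fl gl H1 HM X; elim/ext_ind: X => [|a x y IHx IHy||p v X hv IH] //.
- by rewrite !linf0.
- by rewrite fl gl IHx IHy.
- exact: HM hv IH.
Qed.
End exterior_theory.

(** * Identities in modules *)

(* A decision procedure for identities between linear combinations in a module,
   up to identities between their coefficients. *)
Section module_reflection.
Variables (R : comNzRingType) (V : lmodType R).

Inductive mexp := MVar of nat | MAdd of mexp & mexp | MOpp of mexp | MZero | MScale of R & mexp.

Fixpoint meval (env : seq V) (e : mexp) : V :=
  match e with
  | MVar n => nth 0 env n
  | MAdd a b => meval env a + meval env b
  | MOpp a => - meval env a
  | MZero => 0
  | MScale c a => c *: meval env a
  end.

Fixpoint mcoef (e : mexp) (n : nat) : R :=
  match e with
  | MVar k => if eqn k n then 1 else 0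
  | MAdd a b => mcoef a n + mcoef b n
  | MOpp a => - mcoef a n
  | MZero => 0
  | MScale c a => c * mcoef a n
  end.

Lemma mevalE env e : meval env e = \sum_(i < size env) mcoef e i *: nth 0 env i.
Proof.
elim: e => /= [n|a -> b ->|a ->||c a ->].
- have [ltn|gen] := ltnP n (size env); last first.
    rewrite nth_default // big1 // => i _; case: eqnP => [ni|_]; last by rewrite scale0r.
    by have := ltn_ord i; rewrite -ni ltnNge gen.
  rewrite (bigD1 (Ordinal ltn)) //= (_ : eqn n n = true) ?scale1r; last exact/eqnP.
  rewrite big1 ?addr0 // => i; rewrite -val_eqE /= => ni.
  by case: eqnP ni => [->|_]; rewrite ?eqxx ?scale0r.
- by rewrite -big_split; apply: eq_bigr => i _; rewrite scalerDl.
- by rewrite -sumrN; apply: eq_bigr => i _; rewrite scaleNr.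
- by rewrite big1 // => i _; rewrite scale0r.
- by rewrite scaler_sumr; apply: eq_bigr => i _; rewrite scalerA.
Qed.

Fixpoint mall (k : nat) (e1 e2 : mexp) : Prop :=
  match k with 0 => True | k'.+1 => mcoef e1 k' = mcoef e2 k' /\ mall k' e1 e2 end.

Lemma meval_eq env e1 e2 : mall (size env) e1 e2 -> meval env e1 = meval env e2.
Proof.
move=> H; rewrite !mevalE; apply: eq_bigr => i _; congr (_ *: _).
elim: (size env) H (i : nat) (ltn_ord i) => // k IH [Hk H] j.
by rewrite ltnS leq_eqVlt => /orP[/eqP ->|/(IH H)].
Qed.
End module_reflection.

Ltac m_same x y := match constr:(tt) with
  | _ => let _ := match constr:(tt) with _ => constr_eq_nounivs x y end in constr:(true)
  | _ => let _ := match constr:(tt) with _ => unify x y end in constr:(true)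
  | _ => constr:(false) end.
Ltac m_mem x l := lazymatch l with
  | nil => constr:(false)
  | cons ?y ?l' => let b := m_same x y in
    lazymatch b with true => constr:(true) | false => m_mem x l' end
  end.
Ltac m_idx x l := lazymatch l with
  | cons ?y ?l' => let b := m_same x y in
    lazymatch b with true => constr:(0%N) | false => let i := m_idx x l' in constr:(S i) end
  end.
Ltac m_atoms e l := lazymatch e with
  | @GRing.add _ ?a ?b => let l1 := m_atoms a l in m_atoms b l1
  | @GRing.opp _ ?a => m_atoms a l
  | @GRing.zero _ => l
  | @GRing.scale _ _ _ ?a => m_atoms a l
  | _ => let b := m_mem e l in lazymatch b with true => l | false => constr:(cons e l) end
  end.
Ltac m_reify R l e := lazymatch e with
  | @GRing.add _ ?a ?b => let x := m_reify R l a in let y := m_reify R l b in constr:(@MAdd R x y)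
  | @GRing.opp _ ?a => let x := m_reify R l a in constr:(@MOpp R x)
  | @GRing.zero _ => constr:(@MZero R)
  | @GRing.scale _ _ ?c ?a => let x := m_reify R l a in constr:(@MScale R c x)
  | _ => let i := m_idx e l in constr:(@MVar R i)
  end.
Ltac module_with R V := lazymatch goal with |- ?x = ?y =>
  let l0 := constr:(@nil V) in
  let l1 := m_atoms x l0 in let l := m_atoms y l1 in
  let ex := m_reify R l x in let ey := m_reify R l y in
  apply: (@meval_eq R _ l ex ey); repeat split; rewrite /mcoef /=; try ring
  end.

Lemma pair_ext (A B : Type) (x y : A * B) : x.1 = y.1 -> x.2 = y.2 -> x = y.
Proof. by case: x y => [a b] [c d] /= -> ->. Qed.

Lemma fct_ext (A B : Type) (f g : A -> B) : (forall x, f x = g x) -> f = g.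
Proof. by move=> H; apply: funext. Qed.

Lemma signr_eq (R : pzRingType) m n : odd m = odd n -> (-1) ^+ m = (-1) ^+ n :> R.
Proof. by move=> e; rewrite -signr_odd e signr_odd. Qed.

Ltac odds := rewrite ?(oddD, oddM, oddS, oddb, odd_double, mul1n, mul0n, muln1, muln0, add0n, addn0) /=.

(** * Derivations, contractions and brackets on exterior algebras *)

(** The linear operator (-1)^deg in [gl_sgn] expresses that the even and the odd part of [V] are
    independent; without it the signs below would not define linear maps. *)
Record glie (R : realType) (V : gradedSpace R) : Prop := {
  gl_br : bilin (@gs_br R V);
  gl_hom : forall p q u v, gs_hom p u -> gs_hom q v -> gs_hom (p + q) (gs_br (g := V) u v);
  gl_span : homog_spanned V;
  gl_anti : forall p q u v, gs_hom p u -> gs_hom q v ->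
    gs_br (g := V) u v = - ((-1) ^+ (p * q) *: gs_br v u);
  gl_sgn : exists sg : V -> V, linear sg /\ forall k v, gs_hom k v -> sg v = (-1) ^+ k *: v }.

Section operators.
Variables (R : realType) (V : gradedSpace R) (E : lalgType R) (inn : V -> E).

(** [bihom] over an abstract specification of the exterior algebra; the two are convertible for
    [ext_in]. In the same way [gis_ext_bracket], [gis_wedge_proj], [gis_koszul], [gDeg] and [gH]
    mirror the notions of the statement. *)
Definition gbihom (p q : nat) : set E :=
  lin_span [set X | exists s : seq (nat * V),
    [/\ forall t, t \in s -> gs_hom t.1 t.2,
        (\sum_(t <- s) t.1 = p)%N, size s = q &
        X = \prod_(t <- s) inn t.2]]%classic.

Definition is_sign_op (a b : bool) (f : E -> E) : Prop :=
  [/\ linear f, f 1 = 1, forall X Y, f (X * Y) = f X * f Y &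
      forall k v, gs_hom k v -> f (inn v) = (-1) ^+ (a * k + b) *: inn v].

(* The automorphism (-1)^(a deg + b deg_w). *)
Definition sgop (a b : bool) : E -> E := xget (fun X : E => X) (is_sign_op a b).

(** The sign rule under which [f] extends to a derivation of parity [s]. It constrains [inn (f v)]
    and not the degree of [f v], so that it also covers [v, .] for an inhomogeneous [v] of one
    parity. *)
Definition parity_shift (s : bool) (f : V -> V) : Prop :=
  linear f /\ forall k v l w, gs_hom k v -> gs_hom l w ->
    inn (f v) * inn w = - ((-1) ^+ ((k + s) * l) *: (inn w * inn (f v))).

Lemma parity_shiftP (d : nat) f : ext_spec inn -> linear f ->
  (forall k v, gs_hom k v -> exists2 k', odd k' = odd (k + d) & gs_hom k' (f v)) ->
  parity_shift (odd d) f.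
Proof.
move=> ES fl H; split=> // k v l w hv hw; have [k' e hk'] := H _ _ hv.
rewrite (ext_anticomm ES hk' hw); congr (- (_ *: _)); apply: signr_eq.
by rewrite !oddM e !oddD oddb.
Qed.

(** The sign involves [deg] but not [deg_w], since such a D keeps the number of wedge factors. *)
Definition is_deriv (s : bool) (f : V -> V) (D : E -> E) : Prop :=
  [/\ linear D, D 1 = 0, forall v, D (inn v) = inn (f v) &
      forall X Y, D (X * Y) = D X * Y + sgop s false X * D Y].

Definition is_gcontr (p : nat) (phi : V -> R) (f : E -> E) : Prop :=
  [/\ linear f, f 1 = 0 &
      forall k v X, gs_hom k v ->
        f (inn v * X) = phi v *: X - (-1) ^+ (p * k) *: (inn v * f X)].

Hypotheses (ES : ext_spec inn) (GL : glie V).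
Let hsp := gl_span GL.
Let il := ext_lin ES.
Let mb := ext_mul_bilin ES.

Lemma scaleAr (a : R) (x y : E) : a *: (x * y) = x * (a *: y).
Proof. exact: (ext_scAr ES). Qed.

(** The generators act on [A] by left multiplication by their images; the morphism is the orbit of
    1. *)
Lemma ext_hom_ex (A : lalgType R) (f : V -> A) : scale_central A -> linear f ->
  (forall p q u v, gs_hom p u -> gs_hom q v -> f u * f v + (-1) ^+ (p * q) *: (f v * f u) = 0) ->
  exists F : E -> A, [/\ linear F, F 1 = 1, forall X Y, F (X * Y) = F X * F Y &
    forall v, F (inn v) = f v].
Proof.
move=> sA fl rel; pose act v m := f v * m.
have ab : bilin act.
  split=> [v a x y|m a x y]; first by rewrite /act mulrDr sA.
  by rewrite /act fl mulrDl scalerAl.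
have [p q u v m hu hv|Act [Ab A1 Ag AM]] := ext_act_ex ES ab.
  by rewrite /act !mulrA scalerAl -mulrDl rel // mul0r.
have AE X m : Act X m = Act X 1 * m.
  move: X; apply: (ext_lin_ind ES hsp); first exact: bilinl.
  - by move=> a x y /=; rewrite (bilinl Ab) mulrDl scalerAl.
  - by rewrite !A1 mul1r.
  by move=> p v X _ IH; rewrite !AM !Ag IH /act mulrA.
exists (Act^~ 1); split=> //; first exact: bilinl.
- by move=> X Y; rewrite AM AE.
- by move=> v; rewrite Ag /act mulr1.
Qed.

Lemma sgopP a b : is_sign_op a b (sgop a b).
Proof.
apply: xgetPex; have [sg [sgl sgE]] := gl_sgn GL.
pose f v := (-1) ^+ b *: inn (if a then sg v else v).
have fE k v : gs_hom k v -> f v = (-1) ^+ (a * k + b) *: inn v.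
  rewrite /f => hv; case: (a); last by rewrite mul0n add0n.
  by rewrite (sgE _ _ hv) (linfZ il) scalerA -exprD mul1n addnC.
have fl : linear f.
  by move=> c u v; rewrite /f; case: (a); rewrite ?sgl il scalerDr !scalerA mulrC.
have [|p q u v hu hv|F [Fl F1 FM Fi]] := ext_hom_ex (f := f) _ fl.
- exact: (ext_scAr ES).
- rewrite (fE _ _ hu) (fE _ _ hv) -!scalerAl -!scaleAr (ext_anticomm ES hu hv).
  rewrite !scalerN !scalerA addrC; apply/eqP; rewrite subr_eq0 mulrC; apply/eqP; congr (_ *: _).
  by ring.
by exists F; split=> // k v hv; rewrite Fi (fE k).
Qed.

Lemma sgop_lin a b : linear (sgop a b). Proof. by case: (sgopP a b). Qed.
Lemma sgop1 a b : sgop a b 1 = 1. Proof. by case: (sgopP a b). Qed.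
Lemma sgopM a b X Y : sgop a b (X * Y) = sgop a b X * sgop a b Y.
Proof. by case: (sgopP a b). Qed.
Lemma sgop_in a b k v : gs_hom k v -> sgop a b (inn v) = (-1) ^+ (a * k + b) *: inn v.
Proof. by case: (sgopP a b) => _ _ _; apply. Qed.

Lemma sgop_comp a b a' b' X : sgop a b (sgop a' b' X) = sgop (a (+) a') (b (+) b') X.
Proof.
move: X; apply: (ext_lin_ind ES hsp).
- exact: linear_comp_ub (sgop_lin _ _) (sgop_lin _ _).
- exact: sgop_lin.
- by rewrite !sgop1.
move=> p v X hv IH; rewrite !sgopM IH !(sgop_in _ _ hv) (linfZ (sgop_lin _ _)) (sgop_in _ _ hv).
rewrite scalerA -exprD; congr (_ *: _ * _).
by apply: signr_eq; odds; move: (odd p) => {IH} c; case: a a' b b' c => [] [] [] [] [].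
Qed.

Lemma sgop_id X : sgop false false X = X.
Proof.
move: X; apply: (ext_lin_ind ES hsp) => //; first exact: sgop_lin.
  exact: sgop1.
by move=> p v X hv IH; rewrite sgopM IH (sgop_in _ _ hv) scale1r.
Qed.

Lemma sgopK a b X : sgop a b (sgop a b X) = X.
Proof. by rewrite sgop_comp !addbb sgop_id. Qed.

Lemma gbihom1 : gbihom 0 0 1.
Proof. by apply: lin_span_in; exists [::]; split=> //; rewrite big_nil. Qed.

Lemma gbihom_in k v : gs_hom k v -> gbihom k 1 (inn v).
Proof.
move=> hv; apply: lin_span_in; exists [:: (k, v)]; split=> //; last by rewrite big_seq1.
  by move=> t; rewrite inE => /eqP ->.
by rewrite big_seq1.
Qed.

Lemma gbihomM p q p' q' X Y : gbihom p q X -> gbihom p' q' Y -> gbihom (p + p') (q + q') (X * Y).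
Proof.
apply: (bilin_span mb) => {}X {}Y [s [hs <- <- ->]] [t [ht <- <- ->]].
apply: lin_span_in; exists (s ++ t); split; rewrite ?big_cat ?size_cat //.
by move=> u; rewrite mem_cat => /orP[/hs|/ht].
Qed.

Lemma gbihom_ind (P : nat -> nat -> E -> Prop) :
  (forall p q, P p q 0) ->
  (forall p q a x y, P p q x -> P p q y -> P p q (a *: x + y)) -> P 0 0 1 ->
  (forall k p q v X, gs_hom k v -> gbihom p q X -> P p q X -> P (k + p) q.+1 (inn v * X)) ->
  forall p q X, gbihom p q X -> P p q X.
Proof.
move=> P0 PL P1 PM p q; apply: lin_span_ind => // a _ y [s [hs <- <- ->]] Py; apply: PL => // {Py}.
elim: s hs => [|t s IH] hs; first by rewrite !big_nil.
have hs' u : u \in s -> gs_hom u.1 u.2 by move=> us; apply: hs; rewrite inE us orbT.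
rewrite !big_cons /=; apply: PM; last exact: IH.
  by apply: hs; rewrite mem_head.
by apply: lin_span_in; exists s.
Qed.

Lemma sgop_bihom a b p q X : gbihom p q X -> sgop a b X = (-1) ^+ (a * p + b * q) *: X.
Proof.
move: p q X; apply: gbihom_ind => [p q|p q c x y Hx Hy||k p q v X hv _ IH].
- by rewrite (linf0 (sgop_lin _ _)) scaler0.
- by rewrite sgop_lin Hx Hy scalerDr !scalerA mulrC.
- by rewrite sgop1 !muln0 scale1r.
rewrite sgopM IH (sgop_in _ _ hv) -scalerAl -scaleAr scalerA -exprD; congr (_ ^+ _ *: _).
by rewrite mulnDr mulnS; lia.
Qed.

Lemma ext_spanned_bihom (X : E) : lin_span [set Y | exists p q, gbihom p q Y]%classic X.
Proof.
elim/(ext_ind ES hsp): X => [|a x y|| p v X hv IH].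
- exact: lin_span0.
- exact: lin_spanP.
- by apply: lin_span_in; exists 0%N, 0%N; exact: gbihom1.
elim/lin_span_ind: X / IH => [|a x y [p' [q' hx]] hy]; first by rewrite mulr0; apply: lin_span0.
rewrite mulrDr -scaleAr; apply: lin_spanP => //; apply: lin_span_in.
by exists (p + p')%N, (1 + q')%N; apply: gbihomM => //; apply: gbihom_in.
Qed.

Lemma bihom_lin_ext (M : lmodType R) (f g : E -> M) : linear f -> linear g ->
  (forall p q X, gbihom p q X -> f X = g X) -> f =1 g.
Proof.
move=> fl gl H X; elim/lin_span_ind: X / (ext_spanned_bihom X) => [|a x y [p [q hx]] IH].
  by rewrite !linf0.
by rewrite fl gl (H p q) // IH.
Qed.

Lemma gbihom_comm p q p' q' X Y : gbihom p q X -> gbihom p' q' Y ->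
  X * Y = (-1) ^+ (p * p' + q * q') *: (Y * X).
Proof.
move=> hX; move: p q X hX p' q' Y; apply: gbihom_ind.
- by move=> p q p' q' Y _; rewrite mul0r mulr0 scaler0.
- move=> p q a x y Hx Hy p' q' Y hY; rewrite mulrDl -scalerAl (Hx _ _ _ hY) (Hy _ _ _ hY).
  by rewrite mulrDr -scaleAr scalerDr !scalerA mulrC.
- by move=> p' q' Y _; rewrite mul1r mulr1 !mul0n scale1r.
move=> k p q v X hv hX IH p' q' Y hY.
rewrite -mulrA (IH _ _ _ hY) -scaleAr mulrA.
suff -> : inn v * Y = (-1) ^+ (k * p' + q') *: (Y * inn v).
  rewrite -scalerAl scalerA -exprD -!mulrA; congr (_ ^+ _ *: _); lia.
move: p' q' Y hY; apply: gbihom_ind.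
- by move=> p' q'; rewrite mulr0 mul0r scaler0.
- move=> p' q' a x y Hx Hy; rewrite mulrDr -scaleAr Hx Hy mulrDl -scalerAl.
  by rewrite scalerDr !scalerA mulrC.
- by rewrite mul1r mulr1 muln0 scale1r.
move=> k' p' q' w Y hw _ IHY; rewrite mulrA (ext_anticomm ES hv hw) mulNr -scalerAl -(mulrA (inn w) (inn v)) IHY.
rewrite -!scaleAr scalerA -exprD mulrA -scaleN1r scalerA -exprS; congr (_ ^+ _ *: _); lia.
Qed.

(** D is a derivation exactly when X -> (X, 0; D X, sg X) is multiplicative in 2 x 2 matrices. The
    generators are made to act on pairs by these matrices. In the anticommutation relation [e1] and
    [e2] are the two contributions to the corner entry, [e3] is the lower diagonal entry, and D X is
    the second component of the orbit of (1, 0). *)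
Lemma der_ex s f : parity_shift s f -> exists D, is_deriv s f D.
Proof.
move=> [fl fh]; have [sg [sgl sgE]] := gl_sgn GL.
pose ss v := if s then sg v else v.
have ssE k v : gs_hom k v -> ss v = (-1) ^+ (s * k) *: v.
  by move=> hv; rewrite /ss; case: (s); rewrite ?(sgE _ _ hv) ?mul1n // mul0n scale1r.
have ssl : linear ss by rewrite /ss; case: (s).
pose act v (m : E * E) : E * E := (inn v * m.1, inn (f v) * m.1 + inn (ss v) * m.2).
have ab : bilin act.
  split=> [v a x y|m a x y]; apply: pair_ext => /=.
  - by rewrite mulrDr scaleAr.
  - by rewrite !mulrDr -!scaleAr; module_with R (E : lmodType R).
  - by rewrite il mulrDl scalerAl.
  - by rewrite fl ssl !il !mulrDl -!scalerAl; module_with R (E : lmodType R).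
have [p q u v m hu hv|Act [Ab A1 Ag AM]] := ext_act_ex ES ab.
  apply: pair_ext => /=; first by rewrite !mulrA (ext_anticomm ES hu hv) mulNr -scalerAl addNr.
  have e1 : inn (f u) * inn v + (-1) ^+ (p * q) *: (inn (ss v) * inn (f u)) = 0.
    rewrite (fh _ _ _ _ hu hv) (ssE _ _ hv) (linfZ il) -scalerAl scalerA -exprD.
    by rewrite mulnDl addNr.
  have e2 : inn (ss u) * inn (f v) + (-1) ^+ (p * q) *: (inn (f v) * inn u) = 0.
    rewrite (fh _ _ _ _ hv hu) (ssE _ _ hu) (linfZ il) -scalerAl scalerN scalerA -exprD.
    rewrite [X in _ - X *: _](signr_eq R (n := s * p)) ?subrr //.
    by rewrite mulnDl [(q * p)%N]mulnC addnA oddD addnn odd_double.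
  have e3 : inn (ss u) * inn (ss v) + (-1) ^+ (p * q) *: (inn (ss v) * inn (ss u)) = 0.
    rewrite (ssE _ _ hu) (ssE _ _ hv) !(linfZ il) -!scalerAl -!scaleAr (ext_anticomm ES hu hv).
    rewrite !scalerN !scalerA addrC; apply/eqP; rewrite subr_eq0; apply/eqP; congr (_ *: _).
    by ring.
  transitivity ((inn (f u) * inn v + (-1) ^+ (p * q) *: (inn (ss v) * inn (f u))) * m.1
    + (inn (ss u) * inn (f v) + (-1) ^+ (p * q) *: (inn (f v) * inn u)) * m.1
    + (inn (ss u) * inn (ss v) + (-1) ^+ (p * q) *: (inn (ss v) * inn (ss u))) * m.2).
    rewrite !mulrDl !mulrDr !scalerDr -!scalerAl -!mulrA.
    by module_with R (E : lmodType R).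
  by rewrite e1 e2 e3 !mul0r !addr0.
exists (fun X => (Act X (1, 0)).2); split.
- by move=> a x y /=; rewrite (bilinl Ab).
- by rewrite A1.
- by move=> v; rewrite Ag /= mulr1 mulr0 addr0.
have Act1 X m : (Act X m).1 = X * m.1.
  move: X; apply: (ext_lin_ind ES hsp).
  - by move=> a x y; rewrite (bilinl Ab).
  - by move=> a x y; rewrite mulrDl scalerAl.
  - by rewrite A1 mul1r.
  by move=> k v X _ IH; rewrite AM Ag /= IH mulrA.
have Act2 X m : (Act X m).2 = (Act X (1, 0)).2 * m.1 + sgop s false X * m.2.
  move: X; apply: (ext_lin_ind ES hsp).
  - by move=> a x y; rewrite (bilinl Ab).
  - move=> a x y /=; rewrite (bilinl Ab) /= sgop_lin !mulrDl -!scalerAl.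
    by module_with R (E : lmodType R).
  - by rewrite !A1 /= mul0r add0r sgop1 mul1r.
  move=> k v X hv IH; rewrite !AM !Ag /= IH !Act1 /= mulr1.
  rewrite sgopM (sgop_in _ _ hv) addn0 (ssE _ _ hv) (linfZ il) mulrDr !mulrDl !mulrA addrA.
  by [].
by move=> X Y; rewrite AM Act2 Act1 /= mulr1.
Qed.

(** Triangular matrices again, with [phi v] in the corner. The corner entry of the relation vanishes
    because [phi] only sees vectors of the parity of [p], for which the signs (-1)^(kl) and
    (-1)^(pk) agree. *)
Lemma gcontr_ex p phi : linear (phi : V -> R^o) ->
  (forall k v, gs_hom k v -> odd k != odd p -> phi v = 0) -> exists f, is_gcontr p phi f.
Proof.
move=> pl ph; have [sg [sgl sgE]] := gl_sgn GL.
pose ss v := if odd p then sg v else v.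
have ssE k v : gs_hom k v -> ss v = (-1) ^+ (p * k) *: v.
  move=> hv; rewrite /ss -signr_odd oddM; case: (odd p); rewrite ?(sgE _ _ hv) ?scale1r //.
  by rewrite andTb signr_odd.
have ssl : linear ss by rewrite /ss; case: (odd p).
pose act v (m : E * E) : E * E := (inn v * m.1, phi v *: m.1 - inn (ss v) * m.2).
have ab : bilin act.
  split=> [v a x y|m a x y]; apply: pair_ext => /=.
  - by rewrite mulrDr scaleAr.
  - by rewrite !mulrDr -!scaleAr; module_with R (E : lmodType R).
  - by rewrite il mulrDl scalerAl.
  - by rewrite (_ : phi (a *: x + y) = a * phi x + phi y :> R) ?pl // ssl !il !mulrDl -!scalerAl; module_with R (E : lmodType R).
have [k l u v m hu hv|Act [Ab A1 Ag AM]] := ext_act_ex ES ab.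
  apply: pair_ext => /=; first by rewrite !mulrA (ext_anticomm ES hu hv) mulNr -scalerAl addNr.
  have e1 : phi u *: inn v - (-1) ^+ (k * l) *: (phi u *: inn (ss v)) = 0.
    have [pu|/(ph _ _ hu) ->] := eqVneq (odd k) (odd p); last by rewrite !scale0r scaler0 subr0.
    rewrite (ssE _ _ hv) (linfZ il) !scalerA mulrAC -exprD -signr_odd oddD !oddM pu addbb mul1r.
    by rewrite subrr.
  have e2 : (-1) ^+ (k * l) *: (phi v *: inn u) - phi v *: inn (ss u) = 0.
    have [pv|/(ph _ _ hv) ->] := eqVneq (odd l) (odd p); last by rewrite !scale0r scaler0 subr0.
    rewrite (ssE _ _ hu) (linfZ il) !scalerA mulrC -signr_odd -[X in _ - (_ * X) *: _]signr_odd.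
    by rewrite !oddM pv andbC subrr.
  have e3 : inn (ss u) * inn (ss v) + (-1) ^+ (k * l) *: (inn (ss v) * inn (ss u)) = 0.
    rewrite (ssE _ _ hu) (ssE _ _ hv) !(linfZ il) -!scalerAl -!scaleAr (ext_anticomm ES hu hv).
    rewrite !scalerN !scalerA addrC; apply/eqP; rewrite subr_eq0; apply/eqP; congr (_ *: _).
    by ring.
  transitivity ((phi u *: inn v - (-1) ^+ (k * l) *: (phi u *: inn (ss v))) * m.1
    + ((-1) ^+ (k * l) *: (phi v *: inn u) - phi v *: inn (ss u)) * m.1
    + (inn (ss u) * inn (ss v) + (-1) ^+ (k * l) *: (inn (ss v) * inn (ss u))) * m.2).
    rewrite !mulrBl !mulrBr !mulrDl !scalerBr -!scalerAl -!scaleAr -!mulrA !opprB.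
    by module_with R (E : lmodType R).
  by rewrite e1 e2 e3 !mul0r !addr0.
have Act1 X m : (Act X m).1 = X * m.1.
  move: X; apply: (ext_lin_ind ES hsp).
  - by move=> a x y; rewrite (bilinl Ab).
  - by move=> a x y; rewrite mulrDl scalerAl.
  - by rewrite A1 mul1r.
  by move=> l v X _ IH; rewrite AM Ag /= IH mulrA.
exists (fun X => (Act X (1, 0)).2); split.
- by move=> a x y /=; rewrite (bilinl Ab).
- by rewrite A1.
by move=> k v X hv; rewrite AM Ag /= Act1 /= mulr1 (ssE _ _ hv) (linfZ il) -scalerAl.
Qed.
End operators.

Section derivations.
Variables (R : realType) (V : gradedSpace R) (E : lalgType R) (inn : V -> E).
Hypotheses (ES : ext_spec inn) (GL : glie V).
Let hsp := gl_span GL.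
Let il := ext_lin ES.
Let sA := scaleAr ES.

Lemma der_uniq s f D D' : is_deriv inn s f D -> is_deriv inn s f D' -> D =1 D'.
Proof.
move=> [Dl D1 Di DM] [Dl' D1' Di' DM']; apply: (ext_lin_ind ES hsp) => //.
  by rewrite D1 D1'.
by move=> p v X hv IH; rewrite DM DM' IH Di Di'.
Qed.

Lemma der_lincomb s f g D D' (a : R) : is_deriv inn s f D -> is_deriv inn s g D' ->
  is_deriv inn s (fun v => a *: f v + g v) (fun X => a *: D X + D' X).
Proof.
move=> [Dl D1 Di DM] [Dl' D1' Di' DM']; split.
- by move=> b x y; rewrite Dl Dl'; module_with R (E : lmodType R).
- by rewrite D1 D1' scaler0 addr0.
- by move=> v; rewrite Di Di' il.
- move=> X Y; rewrite DM DM' mulrDl mulrDr -scalerAl -sA.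
  by module_with R (E : lmodType R).
Qed.

Lemma der_bihom s f D d : is_deriv inn s f D ->
  (forall k v, gs_hom k v -> gs_hom (k + d) (f v)) ->
  forall p q X, gbihom inn p q X -> gbihom inn (p + d) q (D X).
Proof.
move=> [Dl D1 Di DM] fh; apply: gbihom_ind.
- by move=> p q; rewrite (linf0 Dl); apply: lin_span0.
- by move=> p q a x y Dx Dy; rewrite Dl; apply: lin_spanP.
- by rewrite D1; apply: lin_span0.
move=> k p q v X hv hX IH; rewrite DM Di (sgop_in ES GL _ _ hv) -scalerAl.
apply: lin_spanD; last apply: lin_spanZ.
  rewrite (_ : (k + p + d = k + d + p)%N); last by lia.
  exact: (gbihomM ES (gbihom_in inn (fh _ _ hv)) hX).
rewrite -addnA; exact: (gbihomM ES (gbihom_in inn hv) IH).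
Qed.

Lemma hom_ext (M : lmodType R) (f g : V -> M) : linear f -> linear g ->
  (forall k v, gs_hom k v -> f v = g v) -> f =1 g.
Proof.
move=> fl gl H v; have [t [ht ->]] := hsp v; rewrite (linf_sum fl) (linf_sum gl).
by apply: eq_big_seq => u /ht; apply: H.
Qed.

End derivations.

(** * The extended bracket, the wedge projections and the Koszul boundary operator *)

Section bracket.
Variables (R : realType) (V : gradedSpace R) (E : lalgType R) (inn : V -> E).
Local Notation bihom := (gbihom inn).
Local Notation sg := (sgop inn).

Definition gis_ext_bracket (br : E -> E -> E) : Prop :=
  [/\ bilin br,
      forall u v : V, br (inn u) (inn v) = inn (gs_br u v),
      forall X, br 1 X = 0 /\ br X 1 = 0,
      forall p1 q1 p2 q2 X Y Z, bihom p1 q1 X -> bihom p2 q2 Y ->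
        br (X * Y) Z =
        X * br Y Z + (-1) ^+ (p1 * p2 + q1 * q2) *: (Y * br X Z) &
      forall p2 q2 p3 q3 X Y Z, bihom p2 q2 Y -> bihom p3 q3 Z ->
        br X (Y * Z) =
        br X Y * Z + (-1) ^+ (p2 * p3 + q2 * q3) *: (br X Z * Y)].

Definition gis_wedge_proj (l : nat) (f : E -> E) : Prop :=
  linear f /\
  forall p q X, bihom p q X -> f X = if q == l then X else 0.

Definition gis_koszul (br : E -> E -> E) (f : E -> E) : Prop :=
  [/\ linear f, f 1 = 0, forall v, f (inn v) = 0 &
      forall v X, f (inn v * X) = br (inn v) X - inn v * f X].

Hypotheses (ES : ext_spec inn) (GL : glie V).
Let hsp := gl_span GL.
Let il := ext_lin ES.
Let sA := scaleAr ES.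
Let brb := gl_br GL.
Let sl a b := sgop_lin ES GL a b.

Lemma br_parity_shift k u : gs_hom k u -> parity_shift inn (odd k) (gs_br u).
Proof.
move=> hu; apply: parity_shiftP => //; first exact: bilinr brb u.
by move=> l v hv; exists (k + l)%N; [rewrite addnC|apply: (gl_hom GL)].
Qed.

(** The projection onto the vectors of parity [s]. *)
Let half (s : bool) (sgV : V -> V) (v : V) : V := 2^-1 *: (v + (-1) ^+ s *: sgV v).

(** For [v] of parity s, the operator [v, .] is the derivation of parity s extending the Lie
    bracket. The rule for [v X, Z] then determines the bracket by recursion on X. Linearity in an
    arbitrary [v] is obtained by splitting [v] into its even and odd parts. *)
Lemma bracket_ex : exists br, gis_ext_bracket br.
Proof.
have [sgV [sgl sgE]] := gl_sgn GL.
pose h s := half s sgV.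
have hl s : linear (h s).
  by move=> a x y; rewrite /h /half sgl; module_with R (V : lmodType R).
have hE s k v : gs_hom k v -> h s v = if odd k == s then v else 0.
  move=> hv; rewrite /h /half (sgE _ _ hv) -[(-1) ^+ k]signr_odd.
  case: (odd k) (s) => [] [] /=; module_with R (V : lmodType R); rewrite ?expr0 ?expr1; by field.
have hp s v : parity_shift inn s (gs_br (h s v)).
  have [t [ht ->]] := hsp v; rewrite (linf_sum (hl s)).
  elim: t ht => [|[k u] t IH] ht.
    rewrite big_nil; split=> [|? ? ? ? _ _]; first exact: bilinr brb 0.
    by rewrite (bilin0l brb) (linf0 il) mul0r mulr0 scaler0 oppr0.
  have hu : gs_hom k u by apply: (ht (k, u)); rewrite mem_head.
  rewrite big_cons; set w := \sum_(_ <- _) _ in IH *; have [|_ IHp] := IH.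
    by move=> ? ?; apply: ht; rewrite inE; apply/orP; right.
  split=> [|l v' m w' hv' hw']; first exact: bilinr brb _.
  rewrite (bilinDl brb) (linfD il) mulrDl mulrDr scalerDr opprD (IHp _ _ _ _ hv' hw').
  congr (_ + _); rewrite (hE _ _ _ hu); case: eqP => [<-|_].
    by have [_] := br_parity_shift hu; apply.
  by rewrite (bilin0l brb) (linf0 il) mul0r mulr0 scaler0 oppr0.
pose ad s v : E -> E := xget (fun=> 0) (is_deriv inn s (gs_br (h s v))).
have adP s v : is_deriv inn s (gs_br (h s v)) (ad s v).
  by apply: xgetPex; apply: der_ex.
have adl s Z : linear (fun v => ad s v Z).
  move=> a u v; have H := der_lincomb ES a (adP s u) (adP s v).
  have e : (fun w => a *: gs_br (h s u) w + gs_br (h s v) w) = gs_br (h s (a *: u + v)).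
    by apply: funext => w; rewrite hl (bilinl brb).
  by rewrite e in H; exact: (der_uniq ES GL (adP s _) H Z).
have ad0 s k v : gs_hom k v -> odd k != s -> ad s v =1 (fun=> 0).
  move=> hv ne; apply: (der_uniq ES GL (adP s v)); have e : h s v = 0.
    by rewrite (hE _ _ _ hv) (negbTE ne).
  split=> [a x y||w|X Y]; rewrite ?scaler0 ?addr0 //; last by rewrite mul0r mulr0 addr0.
  by rewrite e (bilin0l brb) (linf0 il).
have adh k v : gs_hom k v -> is_deriv inn (odd k) (gs_br v) (ad (odd k) v).
  by move=> hv; have := adP (odd k) v; rewrite (hE _ _ _ hv) eqxx.
(* The first component of an orbit records X, the second the whole map Z -> [X, Z]; the action of
   [v] is the recursion for [v X, Z]. *)
pose M : lmodType R := (E * (E -> E))%type.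
pose act (v : V) (m : M) : M := (inn v * m.1, fun Z =>
  inn v * m.2 Z + (sg false true m.1 * ad false v Z + sg true true m.1 * ad true v Z)).
have ab : bilin act.
  split=> [v a x y|m a x y]; apply: pair_ext => /=.
  - by rewrite mulrDr sA.
  - apply: funext => Z; rewrite /= !fctE /=.
    rewrite !sl !mulrDr !mulrDl -!sA -!scalerAl.
    by module_with R (E : lmodType R).
  - by rewrite il mulrDl scalerAl.
  - apply: funext => Z; rewrite /= !fctE /= il !adl !mulrDl !mulrDr -!sA -!scalerAl.
    by module_with R (E : lmodType R).
have actE k v m : gs_hom k v -> act v m =
    (inn v * m.1, fun Z => inn v * m.2 Z + sg (odd k) true m.1 * ad (odd k) v Z).
  move=> hv; rewrite /act; congr (_, _); apply: funext => Z; congr (_ + _).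
  have := ad0 (~~ odd k) _ _ hv; rewrite -[~~ odd k]addbT.
  by case: (odd k) => H; rewrite H // mulr0 ?addr0 ?add0r.
have [k l u v m hu hv|Act [Ab A1 Ag AM]] := ext_act_ex ES ab.
  rewrite !(actE _ _ _ hu) !(actE _ _ _ hv); apply: pair_ext => /=.
    by rewrite !mulrA (ext_anticomm ES hu hv) mulNr -scalerAl addNr.
  apply: funext => Z; rewrite /= !fctE /= !(sgopM ES GL) !(sgop_in ES GL _ _ hu) !(sgop_in ES GL _ _ hv).
  rewrite !mulrDr !mulrA (ext_anticomm ES hu hv) !mulNr -!scalerAl.
  have e1 : (-1) ^+ (odd k * l + true) = - (-1) ^+ (k * l) :> R.
    by rewrite addn1 exprS mulN1r; congr (- _); apply: signr_eq; rewrite !oddM oddb.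
  have e2 : (-1) ^+ (odd l * k + true) = - (-1) ^+ (k * l) :> R.
    by rewrite addn1 exprS mulN1r; congr (- _); apply: signr_eq; rewrite !oddM oddb andbC.
  rewrite e1 e2; have e := sqrr_sign R (k * l); rewrite expr2 in e.
  set c := (-1) ^+ (k * l) in e *.
  rewrite -[RHS]/(0 : E) !scalerDr !scalerA mulrN e.
  by module_with R (E : lmodType R).
have Act1 X m : (Act X m).1 = X * m.1.
  move: X; apply: (ext_lin_ind ES hsp).
  - by move=> a x y; rewrite (bilinl Ab).
  - by move=> a x y; rewrite mulrDl scalerAl.
  - by rewrite A1 mul1r.
  by move=> k v X _ IH; rewrite AM Ag /= IH mulrA.
pose br X Z := (Act X (1, 0)).2 Z.
have brvX k v X Z : gs_hom k v ->
    br (inn v * X) Z = inn v * br X Z + sg (odd k) true X * ad (odd k) v Z.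
  by move=> hv; rewrite /br AM Ag (actE _ _ _ hv) /= Act1 /= mulr1.
have br1 Z : br 1 Z = 0 by rewrite /br A1.
have brl Z : linear (fun X => br X Z).
  by move=> a x y; rewrite /br (bilinl Ab).
have brr X : linear (br X).
  move=> a y z; elim/(ext_ind ES hsp): X => [|b x x' IHx IHx'||k v X hv IH].
  - by rewrite !(linf0 (brl _)) scaler0 addr0.
  - by rewrite !brl IHx IHx'; module_with R (E : lmodType R).
  - by rewrite !br1 scaler0 addr0.
  rewrite !(brvX _ _ _ _ hv) IH; have [-> _ _ _] := adh _ _ hv.
  by rewrite !mulrDr -!sA; module_with R (E : lmodType R).
have brv k v Z : gs_hom k v -> br (inn v) Z = ad (odd k) v Z.
  by move=> hv; rewrite -[inn v]mulr1 (brvX _ _ _ _ hv) br1 mulr0 add0r (sgop1 ES GL) mul1r.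
have adb k v p q Z : gs_hom k v -> bihom p q Z -> bihom (p + k) q (ad (odd k) v Z).
  move=> hv; apply: (der_bihom ES GL (adh _ _ hv)) => l w hw.
  by rewrite addnC; apply: (gl_hom GL).
have brb' : bilin br by [].
exists br; split=> //.
- move=> u v; move: u; apply: (hom_ext GL).
  + exact: linear_comp_ub (brl _) il.
  + exact: linear_comp_ub il (bilinl brb v).
  by move=> k u hu; rewrite (brv _ _ _ hu); have [_ _ -> _] := adh _ _ hu.
- move=> X; split=> //; move: X; apply: (ext_lin_ind ES hsp) => [||//|k v X hv IH].
  + exact: brl.
  + by move=> a x y; rewrite scaler0 addr0.
  by rewrite (brvX _ _ _ _ hv) IH mulr0; have [_ -> _ _] := adh _ _ hv; rewrite mulr0 addr0.
- move=> p1 q1 p2 q2 X Y Z hX; move: p1 q1 X hX p2 q2 Y; apply: gbihom_ind.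
  + by move=> p q p2 q2 Y _; rewrite !mul0r (bilin0l brb') mulr0 scaler0 addr0.
  + move=> p q a x y Hx Hy p2 q2 Y hY; rewrite mulrDl -scalerAl !brl (Hx _ _ _ hY) (Hy _ _ _ hY).
    by rewrite !mulrDl !mulrDr -!scalerAl -!sA; module_with R (E : lmodType R).
  + by move=> p2 q2 Y _; rewrite !mul1r br1 mulr0 scaler0 addr0.
  move=> k p q v X hv hX IH p2 q2 Y hY.
  rewrite -mulrA (brvX _ _ _ _ hv) (IH _ _ _ hY) (brvX _ _ _ _ hv) (sgopM ES GL).
  rewrite !(sgop_bihom ES GL _ _ hX) !(sgop_bihom ES GL _ _ hY) !mulrDr -!scalerAl -!sA -!scalerAl.
  rewrite !mulrA (gbihom_comm ES hX hY) (gbihom_comm ES hY (gbihom_in inn hv)) -!scalerAl.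
  rewrite !scalerDr !scalerA -!exprD -!addrA; congr (_ + (_ *: _ + _ *: _)); apply: signr_eq.
    by rewrite muln1; odds; case: (odd k) (odd p) (odd p2) (odd q) (odd q2) => [] [] [] [] [].
  by odds; case: (odd k) (odd p) (odd p2) (odd q) (odd q2) => [] [] [] [] [].
- move=> p2 q2 p3 q3 X Y Z hY hZ; move: X; apply: (ext_lin_ind ES hsp).
  + exact: brl.
  + by move=> a x y; rewrite !brl !mulrDl -!scalerAl; module_with R (E : lmodType R).
  + by rewrite !br1 !mul0r scaler0 addr0.
  move=> k v X hv IH; rewrite !(brvX _ _ _ _ hv) IH; have [_ _ _ ->] := adh _ _ hv.
  rewrite (sgop_bihom ES GL _ _ hY) !mulrDr !mulrDl -!scalerAl -!sA -!mulrA.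
  rewrite (gbihom_comm ES hY (adb _ _ _ _ _ hv hZ)) -!sA !scalerA -exprD.
  rewrite [X in X *: (_ * (ad _ _ _ * _))](signr_eq R (n := p2 * p3 + q2 * q3)); last first.
    by odds; case: (odd k) (odd p2) (odd p3) (odd q2) (odd q3) => [] [] [] [] [].
  by module_with R (E : lmodType R).
Qed.

End bracket.

Section derivations_and_brackets.
Variables (R : realType) (V : gradedSpace R) (E : lalgType R) (inn : V -> E).
Local Notation bihom := (gbihom inn).
Local Notation sg := (sgop inn).
Hypotheses (ES : ext_spec inn) (GL : glie V).
Let hsp := gl_span GL.
Let il := ext_lin ES.
Let sA := scaleAr ES.
Let sl a b := sgop_lin ES GL a b.

Definition degree_shift (s : bool) (f : V -> V) : Prop :=
  linear f /\ forall k v, gs_hom k v -> exists2 k', odd k' = odd k (+) s & gs_hom k' (f v).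

Lemma degree_parity_shift s f : degree_shift s f -> parity_shift inn s f.
Proof.
move=> [fl fh]; rewrite -[s]oddb; apply: parity_shiftP => // k v hv.
by have [k' e hk] := fh _ _ hv; exists k' => //; rewrite e oddD oddb.
Qed.

(** The algebra acts on sequences, a generator multiplying and shifting by one place. The orbit of
    (1, 0, 0, ...) under X lists the components of X by wedge degree. *)
Lemma wedge_proj_ex l : exists f, gis_wedge_proj inn l f.
Proof.
pose M : lmodType R := (nat -> E)%type.
pose act (v : V) (m : M) : M := fun l => if l is l'.+1 then inn v * m l' else 0.
have ab : bilin act.
  split=> [v a x y|m a x y]; apply: funext => - [|j]; rewrite /= !fctE /= ?scaler0 ?addr0 //.
    by rewrite mulrDr sA.
  by rewrite il mulrDl scalerAl.
have [k q u v m hu hv|Act [Ab A1 Ag AM]] := ext_act_ex ES ab.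
  apply: funext => - [|[|j]]; rewrite /= !fctE /= ?mulr0 ?scaler0 ?addr0 // !mulrA.
  by rewrite (ext_anticomm ES hu hv) mulNr -scalerAl addNr.
pose one : M := fun j => if j is 0 then 1 else 0.
have AE p q X : bihom p q X -> Act X one = fun j => if q == j then X else 0.
  move: p q X; apply: gbihom_ind.
  - by move=> p q; rewrite (bilin0l Ab); apply: funext => j; rewrite if_same.
  - move=> p q a x y Hx Hy; rewrite (bilinl Ab) Hx Hy; apply: funext => j; rewrite !fctE.
    by case: ifP; rewrite // scaler0 addr0.
  - by rewrite A1; apply: funext => - [].
  by move=> k p q v X hv hX IH; rewrite AM Ag IH; apply: funext => - [|j] //=; rewrite eqSS; case: ifP; rewrite // mulr0.
exists (fun X => Act X one l); split; first by move=> a x y; rewrite (bilinl Ab).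
by move=> p q X hX; rewrite (AE _ _ _ hX).
Qed.

Section bracket_spec.
Variable br : E -> E -> E.
Hypothesis BS : gis_ext_bracket inn br.

Lemma gbr_bilin : bilin br. Proof. by case: BS. Qed.
Lemma gbr_in u v : br (inn u) (inn v) = inn (gs_br u v). Proof. by case: BS. Qed.
Lemma gbr1l X : br 1 X = 0. Proof. by case: BS => _ _ /(_ X)[]. Qed.
Lemma gbr1r X : br X 1 = 0. Proof. by case: BS => _ _ /(_ X)[]. Qed.

Lemma gbrMl p1 q1 p2 q2 X Y Z : bihom p1 q1 X -> bihom p2 q2 Y ->
  br (X * Y) Z = X * br Y Z + (-1) ^+ (p1 * p2 + q1 * q2) *: (Y * br X Z).
Proof. by case: BS => _ _ _ H _; apply: H. Qed.
Lemma gbrMr p2 q2 p3 q3 X Y Z : bihom p2 q2 Y -> bihom p3 q3 Z ->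
  br X (Y * Z) = br X Y * Z + (-1) ^+ (p2 * p3 + q2 * q3) *: (br X Z * Y).
Proof. by case: BS => _ _ _ _ H; apply: H. Qed.

Lemma gbr_bihom k u : gs_hom k u -> forall p q X, bihom p q X -> bihom (k + p) q (br (inn u) X).
Proof.
move=> hu; apply: gbihom_ind.
- by move=> p q; rewrite (bilin0r gbr_bilin); apply: lin_span0.
- by move=> p q a x y hx hy; rewrite (bilinr gbr_bilin); apply: lin_spanP.
- by rewrite gbr1r; apply: lin_span0.
move=> l p q v X hv hX IH; rewrite (gbrMr _ (gbihom_in inn hv) hX).
apply: lin_spanD; last apply: lin_spanZ.
  rewrite gbr_in addnA; exact: (gbihomM ES (gbihom_in inn (gl_hom GL hu hv)) hX).
rewrite addnCA addnC -(addn1 q); exact: (gbihomM ES IH (gbihom_in inn hv)).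
Qed.

Lemma gbr_deriv k u : gs_hom k u -> is_deriv inn (odd k) (gs_br u) (br (inn u)).
Proof.
move=> hu; split; [exact: bilinr gbr_bilin _|exact: gbr1r|by move=> v; rewrite gbr_in|].
move=> X Y; move: X; apply: (bihom_lin_ext ES GL).
- by move=> a x y; rewrite mulrDl -scalerAl (bilinr gbr_bilin).
- move=> a x y; rewrite (bilinr gbr_bilin) sl !mulrDl -!scalerAl.
  by module_with R (E : lmodType R).
move=> p q X hX; move: Y; apply: (bihom_lin_ext ES GL).
- by move=> a x y; rewrite mulrDr -sA (bilinr gbr_bilin).
- move=> a x y; rewrite (bilinr gbr_bilin) !mulrDr -!sA.
  by module_with R (E : lmodType R).
move=> p' q' Y hY; rewrite (gbrMr _ hX hY) (gbihom_comm ES (gbr_bihom hu hY) hX) (sgop_bihom ES GL _ _ hX) -scalerAl scalerA -exprD.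
congr (_ + _ *: _); apply: signr_eq.
by odds; case: (odd k) (odd p) (odd p') (odd q) (odd q') => [] [] [] [] [].
Qed.

Lemma gbr_inM k v X Z : gs_hom k v ->
  br (inn v * X) Z = inn v * br X Z + sg (odd k) true X * br (inn v) Z.
Proof.
move=> hv; move: X; apply: (bihom_lin_ext ES GL).
- by move=> a x y; rewrite mulrDr -sA (bilinl gbr_bilin).
- move=> a x y; rewrite (bilinl gbr_bilin) sl !mulrDl !mulrDr -!scalerAl -!sA.
  by module_with R (E : lmodType R).
move=> p q X hX; rewrite (gbrMl _ (gbihom_in inn hv) hX) (sgop_bihom ES GL _ _ hX) -scalerAl; congr (_ + _ *: _); apply: signr_eq.
by odds; case: (odd k) (odd p) (odd q) => [] [] [].
Qed.

(** The defining recursion is a triangular action on pairs. It respects the relations because [u, .]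
    is a derivation and the bracket of generators is graded antisymmetric. *)
Lemma koszul_ex : exists f, gis_koszul inn br f.
Proof.
have bb := gbr_bilin.
pose act v (m : E * E) : E * E := (inn v * m.1, br (inn v) m.1 - inn v * m.2).
have ab : bilin act.
  split=> [v a x y|m a x y]; apply: pair_ext => /=.
  - by rewrite mulrDr sA.
  - by rewrite !mulrDr (bilinr bb) -!sA; module_with R (E : lmodType R).
  - by rewrite il mulrDl scalerAl.
  - by rewrite il (bilinl bb) mulrDl -!scalerAl; module_with R (E : lmodType R).
have [k l u v m hu hv|Act [Ab A1 Ag AM]] := ext_act_ex ES ab.
  apply: pair_ext => /=; first by rewrite !mulrA (ext_anticomm ES hu hv) mulNr -scalerAl addNr.
  have [_ _ bu bu'] := gbr_deriv hu; have [_ _ bv bv'] := gbr_deriv hv.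
  rewrite bu' bv' bu bv (sgop_in ES GL _ _ hu) (sgop_in ES GL _ _ hv) (gl_anti GL hv hu).
  rewrite (linfN il) (linfZ il) !mulrBr !mulNr -!scalerAl !mulrA (ext_anticomm ES hu hv).
  rewrite mulNr -scalerAl !addn0.
  have e1 : (-1) ^+ (odd k * l) = (-1) ^+ (k * l) :> R by apply: signr_eq; odds.
  have e2 : (-1) ^+ (odd l * k) = (-1) ^+ (k * l) :> R by apply: signr_eq; odds; rewrite andbC.
  rewrite e1 e2 [(l * k)%N]mulnC; have e := sqrr_sign R (k * l); rewrite expr2 in e.
  set c := (-1) ^+ (k * l) in e *; rewrite !(scalerDr, scalerN, scalerA) e.
  by module_with R (E : lmodType R).
have Act1 X m : (Act X m).1 = X * m.1.
  move: X; apply: (ext_lin_ind ES hsp).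
  - by move=> a x y; rewrite (bilinl Ab).
  - by move=> a x y; rewrite mulrDl scalerAl.
  - by rewrite A1 mul1r.
  by move=> k v X _ IH; rewrite AM Ag /= IH mulrA.
exists (fun X => (Act X (1, 0)).2); split.
- by move=> a x y /=; rewrite (bilinl Ab).
- by rewrite A1.
- by move=> v; rewrite Ag /= gbr1r mulr0 subr0.
by move=> v X; rewrite AM Ag /= Act1 /= mulr1.
Qed.

Section commutation.
Variables (s : bool) (f : V -> V) (D : E -> E).
Hypotheses (fs : degree_shift s f) (DD : is_deriv inn s f D).
Hypothesis fbr : forall k u v, gs_hom k u ->
  f (gs_br u v) = gs_br (f u) v + (-1) ^+ (s * k) *: gs_br u (f v).
Let Dl : linear D. Proof. by case: DD. Qed.
Let D1 : D 1 = 0. Proof. by case: DD. Qed.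
Let Di v : D (inn v) = inn (f v). Proof. by case: DD. Qed.
Let DM X Y : D (X * Y) = D X * Y + sg s false X * D Y. Proof. by case: DD. Qed.

Lemma der_inM k v X : gs_hom k v -> D (inn v * X) = inn (f v) * X + (-1) ^+ (s * k) *: (inn v * D X).
Proof. by move=> hv; rewrite DM Di (sgop_in ES GL _ _ hv) addn0 -scalerAl. Qed.

(** By [fbr] the rule holds on generators; both sides are computed on v X by the derivation property
    of [D] and of [u, .]. *)
Lemma der_gbr k u X : gs_hom k u ->
  D (br (inn u) X) = br (inn (f u)) X + (-1) ^+ (s * k) *: br (inn u) (D X).
Proof.
move=> hu; have bb := gbr_bilin; move: X; apply: (ext_lin_ind ES hsp).
- by move=> a x y; rewrite (bilinr bb) Dl.
- by move=> a x y; rewrite Dl !(bilinr bb); module_with R (E : lmodType R).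
- by rewrite /= D1 !gbr1r (linf0 Dl) (bilin0r bb) scaler0 addr0.
move=> l v X hv IH; have [k' ek hk'] := fs.2 _ _ hu; have [l' el hl'] := fs.2 _ _ hv.
have [_ _ bu bu'] := gbr_deriv hu; have [_ _ bv bv'] := gbr_deriv hk'.
rewrite bu' bu (sgop_in ES GL _ _ hv) addn0 -scalerAl (linfD Dl) (linfZ Dl).
rewrite (der_inM X (gl_hom GL hu hv)) !(der_inM _ hv) IH (fbr _ hu).
rewrite bv' bv (bilinDr bb) (bilinZr bb) !bu' !bu.
rewrite !(sgop_in ES GL _ _ hv) (sgop_in ES GL _ _ hl') !addn0.
rewrite (linfD il) (linfZ il) !mulrDl !mulrDr -!scalerAl -!sA.
have e1 : (-1) ^+ (odd k * l) = (-1) ^+ (k * l) :> R by apply: signr_eq; odds.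
have e2 : (-1) ^+ (odd k' * l) = (-1) ^+ (k * l) * (-1) ^+ (s * l) :> R.
  by rewrite -exprD; apply: signr_eq; odds; rewrite ek; case: (odd k) (s) (odd l) => [] [] [].
have e3 : (-1) ^+ (odd k * l') = (-1) ^+ (k * l) * (-1) ^+ (s * k) :> R.
  by rewrite -exprD; apply: signr_eq; odds; rewrite el; case: (odd k) (s) (odd l) => [] [] [].
rewrite e1 e2 e3 mulnDr exprD -[(-1) ^+ (s * k)]signr_odd.
by case: (odd (s * k)) => /=; module_with R (E : lmodType R).
Qed.

(** Both composites obey one recursion on v X, since [D] is a derivation of the bracket. No sign
    appears because the boundary operator carries none in its rule beyond the minus. *)
Lemma der_koszul kz : gis_koszul inn br kz -> forall X, kz (D X) = D (kz X).
Proof.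
move=> [kl k1 ki kM]; apply: (ext_lin_ind ES hsp).
- exact: linear_comp_ub kl Dl.
- exact: linear_comp_ub Dl kl.
- by rewrite /= D1 k1 (linf0 Dl) (linf0 kl).
move=> k v X hv IH; rewrite (der_inM _ hv) kM (linfD kl) (linfZ kl) !kM IH.
rewrite (linfB Dl) (der_gbr _ hv) (der_inM _ hv).
by module_with R (E : lmodType R).
Qed.
End commutation.
End bracket_spec.
End derivations_and_brackets.

(** * Iterated contractions separate the elements of an exterior algebra *)

Section separation.
Variables (R : realType) (V : gradedSpace R) (E : lalgType R) (inn : V -> E).
Hypotheses (ES : ext_spec inn) (GL : glie V).
Let hsp := gl_span GL.
Let il := ext_lin ES.
Let sA := scaleAr ES.

Definition homog_form (p : nat) (phi : V -> R^o) : Prop :=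
  linear phi /\ forall k v, gs_hom k v -> k != p -> phi v = 0.

Definition gctr (p : nat) (phi : V -> R^o) : E -> E :=
  xget (fun _ : E => 0) (is_gcontr inn p phi).

Definition is_counit (f : E -> R^o) : Prop :=
  [/\ linear f, f 1 = 1 & forall v X, f (inn v * X) = 0].

Definition counit : E -> R^o := xget (fun _ : E => 0 : R^o) is_counit.

Lemma counitP : is_counit counit.
Proof.
apply: xgetPex.
have [|||F [Fl F1 FM Fi]] := ext_hom_ex ES GL (A := R^o) (f := fun=> 0).
- by move=> a x y; rewrite /GRing.scale /= mulrCA.
- by move=> a u v; rewrite scaler0 addr0.
- by move=> *; rewrite mulr0 scaler0 addr0.
by exists F; split=> // v X; rewrite FM Fi mul0r.
Qed.

Lemma gctrP p phi : homog_form p phi -> is_gcontr inn p phi (gctr p phi).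
Proof.
move=> [pl ph]; apply: xgetPex; apply: (gcontr_ex ES GL) => // k v hv ne.
by apply: (ph k) => //; apply: contraNneq ne => ->.
Qed.

Lemma gctr_uniq p phi f g : is_gcontr inn p phi f -> is_gcontr inn p phi g -> f =1 g.
Proof.
move=> [fl f1 fM] [gl g1 gM]; apply: (ext_lin_ind ES hsp) => //; first by rewrite f1 g1.
by move=> k v X hv IH; rewrite (fM k) // (gM k) // IH.
Qed.

Lemma gctr_lincomb p a phi psi : homog_form p phi -> homog_form p psi ->
  homog_form p (fun v => a *: phi v + psi v) /\
  gctr p (fun v => a *: phi v + psi v) =1 (fun X => a *: gctr p phi X + gctr p psi X).
Proof.
move=> h1 h2; have [l1 z1] := h1; have [l2 z2] := h2.
have h : homog_form p (fun v => a *: phi v + psi v).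
  split=> [b u v|k v hv ne]; last by rewrite (z1 k) // (z2 k) // scaler0 addr0.
  by rewrite l1 l2; module_with R (R^o : lmodType R).
split=> //; apply: gctr_uniq (gctrP h) _.
have [f1 f11 f1M] := gctrP h1; have [f2 f21 f2M] := gctrP h2; split.
- by move=> b x y; rewrite f1 f2; module_with R (E : lmodType R).
- by rewrite f11 f21 scaler0 addr0.
move=> k v X hv; rewrite (f1M k) // (f2M k) // mulrDr -sA.
by rewrite [(a *: phi v + psi v) *: X]scalerDl [(a *: phi v) *: X](_ : _ = a *: (phi v *: X));
  [module_with R (E : lmodType R)|rewrite scalerA].
Qed.

Definition ext_filt (q : nat) : set E :=
  lin_span [set X | exists s : seq (nat * V),
    [/\ forall t, t \in s -> gs_hom t.1 t.2, (size s <= q)%N &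
        X = \prod_(t <- s) inn t.2]]%classic.

Lemma ext_filtS q q' X : (q <= q')%N -> ext_filt q X -> ext_filt q' X.
Proof.
move=> le; apply: lin_span_sub => {}X [s [hs sz ->]]; apply: lin_span_in; exists s; split=> //.
exact: leq_trans le.
Qed.

Lemma ext_filt_in q k v X : gs_hom k v -> ext_filt q X -> ext_filt q.+1 (inn v * X).
Proof.
move=> hv; apply: (lin_span_map (f := fun X => inn v * X)); first exact: bilinr (ext_mul_bilin ES) _.
move=> {}X [s [hs sz ->]]; apply: lin_span_in; exists ((k, v) :: s); split; rewrite ?big_cons //.
by move=> t; rewrite inE => /orP[/eqP ->|/hs].
Qed.

Lemma ext_filt_ex X : exists q, ext_filt q X.
Proof.
elim/(ext_ind ES hsp): X => [|a x y [q hx] [q' hy]||k v X hv [q hX]].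
- by exists 0%N; apply: lin_span0.
- exists (maxn q q'); apply: lin_spanP; first exact: ext_filtS (leq_maxl _ _) hx.
  exact: ext_filtS (leq_maxr _ _) hy.
- by exists 0%N; apply: lin_span_in; exists [::]; rewrite big_nil.
- by exists q.+1; apply: ext_filt_in hv hX.
Qed.

Lemma gctr_filt p phi : homog_form p phi ->
  forall q X, ext_filt q.+1 X -> ext_filt q (gctr p phi X).
Proof.
move=> h q; have [gl g1 gM] := gctrP h; apply: lin_span_map => // X [s [hs sz ->]].
elim: s q hs sz => [|[k v] s IH] q hs sz; first by rewrite big_nil g1; apply: lin_span0.
have hv : gs_hom k v by apply: (hs (k, v)); rewrite mem_head.
have hs' t : t \in s -> gs_hom t.1 t.2 by move=> ts; apply: hs; rewrite inE ts orbT.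
rewrite big_cons (gM k) //=; apply: lin_spanB; apply: lin_spanZ.
  by apply: lin_span_in; exists s.
case: q sz => [|q] sz; last by apply: ext_filt_in hv _; apply: IH.
by move: sz; rewrite /= ltnS leqn0 size_eq0 => /eqP ->; rewrite big_nil g1 mulr0; apply: lin_span0.
Qed.

Variable Phi : nat -> set (V -> R^o).
Hypothesis PhiH : forall p phi, Phi p phi -> homog_form p phi.

(** A substitute for dual bases in infinite dimension: on any finite set of homogeneous vectors the
    identity is a finite sum of rank one maps whose forms lie in the span of [Phi]. *)
Definition reproducing : Prop := forall s : seq (nat * V), (forall t, t \in s -> gs_hom t.1 t.2) ->
  exists t : seq (nat * V * (V -> R^o)),
   (forall i, i \in t -> gs_hom i.1.1 i.1.2 /\ lin_span (Phi i.1.1) i.2) /\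
   forall u, u \in s -> u.2 = \sum_(i <- t) i.2 u.2 *: i.1.2.

Lemma span_homog_form p phi : lin_span (Phi p) phi -> homog_form p phi.
Proof.
elim/lin_span_ind: phi / => [|a f g Pf IH].
  by split=> // a x y; rewrite /= scaler0 addr0.
by have [] := gctr_lincomb a (PhiH Pf) IH.
Qed.

Lemma span_gctr0 p phi X : (forall f, Phi p f -> gctr p f X = 0) ->
  lin_span (Phi p) phi -> gctr p phi X = 0.
Proof.
move=> H; suff : forall phi, lin_span (Phi p) phi -> homog_form p phi /\ gctr p phi X = 0.
  by move=> H' /H'[].
apply: lin_span_ind => [|a f g Pf [hg g0]].
  have h0 : homog_form p (0 : V -> R^o) by split=> // a x y; rewrite /= scaler0 addr0.
  split=> //; apply: (gctr_uniq (gctrP h0) (g := fun=> 0)); split=> [a x y||k v Y hv] //.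
    by rewrite scaler0 addr0.
  by rewrite mulr0 scaler0 subr0 scale0r.
have [h e] := gctr_lincomb a (PhiH Pf) hg; split=> //.
by rewrite [LHS](e X) H // g0 scaler0 addr0.
Qed.

Hypothesis rep : reproducing.

(** Euler's identity: wedging with a vector after contracting with the dual form counts the factors.
    Vector and form have the same degree, so moving the vector back across a factor cancels the sign
    of the contraction. *)
Lemma euler (t : seq (nat * V * (V -> R^o))) (s : seq (nat * V)) :
  (forall i, i \in t -> gs_hom i.1.1 i.1.2 /\ homog_form i.1.1 i.2) ->
  (forall u, u \in s -> gs_hom u.1 u.2 /\ u.2 = \sum_(i <- t) i.2 u.2 *: i.1.2) ->
  \sum_(i <- t) inn i.1.2 * gctr i.1.1 i.2 (\prod_(u <- s) inn u.2) =
  (size s)%:R *: \prod_(u <- s) inn u.2.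
Proof.
move=> ht; elim: s => [|[k v] s IH] hs.
  rewrite big_nil scale0r big_seq big1 // => i /ht[_ /gctrP[_ -> _]].
  by rewrite mulr0.
have [hv ev] := hs (k, v) (mem_head _ _); rewrite /= in hv ev.
have {}IH := IH (fun u us => hs u (mem_behead (s := (k, v) :: s) us)).
rewrite big_cons /=; set Y := \prod_(_ <- _) _ in IH *.
transitivity (\sum_(i <- t) ((i.2 v *: inn i.1.2) * Y + inn v * (inn i.1.2 * gctr i.1.1 i.2 Y))).
  apply: eq_big_seq => i /ht[hi /gctrP[_ _ iM]].
  rewrite (iM k) // mulrBr -sA -sA mulrA (ext_anticomm ES hi hv) mulNr -scalerAl scalerN opprK.
  by rewrite scalerA -exprD -signr_odd oddD addbb scale1r -!mulrA -scalerAl.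
rewrite big_split /= -mulr_suml -mulr_sumr IH.
have -> : \sum_(i <- t) i.2 v *: inn i.1.2 = inn v.
  by rewrite [in RHS]ev (linf_sum il); apply: eq_bigr => i _; rewrite (linfZ il).
by rewrite -sA -[X in X + _]scale1r -scalerDl -natr1 addrC.
Qed.

(** The part of [X] with q + 1 factors is an eigenvector of the Euler operator for q + 1 and
    cancels. The factors of [X] are collected in [s] before [t] is chosen, because one resolution
    must reproduce all of them. *)
Lemma euler_filt q X : ext_filt q.+1 X ->
  exists s : seq (nat * V), (forall u, u \in s -> gs_hom u.1 u.2) /\
  forall t : seq (nat * V * (V -> R^o)),
    (forall i, i \in t -> gs_hom i.1.1 i.1.2 /\ homog_form i.1.1 i.2) ->
    (forall u, u \in s -> u.2 = \sum_(i <- t) i.2 u.2 *: i.1.2) ->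
  ext_filt q (X - q.+1%:R^-1 *: \sum_(i <- t) inn i.1.2 * gctr i.1.1 i.2 X).
Proof.
elim/lin_span_ind: X / => [|a x y [s [hs sz ->]] [s' [hs' H']]].
  exists [::]; split=> // t ht _; rewrite big_seq big1 ?scaler0 ?subr0; first exact: lin_span0.
  by move=> i /ht[_ /gctrP[gl _ _]]; rewrite (linf0 gl) mulr0.
exists (s ++ s'); split=> [u|t ht htu]; first by rewrite mem_cat => /orP[/hs|/hs'].
have e := euler (s := s) ht; set Y := \prod_(_ <- _) _ in e *.
have -> : \sum_(i <- t) inn i.1.2 * gctr i.1.1 i.2 (a *: Y + y) =
    a *: ((size s)%:R *: Y) + \sum_(i <- t) inn i.1.2 * gctr i.1.1 i.2 y.
  rewrite -e; last by move=> u us; split; [exact: hs|apply: htu; rewrite mem_cat us].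
  rewrite scaler_sumr -big_split; apply: eq_big_seq => i /ht[_ /gctrP[gl _ _]].
  by rewrite gl mulrDr -sA.
rewrite (_ : _ - _ = a *: ((1 - q.+1%:R^-1 * (size s)%:R) *: Y) +
   (y - q.+1%:R^-1 *: \sum_(i <- t) inn i.1.2 * gctr i.1.1 i.2 y)); last first.
  by module_with R (E : lmodType R).
apply: lin_spanD; last first.
  by apply: H' => // u us; apply: htu; rewrite mem_cat us orbT.
apply: lin_spanZ; move: sz; rewrite leq_eqVlt => /orP[/eqP -> | lt].
  by rewrite mulVf ?pnatr_eq0 // subrr scale0r; apply: lin_span0.
by apply/lin_spanZ/lin_span_in; exists s.
Qed.

Fixpoint all_forms (l : seq (nat * (V -> R^o))) : Prop :=
  if l is i :: l' then Phi i.1 i.2 /\ all_forms l' else True.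

Lemma all_forms_rcons l i : all_forms l -> Phi i.1 i.2 -> all_forms (rcons l i).
Proof. by elim: l => //= j l IH [hj hl] hi; split=> //; apply: IH. Qed.

(** Contractions of [X] have fewer factors and satisfy the same hypothesis, so they vanish by
    induction; the Euler operator then kills [X], which puts [X] itself in the lower filtration. *)
Lemma ext_sep X :
  (forall l, all_forms l -> counit (foldr (fun i => gctr i.1 i.2) X l) = 0) -> X = 0.
Proof.
have [q] := ext_filt_ex X; elim: q X => [|q IH] X hX H.
  (* Here [X] is a scalar, and the empty list of contractions gives its value. *)
  have [c e] : exists c, X = c *: 1.
    elim/lin_span_ind: X / hX {H} => [|a x y [s [_ sz ->]] [c ->]]; first by exists 0; rewrite scale0r.
    move: sz; rewrite leqn0 size_eq0 => /eqP ->; exists (a + c).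
    by rewrite big_nil scalerDl.
  have [cl c1 _] := counitP.
  have cX : counit X = c by rewrite e (linfZ cl) c1; exact: mulr1.
  by move: (H [::] I); rewrite /= cX e => ->; rewrite scale0r.
have X0 p phi : Phi p phi -> gctr p phi X = 0.
  have hF := @gctr_filt p phi; move=> hp; apply: IH; first exact: (hF (PhiH hp) q X hX).
  move=> l hl; have := H (rcons l (p, phi)) (all_forms_rcons (i := (p, phi)) hl hp).
  by rewrite foldr_rcons.
apply: IH; last by [].
have [s [hs Hs]] := euler_filt hX; have [t [ht tr]] := rep hs.
have := Hs t (fun i it => conj (ht i it).1 (span_homog_form (ht i it).2)) tr.
rewrite big_seq big1 ?scaler0 ?subr0 // => i /ht[_ si].
by rewrite (span_gctr0 (fun f hf => X0 _ f hf) si) mulr0.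
Qed.
End separation.

(** * Forms at a point as functions on lists of vectors *)

Section pointwise.
Variables (R : realType) (T : Type) (A : lmodType R).
Implicit Types (f h : T -> A).
Lemma ptD f h x : (f + h) x = f x + h x. Proof. by []. Qed.
Lemma ptN f x : (- f) x = - f x. Proof. by []. Qed.
Lemma ptZ (c : R) f x : (c *: f) x = c *: f x. Proof. by []. Qed.
Lemma pt0 x : (0 : T -> A) x = 0. Proof. by []. Qed.
End pointwise.
Definition ptE := (ptD, ptN, ptZ, pt0).

(* A form at a fixed point is represented by the function giving its values on
   lists of tangent vectors, of any length; [gsh] is then the wedge product
   written as a shuffle product, by recursion on the list of arguments. *)
Section shuffles.
Variables (R : realType) (g : Type).

(** The sign paid when a tangent vector is moved across [a]: one for the form degree, and an
    additional operator [sa] on the values. With [sa] the identity this gives the ordinary wedge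
    product. *)
Definition tw (A : lmodType R) (sa : A -> A) (a : seq g -> A) : seq g -> A :=
  fun s => (-1) ^+ size s *: sa (a s).

Definition arg (A : Type) (u : g) (a : seq g -> A) : seq g -> A := fun s => a (u :: s).

Fixpoint gsh (A B C : lmodType R) (op : A -> B -> C) (sa : A -> A)
    (a : seq g -> A) (b : seq g -> B) (v : seq g) {struct v} : C :=
  match v with
  | [::] => op (a [::]) (b [::])
  | u :: v' => gsh op sa (arg u a) b v' + gsh op sa (tw sa a) (arg u b) v'
  end.

Lemma arg_tw (A : lmodType R) (sa : A -> A) u a : arg u (tw sa a) = - tw sa (arg u a).
Proof. by apply: funext => s; rewrite /arg /tw /= exprS mulN1r scaleNr. Qed.

Lemma arg_lin (A : lmodType R) u : linear (@arg A u : (seq g -> A) -> (seq g -> A)).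
Proof. by []. Qed.

Lemma tw_lin (A : lmodType R) (sa : A -> A) : linear sa -> linear (tw sa).
Proof.
move=> sal c a b; apply: funext => s; rewrite /tw !ptE sal.
by module_with R (A : lmodType R).
Qed.

Lemma twK (A : lmodType R) (sa : A -> A) a : linear sa -> involutive sa -> tw sa (tw sa a) = a.
Proof.
move=> sal saK; apply: funext => s; rewrite /tw (linfZ sal) saK scalerA.
by rewrite -exprD -signr_odd oddD addbb scale1r.
Qed.

Section one_product.
Variables (A B C : lmodType R) (op : A -> B -> C) (sa : A -> A).
Hypotheses (opb : bilin op) (sal : linear sa).

Lemma gsh_bilin : bilin (gsh op sa : (seq g -> A) -> (seq g -> B) -> (seq g -> C)).
Proof.
split=> [a c b b'|b c a a']; apply: funext => v.
  elim: v a b b' => [|u v IH] a b b'; first exact: (bilinr opb).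
  rewrite !ptE /= (arg_lin u c b b') !IH !ptE.
  by module_with R (C : lmodType R).
elim: v b a a' => [|u v IH] b a a'; first exact: (bilinl opb).
rewrite !ptE /= (arg_lin u c a a') (tw_lin sal) !IH !ptE.
by module_with R (C : lmodType R).
Qed.

Lemma arg_gsh u a b : arg u (gsh op sa a b) = gsh op sa (arg u a) b + gsh op sa (tw sa a) (arg u b).
Proof. by []. Qed.

Lemma gsh_map (D : lmodType R) (f : C -> D) a b v : linear f ->
  f (gsh op sa a b v) = gsh (fun x y => f (op x y)) sa a b v.
Proof. by move=> fl; elim: v a b => //= u v IH a b; rewrite (linfD fl) !IH. Qed.
End one_product.

Lemma gsh_mapr (A B B' C : lmodType R) (op : A -> B -> C) (sa : A -> A) (f : B' -> B) a b v :
  gsh op sa a (fun s => f (b s)) v = gsh (fun x y => op x (f y)) sa a b v.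
Proof.
elim: v a b => //= u v IH a b.
by rewrite -!IH.
Qed.

Lemma gsh_mapl (A A' B C : lmodType R) (op : A -> B -> C) (sa : A -> A) (sa' : A' -> A')
    (f : A' -> A) a b v : linear f -> (forall x, sa (f x) = f (sa' x)) ->
  gsh op sa (fun s => f (a s)) b v = gsh (fun x y => op (f x) y) sa' a b v.
Proof.
move=> fl fs; elim: v a b => //= u v IH a b; rewrite -!IH; congr (_ + gsh _ _ _ _ _).
by apply: funext => s; rewrite /tw fs (linfZ fl).
Qed.

Lemma tw_gsh (A B C : lmodType R) (op : A -> B -> C) sa sb sc a b :
  bilin op -> linear sa -> linear sb -> linear sc ->
  (forall x y, sc (op x y) = op (sa x) (sb y)) ->
  tw sc (gsh op sa a b) = gsh op sa (tw sa a) (tw sb b).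
Proof.
move=> opb sal sbl scl H; apply: funext => v; have gb := gsh_bilin opb sal.
elim: v a b => [|u v IH] a b; first by rewrite /tw /= !scale1r H.
have IH' x y : (-1) ^+ size v *: sc (gsh op sa x y v) = gsh op sa (tw sa x) (tw sb y) v.
  exact: IH.
rewrite {1}/tw /= exprS mulN1r scaleNr (linfD scl) scalerDr !IH' !arg_tw.
by rewrite (bilinNl gb) (bilinNr gb) opprD.
Qed.

Lemma gsh_assoc (A B C AB BC D : lmodType R) (op1 : A -> B -> AB) (op2 : AB -> C -> D)
    (op3 : B -> C -> BC) (op4 : A -> BC -> D) sa sb sab a b c :
  bilin op1 -> bilin op2 -> bilin op3 -> bilin op4 -> linear sa -> linear sb -> linear sab ->
  (forall x y, sab (op1 x y) = op1 (sa x) (sb y)) ->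
  (forall x y z, op2 (op1 x y) z = op4 x (op3 y z)) ->
  gsh op2 sab (gsh op1 sa a b) c = gsh op4 sa a (gsh op3 sb b c).
Proof.
move=> b1 b2 b3 b4 sal sbl sabl H1 H; apply: funext => v.
elim: v a b c => [|u v IH] a b c; first exact: H.
have g1 := gsh_bilin b1 sal; have g2 := gsh_bilin b2 sabl.
have g3 := gsh_bilin b3 sbl; have g4 := gsh_bilin b4 sal.
rewrite /= !arg_gsh (tw_gsh _ _ _ sal sbl sabl) //.
by rewrite (bilinDl g2) (bilinDr g4) !ptE !IH addrA.
Qed.

(* Parity of the degree of a form. *)
Definition fpar (A : lmodType R) (p : nat) (a : seq g -> A) : Prop :=
  forall s, (-1) ^+ size s *: a s = (-1) ^+ p *: a s.

(** The sign produced when a form of degree parity [p] is moved across [a]. *)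
Definition twn (A : lmodType R) (p : nat) (a : seq g -> A) : seq g -> A :=
  fun s => (-1) ^+ (p * size s) *: a s.

Lemma fpar_arg (A : lmodType R) p u (a : seq g -> A) : fpar p a -> fpar p.+1 (arg u a).
Proof.
move=> H s; have := H (u :: s); rewrite /arg /= !exprS !mulN1r !scaleNr => e.
by rewrite -e opprK.
Qed.

Lemma fpar_tw (A : lmodType R) p (a : seq g -> A) : fpar p a -> tw id a = (-1) ^+ p *: a.
Proof. by move=> H; apply: funext => s; exact: H. Qed.

Lemma twn_lin (A : lmodType R) p : linear (@twn A p).
Proof. by move=> c a b; apply: funext => s; rewrite /twn !ptE; module_with R (A : lmodType R). Qed.

Lemma arg_twn (A : lmodType R) p u (a : seq g -> A) : arg u (twn p a) = (-1) ^+ p *: twn p (arg u a).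
Proof. by apply: funext => s; rewrite /arg /twn !ptE /= mulnS exprD scalerA. Qed.

Lemma tw_twn (A : lmodType R) p (a : seq g -> A) : tw id (twn p a) = twn p.+1 a.
Proof. by apply: funext => s; rewrite /tw /twn scalerA -exprD mulSn. Qed.

Lemma twn_tw (A : lmodType R) p (a : seq g -> A) : twn p (tw id a) = twn p.+1 a.
Proof. by apply: funext => s; rewrite /tw /twn scalerA -exprD mulSn addnC. Qed.

Lemma idl (A : lmodType R) : linear (@id A). Proof. by []. Qed.

Definition sh (A B C : lmodType R) (op : A -> B -> C) := gsh op id.

Lemma sh_nil (A B C : lmodType R) (op : A -> B -> C) a b :
  sh op a b [::] = op (a [::]) (b [::]).
Proof. by []. Qed.
Lemma sh_cons (A B C : lmodType R) (op : A -> B -> C) a b u v :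
  sh op a b (u :: v) = sh op (arg u a) b v + sh op (tw id a) (arg u b) v.
Proof. by []. Qed.
Lemma arg_sh (A B C : lmodType R) (op : A -> B -> C) u a b :
  arg u (sh op a b) = sh op (arg u a) b + sh op (tw id a) (arg u b).
Proof. by []. Qed.

Lemma sh_bilin (A B C : lmodType R) (op : A -> B -> C) : bilin op ->
  bilin (sh op : (seq g -> A) -> (seq g -> B) -> (seq g -> C)).
Proof. by move=> b; apply: gsh_bilin => //; apply: idl. Qed.

(** Graded commutation of the form parts of [a] and [b], whenever the pairings of the values allow
    the exchange without a sign. Several value spaces occur because forms valued in g will be moved
    across forms valued in its exterior algebra. *)
Lemma sh_lcomm (A B C BC AC D : lmodType R) (op1 : B -> C -> BC) (op2 : A -> BC -> D)
    (op3 : A -> C -> AC) (op4 : B -> AC -> D) p a b c :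
  bilin op1 -> bilin op2 -> bilin op3 -> bilin op4 ->
  (forall x y z, op2 x (op1 y z) = op4 y (op3 x z)) -> fpar p a ->
  sh op2 a (sh op1 b c) = sh op4 (twn p b) (sh op3 a c).
Proof.
move=> b1 b2 b3 b4 H ap; apply: funext => v.
elim: v p a b c ap => [|u v IH] p a b c ap; first by rewrite !sh_nil H /twn muln0 scale1r.
have g1 := sh_bilin b1; have g2 := sh_bilin b2; have g3 := sh_bilin b3; have g4 := sh_bilin b4.
rewrite !sh_cons !arg_sh (fpar_tw ap) arg_twn tw_twn.
rewrite (bilinDr g2) (bilinZl g2) !ptE (IH _ _ _ _ (fpar_arg u ap)).
rewrite (bilinZl g4) (bilinZl g2) (bilinDr g4) (bilinZl g3) (bilinZr g4) !ptE.
by rewrite !(IH _ _ _ _ ap) twn_tw; module_with R (D : lmodType R).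
Qed.

Lemma sh_comm (A B C : lmodType R) (op : A -> B -> C) (op' : B -> A -> C) p a b :
  bilin op -> bilin op' -> (forall x y, op x y = op' y x) -> fpar p a ->
  sh op a b = sh op' (twn p b) a.
Proof.
move=> ob ob' H ap; apply: funext => v.
elim: v p a b ap => [|u v IH] p a b ap; first by rewrite !sh_nil H /twn muln0 scale1r.
have g1 := sh_bilin ob; have g2 := sh_bilin ob'.
rewrite !sh_cons (fpar_tw ap) arg_twn tw_twn (bilinZl g1) (bilinZl g2) !ptE.
by rewrite (IH _ _ _ (fpar_arg u ap)) (IH _ _ _ ap) addrC.
Qed.

Lemma twn_sh (A B C : lmodType R) (op : A -> B -> C) p a b : bilin op ->
  twn p (sh op a b) = sh op (twn p a) (twn p b).
Proof.
move=> ob; case: (boolP (odd p)) => [po|po]; last first.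
  have e (X : lmodType R) (x : seq g -> X) : twn p x = x.
    by apply: funext => s; rewrite /twn -signr_odd oddM (negbTE po) scale1r.
  by rewrite !e.
have e (X : lmodType R) (x : seq g -> X) : twn p x = tw id x.
  by apply: funext => s; rewrite /twn /tw -signr_odd oddM po signr_odd.
by rewrite !e (tw_gsh (sb := id) (sa := id)) //; exact: idl.
Qed.

Lemma fpar_size (A : lmodType R) p (a : seq g -> A) : (forall s, size s != p -> a s = 0) -> fpar p a.
Proof. by move=> H s; have [->|/H ->] := eqVneq (size s) p; rewrite ?scaler0. Qed.

Lemma sh_supp (A B C : lmodType R) (op : A -> B -> C) p q a b : bilin op ->
  (forall s, size s != p -> a s = 0) -> (forall s, size s != q -> b s = 0) ->
  forall s, size s != (p + q)%N -> sh op a b s = 0.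
Proof.
move=> ob ap bq v; elim: v p q a b ap bq => [|u v IH] p q a b ap bq.
  rewrite sh_nil; case: p ap => [|p] ap; last by rewrite ap // (bilin0l ob).
  by case: q bq => [|q] bq //; rewrite bq // (bilin0r ob).
rewrite sh_cons => ne; have g1 := sh_bilin ob.
rewrite (_ : sh op (arg u a) b v = 0) ?add0r.
  case: q bq ne => [|q] bq ne.
    have -> : arg u b = 0 by apply: funext => s; apply: bq.
    by rewrite (bilin0r g1).
  apply: (IH p q); last by move: ne; rewrite addnS eqSS.
    by move=> s ns; rewrite /tw ap // scaler0.
  by move=> s ns; apply: bq; rewrite /= eqSS.
case: p ap ne => [|p] ap ne.
  have -> : arg u a = 0 by apply: funext => s; apply: ap.
  by rewrite (bilin0l g1).
have ap' s : size s != p -> arg u a s = 0 by move=> ns; apply: ap; rewrite /= eqSS.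
by apply: (IH p q _ _ ap' bq); move: ne; rewrite /= addSn eqSS.
Qed.
End shuffles.

(** * From sums over permutations to shuffles *)

Section permutation_shuffle.
Variables (R : realType) (g : lmodType R).

Definition ins (A : Type) (j : nat) (u : A) (s : seq A) : seq A := take j s ++ u :: drop j s.

Lemma size_ins (A : Type) j (u : A) s : size (ins j u s) = (size s).+1.
Proof. by rewrite /ins size_cat /= addnS -size_cat cat_take_drop. Qed.

Lemma ins0 (A : Type) (u : A) s : ins 0 u s = u :: s.
Proof. by rewrite /ins take0 drop0. Qed.

Definition seq_of k (v : 'I_k -> g) : seq g := [seq v i | i <- enum 'I_k].

Lemma size_seq_of k (v : 'I_k -> g) : size (seq_of v) = k.
Proof. by rewrite size_map size_enum_ord. Qed.

Lemma nth_seq_of k (v : 'I_k -> g) (i : 'I_k) : nth 0 (seq_of v) i = v i.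
Proof. by rewrite (nth_map i) ?size_enum_ord // nth_ord_enum. Qed.

Lemma seq_ofS k (v : 'I_k.+1 -> g) : seq_of v = v ord0 :: seq_of (fun i => v (lift ord0 i)).
Proof. by rewrite /seq_of enum_ordSl /= -map_comp. Qed.

Lemma seq_ofP k (v : 'I_k -> g) (s : seq g) : size s = k ->
  (forall i : 'I_k, nth 0 s i = v i) -> seq_of v = s.
Proof.
move=> sz H; apply: (@eq_from_nth _ 0); first by rewrite size_seq_of.
move=> i; rewrite size_seq_of => lt; rewrite -[i]/(nat_of_ord (Ordinal lt)).
by rewrite nth_seq_of H.
Qed.

Definition evseq (A : Type) (w : forall k, ('I_k -> g) -> A) (s : seq g) : A :=
  w (size s) (fun i => nth 0 s i).

Lemma evseq_of (A : Type) (w : forall k, ('I_k -> g) -> A) k (v : 'I_k -> g) :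
  evseq w (seq_of v) = w k v.
Proof.
have H k' (e : k' = k) (v' : 'I_k' -> g) : (forall i : 'I_k', v' i = v (cast_ord e i)) -> w k' v' = w k v.
  move: e v v'; case: k / => v v' Hv; congr (w _ _); apply: funext => i; rewrite Hv.
  by congr (v _); apply: val_inj.
apply: (H _ (size_seq_of v)) => i.
by rewrite -[nat_of_ord i]/(nat_of_ord (cast_ord (size_seq_of v) i)) nth_seq_of.
Qed.

Lemma seq_of_lift_perm k (v : 'I_k.+1 -> g) (j : 'I_k.+1) (t : 'S_k) :
  seq_of (fun i => v (lift_perm j ord0 t i)) =
  ins j (v ord0) (seq_of (fun i => v (lift ord0 (t i)))).
Proof.
apply: seq_ofP => [|i]; first by rewrite size_ins size_seq_of.
have szt : size (take j (seq_of (fun i => v (lift ord0 (t i))))) = j.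
  by rewrite size_take size_seq_of; case: ltnP => // le; apply/eqP; rewrite eqn_leq le -ltnS ltn_ord.
rewrite /ins nth_cat szt; case: (unliftP j i) => [i' ->|->]; last first.
  by rewrite ltnn subnn lift_perm_id.
rewrite lift_perm_lift /= /bump; case: (leqP j i') => le /=.
  rewrite add1n ltnNge (leq_trans le (leqnSn _)) /= subSn //= nth_drop subnKC // -[RHS]/((fun i => v (lift ord0 (t i))) i').
  by rewrite -nth_seq_of.
by rewrite add0n le nth_take // nth_seq_of.
Qed.

Section alternation.
Variable A : lmodType R.
Implicit Types F : seq g -> A.

(** The signed sum of [F] over all orderings, organized by the place [j] at which the first vector
    is inserted among the others. *)
Fixpoint altn F (s : seq g) : A :=
  match s with
  | [::] => F [::]
  | u :: s' => \sum_(j < (size s').+1) (-1) ^+ j *: altn (fun t => F (ins j u t)) s'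
  end.

Lemma eq_altn F F' s : (forall t, size t = size s -> F t = F' t) -> altn F s = altn F' s.
Proof.
elim: s F F' => [|u s IH] F F' H /=; first exact: H.
apply: eq_bigr => j _; congr (_ *: _); apply: IH => t st; apply: H.
by rewrite size_ins st.
Qed.

Lemma altnZ c F s : altn (fun t => c *: F t) s = c *: altn F s.
Proof.
elim: s F => //= u s IH F; rewrite scaler_sumr; apply: eq_bigr => j _.
by rewrite IH !scalerA mulrC.
Qed.

(** Permutations of k + 1 indices are sorted by the preimage j of 0, the place where the first
    vector ends up; [lift_perm] identifies each class with the permutations of k indices and
    contributes the sign (-1)^j. *)
Lemma sum_perm_altn F k (v : 'I_k -> g) :
  \sum_(s : 'S_k) (-1) ^+ s *: F (seq_of (fun i => v (s i))) = altn F (seq_of v).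
Proof.
elim: k F v => [|k IH] F v.
  rewrite (big_pred1 1%g) => [|s]; last by rewrite /= (_ : s = 1%g) ?eqxx //; apply/permP => - [].
  rewrite odd_perm1 scale1r (_ : seq_of v = [::]) //=; last by apply/size0nil; rewrite size_seq_of.
  by congr F; apply/size0nil; rewrite size_seq_of.
rewrite seq_ofS /= size_seq_of.
rewrite (partition_big (fun s : 'S_k.+1 => (s^-1)%g ord0) predT) //=.
apply: eq_bigr => j _.
rewrite (eq_bigl (fun s : 'S_k.+1 => s j == ord0)); last first.
  by move=> s; apply/eqP/eqP => [<-|<-]; rewrite ?permKV ?permK.
(* [ulsf] recovers the smaller permutation by deleting j and its image. *)
rewrite (reindex (lift_perm j ord0)) /=; last first.
  pose ulsf i (s : 'S_k.+1) k' := odflt k' (unlift (s i) (s (lift i k'))).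
  have ulsfK i (s : 'S_k.+1) k' : lift (s i) (ulsf i s k') = s (lift i k').
    rewrite /ulsf; have:= neq_lift i k'.
    by rewrite -(can_eq (permK s)) => /unlift_some[] ? ? ->.
  have inj_ulsf : injective (ulsf j _).
    move=> s; apply: can_inj (ulsf (s j) s^-1%g) _ => k'.
    by rewrite {1}/ulsf ulsfK !permK liftK.
  exists (fun s => perm (inj_ulsf s)) => [s _ | s].
    by apply/permP=> k'; rewrite permE /ulsf lift_perm_lift lift_perm_id liftK.
  move/(s _ =P _) => si0; apply/permP=> k'.
  case: (unliftP j k') => [k''|] ->; rewrite ?lift_perm_id ?lift_perm_lift //.
  by rewrite -si0 permE ulsfK.
rewrite -(IH (fun t => F (ins j (v ord0) t)) (fun i => v (lift ord0 i))) scaler_sumr.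
apply: eq_big => [t|t _]; first by rewrite lift_perm_id eqxx.
by rewrite seq_of_lift_perm scalerA odd_lift_perm /= addbF signr_addb signr_odd.
Qed.
End alternation.

Definition ialt (A : lmodType R) (a : seq g -> A) : Prop :=
  forall j u s, (j <= size s)%N -> a (ins j u s) = (-1) ^+ j *: a (u :: s).

Lemma ialt_arg (A : lmodType R) u (a : seq g -> A) : ialt a -> ialt (arg u a).
Proof.
move=> H j w s le; rewrite /arg.
rewrite -[u :: ins _ _ _]/(ins j.+1 w (u :: s)) H // exprS mulN1r scaleNr.
have := H 1%N u (w :: s) isT; rewrite /ins /= take0 drop0 => ->.
by rewrite expr1 scaleN1r scalerN opprK.
Qed.

Lemma ialt_tw (A : lmodType R) (a : seq g -> A) : ialt a -> ialt (tw id a).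
Proof. by move=> H j w s le; rewrite /tw size_ins H // !scalerA mulrC. Qed.

Section product.
Variables (A B C : lmodType R) (op : A -> B -> C).
Hypothesis opb : bilin op.

Definition split_op p (a : seq g -> A) (b : seq g -> B) (s : seq g) : C :=
  op (a (take p s)) (b (drop p s)).

(** The vector [u] lands among the p arguments of [a] in p ways and among those of [b] in the
    remaining ways. By alternation it can be moved to the front of its block, and all the ways
    within one block then contribute equally. *)
Lemma altn_split_op p a b u s : ialt a -> ialt b -> (p <= (size s).+1)%N ->
  altn (split_op p a b) (u :: s) =
  p%:R *: altn (split_op p.-1 (arg u a) b) s +
  ((size s).+1 - p)%:R *: altn (split_op p (tw id a) (arg u b)) s.
Proof.
move=> aa ab lep /=; rewrite -(big_mkord xpredT (fun j => (-1) ^+ j *: altn (fun t => split_op p a b (ins j u t)) s)).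
rewrite (big_cat_nat (leq0n p) lep) /=; congr (_ + _).
  rewrite (eq_big_nat _ _ (F2 := fun=> altn (split_op p.-1 (arg u a) b) s)); last first.
    move=> j /andP[_ ltj]; rewrite -altnZ; apply: eq_altn => t st; rewrite /split_op /ins.
    case: p lep ltj => // p lep ltj; rewrite !ltnS in lep ltj *.
    have szj : size (take j t) = j by rewrite size_takel // st (leq_trans ltj).
    rewrite take_cat drop_cat szj ltnNge (leq_trans ltj) //= subSn //=.
    rewrite take_drop drop_drop subnK // /arg.
    have -> : take j t ++ u :: drop j (take p t) = ins j u (take p t).
      by rewrite /ins -{1}(minn_idPl ltj) take_min; congr (_ ++ _); rewrite take_takel.
    rewrite aa; last by rewrite size_takel // st.
    by rewrite (bilinZl opb) scalerA -exprD -signr_odd oddD addbb scale1r.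
  by rewrite sumr_const_nat subn0 scaler_nat.
rewrite (eq_big_nat _ _ (F2 := fun=> altn (split_op p (tw id a) (arg u b)) s)); last first.
  move=> j /andP[lej ltj]; rewrite -altnZ; apply: eq_altn => t st; rewrite /split_op /ins.
  have szj : size (take j t) = j by rewrite size_takel // st.
  rewrite ltnS in ltj; have lept : (p <= size t)%N by rewrite st (leq_trans lej).
  have e1 : take p (take j t ++ u :: drop j t) = take p t.
    rewrite takel_cat ?szj // -{2}(cat_take_drop j t) takel_cat ?szj //.
  have e2 : drop p (take j t ++ u :: drop j t) = ins (j - p) u (drop p t).
    rewrite drop_cat szj; case: ltngtP lej => // [lt|->] _; last by rewrite subnn ins0 drop0.
    by rewrite /ins drop_drop subnK 1?ltnW // take_drop subnK // ltnW.
  rewrite e1 e2 ab; last by rewrite size_drop st leq_sub2r.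
  rewrite /tw size_takel // (bilinZr opb) (bilinZl opb) scalerA -exprD; congr (_ *: _).
  by apply: signr_eq; rewrite oddD oddB // addKb.
by rewrite sumr_const_nat scaler_nat.
Qed.

(** The multiplicities p and k + 1 - p of the preceding identity each cancel one factor of the
    factorials, which leaves the recursion of the shuffle product. *)
Lemma sh_altn a b s : ialt a -> ialt b ->
  \sum_(p < (size s).+1) ((p`! * (size s - p)`!)%:R : R)^-1 *: altn (split_op p a b) s = sh op a b s.
Proof.
elim: s a b => [|u s IH] a b aa ab.
  by rewrite big_ord1 /= subn0 fact0 muln1 invr1 scale1r.
rewrite sh_cons -(IH _ _ (ialt_arg u aa) ab) -(IH _ _ (ialt_tw aa) (ialt_arg u ab)).
set k := size s.
transitivity (\sum_(p < k.+2) ((p`! * (k.+1 - p)`!)%:R : R)^-1 *: (p%:R *: altn (split_op p.-1 (arg u a) b) s)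
  + \sum_(p < k.+2) ((p`! * (k.+1 - p)`!)%:R : R)^-1 *: ((k.+1 - p)%:R *: altn (split_op p (tw id a) (arg u b)) s)).
  rewrite -big_split; apply: eq_bigr => p _; rewrite altn_split_op ?scalerDr //.
  by rewrite -ltnS ltn_ord.
congr (_ + _).
  rewrite big_ord_recl /= scale0r scaler0 add0r; apply: eq_bigr => p _.
  rewrite /bump /= add1n subSS scalerA; congr (_ *: _).
  by rewrite factS -mulnA natrM invfM mulrAC mulVf ?pnatr_eq0 // mul1r.
rewrite big_ord_recr /= subnn scale0r scaler0 addr0; apply: eq_bigr => p _.
have lep : (p <= k)%N by rewrite -ltnS ltn_ord.
rewrite scalerA; congr (_ *: _).
by rewrite subSn // factS mulnCA natrM invfM mulrAC mulVf ?pnatr_eq0 // mul1r.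
Qed.
End product.

Definition perm_anti (A : lmodType R) (w : forall k, ('I_k -> g) -> A) : Prop :=
  forall k (v : 'I_k -> g) (s : 'S_k), w k (fun i => v (s i)) = (-1) ^+ s *: w k v.

(** Inserting at place j is the cycle [lift_perm j ord0 1], of sign (-1)^j. *)
Lemma perm_anti_ialt (A : lmodType R) (w : forall k, ('I_k -> g) -> A) :
  perm_anti w -> ialt (evseq w).
Proof.
move=> H j u s le; pose v (i : 'I_(size s).+1) := nth 0 (u :: s) i.
have ev : seq_of v = u :: s by apply: seq_ofP.
have jlt : (j < (size s).+1)%N by [].
have := seq_of_lift_perm v (Ordinal jlt) 1%g; rewrite /= {2}/v /=.
have -> : seq_of (fun i => v (lift ord0 ((1%g : 'S_(size s)) i))) = s.
  by apply: seq_ofP => // i; rewrite perm1.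
move=> <-; rewrite evseq_of H odd_lift_perm /= odd_perm1 addbF addbF signr_odd.
by rewrite -ev evseq_of.
Qed.

Definition gform_op (A B C : lmodType R) (op : A -> B -> C) (a : forall k, ('I_k -> g) -> A)
    (b : forall k, ('I_k -> g) -> B) : forall k, ('I_k -> g) -> C :=
  fun k v => \sum_(p < k.+1) ((p`! * (k - p)`!)%:R : R)^-1 *:
    \sum_(s : 'S_k)
      let w i := v (s (cast_ord (subnKC (leq_ord p)) i)) in
      (-1) ^+ s *: op (a p (fun i => w (lshift (k - p) i)))
                      (b (k - p)%N (fun i => w (rshift p i))).

Lemma evseq_gform_op (A B C : lmodType R) (op : A -> B -> C) a b : bilin op ->
  perm_anti a -> perm_anti b -> evseq (gform_op op a b) = sh op (evseq a) (evseq b).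
Proof.
move=> opb aa ab; apply: funext => s0.
pose v (i : 'I_(size s0)) := nth 0 s0 i.
have ev : seq_of v = s0 by apply: seq_ofP.
rewrite -(sh_altn opb s0 (perm_anti_ialt aa) (perm_anti_ialt ab)) -[LHS]/(gform_op op a b v).
apply: eq_bigr => p _; congr (_ *: _).
have := sum_perm_altn (split_op op p (evseq a) (evseq b)) v; rewrite ev => <-.
apply: eq_bigr => s _; congr (_ *: _); rewrite /split_op -(evseq_of a) -(evseq_of b).
have lep : (p <= size s0)%N by rewrite -ltnS ltn_ord.
congr (op (evseq a _) (evseq b _)); apply: seq_ofP.
- by rewrite size_takel // size_seq_of.
- move=> i; rewrite nth_take //.
  exact: (nth_seq_of (fun i => v (s i)) (cast_ord (subnKC (leq_ord p)) (lshift _ i))).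
- by rewrite size_drop size_seq_of.
- move=> i; rewrite nth_drop.
  exact: (nth_seq_of (fun i => v (s i)) (cast_ord (subnKC (leq_ord p)) (rshift _ i))).
Qed.
End permutation_shuffle.

(** * Associativity of a product built from commuting pairs of contractions *)

Section convolution_abstract.
Variables (R : realType) (B : lmodType R) (I : Type).
Variables (P : B -> B -> B) (eps : B -> B) (io jo : I -> B -> B) (K : B -> Prop).

Fixpoint cv (l : seq I) (a b : B) : B :=
  match l with
  | [::] => P a b
  | j :: l' => cv l' a b + cv l' (io j a) (jo j b)
  end.

Fixpoint sub_sum (l : seq I) (F : seq I -> B) : B :=
  match l with
  | [::] => F [::]
  | j :: l' => sub_sum l' F + sub_sum l' (fun s => F (j :: s))
  end.

Lemma cvE l a b :
  cv l a b = sub_sum l (fun s => P (foldl (fun x i => io i x) a s) (foldl (fun x i => jo i x) b s)).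
Proof. by elim: l a b => //= j l IH a b; rewrite !IH. Qed.

Hypotheses (Pb : bilin P) (PA : forall a b c, P (P a b) c = P a (P b c)).
Hypotheses (el : linear eps) (eK : involutive eps)
  (eP : forall a b, eps (P a b) = P (eps a) (eps b)).
Hypotheses (il : forall i, linear (io i)) (jl : forall i, linear (jo i)).
Hypotheses (iP : forall i a b, io i (P a b) = P (io i a) (eps b) + P a (io i b))
  (jP : forall i a b, jo i (P a b) = P (jo i a) b + P (eps a) (jo i b)).
Hypotheses (ii : forall i j a, K a -> io i (io j a) = - io j (io i a))
  (jj : forall i j a, jo i (jo j a) = - jo j (jo i a))
  (ij : forall i j a, io i (jo j a) = jo j (io i a))
  (ie : forall i a, io i (eps a) = - eps (io i a))
  (je : forall i a, jo i (eps a) = - eps (jo i a)).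
Hypotheses (Ki : forall i a, K a -> K (io i a)) (Kj : forall i a, K a -> K (jo i a))
  (Ke : forall a, K a -> K (eps a)) (KP : forall a b, K a -> K b -> K (P a b))
  (KD : forall a b, K a -> K b -> K (a + b)).

Lemma cv_bilin l : bilin (cv l).
Proof.
elim: l => [|j l IH] //=; split=> [x a u v|y a u v].
  by rewrite (jl j) !(bilinr IH); module_with R (B : lmodType R).
by rewrite (il j) !(bilinl IH); module_with R (B : lmodType R).
Qed.

Lemma cvK l a b : K a -> K b -> K (cv l a b).
Proof.
elim: l a b => [|j l IH] a b Ka Kb /=; first exact: KP.
by apply: KD; apply: IH => //; [apply: Ki|apply: Kj].
Qed.

(** The contractions [io i] stay odd derivations from the right after each step: crossing [io j]
    costs a sign, which is the one that [jo j] picks up in crossing [eps]. The predicate [K] selects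
    the elements on which the [io] anticommute; for forms these are the alternating ones. *)
Lemma io_cv i l a b : K a -> io i (cv l a b) = cv l (io i a) (eps b) + cv l a (io i b).
Proof.
elim: l a b => [|j l IH] a b Ka /=; first exact: iP.
rewrite (linfD (il i)) !IH //; last exact: Ki.
rewrite (ii i j Ka) je (bilinNl (cv_bilin l)) (bilinNr (cv_bilin l)) ij.
by module_with R (B : lmodType R).
Qed.

Lemma jo_cv i l a b : jo i (cv l a b) = cv l (jo i a) b + cv l (eps a) (jo i b).
Proof.
elim: l a b => [|j l IH] a b /=; first exact: jP.
rewrite (linfD (jl i)) !IH (jj i j b) ie (bilinNl (cv_bilin l)) (bilinNr (cv_bilin l)) -ij.
by module_with R (B : lmodType R).
Qed.

Lemma double0 (x : B) : x = - x -> x = 0.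
Proof.
move=> e; have : 2%:R *: x = 0 by rewrite (_ : 2 = 1 + 1 :> R) // scalerDl !scale1r [X in X + _]e addNr.
by move/eqP; rewrite scaler_eq0 pnatr_eq0 /= => /eqP.
Qed.

(* One index j at a time: both sides expand into a b c + a.i(b).j(c) + i(a).j(b).c
   + i(a).eps(b).j(c) + i(a).(i j b).j(c). *)
Lemma cvA l a b c : K a -> K b -> cv l (cv l a b) c = cv l a (cv l b c).
Proof.
elim: l a b c => [|j l IH] a b c Ka Kb /=; first exact: PA.
have cb := cv_bilin l; have Kia := Ki j Ka; have Kjb := Kj j Kb.
have ii0 : io j (io j a) = 0 by apply/double0/ii.
have jj0 : jo j (jo j c) = 0 by apply/double0/jj.
rewrite (linfD (il j)) (linfD (jl j)) !io_cv // !jo_cv ii0 jj0 (bilin0l cb) (bilin0r cb).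
rewrite !(bilinDl cb) !(bilinDr cb) !IH ?ij //; try by [apply: Ki|apply: Ke|apply: Kj|apply/Kj/Ki].
rewrite -?ij (bilin0r cb) ?(bilin0l cb).
by module_with R (B : lmodType R).
Qed.
End convolution_abstract.

Section subset_sum.
Variables (R : realType) (B : lmodType R) (n : nat).

Lemma sub_sum_set (t : seq 'I_n) (F : seq 'I_n -> B) : uniq t ->
  sub_sum t F = \sum_(K : {set 'I_n} | K \subset [set x in t]) F [seq i <- t | i \in K].
Proof.
elim: t F => [|j t IH] F /=.
  move=> _; rewrite (big_pred1 (finset.set0 : {set 'I_n})) // => K; apply/idP/eqP => [KS|->].
    by apply/finset.setP => x; rewrite !inE; apply/negP => /(fintype.subsetP KS); rewrite inE.
  by apply/fintype.subsetP => x; rewrite inE.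
move=> /andP[jt ut]; rewrite !IH // [RHS](bigID (fun K : {set 'I_n} => j \notin K)) /=.
congr (_ + _).
  apply: eq_big => [K|K KS]; last first.
    by rewrite (_ : (j \in K) = false) //; apply: contraNF jt => jK; have := fintype.subsetP KS _ jK; rewrite inE.
  apply/idP/andP => [KS|[KS jK]].
    split; first by apply: fintype.subset_trans KS _; apply/fintype.subsetP => x; rewrite !inE => ->; rewrite orbT.
    by apply/negP => /(fintype.subsetP KS); rewrite inE (negbTE jt).
  apply/fintype.subsetP => x xK; have := fintype.subsetP KS _ xK; rewrite !inE => /orP[/eqP xj|//].
  by rewrite xj (negbTE jK) in xK.
rewrite [RHS](reindex_onto (fun K : {set 'I_n} => j |: K) (fun K => K :\ j)) /=; last first.
  by move=> K /andP[_]; rewrite negbK => jK; rewrite finset.setD1K.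
apply: eq_big => [K|K KS].
  rewrite !inE eqxx /= andbT; apply/idP/andP => [KS|[KS /eqP e]].
    have jK : j \notin K by apply: contra jt => /(fintype.subsetP KS); rewrite inE.
    split; last by rewrite finset.setU1K.
    by apply/fintype.subsetP => x; rewrite !inE => /orP[->//|/(fintype.subsetP KS)]; rewrite inE => ->; rewrite orbT.
  have jK : j \notin K by rewrite -e !inE eqxx.
  apply/fintype.subsetP => x xK; have := fintype.subsetP KS x; rewrite !inE xK orbT => /(_ isT) /orP[/eqP xj|//].
  by rewrite xj (negbTE jK) in xK.
rewrite !inE eqxx /=; congr (F (_ :: _)); apply: eq_in_filter => x xt.
by rewrite !inE; case: eqP => // xj; rewrite xj (negbTE jt) in xt.
Qed.

(** The reversal turns the left folds of [cvE] into the compositions of contractions in the order of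
    [S_hat]. *)
Lemma sub_sum_rev_enum (F : seq 'I_n -> B) :
  sub_sum (rev (enum 'I_n)) F = \sum_(K : {set 'I_n}) F (rev (enum K)).
Proof.
rewrite sub_sum_set ?rev_uniq ?enum_uniq //; apply: eq_big => [K|K _].
  by apply/fintype.subsetP => x _; rewrite inE mem_rev mem_enum.
by rewrite filter_rev enumT.
Qed.
End subset_sum.

(** * Alternating and multilinear functions on lists *)

Section form_classes.
Variables (R : realType) (g : lmodType R).

Definition aalt (A : lmodType R) (a : seq g -> A) : Prop :=
  forall s1 u w s2, a (s1 ++ u :: w :: s2) = - a (s1 ++ w :: u :: s2).

Definition mlin (A : lmodType R) (a : seq g -> A) : Prop :=
  forall s1 c u w s2, a (s1 ++ (c *: u + w) :: s2) = c *: a (s1 ++ u :: s2) + a (s1 ++ w :: s2).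

Lemma aalt_arg (A : lmodType R) u (a : seq g -> A) : aalt a -> aalt (arg u a).
Proof. by move=> H s1 v w s2; exact: (H (u :: s1)). Qed.
Lemma mlin_arg (A : lmodType R) u (a : seq g -> A) : mlin a -> mlin (arg u a).
Proof. by move=> H s1 c v w s2; exact: (H (u :: s1)). Qed.
Lemma aalt_args (A : lmodType R) u w (a : seq g -> A) : aalt a -> arg u (arg w a) = - arg w (arg u a).
Proof. by move=> H; apply: funext => s; exact: (H [::]). Qed.

Lemma aalt_tw (A : lmodType R) sa (a : seq g -> A) : linear sa -> aalt a -> aalt (tw sa a).
Proof. by move=> sal H s1 v w s2; rewrite /tw H (linfN sal) scalerN !size_cat. Qed.
Lemma mlin_tw (A : lmodType R) sa (a : seq g -> A) : linear sa -> mlin a -> mlin (tw sa a).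
Proof.
move=> sal H s1 c v w s2; rewrite /tw H sal !size_cat /=.
by module_with R (A : lmodType R).
Qed.

Lemma aaltD (A : lmodType R) (a b : seq g -> A) : aalt a -> aalt b -> aalt (a + b).
Proof. by move=> H1 H2 s1 u w s2; rewrite !ptE H1 H2 opprD. Qed.
Lemma mlinD (A : lmodType R) (a b : seq g -> A) : mlin a -> mlin b -> mlin (a + b).
Proof. by move=> H1 H2 s1 c u w s2; rewrite !ptE H1 H2; module_with R (A : lmodType R). Qed.

Lemma aalt_map (A C : lmodType R) (f : A -> C) (a : seq g -> A) :
  linear f -> aalt a -> aalt (fun s => f (a s)).
Proof. by move=> fl H s1 u w s2; rewrite H (linfN fl). Qed.
Lemma mlin_map (A C : lmodType R) (f : A -> C) (a : seq g -> A) :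
  linear f -> mlin a -> mlin (fun s => f (a s)).
Proof. by move=> fl H s1 c u w s2; rewrite H fl. Qed.

Lemma aalt_gsh (A B C : lmodType R) (op : A -> B -> C) sa a b : bilin op -> linear sa -> involutive sa ->
  aalt a -> aalt b -> aalt (gsh op sa a b).
Proof.
move=> ob sal saK aa ab s1; have gb := @gsh_bilin R g A B C op sa ob sal.
elim: s1 a b aa ab => [|x s1 IH] a b aa ab u w s2 /=; last first.
  rewrite (IH _ _ (aalt_arg x aa) ab u w) (IH _ _ (aalt_tw sal aa) (aalt_arg x ab) u w).
  by rewrite opprD.
rewrite !(arg_tw _ u) !(arg_tw _ w) !(twK _ sal saK).
rewrite (aalt_args u w aa) (aalt_args u w ab).
rewrite !(bilinNl gb) !(bilinNr gb) !ptE.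
by module_with R (C : lmodType R).
Qed.

Lemma mlin_gsh (A B C : lmodType R) (op : A -> B -> C) sa a b : bilin op -> linear sa ->
  mlin a -> mlin b -> mlin (gsh op sa a b).
Proof.
move=> ob sal ma mb s1; have gb := @gsh_bilin R g A B C op sa ob sal.
elim: s1 a b ma mb => [|x s1 IH] a b ma mb c u w s2 /=; last first.
  rewrite (IH _ _ (mlin_arg x ma) mb) (IH _ _ (mlin_tw sal ma) (mlin_arg x mb)).
  by module_with R (C : lmodType R).
have e (X : lmodType R) (y : seq g -> X) : mlin y -> arg (c *: u + w) y = c *: arg u y + arg w y.
  by move=> H; apply: funext => s; exact: (H [::]).
rewrite (e _ _ ma) (e _ _ mb) (bilinl gb) (bilinr gb) !ptE.
by module_with R (C : lmodType R).
Qed.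

Lemma aalt0 (A : lmodType R) (a : seq g -> A) s1 u s2 : aalt a -> a (s1 ++ u :: u :: s2) = 0.
Proof.
move=> H; have := H s1 u u s2; set x := a _ => e.
have : 2%:R *: x = 0 by rewrite (_ : 2 = 1 + 1 :> R) // scalerDl !scale1r [X in X + _]e addNr.
by move/eqP; rewrite scaler_eq0 pnatr_eq0 /= => /eqP.
Qed.
End form_classes.

(** * The twisted product of forms and its contractions *)

Section twisted_product.
Variables (R : realType) (g : lmodType R) (E : lmodType R) (I : Type).
Variables (pr : E -> E -> E) (sg : E -> E) (con : I -> E -> E) (vec : I -> g).
Local Notation B := (seq g -> E).

Definition cvP (a b : B) : B := gsh pr sg a b.
Definition cve (a : B) : B := tw sg a.
(** The signs in [cvi] and [cvj] make the two kinds of contraction commute with each other and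
    anticommute with [cve], and turn them into odd derivations of [cvP], from the right and from the
    left respectively. *)
Definition cvi (i : I) (a : B) : B := arg (vec i) (tw sg a).
Definition cvj (i : I) (a : B) : B := fun s => (-1) ^+ size s *: con i (a s).

Hypotheses (prb : bilin pr) (prA : forall x y z, pr (pr x y) z = pr x (pr y z)).
Hypotheses (sgl : linear sg) (sgK : involutive sg)
  (sgM : forall x y, sg (pr x y) = pr (sg x) (sg y)).
Hypotheses (conl : forall i, linear (con i))
  (conM : forall i x y, con i (pr x y) = pr (con i x) y + pr (sg x) (con i y))
  (cons : forall i x, con i (sg x) = - sg (con i x))
  (conC : forall i j x, con i (con j x) = - con j (con i x)).

Let Pb : bilin cvP. Proof. exact: gsh_bilin. Qed.

Let jP i (a b : B) : cvj i (cvP a b) = cvP (cvj i a) b + cvP (cve a) (cvj i b).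
Proof.
apply: funext => v; elim: v a b => [|u v IH] a b.
  by rewrite ptD /cvj /cvP /cve /tw /= !expr0 !scale1r conM.
have argj w (c : B) : arg w (cvj i c) = - cvj i (arg w c).
  by apply: funext => s; rewrite /arg /cvj /= exprS mulN1r scaleNr.
have twj (c : B) : tw sg (cvj i c) = - cvj i (tw sg c).
  apply: funext => s; rewrite /tw /cvj !ptE (linfZ sgl) (linfZ (conl i)) cons.
  by module_with R (E : lmodType R).
have argP w x y : arg w (cvP x y) = cvP (arg w x) y + cvP (cve x) (arg w y) by [].
have cvjD (x y : B) : cvj i (x + y) = cvj i x + cvj i y.
  by apply: funext => s; rewrite /cvj !ptD (linfD (conl i)) scalerDr.
rewrite -[LHS]/(arg u (cvj i (cvP a b)) v).
rewrite -[RHS]/(arg u (cvP (cvj i a) b) v + arg u (cvP (cve a) (cvj i b)) v).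
rewrite argj argP cvjD !ptE !IH !argP !argj /cve !twj !arg_tw.
rewrite !(bilinNl Pb) !(bilinNr Pb) !ptE.
by module_with R (E : lmodType R).
Qed.

Lemma form_cvA l a b c : aalt a -> aalt b ->
  cv cvP cvi cvj l (cv cvP cvi cvj l a b) c = cv cvP cvi cvj l a (cv cvP cvi cvj l b c).
Proof.
apply: (cvA (eps := cve)) => //.
- by move=> x y z; apply: gsh_assoc.
- by move=> i x u v; rewrite /cvi (tw_lin sgl).
- by move=> i x u v; apply: funext => s; rewrite /cvj !ptE conl; module_with R (E : lmodType R).
- by move=> i x y; rewrite /cvi /cvP (tw_gsh _ _ prb sgl sgl sgl sgM) arg_gsh (twK _ sgl sgK).
- move=> i j x ax.
  have e i' j' : cvi i' (cvi j' x) = - arg (vec i') (arg (vec j') x).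
    by rewrite /cvi (arg_tw sg (vec j')) (linfN (tw_lin sgl)) (twK _ sgl sgK).
  by rewrite !e aalt_args.
- move=> i j x; apply: funext => s; rewrite /cvj !ptE !(linfZ (conl _)) conC.
  by module_with R (E : lmodType R).
- move=> i j x; apply: funext => s; rewrite /cvi /cvj /arg /tw /= exprS !(linfZ sgl) !(linfZ (conl _)) cons.
  by module_with R (E : lmodType R).
- by move=> i x; rewrite /cvi /cve arg_tw.
- move=> i x; apply: funext => s; rewrite /cvj /cve /tw !ptE (linfZ sgl) (linfZ (conl _)) cons.
  by module_with R (E : lmodType R).
- by move=> i x ax; apply/aalt_arg/aalt_tw.
- move=> i x ax s1 u w s2; rewrite /cvj ax (linfN (conl i)) scalerN !size_cat //.
- by move=> x ax; apply: aalt_tw.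
Qed.

Lemma form_cv_bilin l : bilin (cv cvP cvi cvj l).
Proof.
apply: cv_bilin => // i x u v; first by rewrite /cvi (tw_lin sgl).
by apply: funext => s; rewrite /cvj !ptE conl; module_with R (E : lmodType R).
Qed.
End twisted_product.

(** * The convolution of forms *)

Section alternating_vanish.
Variables (R : realType) (g : vectType R) (A : lmodType R) (a : seq g -> A).
Hypotheses (aa : aalt a) (ma : mlin a).

Lemma aalt_mem0 s1 x s2 : x \in s2 -> a (s1 ++ x :: s2) = 0.
Proof.
elim: s2 s1 => // y s2 IH s1; rewrite inE => /orP[/eqP ->|xs2]; first exact: aalt0.
by rewrite aa -cat_rcons IH // oppr0.
Qed.

(** The arguments are linearly dependent, so one of them is a combination of later ones; expanding
    it repeats an argument in every term. *)
Lemma aalt_dim s : (\dim {:g} < size s)%N -> a s = 0.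
Proof.
move=> lt; have : ~~ free s.
  apply/negP => fs; move: lt; rewrite ltnNge; have := dimvS (subvf (span s)).
  by move: fs; rewrite /free => /eqP ->  ->.
rewrite (freeNE (in_tuple s)) => /existsP[i] /=; set s2 := drop _ s => xs2.
rewrite -(cat_take_drop i s) (drop_nth 0) // -/s2.
have m0 : linear (fun x : g => a (take i s ++ x :: s2)) by move=> c u w; apply: ma.
rewrite (coord_span (X := in_tuple s2) xs2) [LHS](linf_sum m0) big1 // => j _.
rewrite (linfZ m0) aalt_mem0 ?scaler0 //.
by rewrite mem_nth.
Qed.
End alternating_vanish.

Lemma deg0_glie (R : realType) (g : lieAlgebra R) : glie (deg0 g).
Proof.
have brb := lie_brP g.
have anti (u v : g) : lie_br u v = - lie_br v u.
  have := lie_alt (u + v); rewrite (bilinDl brb) !(bilinDr brb) !lie_alt add0r addr0 => /eqP.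
  by rewrite addr_eq0 => /eqP.
split=> //.
- move=> p q u v /= [->|->] [->|->]; rewrite ?(bilin0l brb) ?(bilin0r brb); by [left|right].
- move=> v; exists [:: (0%N, v)]; split; last by rewrite big_seq1.
  by move=> t; rewrite inE => /eqP -> /=; left.
- move=> p q u v /= [->|->] [->|->]; rewrite ?(bilin0l brb) ?(bilin0r brb) ?scaler0 ?oppr0 //.
  by rewrite scale1r; apply: anti.
(* Only 0 is homogeneous of nonzero degree, so (-1)^deg is the identity. *)
- exists id; split=> // k v [->|->]; first by rewrite scale1r.
  by rewrite scaler0.
Qed.

(** * Signs and contractions on the exterior algebra of g *)

Section exterior_of_lie.
Variables (R : realType) (g : lieAlgebra R) (E : lalgType R) (inn : deg0 g -> E).
Local Notation n := (\dim {:g}).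
Hypothesis ES : ext_spec inn.
Let GL := deg0_glie g.
Let hsp := gl_span GL.
Let sA := scaleAr ES.
Local Notation B := (seq g -> E).

Definition s2 (x : E) : E := sgop inn false true x.
Let s2l : linear s2. Proof. exact: sgop_lin. Qed.
Lemma s2K : involutive s2. Proof. by move=> x; apply: sgopK. Qed.
Lemma s2M x y : s2 (x * y) = s2 x * s2 y. Proof. exact: sgopM. Qed.
Lemma s2_in v : s2 (inn v) = - inn v.
Proof.
have h0 : gs_hom 0 (v : deg0 g) by left.
by rewrite /s2 (sgop_in ES GL _ _ h0) /= mul0n add0n expr1 scaleN1r.
Qed.
Lemma s21 : s2 1 = 1. Proof. exact: sgop1. Qed.

Definition hasL (l : nat) (x : E) : Prop := s2 x = (-1) ^+ l *: x.

Lemma hasL_bihom p l x : gbihom inn p l x -> hasL l x.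
Proof. by move=> hx; rewrite /hasL /s2 (sgop_bihom ES GL _ _ hx) mul0n add0n mul1n. Qed.

Lemma hasL_ext (M : lmodType R) (f h : E -> M) : linear f -> linear h ->
  (forall l x, hasL l x -> f x = h x) -> f =1 h.
Proof.
move=> fl hl H; apply: (bihom_lin_ext ES GL) => // p q X hX; exact: H (hasL_bihom hX).
Qed.

Definition s2n (l : nat) (x : E) : E := if odd l then s2 x else x.
Let s2nl l : linear (s2n l). Proof. by rewrite /s2n; case: odd => // a x y; rewrite s2l. Qed.
Lemma s2nM l x y : s2n l (x * y) = s2n l x * s2n l y.
Proof. by rewrite /s2n; case: odd => //; apply: s2M. Qed.
Lemma s2n_s2 l x : s2n l (s2 x) = s2n l.+1 x.
Proof. by rewrite /s2n /=; case: odd => //=; rewrite s2K. Qed.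
Lemma s2_s2n l x : s2 (s2n l x) = s2n l.+1 x.
Proof. by rewrite /s2n /=; case: odd => //=; rewrite s2K. Qed.
Lemma s2nD k l x : s2n k (s2n l x) = s2n (k + l) x.
Proof. by rewrite /s2n oddD; case: (odd k) (odd l) => [] [] //=; rewrite s2K. Qed.

(** The bilinear map equal to (-1)^(lm) x y for wedge degrees l and m; splitting [x] by parity gives
    a formula valid for all elements. *)
Definition prt (x y : E) : E := 2^-1 *: ((x + s2 x) * y + (x - s2 x) * s2 y).

Lemma prt_bilin : bilin prt.
Proof.
split=> [x a u v|y a u v]; rewrite /prt !s2l.
  by rewrite !mulrDr -!sA; module_with R (E : lmodType R).
by rewrite !(mulrDl, mulNr) -!scalerAl; module_with R (E : lmodType R).
Qed.

Lemma prtE l x y : hasL l x -> prt x y = x * s2n l y.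
Proof.
rewrite /hasL /prt -signr_odd /s2n => ->; case: (odd l); rewrite ?expr1 ?expr0 ?scaleN1r ?scale1r.
  rewrite subrr mul0r add0r opprK mulrDl scalerDr -scalerDl.
  by rewrite (_ : 2^-1 + 2^-1 = 1 :> R) ?scale1r //; field.
rewrite subrr mul0r addr0 mulrDl scalerDr -scalerDl.
by rewrite (_ : 2^-1 + 2^-1 = 1 :> R) ?scale1r //; field.
Qed.

Lemma hasL_M k l x y : hasL k x -> hasL l y -> hasL (k + l) (x * y).
Proof. by rewrite /hasL s2M => -> ->; rewrite -scalerAl -sA scalerA exprD. Qed.

Lemma hasL_s2n k l x : hasL l x -> s2n k x = (-1) ^+ (k * l) *: x.
Proof.
move=> h; rewrite /s2n -signr_odd oddM; case: (odd k) => /=; last by rewrite scale1r.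
by rewrite signr_odd h.
Qed.

Lemma hasL_s2n' k l x : hasL l x -> hasL l (s2n k x).
Proof. by move=> h; rewrite (hasL_s2n k h) /hasL (linfZ s2l) h !scalerA mulrC. Qed.

Lemma prtA x y z : prt (prt x y) z = prt x (prt y z).
Proof.
have pb := prt_bilin; move: x; apply: hasL_ext.
- by move=> a u v; rewrite !(bilinl pb).
- exact: bilinl.
move=> l x hx; move: y; apply: hasL_ext.
- by move=> a u v; rewrite (bilinr pb) (bilinl pb).
- by move=> a u v; rewrite (bilinl pb) (bilinr pb).
move=> k y hy; rewrite !(prtE _ hx) (prtE _ hy) (prtE _ (hasL_M hx (hasL_s2n' l hy))).
by rewrite s2nM s2nD mulrA.
Qed.

Lemma prt_s2 x y : s2 (prt x y) = prt (s2 x) (s2 y).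
Proof.
by rewrite /prt (linfZ s2l) (linfD s2l) !s2M (linfB s2l) (linfD s2l) !s2K.
Qed.

Variables (phi : 'I_n -> g -> R) (J : 'I_n -> E -> E).
Hypothesis JC : forall i, [/\ linear (J i), J i 1 = 0 &
      forall v X, J i (inn v * X) = phi i v *: X - inn v * J i X].

Lemma con_lin i : linear (J i). Proof. by case: (JC i). Qed.
Lemma con1 i : J i 1 = 0. Proof. by case: (JC i). Qed.
Lemma con_inM i v X : J i (inn v * X) = phi i v *: X - inn v * J i X. Proof. by case: (JC i). Qed.

Lemma con_s2 i x : J i (s2 x) = - s2 (J i x).
Proof.
have Jl := con_lin i; move: x; apply: (ext_lin_ind ES hsp).
- exact: linear_comp_ub Jl s2l.
- by move=> a x y /=; rewrite Jl s2l; module_with R (E : lmodType R).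
- by rewrite s21 con1 (linf0 s2l) oppr0.
move=> p v X hv IH; rewrite s2M s2_in mulNr (linfN Jl) !con_inM IH (linfB s2l) (linfZ s2l) s2M s2_in.
by rewrite ?mulrN ?mulNr; module_with R (E : lmodType R).
Qed.

Lemma conM i x y : J i (x * y) = J i x * y + s2 x * J i y.
Proof.
have Jl := con_lin i; move: x; apply: (ext_lin_ind ES hsp).
- by move=> a u v; rewrite mulrDl -scalerAl Jl.
- by move=> a u v; rewrite Jl s2l !mulrDl -!scalerAl; module_with R (E : lmodType R).
- by rewrite !mul1r con1 mul0r add0r s21 mul1r.
move=> p v X hv IH; rewrite -mulrA !con_inM IH s2M s2_in mulrBl -scalerAl mulrDr !mulNr !mulrA.
by module_with R (E : lmodType R).
Qed.

Lemma conC i j x : J i (J j x) = - J j (J i x).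
Proof.
have Jl := con_lin; move: x; apply: (ext_lin_ind ES hsp).
- exact: linear_comp_ub (Jl i) (Jl j).
- by move=> a x y /=; rewrite !(Jl i, Jl j); module_with R (E : lmodType R).
- by rewrite !con1 !(linf0 (Jl _)) oppr0.
move=> p v X hv IH; rewrite !con_inM !(linfB (Jl _)) !(linfZ (Jl _)) !con_inM IH mulrN.
by module_with R (E : lmodType R).
Qed.

Lemma con_hasL i l x : hasL l x -> hasL l.+1 (J i x).
Proof.
rewrite /hasL exprS mulN1r scaleNr => h.
by rewrite -[s2 _]opprK -con_s2 h (linfZ (con_lin i)).
Qed.

(** The sign turns the antiderivation [J i] of the product into an antiderivation of [prt], see
    [cont_prt]. *)
Definition cont (i : 'I_n) (x : E) : E := J i (s2 x).

Lemma cont_lin i : linear (cont i). Proof. exact: linear_comp_ub (con_lin i) s2l. Qed.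
Lemma cont_s2 i x : cont i (s2 x) = - s2 (cont i x).
Proof. by rewrite /cont con_s2. Qed.
Lemma contC i j x : cont i (cont j x) = - cont j (cont i x).
Proof.
have e i' j' : cont i' (cont j' x) = - J i' (J j' x).
  by rewrite /cont (con_s2 j') (linfN s2l) s2K (linfN (con_lin i')).
by rewrite !e conC.
Qed.
Lemma cont_prt i x y : cont i (prt x y) = prt (cont i x) y + prt (s2 x) (cont i y).
Proof.
have pb := prt_bilin; move: x; apply: hasL_ext.
- by move=> a u v; rewrite (bilinl pb) cont_lin.
- by move=> a u v; rewrite cont_lin s2l !(bilinl pb); module_with R (E : lmodType R).
move=> l x hx; have hsx : hasL l (s2 x) by rewrite hx /hasL (linfZ s2l) hx !scalerA mulrC.
have hc : hasL l.+1 (cont i x) by apply: con_hasL.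
rewrite (prtE _ hx) (prtE _ hc) (prtE _ hsx) /cont s2M conM s2K s2_s2n.
congr (_ + _); rewrite hx -scalerAl -[s2n l.+1 y]s2n_s2 /s2n -signr_odd.
case: (odd l); rewrite ?scale1r // expr1 scaleN1r [J i (s2 (s2 y))]con_s2 mulrN //.
Qed.

Section signs.
Variable vec : 'I_n -> g.

Definition fhasL l (a : B) : Prop := forall s, hasL l (a s).

Lemma twP k l (a : B) : fpar k a -> fhasL l a -> tw s2 a = (-1) ^+ (k + l) *: a.
Proof.
move=> ka la; apply: funext => s; rewrite /tw la !ptE scalerA mulrC -scalerA ka scalerA.
by rewrite -exprD addnC.
Qed.

(** The sign l2 l1 comes from [prt], and k2 l1 from the operator [s2] applied to [a] once for each
    vector given to [b]. *)
Lemma gsh_prt l1 k2 l2 (a b : B) : fhasL l1 a -> fpar k2 b -> fhasL l2 b ->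
  gsh prt s2 a b = (-1) ^+ ((k2 + l2) * l1) *: sh *%R a b.
Proof.
move=> la kb lb; apply: funext => v; elim: v l1 k2 l2 a b la kb lb => [|u v IH] l1 k2 l2 a b la kb lb.
  have e0 : (-1) ^+ (k2 * l1) *: b [::] = b [::].
    rewrite -signr_odd oddM; case: (odd l1); rewrite ?andbF ?scale1r // andbT signr_odd.
    by rewrite -(kb [::]) scale1r.
  rewrite ptE sh_nil /= (prtE _ (la _)) (hasL_s2n _ (lb _)) -{1}e0 -!sA scalerA -exprD.
  by congr (_ ^+ _ *: _); lia.
rewrite ptE sh_cons /= (IH l1 _ _ _ _ (fun s => la (u :: s)) kb lb).
have lta : fhasL l1 (tw s2 a).
  by move=> s; rewrite /tw /hasL (linfZ s2l) !la (linfZ s2l) la !scalerA; congr (_ *: _); ring.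
rewrite (IH l1 _ _ _ _ lta (fpar_arg u kb) (fun s => lb (u :: s))).
have -> : tw s2 a = (-1) ^+ l1 *: tw id a.
  by apply: funext => s; rewrite /tw !ptE la !scalerA mulrC.
rewrite (bilinZl (sh_bilin _ (ext_mul_bilin ES))) !ptE scalerDr scalerA -exprD; congr (_ + _ *: _).
by apply: signr_eq; odds; case: (odd k2) (odd l2) (odd l1) => [] [] [].
Qed.

(** x + (x + 1) + ... + (x + r - 1): the sign exponent of r successive contractions, each of which
    flips the total parity x once more. *)
Fixpoint ee (x r : nat) : nat := if r is r'.+1 then ee x r' + (x + r') else 0.

Lemma foldr_cvi k l (a : B) L : fpar k a -> fhasL l a ->
  [/\ foldr (cvi s2 vec) a L = (-1) ^+ ee (k + l) (size L) *: foldr (fun i => arg (vec i)) a L,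
     fpar (k + size L) (foldr (fun i => arg (vec i)) a L) &
     fhasL l (foldr (fun i => arg (vec i)) a L)].
Proof.
move=> ka la; elim: L => [|i L [IH kp lp]] /=; first by rewrite expr0 scale1r addn0.
split; last by move=> s; apply: lp.
  rewrite IH /cvi (linfZ (tw_lin s2l)) (twP kp lp) scalerA -exprD.
  by rewrite (addnAC k) addnC.
by rewrite addnS; apply: fpar_arg.
Qed.

Lemma foldr_cvj k l (b : B) L : fpar k b -> fhasL l b ->
  [/\ foldr (cvj cont) b L = (-1) ^+ ee (k + l) (size L) *: foldr (fun i (c : B) s => J i (c s)) b L,
     fpar k (foldr (fun i (c : B) s => J i (c s)) b L) &
     fhasL (l + size L) (foldr (fun i (c : B) s => J i (c s)) b L)].
Proof.
move=> ka la; elim: L => [|i L [IH kp lp]] /=; first by rewrite expr0 scale1r addn0.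
split; last by move=> s; rewrite addnS; apply: con_hasL.
  apply: funext => s; rewrite IH /cvj /cont !ptE (linfZ s2l) (linfZ (con_lin i)).
  set F := foldr _ b L in kp lp *.
  have e : (-1) ^+ size s *: J i (F s) = (-1) ^+ k *: J i (F s) by rewrite -!(linfZ (con_lin i)) kp.
  rewrite (lp s) (linfZ (con_lin i)).
  transitivity ((-1) ^+ ee (k + l) (size L) *: ((-1) ^+ (l + size L) *: ((-1) ^+ size s *: J i (F s)))).
    by module_with R (E : lmodType R).
  by rewrite e !scalerA -!exprD; congr (_ ^+ _ *: _); lia.
by move=> s; rewrite -!(linfZ (con_lin i)) kp.
Qed.
End signs.
End exterior_of_lie.

Section convolution_sum.
Variables (R : realType) (g : lieAlgebra R) (E : lalgType R) (inn : deg0 g -> E).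
Local Notation n := (\dim {:g}).
Hypothesis ES : ext_spec inn.
Let GL := deg0_glie g.
Let il := ext_lin ES.
Local Notation B := (seq g -> E).
Local Notation s2 := (s2 inn).
Local Notation hasL := (hasL inn).
Variables (phi : 'I_n -> g -> R) (J : 'I_n -> E -> E).
Hypothesis JC : forall i, [/\ linear (J i), J i 1 = 0 &
      forall v X, J i (inn v * X) = phi i v *: X - inn v * J i X].
Variable vec : 'I_n -> g.

Definition fcv (a b : B) : B :=
  cv (cvP (prt inn) s2) (cvi s2 vec) (cvj (cont inn J)) (rev (enum 'I_n)) a b.

Definition Iop (i : 'I_n) (a : B) : B := arg (vec i) a.
Definition Jop (i : 'I_n) (b : B) : B := fun s => J i (b s).

Let s2l : linear s2. Proof. exact: sgop_lin ES GL _ _. Qed.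

Lemma fcv_bilin : bilin fcv.
Proof. by apply: form_cv_bilin => //; [exact: prt_bilin|exact: (cont_lin ES JC)]. Qed.

Lemma fcvA a b c : aalt a -> aalt b -> fcv (fcv a b) c = fcv a (fcv b c).
Proof.
apply: form_cvA.
- exact: prt_bilin.
- exact: prtA.
- exact: s2l.
- exact: (s2K ES).
- exact: prt_s2.
- exact: (cont_lin ES JC).
- exact: (cont_prt ES JC).
- exact: (cont_s2 ES JC).
- exact: (contC ES JC).
Qed.

(** The triangular number r(r-1)/2 occurs in both exponents and cancels modulo 2. *)
Lemma ee_add x y r : odd (ee x r + ee y r) = odd (r * (x + y)).
Proof.
elim: r => //= r IH.
rewrite (_ : ee x r + (x + r) + (ee y r + (y + r)) = ee x r + ee y r + (x + y) + r.*2)%N; last by lia.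
by rewrite oddD odd_double addbF (oddD (ee x r + ee y r)) IH mulSn [RHS]oddD addbC.
Qed.

(** With r = |K|, the contractions contribute r(k1 + l1 + k2 + l2) and the twisted product (k2 + l2
    + r) l1, since the contracted second factor has wedge parity l2 + r. Modulo 2 the sum is the
    exponent (k2 + l2)(l1 + r) + r k1 of the convolution. *)
Lemma fcv_sum k1 l1 k2 l2 a b : fpar k1 a -> fhasL inn l1 a -> fpar k2 b -> fhasL inn l2 b ->
  fcv a b = \sum_(K : {set 'I_n}) (-1) ^+ ((k2 + l2) * (l1 + #|K|) + #|K| * k1) *:
    sh *%R (foldr Iop a (enum K)) (foldr Jop b (enum K)).
Proof.
move=> ka la kb lb; rewrite /fcv cvE sub_sum_rev_enum; apply: eq_bigr => K _.
rewrite !foldl_rev /cvP.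
have [-> kI lI] := foldr_cvi ES vec (enum K) ka la.
have [-> kJ lJ] := foldr_cvj ES JC (enum K) kb lb.
rewrite -cardE in kI lI kJ lJ *.
have gb := gsh_bilin g (prt_bilin ES) s2l.
rewrite (bilinZl gb) (bilinZr gb) (gsh_prt ES lI kJ lJ) !scalerA -!exprD; congr (_ *: _).
apply: signr_eq; rewrite oddD ee_add -oddD; odds.
by case: (odd #|K|) (odd k1) (odd k2) (odd l1) (odd l2) => [] [] [] [] [].
Qed.

Lemma gword_aalt : aalt (gword inn : B).
Proof.
move=> s1 u w s; rewrite !gword_cat !gword_cons !mulrA.
have h0 v : gs_hom 0 (v : deg0 g) by left.
rewrite -[gword _ s1 * inn u * inn w]mulrA (ext_anticomm ES (h0 u) (h0 w)) scale1r.
by rewrite mulrN !mulNr mulrA.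
Qed.

Lemma gword_mlin : mlin (gword inn : B).
Proof.
move=> s1 c u w s; rewrite !gword_cat !gword_cons il !(mulrDl, mulrDr) -!scalerAl.
by rewrite -(scaleAr ES).
Qed.

(** A product of vectors of g is an alternating function of them. Hence the truncation at [n] in
    [form_conv] loses no component. *)
Lemma bihom_dim0 p l X : (n < l)%N -> gbihom inn p l X -> X = 0.
Proof.
move=> lt; elim/lin_span_ind: X / => // a x y [s [hs _ sz ->]] ->.
have -> : \prod_(t <- s) inn t.2 = gword inn [seq t.2 | t <- s] by rewrite /gword big_map.
by rewrite (aalt_dim gword_aalt gword_mlin) ?size_map ?sz // scaler0 addr0.
Qed.

Variable wp : nat -> E -> E.
Hypothesis WP : forall l, gis_wedge_proj inn l (wp l).

Lemma wp_hasL l x : hasL l (wp l x).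
Proof.
have [wl wE] := WP l; rewrite /hasL; move: x; apply: (bihom_lin_ext ES GL).
- exact: linear_comp_ub s2l wl.
- by move=> a x y; rewrite wl; module_with R (E : lmodType R).
move=> p q X hX; rewrite (wE _ _ _ hX); case: eqP => [<-|_]; first exact: (hasL_bihom ES hX).
by rewrite scaler0 (linf0 s2l).
Qed.

Lemma wp_sum x : \sum_(l < n.+1) wp l x = x.
Proof.
move: x; apply: (bihom_lin_ext ES GL) => //.
  move=> a x y; rewrite scaler_sumr -big_split; apply: eq_bigr => l _.
  by have [-> _] := WP l.
move=> p q X hX; case: (ltnP n q) => [lt|le].
  rewrite (bihom_dim0 lt hX) big1 // => l _; have [wl _] := WP l; exact: linf0 wl.
rewrite (bigD1 (Ordinal (le : (q < n.+1)%N))) //= (proj2 (WP q) _ _ _ hX) eqxx big1 ?addr0 // => l.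
by rewrite -val_eqE /= eq_sym (proj2 (WP l) _ _ _ hX) => /negbTE ->.
Qed.

Definition bpart (k l : nat) (a : B) : B := fun s => if size s == k then wp l (a s) else 0.

Lemma bpart_fpar k l a : fpar k (bpart k l a).
Proof. by apply: fpar_size => s /negbTE; rewrite /bpart => ->. Qed.

Lemma bpart_hasL k l a : fhasL inn l (bpart k l a).
Proof.
move=> s; rewrite /bpart; case: ifP => _; first exact: wp_hasL.
by rewrite /hasL scaler0 (linf0 s2l).
Qed.

Lemma bpart_sum a : aalt a -> mlin a -> \sum_(k < n.+1) \sum_(l < n.+1) bpart k l a = a.
Proof.
move=> aa ma; apply: funext => s.
have sumE (I : finType) (F : I -> B) : (\sum_i F i) s = \sum_i F i s.
  by elim/big_rec2: _ => // i x y _ <-.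
rewrite sumE; under eq_bigr do rewrite sumE.
case: (ltnP n (size s)) => [lt|le].
  rewrite (aalt_dim aa ma lt) big1 // => k _; rewrite big1 // => l _; rewrite /bpart.
  by case: eqP => // e; move: lt; rewrite e ltnNge -ltnS ltn_ord.
rewrite (bigD1 (Ordinal (le : (size s < n.+1)%N))) //= [X in _ + X]big1 ?addr0; last first.
  by move=> k; rewrite -val_eqE /= eq_sym => /negbTE ne; rewrite big1 // => l _; rewrite /bpart ne.
rewrite -[RHS]wp_sum; apply: eq_bigr => l _; by rewrite /bpart eqxx.
Qed.

Lemma fcv_parts a b : aalt a -> mlin a -> aalt b -> mlin b ->
  \sum_(k1 < n.+1) \sum_(l1 < n.+1) \sum_(k2 < n.+1) \sum_(l2 < n.+1) \sum_(r < n.+1)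
   (-1) ^+ ((k2 + l2) * (l1 + r) + r * k1) *:
   (\sum_(K : {set 'I_n} | #|K| == r)
     sh *%R (foldr Iop (bpart k1 l1 a) (enum K)) (foldr Jop (bpart k2 l2 b) (enum K))) = fcv a b.
Proof.
move=> aa ma ab mb; have fb := fcv_bilin.
rewrite -{2}(bpart_sum aa ma) -{2}(bpart_sum ab mb) (bilin_suml fb); apply: eq_bigr => k1 _.
rewrite (bilin_suml fb); apply: eq_bigr => l1 _.
rewrite (bilin_sumr fb); apply: eq_bigr => k2 _.
rewrite (bilin_sumr fb); apply: eq_bigr => l2 _.
rewrite (fcv_sum (@bpart_fpar k1 l1 a) (@bpart_hasL _ l1 a) (@bpart_fpar k2 l2 b) (@bpart_hasL _ l2 b)).
have cK (K : {set 'I_n}) : (#|K| < n.+1)%N by rewrite ltnS; have := max_card (mem K); rewrite card_ord.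
rewrite [RHS](partition_big (fun K : {set 'I_n} => Ordinal (cK K)) predT) //=.
apply: eq_bigr => r _; rewrite scaler_sumr; apply: eq_big => [K|K /eqP ->//].
by rewrite -val_eqE.
Qed.
End convolution_sum.

(** * Forms in the sense of the statement and their values on lists *)

Section forms_as_list_functions.
Variables (R : realType) (g : vectType R) (E : lmodType R).
Local Notation EC := (E * E)%type.
Local Notation pf := (forall k : nat, g -> ('I_k -> g) -> EC).

Definition pt (w : pf) (x : g) : forall k, ('I_k -> g) -> EC := fun k v => w k x v.
(** Only the real part is kept; the forms that realize elements of G have no imaginary part, see
    [gr_real]. *)
Definition ev (w : pf) (x : g) : seq g -> E := fun s => (evseq (pt w x) s).1.

Definition altform (w : pf) : Prop :=
  (forall k x (v : 'I_k -> g) i,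
        linear (fun u => w k x (fun j => if j == i then u else v j))) /\
  (forall k x (v : 'I_k -> g) i j, i != j -> v i = v j -> w k x v = 0).
Definition realform (w : pf) : Prop := forall k x v, (w k x v).2 = 0.

Lemma evseqE (A : Type) (w : forall k, ('I_k -> g) -> A) k s : size s = k ->
  evseq w s = w k (fun i => nth 0 s i).
Proof. by move=> <-. Qed.

Lemma pf_ext (a b : pf) : realform a -> realform b -> (forall x, ev a x = ev b x) -> a = b.
Proof.
move=> ra rb H; apply: functional_extensionality_dep => k; apply: funext => x; apply: funext => v.
rewrite -[a k x v]/(pt a x v) -[b k x v]/(pt b x v) -(evseq_of (pt a x)) -(evseq_of (pt b x)); apply: pair_ext.
  by have := congr1 (fun f => f (seq_of v)) (H x).
by rewrite /evseq /pt ra rb.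
Qed.

(** For a transposition, the value on a repeated sum of two vectors is expanded; a general
    permutation is a product of transpositions. *)
Lemma altform_perm (w : pf) x : altform w -> perm_anti (pt w x).
Proof.
move=> [wl w0] k v s.
have tp (v' : 'I_k -> g) i j : i != j -> w k x (fun h => v' (tperm i j h)) = - w k x v'.
  move=> ne; pose W a b := w k x (fun h => if h == i then a else if h == j then b else v' h).
  have Wl b : linear (W^~ b).
    exact: (wl k x (fun h => if h == j then b else v' h) i).
  have Wr a : linear (W a).
    move=> c u u'; have := wl k x (fun h => if h == i then a else v' h) j c u u'.
    have e z : W a z = w k x (fun h => if h == j then z else if h == i then a else v' h).
      by congr (w k x _); apply: funext => h; case: eqP => // ->; rewrite (negbTE ne).
    by rewrite -!e.
  have WW a : W a a = 0 by apply: (w0 k x _ i j ne); rewrite eqxx eq_sym (negbTE ne) eqxx.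
  have -> : w k x v' = W (v' i) (v' j).
    congr (w k x _); apply: funext => h; case: eqP => [->//|_]; by case: eqP => [->|].
  have -> : w k x (fun h => v' (tperm i j h)) = W (v' j) (v' i).
    congr (w k x _); apply: funext => h; case: tpermP => [->|->|]; rewrite ?eqxx //.
      by rewrite eq_sym (negbTE ne).
    by move=> /eqP/negbTE -> /eqP/negbTE ->.
  apply/eqP; rewrite -addr_eq0; have := WW (v' i + v' j).
  by rewrite (linfD (Wl _)) !(linfD (Wr _)) !WW add0r addr0 addrC => ->.
rewrite /pt; have [ts -> dts] := prod_tpermP s.
elim: ts dts v => [|[i j] ts IH] /= dts v.
  rewrite big_nil odd_perm1 scale1r; congr (w k x _); apply: funext => h; by rewrite perm1.
move: dts => /andP[dij dts]; rewrite big_cons odd_mul_tperm; move: dij; rewrite /dpair /= => dij.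
rewrite dij /=; set t := (\prod_(_ <- _) _)%g in IH *.
have -> : (fun h => v ((tperm i j * t)%g h)) = (fun h => (fun h' => v (t h')) (tperm i j h)).
  by apply: funext => h; rewrite permM.
by rewrite (tp (fun h' => v (t h')) i j dij) (IH dts v); case: (odd_perm t); rewrite ?expr1 ?expr0 ?scale1r ?scaleN1r ?opprK.
Qed.

Lemma altform_mlin (w : pf) x : altform w -> mlin (ev w x).
Proof.
move=> [wl w0] s1 c u u' s2; rewrite /ev; set k := (size s1 + (size s2).+1)%N.
have sz z : size (s1 ++ z :: s2) = k by rewrite size_cat.
have lt : (size s1 < k)%N by rewrite /k -addSnnS leq_addr.
have e z : evseq (pt w x) (s1 ++ z :: s2) =
    w k x (fun j => if j == Ordinal lt then z else nth 0 (s1 ++ 0 :: s2) j).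
  rewrite (evseqE _ (sz z)); congr (w k x _); apply: funext => j; rewrite -val_eqE /= !nth_cat.
  by case: ltngtP => [|lt'|->] //; rewrite ?subnn //; case: (j - size s1)%N (subn_gt0 (size s1) j) => [|m]; rewrite lt'.
by rewrite !e wl.
Qed.

Lemma altform_aalt (w : pf) x : altform w -> aalt (ev w x).
Proof.
move=> H; have ml := altform_mlin x H; have [wl w0] := H.
have d0 s1 u s2 : ev w x (s1 ++ u :: u :: s2) = 0.
  rewrite /ev; set s := s1 ++ _; have sz : size s = (size s1 + (size s2).+2)%N by rewrite size_cat.
  have lt : (size s1 < size s1 + (size s2).+2)%N by rewrite -addSnnS leq_addr.
  have lt' : ((size s1).+1 < size s1 + (size s2).+2)%N by rewrite -!addSnnS leq_addr.
  rewrite (evseqE _ sz) /pt (w0 _ _ _ (Ordinal lt) (Ordinal lt')) //.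
    by rewrite -val_eqE /= neq_ltn leqnn.
  by rewrite /s /= !nth_cat ltnn subnn ltnNge leqnSn /= subSnn.
move=> s1 u w' s2; apply/eqP; rewrite -addr_eq0; apply/eqP.
have m2 s1' a b s2' : ev w x (s1' ++ (a + b) :: s2') = ev w x (s1' ++ a :: s2') + ev w x (s1' ++ b :: s2').
  by rewrite -{1}[a]scale1r ml scale1r.
have m3 a b c : ev w x (s1 ++ a :: (b + c) :: s2) = ev w x (s1 ++ a :: b :: s2) + ev w x (s1 ++ a :: c :: s2).
  by rewrite -!(cat_rcons a) m2.
by have := d0 s1 (u + w') s2; rewrite m2 !m3 !d0 add0r addr0.
Qed.

Definition cplxop (op : E -> E -> E) (z w : EC) : EC :=
  (op z.1 w.1 - op z.2 w.2, op z.1 w.2 + op z.2 w.1).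
Definition cplxmap (f : E -> E) (z : EC) : EC := (f z.1, f z.2).

Definition pf_op (op : E -> E -> E) (a b : pf) : pf := fun k x v =>
  gform_op (cplxop op) (pt a x) (pt b x) v.

Lemma cplxop_bilin op : bilin op -> bilin (cplxop op).
Proof.
move=> ob; split=> [z c u v|z c u v]; apply: pair_ext; rewrite /= ?(bilinl ob) ?(bilinr ob);
  by module_with R E.
Qed.

Lemma sh_cplx op (a b : seq g -> EC) : (forall s, (a s).2 = 0) -> (forall s, (b s).2 = 0) -> bilin op ->
  forall s, sh (cplxop op) a b s = (sh op (fun s => (a s).1) (fun s => (b s).1) s, 0).
Proof.
move=> a0 b0 ob v; elim: v a b a0 b0 => [|u v IH] a b a0 b0.
  by rewrite !sh_nil /cplxop a0 b0 !(bilin0l ob) !(bilin0r ob) subr0 addr0.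
rewrite !sh_cons (IH (arg u a)) ?(IH (tw id a)) //; try by move=> s; apply: a0 || apply: b0.
  by apply: pair_ext => //=; rewrite addr0.
by move=> s; rewrite /tw /= a0 scaler0.
Qed.

Lemma pf_op_ev op (a b : pf) x : bilin op -> realform a -> realform b ->
  perm_anti (pt a x) -> perm_anti (pt b x) ->
  evseq (pt (pf_op op a b) x) = fun s => (sh op (ev a x) (ev b x) s, 0).
Proof.
move=> ob ra rb pa pb.
rewrite -[evseq _]/(evseq (gform_op (cplxop op) (pt a x) (pt b x))).
rewrite (evseq_gform_op (cplxop_bilin ob)) //; apply: funext => s; apply: sh_cplx => // t.
  exact: ra.
exact: rb.
Qed.

Lemma pf_op_evr op (a b : pf) : bilin op -> realform a -> realform b -> altform a -> altform b ->
  realform (pf_op op a b) /\ forall x, ev (pf_op op a b) x = sh op (ev a x) (ev b x).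
Proof.
move=> ob ra rb aa ab; have H x := pf_op_ev ob ra rb (altform_perm x aa) (altform_perm x ab).
split=> [k x v|x]; last by rewrite /ev H.
by rewrite -[pf_op op a b x v]/(pt (pf_op op a b) x v) -(evseq_of (pt (pf_op op a b) x)) H.
Qed.

Definition pf_iota (u : g -> g) (w : pf) : pf := fun k x v =>
  w k.+1 x (fun j => if unlift ord0 j is Some j' then v j' else u x).
Definition pf_map (f : E -> E) (w : pf) : pf := fun k x v => cplxmap f (w k x v).
Definition pf_part (wp : nat -> E -> E) (p q : nat) (w : pf) : pf := fun k x v =>
  if k == p then cplxmap (wp q) (w k x v) else 0.

Definition goodform (w : pf) : Prop := realform w /\ forall x, perm_anti (pt w x).

Lemma pf_iota_good u w : goodform w -> goodform (pf_iota u w) /\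
  forall x, ev (pf_iota u w) x = arg (u x) (ev w x).
Proof.
move=> [rw pw]; split; [split=> [k x v|x k v s]|move=> x]; first exact: rw.
  rewrite /pt /pf_iota; pose c j := if unlift ord0 j is Some j' then v j' else u x.
  have := pw x _ c (lift_perm ord0 ord0 s); rewrite odd_lift_perm /= => <-.
  rewrite /pt; congr (w _ _ _); apply: funext => j; rewrite /c.
  by case: unliftP => [j'|] ->; rewrite ?lift_perm_lift ?lift_perm_id ?liftK ?unlift_none.
apply: funext => s; rewrite /ev /arg; congr (_.1); rewrite /evseq /pt /pf_iota.
by congr (w _ _ _); apply: funext => j; case: unliftP => [j'|] ->.
Qed.

Lemma pf_map_good f w : linear f -> goodform w -> goodform (pf_map f w) /\
  forall x, ev (pf_map f w) x = fun s => f (ev w x s).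
Proof.
move=> fl [rw pw]; split=> //; split=> [k x v|x k v s]; first by rewrite /= rw (linf0 fl).
have := pw x k v s; rewrite /pt /pf_map => ->.
by apply: pair_ext; rewrite /= (linfZ fl).
Qed.

Lemma pf_part_good wp p q w : linear (wp q) -> goodform w -> goodform (pf_part wp p q w) /\
  forall x, ev (pf_part wp p q w) x = fun s => if size s == p then wp q (ev w x s) else 0.
Proof.
move=> fl [rw pw]; split=> [|x].
  split=> [k x v|x k v s]; rewrite /pt /pf_part; case: eqP => // _; rewrite ?scaler0 //=.
    by rewrite rw (linf0 fl).
  have := pw x k v s; rewrite /pt => ->.
  by apply: pair_ext; rewrite /= (linfZ fl).
by apply: funext => s; rewrite /ev /evseq /pt /pf_part; case: eqP.
Qed.
End forms_as_list_functions.

Section convolution_of_forms.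
Variables (R : realType) (g : lieAlgebra R) (E : lalgType R) (inn : deg0 g -> E).
Local Notation n := (\dim {:g}).
Local Notation EC := (E * E)%type.
Local Notation pf := (forall k : nat, g -> ('I_k -> g) -> EC).
Hypothesis ES : ext_spec inn.
Variables (phi : 'I_n -> g -> R) (J : 'I_n -> E -> E).
Hypothesis JC : forall i, [/\ linear (J i), J i 1 = 0 &
      forall v X, J i (inn v * X) = phi i v *: X - inn v * J i X].
Variable wp : nat -> E -> E.
Hypothesis WP : forall l, gis_wedge_proj inn l (wp l).
Variable vec : 'I_n -> g -> g.

Definition pf_S_hat (r : nat) (a b : pf) : pf := fun k x v =>
  \sum_(K : {set 'I_n} | #|K| == r)
    pf_op *%R (foldr (fun i => pf_iota (vec i)) a (enum K))
      (foldr (fun i => pf_map (J i)) b (enum K)) x v.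

Definition pf_conv (a b : pf) : pf := fun k x v =>
  \sum_(k1 < n.+1) \sum_(l1 < n.+1) \sum_(k2 < n.+1) \sum_(l2 < n.+1)
  \sum_(r < n.+1)
    (-1) ^+ ((k2 + l2) * (l1 + r) + r * k1) *:
      pf_S_hat r (pf_part wp k1 l1 a) (pf_part wp k2 l2 b) x v.

Lemma foldr_iota_good a L : goodform a -> goodform (foldr (fun i => pf_iota (vec i)) a L) /\
  forall x, ev (foldr (fun i => pf_iota (vec i)) a L) x = foldr (Iop (E := E) (vec^~ x)) (ev a x) L.
Proof.
move=> ga; elim: L => [|i L [IH e]] //=; have [g1 e1] := pf_iota_good (vec i) IH.
by split=> // x; rewrite e1 e.
Qed.

Lemma foldr_map_good a L : goodform a -> goodform (foldr (fun i => pf_map (J i)) a L) /\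
  forall x, ev (foldr (fun i => pf_map (J i)) a L) x = foldr (Jop J) (ev a x) L.
Proof.
move=> ga; elim: L => [|i L [IH e]] //=.
have [g1 e1] := pf_map_good (con_lin JC i) IH.
by split=> // x; rewrite e1 e.
Qed.

(** The convolution only involves values at one point: the vector fields enter through their value
    at [x]. *)
Lemma pf_convE a b : altform a -> altform b -> realform a -> realform b ->
  pf_conv a b = fun k x v => (fcv inn J (vec^~ x) (ev a x) (ev b x) (seq_of v), 0).
Proof.
move=> aa ab ra rb; apply: functional_extensionality_dep => k; apply: funext => x; apply: funext => v.
rewrite /pf_conv -(fcv_parts ES JC (vec^~ x) WP (altform_aalt x aa) (altform_mlin x aa)
  (altform_aalt x ab) (altform_mlin x ab)).
pose T (y : E) : EC := (y, 0).
have Tl : linear T by move=> c y z; apply: pair_ext; rewrite /= ?scaler0 ?addr0.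
rewrite -[RHS]/(T _).
have sumE (I : finType) (F : I -> seq g -> E) s : (\sum_i F i) s = \sum_i F i s.
  by elim/big_rec2: _ => // i y z _ <-.
have sumP (I : finType) (P : pred I) (F : I -> seq g -> E) s : (\sum_(i | P i) F i) s = \sum_(i | P i) F i s.
  by elim/big_rec2: _ => // i y z _ <-.
rewrite sumE (linf_sum Tl); apply: eq_bigr => k1 _.
rewrite sumE (linf_sum Tl); apply: eq_bigr => l1 _.
rewrite sumE (linf_sum Tl); apply: eq_bigr => k2 _.
rewrite sumE (linf_sum Tl); apply: eq_bigr => l2 _.
rewrite sumE (linf_sum Tl); apply: eq_bigr => r _.
rewrite ptZ (linfZ Tl); congr (_ *: _).
rewrite sumP (linf_sum Tl); apply: eq_bigr => K _.
have ga : goodform a by split=> // y; apply: altform_perm.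
have gb : goodform b by split=> // y; apply: altform_perm.
have [wl _] := WP l1; have [wl' _] := WP l2.
have [ga1 e1] := pf_part_good k1 wl ga; have [gb1 e2] := pf_part_good k2 wl' gb.
have [ga2 e3] := foldr_iota_good (enum K) ga1; have [gb2 e4] := foldr_map_good (enum K) gb1.
have := pf_op_ev (ext_mul_bilin ES) ga2.1 gb2.1 (ga2.2 x) (gb2.2 x).
move/(congr1 (fun f => f (seq_of v))); rewrite (evseq_of (pt _ x)) /pt => ->.
by rewrite e3 e4 e1 e2.
Qed.
End convolution_of_forms.

(** * The free differential graded Lie algebra *)

Definition Thom (R : realType) (T : lalgType R) (gen : bool -> T) (k : nat) : set T :=
  lin_span [set x | exists2 s : seq bool, count id s = k & x = gword gen s]%classic.

(* The graded Lie algebra generated by xi (degree 0) and gam (degree 1) inside the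
   free algebra T on two letters. *)
Record A_spec (R : realType) (A : gradedSpace R) (T : lalgType R) (gen : bool -> T)
    (brT : T -> T -> T) (val : A -> T) (xi gam : A) : Prop := {
  AS_free : free_spec gen;
  AS_lin : linear val;
  AS_inj : injective val;
  AS_hom : forall k v, gs_hom k v <-> Thom gen k (val v);
  AS_br : forall u v, val (gs_br u v) = brT (val u) (val v);
  AS_bil : bilin brT;
  AS_brh : forall k l a b, Thom gen k a -> Thom gen l b ->
    brT a b = a * b - (-1) ^+ (k * l) *: (b * a);
  AS_xi : val xi = gen false;
  AS_gam : val gam = gen true;
  AS_ind : forall P : A -> Prop, P xi -> P gam ->
    (forall c u v, P u -> P v -> P (c *: u + v)) ->
    (forall u v, P u -> P v -> P (gs_br u v)) -> forall v, P v }.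

Section free_two.
Variables (R : realType) (T : lalgType R) (gen : bool -> T).
Hypothesis FS : free_spec gen.
Let mb := free_mul_bilin FS.
Let sA := free_scAr FS.
Local Notation word := (gword gen).
Local Notation Thom := (Thom gen).

Lemma Thom_word s : Thom (count id s) (word s).
Proof. by apply: lin_span_in; exists s. Qed.
Lemma Thom_gen (b : bool) : Thom b (gen b).
Proof. by apply: lin_span_in; exists [:: b]; rewrite ?gword1 //=; case: b. Qed.
Lemma ThomM k l a b : Thom k a -> Thom l b -> Thom (k + l) (a * b).
Proof.
apply: (bilin_span mb) => _ _ [s <- ->] [t <- ->]; rewrite -gword_cat -count_cat.
exact: Thom_word.
Qed.

Lemma Thom_span x : lin_span [set y | exists k, Thom k y]%classic x.
Proof.
elim/(free_ind FS): x => [|a s y IH]; first exact: lin_span0.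
by apply: lin_spanP => //; apply: lin_span_in; exists (count id s); apply: Thom_word.
Qed.

Lemma T_sign_ex (s : bool) : exists f : T -> T, [/\ linear f, f 1 = 1,
  forall x y, f (x * y) = f x * f y & forall k x, Thom k x -> f x = (-1) ^+ (s * k) *: x].
Proof.
have [f [fl fw]] := free_ext FS (fun w => (-1) ^+ (s * count id w) *: word w).
exists f; split=> //.
- by rewrite -(gword_nil gen) fw /= muln0 scale1r.
- apply: (word_bilin_ext FS).
  + split=> [x a u v|y a u v]; first by rewrite (bilinr mb) fl.
    by rewrite (bilinl mb) fl.
  + split=> [x a u v|y a u v]; first by rewrite fl (bilinr mb).
    by rewrite fl (bilinl mb).
  move=> w t; rewrite -gword_cat !fw count_cat mulnDr exprD gword_cat -scalerAl -sA.
  by rewrite scalerA.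
- move=> k x; elim/lin_span_ind: x / => [|a _ y [w <- ->] IH]; first by rewrite (linf0 fl) scaler0.
  by rewrite fl fw IH scalerDr !scalerA mulrC.
Qed.

(** The triangular action of [der_ex], here on pairs of elements of the free algebra, where the
    values on letters are unconstrained. *)
Lemma T_der_ex (s : bool) (f : bool -> T) : exists D : T -> T,
  [/\ linear D, D 1 = 0, forall b, D (gen b) = f b &
   forall k x y, Thom k x -> D (x * y) = D x * y + (-1) ^+ (s * k) *: (x * D y)].
Proof.
pose act b (m : T * T) : T * T := (gen b * m.1, f b * m.1 + (-1) ^+ (s * b) *: (gen b * m.2)).
have al b : linear (act b).
  move=> a x y; apply: pair_ext; rewrite /= !mulrDr -!sA //.
  by module_with R (T : lmodType R).
have [Act [Ab Aw Ag AM]] := free_act_ex FS al.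
have A1 m : Act 1 m = m by rewrite -(gword_nil gen) Aw.
have Act1 x m : (Act x m).1 = x * m.1.
  move: x; apply: (word_lin_ext FS).
  - by move=> a x y; rewrite (bilinl Ab).
  - by move=> a x y; rewrite mulrDl scalerAl.
  elim => [|b w IH]; first by rewrite gword_nil A1 mul1r.
  by rewrite gword_cons AM Ag /= IH mulrA.
have Act2 w m : (Act (word w) m).2 = (Act (word w) (1, 0)).2 * m.1 + (-1) ^+ (s * count id w) *: (word w * m.2).
  elim: w => [|b w IH]; first by rewrite gword_nil !A1 /= mul0r add0r muln0 scale1r mul1r.
  rewrite gword_cons !AM !Ag /= IH !Act1 /= mulr1 mulnDr exprD mulrDl !mulrDr -!scalerAl -!sA !mulrA.
  by module_with R (T : lmodType R).
exists (fun x => (Act x (1, 0)).2); split.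
- by move=> a x y; rewrite (bilinl Ab).
- by rewrite A1.
- by move=> b; rewrite Ag /= mulr1 mulr0 scaler0 addr0.
move=> k x y; elim/lin_span_ind: x / => [|a _ x [w <- ->] IH].
  by rewrite mul0r (bilin0l Ab) /= mul0r add0r mul0r scaler0.
rewrite mulrDl -scalerAl !(bilinl Ab) /= IH AM Act2 Act1 /= mulr1 !mulrDl -!scalerAl.
by module_with R (T : lmodType R).
Qed.
End free_two.

Section A_theory.
Variables (R : realType) (A : gradedSpace R) (T : lalgType R) (gen : bool -> T).
Variables (brT : T -> T -> T) (val : A -> T) (xi gam : A).
Hypothesis AS : A_spec gen brT val xi gam.
Let FS := AS_free AS.
Let sA := free_scAr FS.
Let vl := AS_lin AS.
Let bb := AS_bil AS.
Local Notation Thom := (Thom gen).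
Local Notation hom := (@gs_hom R A).

Lemma A_br_bilin : bilin (@gs_br R A).
Proof.
split=> [x a u v|x a u v]; apply: (AS_inj AS); rewrite vl !(AS_br AS) vl.
  by rewrite (bilinr bb).
by rewrite (bilinl bb).
Qed.

Lemma brT_hom k l a b : Thom k a -> Thom l b -> Thom (k + l) (brT a b).
Proof.
move=> ha hb; rewrite (AS_brh AS ha hb); apply: lin_spanB; first exact: (ThomM FS).
by apply: lin_spanZ; rewrite addnC; apply: (ThomM FS).
Qed.

Lemma A_hom_br p q u v : hom p u -> hom q v -> hom (p + q)%N (gs_br u v).
Proof. by move=> /(AS_hom AS) hu /(AS_hom AS) hv; apply/(AS_hom AS); rewrite (AS_br AS); apply: brT_hom. Qed.

Lemma A_hom_xi : hom 0%N xi.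
Proof. by apply/(AS_hom AS); rewrite (AS_xi AS); exact: (Thom_gen gen false). Qed.
Lemma A_hom_gam : hom 1%N gam.
Proof. by apply/(AS_hom AS); rewrite (AS_gam AS); exact: (Thom_gen gen true). Qed.
Lemma A_hom_lin k a u v : hom k u -> hom k v -> hom k (a *: u + v).
Proof. by move=> /(AS_hom AS) hu /(AS_hom AS) hv; apply/(AS_hom AS); rewrite vl; apply: lin_spanP. Qed.
Lemma A_hom0 k : hom k 0.
Proof. by apply/(AS_hom AS); rewrite (linf0 vl); apply: lin_span0. Qed.

(** Sign rules for a bracket ask for a homogeneous left entry. Each element is shown to be a sum of
    homogeneous elements that satisfy [P], and the bracket of two such sums is expanded. *)
Lemma A_hom_ind (P : A -> Prop) : P xi -> P gam ->
  (forall k u v, hom k u -> P u -> P v -> P (gs_br u v)) ->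
  (forall c u v, P u -> P v -> P (c *: u + v)) -> forall v, P v.
Proof.
move=> Px Pg Pb PL v.
have P0 : P 0 by rewrite -[0](addNr xi) -scaleN1r; apply: PL.
suff [s [hs ->]] : exists s : seq (nat * A),
    (forall t, t \in s -> hom t.1 t.2 /\ P t.2) /\ v = \sum_(t <- s) t.2.
  elim: s hs => [|t s IH] hs; first by rewrite big_nil.
  rewrite big_cons -[t.2]scale1r; apply: PL; first by apply: (hs t _).2; rewrite mem_head.
  by apply: IH => u us; apply: hs; rewrite inE us orbT.
elim/(AS_ind AS): v => [||c u v [s [hs ->]] [t [ht ->]]|u v [s [hs ->]] [t [ht ->]]].
- exists [:: (0%N, xi)]; rewrite big_seq1; split=> // t; rewrite inE => /eqP ->.
  by split=> //; exact: A_hom_xi.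
- exists [:: (1%N, gam)]; rewrite big_seq1; split=> // t; rewrite inE => /eqP ->.
  by split=> //; exact: A_hom_gam.
- exists ([seq (w.1, c *: w.2) | w <- s] ++ t); split; last by rewrite big_cat big_map scaler_sumr.
  move=> w; rewrite mem_cat => /orP[/mapP[w' w's ->]|/ht//].
  have [h p] := hs _ w's; rewrite /= -[c *: _]addr0; split; last exact: PL.
  by apply: A_hom_lin => //; apply: A_hom0.
exists [seq ((w.1 + w'.1)%N, gs_br w.2 w'.2) | w <- s, w' <- t]; split.
  move=> w /allpairsP[[w1 w2] /= [/hs[h1 p1] /ht[h2 p2] ->]] /=.
  by split; [exact: A_hom_br|exact: Pb h1 p1 p2].
rewrite (bilin_suml A_br_bilin) big_allpairs_dep; apply: eq_bigr => w _ /=.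
by rewrite (bilin_sumr A_br_bilin).
Qed.

Lemma A_spanned : homog_spanned A.
Proof.
move=> v; elim/(AS_ind AS): v => [||c u v [s [hs ->]] [t [ht ->]]|u v [s [hs ->]] [t [ht ->]]].
- by exists [:: (0%N, xi)]; rewrite big_seq1; split=> // t; rewrite inE => /eqP ->; exact: A_hom_xi.
- by exists [:: (1%N, gam)]; rewrite big_seq1; split=> // t; rewrite inE => /eqP ->; exact: A_hom_gam.
- exists ([seq (w.1, c *: w.2) | w <- s] ++ t); split; last by rewrite big_cat big_map scaler_sumr.
  move=> w; rewrite mem_cat => /orP[/mapP[w' w's ->]|/ht//] /=; rewrite -[c *: _]addr0.
  by apply: A_hom_lin (hs _ w's) (A_hom0 _).
exists [seq ((w.1 + w'.1)%N, gs_br w.2 w'.2) | w <- s, w' <- t]; split.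
  by move=> w /allpairsP[[w1 w2] /= [/hs h1 /ht h2 ->]] /=; exact: A_hom_br.
rewrite (bilin_suml A_br_bilin) big_allpairs_dep; apply: eq_bigr => w _ /=.
by rewrite (bilin_sumr A_br_bilin).
Qed.

Lemma A_restrict (D : T -> T) : linear D -> (exists u, val u = D (gen false)) ->
  (exists u, val u = D (gen true)) ->
  (forall k u v, hom k u -> (exists u', val u' = D (val u)) -> (exists v', val v' = D (val v)) ->
     exists w, val w = D (brT (val u) (val v))) ->
  exists f : A -> A, linear f /\ forall v, val (f v) = D (val v).
Proof.
move=> Dl hx hg hb.
have H v : exists w, val w = D (val v).
  elim/A_hom_ind: v => [||k u v hu iu iv|c u v [u' eu] [v' ev]].
  - by rewrite (AS_xi AS).
  - by rewrite (AS_gam AS).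
  - by rewrite (AS_br AS); apply: (hb k).
  - by exists (c *: u' + v'); rewrite !vl Dl eu ev.
have [f fE] := boolp.choice (P := fun v w => val w = D (val v)) H; exists f; split=> //.
by move=> a u v; apply: (AS_inj AS); rewrite vl !fE vl Dl.
Qed.

Lemma A_sign_ex : exists sg : A -> A, linear sg /\ forall k v, hom k v -> sg v = (-1) ^+ k *: v.
Proof.
have [f [fl f1 fM fh]] := T_sign_ex FS true.
have fv k v : hom k v -> f (val v) = val ((-1) ^+ k *: v).
  by move=> /(AS_hom AS) hv; rewrite (fh _ _ hv) mul1n (linfZ vl).
have [||k u v hu iu iv|sg [sl se]] := A_restrict fl.
- by exists xi; rewrite -(AS_xi AS) (fv _ _ A_hom_xi) scale1r.
- by exists ((-1) ^+ 1 *: gam); rewrite -(AS_gam AS) (fv _ _ A_hom_gam).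
- have [s [hs ->]] := A_spanned v.
  exists (\sum_(t <- s) (-1) ^+ (k + t.1) *: gs_br u t.2).
  rewrite (linf_sum vl) (linf_sum vl) (bilin_sumr bb) (linf_sum fl); apply: eq_big_seq => t /hs ht.
  by rewrite -(fv _ _ (A_hom_br hu ht)) (AS_br AS).
exists sg; split=> // k v hv; apply: (AS_inj AS); by rewrite se (fv _ _ hv).
Qed.

Lemma A_anti p q u v : hom p u -> hom q v -> gs_br u v = - ((-1) ^+ (p * q) *: gs_br v u).
Proof.
move=> hu hv; apply: (AS_inj AS); rewrite (linfN vl) (linfZ vl) !(AS_br AS).
move/(AS_hom AS): hu => hu; move/(AS_hom AS): hv => hv.
rewrite (AS_brh AS hu hv) (AS_brh AS hv hu) [(q * p)%N]mulnC -[(-1) ^+ (p * q)]signr_odd.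
by case: odd; module_with R (T : lmodType R).
Qed.

Lemma A_glie : glie A.
Proof.
split; [exact: A_br_bilin|exact: A_hom_br|exact: A_spanned|exact: A_anti|exact: A_sign_ex].
Qed.

Lemma A_der (s : bool) (D : T -> T) : linear D ->
  (forall k x y, Thom k x -> D (x * y) = D x * y + (-1) ^+ (s * k) *: (x * D y)) ->
  (forall k x, Thom k x -> exists2 k', odd k' = odd k (+) s & Thom k' (D x)) ->
  (exists u, val u = D (gen false)) -> (exists u, val u = D (gen true)) ->
  exists f : A -> A, [/\ linear f, forall v, val (f v) = D (val v) &
   forall k u v, hom k u -> f (gs_br u v) = gs_br (f u) v + (-1) ^+ (s * k) *: gs_br u (f v)].
Proof.
move=> Dl DM Dh hx hg.
have Db k l x y : Thom k x -> Thom l y -> D (brT x y) = brT (D x) y + (-1) ^+ (s * k) *: brT x (D y).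
  move=> hx' hy; have [k' ek hk] := Dh _ _ hx'; have [l' el hl] := Dh _ _ hy.
  rewrite (AS_brh AS hx' hy) (AS_brh AS hk hy) (AS_brh AS hx' hl) (linfB Dl) (linfZ Dl).
  rewrite (DM _ _ _ hx') (DM _ _ _ hy).
  rewrite -[(-1) ^+ (k' * l)]signr_odd -[(-1) ^+ (k * l')]signr_odd !oddM ek el.
  rewrite -[(-1) ^+ (s * k)]signr_odd -[(-1) ^+ (s * l)]signr_odd -[(-1) ^+ (k * l)]signr_odd !oddM oddb.
  by case: (s) (odd k) (odd l) => [] [] []; module_with R (T : lmodType R).
have [k u v hu [u' eu] [v' ev]|f [fl fv]] := A_restrict Dl hx hg.
  have [t [ht et]] := A_spanned v.
  exists (gs_br u' v + (-1) ^+ (s * k) *: gs_br u v').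
  rewrite (linfD vl) (linfZ vl) !(AS_br AS) eu ev et (linf_sum vl) !(bilin_sumr bb) !(linf_sum Dl).
  rewrite (bilin_sumr bb) scaler_sumr -big_split; apply: eq_big_seq => w /ht hw /=.
  by rewrite (Db k w.1) //; apply/(AS_hom AS).
exists f; split=> // k u v hu; apply: (AS_inj AS); have [t [ht ->]] := A_spanned v.
rewrite fv (linfD vl) (linfZ vl) !(AS_br AS) !fv (linf_sum vl) !(bilin_sumr bb) !(linf_sum Dl).
rewrite (bilin_sumr bb) scaler_sumr -big_split; apply: eq_big_seq => w /ht hw /=.
by rewrite (Db k w.1) //; apply/(AS_hom AS).
Qed.

Lemma A_diff_ex : exists f : A -> A, [/\ linear f, forall k X, hom k X -> hom k.+1 (f X),
  f xi = gam, f gam = 0 &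
  forall k X Y, hom k X -> f (gs_br X Y) = gs_br (f X) Y + (-1) ^+ k *: gs_br X (f Y)].
Proof.
have [D [Dl D1 Dg DM]] := T_der_ex FS true (fun b => if b then 0 else gen true).
have Dh k x : Thom k x -> Thom k.+1 (D x).
  apply: lin_span_map => // _ [w <- ->].
  elim: w => [|b w IH] /=; first by rewrite gword_nil D1; apply: lin_span0.
  rewrite gword_cons (DM _ _ _ (Thom_gen gen b)) Dg; apply: lin_spanD.
    case: b => /=; first by rewrite mul0r; apply: lin_span0.
    exact: (ThomM FS (Thom_gen gen true) (Thom_word gen w)).
  by apply: lin_spanZ; rewrite -addnS; apply: (ThomM FS (Thom_gen gen b)).
have [k x hx|||f [fl fv fb]] := A_der Dl DM.
- by exists k.+1; [rewrite /= addbT|exact: Dh].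
- by exists gam; rewrite Dg (AS_gam AS).
- by exists 0; rewrite Dg (linf0 vl).
exists f; split=> //.
- by move=> k X /(AS_hom AS) hX; apply/(AS_hom AS); rewrite fv; apply: Dh.
- by apply: (AS_inj AS); rewrite fv (AS_xi AS) Dg (AS_gam AS).
- by apply: (AS_inj AS); rewrite fv (AS_gam AS) Dg (linf0 vl).
- by move=> k X Y hX; rewrite (fb _ _ _ hX) mul1n.
Qed.

(** This derivation has degree p - 1, which may be negative. The degrees are therefore stated from k
    + 1 to k + p, and words without gamma, of degree 0, are killed. *)
Lemma A_del_ex p z : hom p z -> exists f : A -> A, [/\ linear f,
  forall k X, hom k.+1 X -> hom (k + p)%N (f X), forall X, hom 0%N X -> f X = 0,
  f xi = 0 /\ f gam = gs_br z xi &
  forall k X Y, hom k X -> f (gs_br X Y) = gs_br (f X) Y + (-1) ^+ (p.+1 * k) *: gs_br X (f Y)].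
Proof.
move=> hz; have [D [Dl D1 Dg DM]] := T_der_ex FS (odd p.+1) (fun b => if b then val (gs_br z xi) else 0).
have hzx : Thom p (val (gs_br z xi)).
  by apply/(AS_hom AS); rewrite -[p]addn0; exact: A_hom_br A_hom_xi.
have Dw w : if count id w is k.+1 then Thom (k + p)%N (D (gword gen w)) else D (gword gen w) = 0.
  elim: w => [|b w IH] /=; first by rewrite gword_nil D1.
  rewrite gword_cons (DM _ _ _ (Thom_gen gen b)) Dg; case: b => /=; last first.
    rewrite add0n mul0r add0r; case: (count id w) IH => [->|k IH]; first by rewrite mulr0 scaler0.
    by apply: lin_spanZ; exact: (ThomM FS (Thom_gen gen false) IH).
  rewrite ?add1n; apply: lin_spanD; first by rewrite addnC; apply: (ThomM FS hzx (Thom_word gen w)).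
  apply: lin_spanZ; case: (count id w) IH => [->|k IH]; first by rewrite mulr0; apply: lin_span0.
  by exact: (ThomM FS (Thom_gen gen true) IH).
have D0 x : Thom 0 x -> D x = 0.
  elim/lin_span_ind => [|a _ y [w cw ->] IH]; first exact: linf0 Dl.
  by rewrite Dl IH; have := Dw w; rewrite cw => ->; rewrite scaler0 addr0.
have DS k x : Thom k.+1 x -> Thom (k + p)%N (D x).
  by apply: lin_span_map => // _ [w cw ->]; have := Dw w; rewrite cw.
have [[|k] x hx|||f [fl fv fb]] := A_der Dl DM.
- by exists (odd p.+1); rewrite ?oddb // D0 //; apply: lin_span0.
- by exists (k + p)%N; [rewrite oddD /=; case: (odd k) (odd p) => [] []|exact: DS].
- by exists 0; rewrite Dg (linf0 vl).
- by exists (gs_br z xi); rewrite Dg.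
exists f; split=> //.
- by move=> k X /(AS_hom AS) hX; apply/(AS_hom AS); rewrite fv; apply: DS.
- by move=> X /(AS_hom AS) hX; apply: (AS_inj AS); rewrite fv D0 // (linf0 vl).
- by split; apply: (AS_inj AS); rewrite fv ?(AS_xi AS) ?(AS_gam AS) Dg ?(linf0 vl).
- move=> k X Y hX; rewrite (fb _ _ _ hX); congr (_ + _ *: _); apply: signr_eq.
  by rewrite !oddM oddb.
Qed.

Lemma A_jacobi k l z u v : hom k z -> hom l u ->
  gs_br z (gs_br u v) = gs_br (gs_br z u) v + (-1) ^+ (k * l) *: gs_br u (gs_br z v).
Proof.
move=> hz hu; apply: (AS_inj AS); have [t [ht ->]] := A_spanned v.
rewrite (linfD vl) (linfZ vl) !(AS_br AS) (linf_sum vl) !(bilin_sumr bb) !scaler_sumr -big_split.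
apply: eq_big_seq => w /ht hw /=; move: hz hu hw => /(AS_hom AS) hz /(AS_hom AS) hu /(AS_hom AS) hw.
rewrite (AS_brh AS hz (brT_hom hu hw)) (AS_brh AS (brT_hom hz hu) hw) (AS_brh AS hu (brT_hom hz hw)).
rewrite (AS_brh AS hz hu) (AS_brh AS hz hw) (AS_brh AS hu hw) !mulrBr !mulrBl -!sA -!scalerAl !mulrA.
rewrite !mulnDr !mulnDl !exprD ?[(l * k)%N]mulnC.
rewrite -[(-1) ^+ (k * l)]signr_odd; case: (odd (k * l)); rewrite ?expr0 ?expr1;
  by module_with R (T : lmodType R).
Qed.
End A_theory.

(** * The concrete free differential graded Lie algebra *)

Lemma malg_supp_span (R : realType) (K : monomType) (P : K -> Prop) (x : {malg R[K]}) :
  (forall w, w \in msupp x -> P w) <-> lin_span [set y | exists2 w, P w & y = mkmalgU w 1]%classic x.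
Proof.
split=> [h|].
  rewrite (monalgE x); apply: lin_span_sum => w wx.
  rewrite (_ : mkmalgU w _ = mcoeff w x *: mkmalgU w 1); last first.
    by apply/malgP => k'; rewrite mcoeffZ !mcoeffU mulrnAr mulr1.
  by apply/lin_spanZ/lin_span_in; exists w => //; exact: h.
move=> hx w; rewrite -mcoeff_neq0; elim/lin_span_ind: x / hx => [|a _ y [u Pu ->] IH].
  by rewrite mcoeff0 eqxx.
have [y0|/IH//] := eqVneq (mcoeff w y) 0.
rewrite mcoeffD mcoeffZ y0 addr0 mcoeffU.
by have [<-//|_] := eqVneq u w; rewrite mulr0n mulr0 eqxx.
Qed.

Lemma bilin_lext (R : realType) (K L : monomType) (M : lmodType R) (phi : K -> L -> M) :
  bilin (fun (a : {malg R[K]}) (b : {malg R[L]}) => lext (fun u => lext (phi u) b) a).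
Proof.
split=> [a c x y|b]; last exact: lext_linear.
have lE (psi : K -> M) : lext psi a = \sum_(u <- msupp a) mcoeff u a *: psi u by [].
rewrite !lE scaler_sumr -big_split; apply: eq_bigr => u _ /=.
by rewrite lext_linear scalerDr !scalerA mulrC.
Qed.

Lemma word_bracket_hom (R : realType) (T : lalgType R) (gen : bool -> T) (brT : T -> T -> T) :
  free_spec gen -> bilin brT ->
  (forall s t, brT (gword gen s) (gword gen t) = gword gen s * gword gen t -
     (-1) ^+ (count id s * count id t) *: (gword gen t * gword gen s)) ->
  forall k l a b, Thom gen k a -> Thom gen l b -> brT a b = a * b - (-1) ^+ (k * l) *: (b * a).
Proof.
move=> FS bb bw k l a b; have mb := free_mul_bilin FS.
elim/lin_span_ind: a / => [|c _ a [s <- ->] IHa] hb.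
  by rewrite (bilin0l bb) mul0r mulr0 scaler0 subr0.
rewrite (bilinl bb) (IHa hb) (bilinl mb) (bilinr mb).
suff -> : brT (gword gen s) b = gword gen s * b - (-1) ^+ (count id s * l) *: (b * gword gen s).
  by module_with R (T : lmodType R).
elim/lin_span_ind: b / hb {IHa} => [|d _ b [t <- ->] IHb].
  by rewrite (bilin0r bb) mul0r mulr0 scaler0 subr0.
by rewrite (bilinr bb) bw IHb (bilinl mb) (bilinr mb); module_with R (T : lmodType R).
Qed.

Section algA_spec.
Variable R : realType.
Local Notation T := (freeT R).
Local Notation W := {fmonom bool}.

Let H (u v : W) : T := mkmalgU (mmul u v) 1 - (-1) ^+ (wdeg u * wdeg v) *: mkmalgU (mmul v u) 1.

Lemma T_bracketE (a b : T) : T_bracket a b = lext (fun u => lext (H u) b) a.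
Proof.
rewrite /T_bracket /lext; apply: eq_bigr => u _; rewrite scaler_sumr; apply: eq_bigr => v _.
by rewrite scalerA.
Qed.

Lemma T_bracket_bilin : bilin (@T_bracket R).
Proof.
have -> : @T_bracket R = fun a b => lext (fun u => lext (H u) b) a.
  by apply: boolp.funext => a; apply: boolp.funext => b; exact: T_bracketE.
exact: bilin_lext.
Qed.

Lemma T_bracket_word s t : T_bracket (gword (@T_letter R) s) (gword (@T_letter R) t) =
  gword (@T_letter R) s * gword (@T_letter R) t -
  (-1) ^+ (count id s * count id t) *: (gword (@T_letter R) t * gword (@T_letter R) s).
Proof.
rewrite T_bracketE -!gword_cat !(gword_malg R) !lextU /H /wdeg /=.
by rewrite /mmul /= !fmmulE.
Qed.

Lemma algA_hom k (x : T) : (forall w : W, w \in msupp x -> wdeg w = k) <-> Thom (@T_letter R) k x.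
Proof.
have -> : Thom (@T_letter R) k = lin_span [set y | exists2 w : W, wdeg w = k & y = mkmalgU w 1]%classic.
  congr lin_span; apply/seteqP; split=> y [w cw ->].
    by exists (FMonom w) => //; exact: gword_malg.
  by exists (w : seq bool) => //; rewrite (gword_malg R); case: w {cw}.
exact: malg_supp_span.
Qed.

Lemma algA_spec : A_spec (@T_letter R) (@T_bracket R) (@A_val R : algA R -> T) (xi R) (gam R).
Proof.
split.
- exact: malg_free_spec.
- by move=> a u v.
- exact: val_inj.
- by move=> k v; exact: algA_hom.
- by [].
- exact: T_bracket_bilin.
- exact: (word_bracket_hom (malg_free_spec R bool) T_bracket_bilin T_bracket_word).
- by [].
- by [].
- move=> P Px Pg PL PB v.
  (* The induction runs over elements of the free algebra, so [P] is stated for every element of the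
     subtype lying above them. *)
  have K x : in_A x -> forall v : algA R, A_val v = x -> P v.
    elim=> [[]||] {x}.
    + by move=> u e; rewrite (_ : u = gam R) //; apply: val_inj.
    + by move=> u e; rewrite (_ : u = xi R) //; apply: val_inj.
    + move=> a x y ix IHx iy IHy u e.
      have px : A_pred x by apply/asboolP.
      have py : A_pred y by apply/asboolP.
      rewrite (_ : u = a *: (ACarrier px : algA R) + (ACarrier py : algA R)).
        by apply: PL; [apply: IHx|apply: IHy].
      by apply: val_inj.
    + move=> x y ix IHx iy IHy u e.
      have px : A_pred x by apply/asboolP.
      have py : A_pred y by apply/asboolP.
      rewrite (_ : u = gs_br (ACarrier px : algA R) (ACarrier py : algA R)).
        by apply: PB; [apply: IHx|apply: IHy].
      by apply: val_inj.
  by apply: (K (A_val v)) => //; case: v => x /= /asboolP.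
Qed.
End algA_spec.

(** * Convolution by an element of A in a realization *)

Section constant_forms.
Variables (R : realType) (g : Type).

Definition cst (A : nmodType) (y : A) : seq g -> A := fun s => if s is [::] then y else 0.
Definition lin1 (A : nmodType) (f : g -> A) : seq g -> A := fun s => if s is [:: u] then f u else 0.

Lemma arg_cst (A : lmodType R) u (y : A) : arg u (cst y) = 0. Proof. by []. Qed.
Lemma tw_cst (A : lmodType R) (y : A) : tw (R := R) id (cst y) = cst y.
Proof. by apply: funext => -[|u s]; rewrite /tw /= ?scale1r ?scaler0. Qed.
Lemma fpar_cst (A : lmodType R) (y : A) : fpar (R := R) 0 (cst y).
Proof. by apply: fpar_size => -[]. Qed.

Variables (A B C : lmodType R) (op : A -> B -> C).
Hypothesis ob : bilin op.
Let sb := sh_bilin g ob.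

Lemma sh_cstl y b v : sh op (cst y) b v = op y (b v).
Proof.
elim: v b => [|u v IH] b; first by rewrite sh_nil.
by rewrite sh_cons arg_cst (bilin0l sb) ptE add0r tw_cst IH.
Qed.

Lemma sh_cstr a y v : sh op a (cst y) v = op (a v) y.
Proof.
elim: v a => [|u v IH] a; first by rewrite sh_nil.
by rewrite sh_cons arg_cst (bilin0r sb) ptE addr0 IH.
Qed.

Lemma sh_sum (I : finType) (ops : I -> A -> B -> C) a b v :
  sh (fun x y => \sum_i ops i x y) a b (v : seq g) = \sum_i sh (ops i) a b v.
Proof.
elim: v a b => [|u v IH] a b; first by rewrite sh_nil.
by rewrite sh_cons !IH -big_split; apply: eq_bigr => i _; rewrite sh_cons.
Qed.
End constant_forms.

Lemma sh_mapr (R : realType) (g : Type) (A B B' C : lmodType R) (op : A -> B -> C) (f : B' -> B) a b (v : seq g) :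
  sh op a (fun s => f (b s)) v = sh (fun x y => op x (f y)) a b v.
Proof. exact: gsh_mapr. Qed.

Lemma sh_mapl (R : realType) (g : Type) (A A' B C : lmodType R) (op : A -> B -> C) (f : A' -> A) a b (v : seq g) :
  linear f -> sh op (fun s => f (a s)) b v = sh (fun x y => op (f x) y) a b v.
Proof. by move=> fl; apply: (@gsh_mapl _ _ _ _ _ _ _ id id f). Qed.

Lemma sh_map (R : realType) (g : Type) (A B C D : lmodType R) (op : A -> B -> C) (f : C -> D) a b (v : seq g) :
  linear f -> f (sh op a b v) = sh (fun x y => f (op x y)) a b v.
Proof. exact: gsh_map. Qed.

Lemma fpar_twn (R : realType) (g : Type) (A : lmodType R) p k (a : seq g -> A) :
  fpar k a -> twn p a = (-1) ^+ (p * k) *: a.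
Proof.
move=> ak; apply: funext => s; rewrite ptE /twn; have := ak s.
rewrite -(signr_odd R (p * _)) -[(-1) ^+ (p * k)]signr_odd !oddM.
by case: (odd p); rewrite ?scale1r //= !signr_odd.
Qed.

(** For convolving with an element of wedge degree 1, which two contractions annihilate. *)
Lemma sum_card_le1 (M : nmodType) (I : finType) (f : {set I} -> M) :
  (forall K : {set I}, (1 < #|K|)%N -> f K = 0) -> \sum_K f K = f finset.set0 + \sum_i f [set i].
Proof.
move=> f0; rewrite (bigD1 finset.set0) //=; congr (_ + _).
rewrite (bigID (fun K : {set I} => #|K| == 1%N)) /= [X in _ + X]big1 ?addr0; last first.
  by move=> K /andP[]; rewrite -cards_eq0; case: #|K| (f0 K) => [|[|m]] //; apply.
rewrite (eq_bigl (fun K => K \in [set [set i] | i : I])); last first.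
  move=> K; apply/andP/imsetP => [[_ /cards1P[i ->]]|[i _ ->]]; first by exists i.
  by rewrite cards1 -cards_eq0 cards1.
by rewrite big_imset //=; move=> i j _ _; exact: finset.set1_inj.
Qed.

Section points.
Variables (R : realType) (A : gradedSpace R) (T : lalgType R) (gen : bool -> T).
Variables (brT : T -> T -> T) (val : A -> T) (xi gam : A).
Hypothesis AS : A_spec gen brT val xi gam.
Variables (E : lalgType R) (inn : A -> E) (br : E -> E -> E).
Hypotheses (ES : ext_spec inn) (BS : gis_ext_bracket inn br).
Variables (g : lieAlgebra R) (E' : lalgType R) (inn' : deg0 g -> E') (br' : E' -> E' -> E').
Hypotheses (ES' : ext_spec inn') (BS' : gis_ext_bracket inn' br').
Local Notation n := (\dim {:g}).
Local Notation hom := (@gs_hom R A).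
Let GL := A_glie AS.
Let hsp := gl_span GL.
Let il := ext_lin ES.
Let il' := ext_lin ES'.
Let mb' := ext_mul_bilin ES'.

(* The properties of the value at x of a realization. *)
Record rpoint (x : g) (r : E -> seq g -> E') : Prop := {
  rp_lin : linear r;
  rp_1 : r 1 = cst 1;
  rp_M : forall X Y, r (X * Y) = sh *%R (r X) (r Y);
  rp_br : forall X Y, r (br X Y) = sh br' (r X) (r Y);
  rp_xi : r (inn xi) = cst (inn' x);
  rp_gam : r (inn gam) = lin1 inn';
  rp_deg : forall p q X, gbihom inn p q X ->
    (forall s, size s != p -> r X s = 0) /\ fhasL inn' q (r X) }.

Variables (x : g) (r : E -> seq g -> E').
Hypothesis rp : rpoint x r.
Let rl := rp_lin rp.

Lemma rp_fpar p q X : gbihom inn p q X -> fpar p (r X).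
Proof. by move=> /(rp_deg rp)[h _]; apply: fpar_size. Qed.

(** Elements of A are realized by forms valued in g itself: this is so for xi and gamma and is
    preserved by brackets. *)
Lemma rp_in v : exists zeta : seq g -> g, r (inn v) = fun s => inn' (zeta s).
Proof.
have l0 : inn' 0 = 0 := linf0 il'.
elim/(AS_ind AS): v => [||c u v [z1 e1] [z2 e2]|u v [z1 e1] [z2 e2]].
- by exists (cst x); rewrite (rp_xi rp); apply: funext => -[].
- by exists (lin1 id); rewrite (rp_gam rp); apply: funext => -[|u []].
- by exists (fun s => c *: z1 s + z2 s); rewrite il rl e1 e2; apply: funext => s; rewrite il'.
exists (sh (@lie_br R g) z1 z2); rewrite -(gbr_in BS) (rp_br rp) e1 e2; apply: funext => s.
rewrite sh_mapr (sh_mapl _ _ _ _ il') (sh_map _ _ _ _ il').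
have e : (fun a b => br' (inn' a) (inn' b)) = (fun a b => inn' (lie_br a b)).
  by apply: funext => a; apply: funext => b; rewrite (gbr_in BS').
by rewrite e.
Qed.

Variables (e : n.-tuple g) (J : 'I_n -> E' -> E').
Hypothesis eb : basis_of {:g} e.
Hypothesis JC : forall i, [/\ linear (J i), J i 1 = 0 &
      forall v X, J i (inn' v * X) = coord e i v *: X - inn' v * J i X].
Let vec i : g := lie_br e`_i x.

Let mulE (a : R) (y z : E') : a *: (y * z) = y * (a *: z). Proof. exact: scaleAr ES' a y z. Qed.

Section delta.
Variables (p : nat) (z : A) (zeta : seq g -> g).
Hypothesis hz : hom p z.
Hypothesis ez : r (inn z) = fun s => inn' (zeta s).
Hypothesis zp : fpar p zeta.

Let F := 'I_n -> E'.
Definition kap (a : seq g -> E') : seq g -> F := fun s j => a (vec j :: s).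
Definition copair (y : g) (f : F) : E' := \sum_j coord e j y *: f j.
(** The sum over j of the j-th coordinate of [zeta] wedged with the contraction of [a] by [e_j, x]:
    the contraction of [a] by the vector-valued form [zeta, x]. *)
Definition Qz (a : seq g -> E') : seq g -> E' := sh copair zeta (kap a).

Lemma copair_bilin : bilin copair.
Proof.
split=> [y c f h|f c y y']; rewrite /copair scaler_sumr -big_split; apply: eq_bigr => j _.
  rewrite /= !ptE. module_with R (E' : lmodType R).
by rewrite linearP scalerDl scalerA.
Qed.

Lemma copair_e (h : g -> E') y : linear h -> copair y (fun j => h e`_j) = h y.
Proof.
move=> hl; have /(coord_basis eb) ey : y \in {:g}%VS by rewrite memvf.
by rewrite [in RHS]ey (linf_sum hl); apply: eq_bigr => j _; rewrite (linfZ hl).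
Qed.

Lemma Qz_lin : linear Qz.
Proof. by move=> c a b; exact: (bilinr (sh_bilin g copair_bilin) zeta c (kap a) (kap b)). Qed.

(** A contraction either hits [a], and then associativity of shuffles applies, or hits [b], and then
    it and [zeta] must be moved across [a], which costs 1 + p times the degree of [a]. *)
Lemma Qz_sh op a b : bilin op -> Qz (sh op a b) = sh op (Qz a) b + sh op (twn p.+1 a) (Qz b).
Proof.
move=> ob.
pose opl (f : F) (y : E') : F := fun j => op (f j) y.
pose opr (y : E') (f : F) : F := fun j => op y (f j).
have bl : bilin opl.
  by split=> [f c y y'|y c f f']; apply: funext => j; rewrite /opl !ptE ?(bilinl ob) ?(bilinr ob).
have brr : bilin opr.
  by split=> [f c y y'|y c f f']; apply: funext => j; rewrite /opr !ptE ?(bilinl ob) ?(bilinr ob).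
have cb := copair_bilin.
have -> : Qz (sh op a b) = sh copair zeta (sh opl (kap a) b) + sh copair zeta (sh opr (tw id a) (kap b)).
  rewrite -(bilinDr (sh_bilin g cb)); congr (sh copair zeta _).
  apply: funext => s; rewrite ptE; apply: funext => j; rewrite ptE /kap sh_cons.
  have pl (M N : lmodType R) (o : M -> N -> F) (m : seq g -> M) (k : seq g -> N) :
      sh o m k s j = sh (fun x y => o x y j) m k s.
    exact: (@sh_map _ _ _ _ _ _ o (fun f : F => f j)).
  rewrite !pl /opl /opr; congr (_ + _).
    exact: (@sh_mapl _ _ _ _ _ _ op (fun f : F => f j)).
  exact: (@sh_mapr _ _ _ _ _ _ op (fun f : F => f j)).
congr (_ + _); last first.
  rewrite (sh_lcomm _ _ brr cb cb ob _ zp); first by rewrite twn_tw.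
  by move=> y u f; rewrite /copair /opr [RHS](linf_sum (bilinr ob u)); apply: eq_bigr => j _; rewrite (bilinZr ob).
symmetry; apply: (gsh_assoc (sb := id) _ _ _ cb ob bl cb) => //.
by move=> y f u; rewrite /copair /opl [LHS](bilin_suml ob); apply: eq_bigr => j _; rewrite (bilinZl ob).
Qed.

Variable dA : A -> A.
Hypotheses (dAl : linear dA) (dx : dA xi = 0) (dg : dA gam = gs_br z xi).
Hypothesis dbr : forall k X Y, hom k X ->
  dA (gs_br X Y) = gs_br (dA X) Y + (-1) ^+ (p.+1 * k) *: gs_br X (dA Y).
Variable dz : E -> E.
Hypothesis dzP : is_deriv inn (odd p.+1) dA dz.

(** Both sides are derivations of the bracket of the same parity. The realization of xi has form
    degree 0 and is killed; that of gamma is the tautological 1-form, whose contraction is the sum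
    of the coordinates of [zeta] times [e_j, x], that is [zeta, x]. *)
Lemma rp_delta_in v : r (inn (dA v)) = Qz (r (inn v)).
Proof.
elim/(A_hom_ind AS): v => [||k u v hu IHu IHv|c u v IHu IHv].
- rewrite dx (linf0 il) (linf0 rl) (rp_xi rp) /Qz.
  by rewrite (_ : kap _ = 0) ?(bilin0r (sh_bilin g copair_bilin)).
- rewrite dg (rp_gam rp) -(gbr_in BS) (rp_br rp) ez (rp_xi rp); apply: funext => s.
  rewrite (sh_cstr (gbr_bilin BS')) (gbr_in BS').
  have ek : kap (lin1 inn') = cst (fun j : 'I_n => inn' (vec j)).
    by apply: funext => -[].
  have il2 : linear (fun y : g => inn' (lie_br y x)).
    by move=> c y y'; rewrite (bilinl (lie_brP g)) il'.
  rewrite /Qz ek; transitivity (copair (zeta s) (fun j => inn' (vec j))).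
    by rewrite (copair_e (zeta s) il2).
  by symmetry; exact: (sh_cstr copair_bilin).
- rewrite (dbr _ hu) (linfD il) (linfZ il) (linfD rl) (linfZ rl) -!(gbr_in BS) !(rp_br rp) IHu IHv.
  rewrite (Qz_sh _ _ (gbr_bilin BS')); congr (_ + _).
  have fk := rp_fpar (gbihom_in inn hu).
  rewrite -(bilinZl (sh_bilin g (gbr_bilin BS'))); congr (sh _ _ _).
  by rewrite (fpar_twn _ fk).
by rewrite dAl !il !rl IHu IHv Qz_lin.
Qed.

Lemma Qz_1 : Qz (cst 1) = 0.
Proof. by rewrite /Qz (_ : kap _ = 0) ?(bilin0r (sh_bilin g copair_bilin)). Qed.

Lemma rp_delta X : r (dz X) = Qz (r X).
Proof.
have [dl d1 di dM] := dzP.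
move: X; apply: (ext_lin_ind ES hsp).
- exact: linear_comp_ub rl dl.
- exact: linear_comp_ub Qz_lin rl.
- by rewrite d1 (rp_1 rp) Qz_1 (linf0 rl).
move=> k v X hv IH; rewrite dM di (sgop_in ES GL _ _ hv) addn0 (linfD rl) -scalerAl (linfZ rl).
rewrite !(rp_M rp) (Qz_sh _ _ mb') -rp_delta_in IH (fpar_twn _ (rp_fpar (gbihom_in inn hv))).
rewrite (bilinZl (sh_bilin g mb')); congr (_ + _ *: _).
by apply: signr_eq; odds.
Qed.

(** The empty index set gives the product and the singletons assemble into [Qz], hence into the
    derivation [dz]. *)
Lemma fcv_in X : fcv inn' J vec (r X) (r (inn z)) =
  r (inn z * sgop inn (odd p) (odd p) X - dz (sgop inn (odd p.+1) (odd p.+1) X)).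
Proof.
have fb := fcv_bilin ES' JC vec; have sl := sgop_lin ES GL; have [dl _ _ _] := dzP.
move: X; apply: (bihom_lin_ext ES GL).
- by move=> a X Y; rewrite rl (bilinl fb).
- move=> a X Y; rewrite -rl; congr (r _); rewrite !sl dl mulrDr -(scaleAr ES).
  by module_with R (E : lmodType R).
move=> k l X hX; have [_ lX] := rp_deg rp hX; have kX := rp_fpar hX.
have hZ := gbihom_in inn hz; have [_ lz] := rp_deg rp hZ; have kz := rp_fpar hZ.
rewrite (fcv_sum ES' JC vec kX lX kz lz) !(sgop_bihom ES GL _ _ hX).
rewrite sum_card_le1; last first.
  (* The second factor has one wedge factor, so a second contraction kills it, whatever the
     remaining indices. *)
  move=> K; rewrite cardE; set L := enum K => sK.
  suff -> : foldr (Jop J) (r (inn z)) L = 0 by rewrite (bilin0r (sh_bilin g mb')) scaler0.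
  case/lastP: L sK => // L i; case/lastP: L => // L j _; rewrite !foldr_rcons.
  have -> : Jop J j (Jop J i (r (inn z))) = 0.
    apply: funext => s; rewrite /Jop ez -[inn' _]mulr1 (con_inM JC) (con1 JC) mulr0 subr0.
    by rewrite (linfZ (con_lin JC _)) (con1 JC) scaler0.
  by elim: L => //= j' L ->; apply: funext => s; rewrite /Jop (linf0 (con_lin JC _)).
rewrite (finset.enum_set0 'I_n) /= cards0 mul0n addn0 addn0 -(rp_M rp) (gbihom_comm ES hX hZ).
under eq_bigr do rewrite enum_set1 cards1 /=.
pose ops (j : 'I_n) (F : F) (y : g) : E' := coord e j y *: F j.
have eS (j : 'I_n) : sh *%R (Iop vec j (r X)) (Jop J j (r (inn z))) = sh (ops j) (kap (r X)) zeta.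
  apply: funext => s; rewrite -[RHS](@sh_mapl _ _ _ _ _ _ (fun y c => coord e j c *: y) (fun f : F => f j)) //.
  have -> : Jop J j (r (inn z)) = fun s => (fun y => coord e j y *: 1) (zeta s).
    apply: funext => s'; rewrite /Jop ez -[inn' _]mulr1 (con_inM JC) (con1 JC) mulr0 subr0 //.
  transitivity (sh (fun (c : E') y => c * (coord e j y *: 1)) (Iop vec j (r X)) zeta s).
    exact: (@sh_mapr _ _ _ _ _ _ *%R (fun y => coord e j y *: 1)).
  by congr (sh _ _ _ _); apply: funext => y; apply: funext => c; rewrite -mulE mulr1.
under eq_bigr do rewrite eS.
rewrite -scaler_sumr.
(* In the convolution the contracted X stands to the left of [zeta], in [Qz] to the right.
   Contracting changes the parity of X to k + 1, whence the sign. *)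
have -> : \sum_j sh (ops j) (kap (r X)) zeta = (-1) ^+ (p * k.+1) *: r (dz X).
  have kk : fpar k.+1 (kap (r X)).
    move=> s; apply: funext => j; rewrite !ptE /kap; exact: (fpar_arg (vec j) kX s).
  rewrite rp_delta /Qz.
  have cb : bilin (fun (f : F) y => copair y f) by split=> [f|y]; [exact: (bilinl copair_bilin)|exact: (bilinr copair_bilin)].
  rewrite (sh_comm _ copair_bilin cb _ zp) // (fpar_twn _ kk) (bilinZl (sh_bilin g cb)).
  rewrite scalerA -exprD addnn -signr_odd odd_double scale1r.
  apply: funext => s; rewrite [RHS]sh_sum.
  by elim/big_rec2: _ => // j y a _ <-.
rewrite !(linfZ dl) (linfB rl) -(scaleAr ES) !(linfZ rl) !scalerA -!exprD -scaleNr.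
have nE m : - ((-1) ^+ m) = (-1) ^+ m.+1 :> R by rewrite exprS mulN1r.
rewrite nE; congr (_ *: _ + _ *: _); apply: signr_eq; odds; rewrite ?oddb.
  by case: (odd p) (odd k) (odd l) => [] [] [].
by case: (odd p) (odd k) (odd l) => [] [] [].
Qed.
End delta.
End points.

(** * Differentials of polynomial forms *)

Section polynomial_maps.
Variables (R : realType) (g : vectType R).
Local Notation n := (\dim {:g}).

(* Polynomial maps g -> M together with their directional derivatives. *)
Inductive poly (M : lmodType R) : (g -> M) -> (g -> g -> M) -> Prop :=
| poly_c m : poly (fun=> m) (fun _ _ => 0)
| poly_D f f' h h' : poly f f' -> poly h h' ->
    poly (fun x => f x + h x) (fun x u => f' x u + h' x u)
| poly_M (l : g -> R^o) f f' : linear l -> poly f f' ->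
    poly (fun x => l x *: f x) (fun x u => l u *: f x + l x *: f' x u).

Lemma poly_eq (M : lmodType R) (f h : g -> M) (f' h' : g -> g -> M) : poly f f' ->
  (forall x, h x = f x) -> (forall x u, h' x u = f' x u) -> poly h h'.
Proof.
move=> pf e e'; have -> : h = f by apply: funext.
by have -> : h' = f' by apply: funext => x; apply: funext.
Qed.

Lemma poly_map (M N : lmodType R) (F : M -> N) f f' : linear F ->
  poly f f' -> poly (fun x => F (f x)) (fun x u => F (f' x u)).
Proof.
move=> Fl; elim=> {f f'} [m|f f' h h' _ IH1 _ IH2|l f f' ll _ IH].
- by apply: poly_eq (poly_c (F m)) _ _ => // x u; rewrite (linf0 Fl).
- by apply: poly_eq (poly_D IH1 IH2) _ _ => *; rewrite (linfD Fl).
- by apply: poly_eq (poly_M ll IH) _ _ => *; rewrite ?(linfD Fl) !(linfZ Fl).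
Qed.

Lemma poly_op (A B C : lmodType R) (op : A -> B -> C) f f' h h' : bilin op ->
  poly f f' -> poly h h' ->
  poly (fun x => op (f x) (h x)) (fun x u => op (f' x u) (h x) + op (f x) (h' x u)).
Proof.
move=> ob pf ph; elim: pf => {f f'} [m|f f' k k' _ IH1 _ IH2|l f f' ll _ IH].
- apply: poly_eq (poly_map (bilinr ob m) ph) _ _ => // x u.
  by rewrite (bilin0l ob) add0r.
- by apply: poly_eq (poly_D IH1 IH2) _ _ => *; rewrite ?(bilinDl ob) // addrACA.
- apply: poly_eq (poly_M ll IH) _ _ => x; first by rewrite (bilinZl ob).
  by move=> u; rewrite (bilinDl ob) !(bilinZl ob) scalerDr addrA.
Qed.

Lemma poly_sum (M : lmodType R) (I : finType) (f : I -> g -> M) (f' : I -> g -> g -> M) :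
  (forall i, poly (f i) (f' i)) -> poly (fun x => \sum_i f i x) (fun x u => \sum_i f' i x u).
Proof.
move=> pf; rewrite !unlock /reducebig /=; elim: (index_enum I) => [|i s IH] /=; first exact: poly_c.
exact: poly_D.
Qed.

Lemma poly_lin (M : lmodType R) (F : g -> M) : linear F -> poly F (fun _ u => F u).
Proof.
move=> Fl; have FE x : F x = \sum_(i < n) coord (vbasis {:g}) i x *: F (vbasis {:g})`_i.
  rewrite {1}(coord_vbasis (memvf x)) (linf_sum Fl); apply: eq_bigr => i _.
  by rewrite (linfZ Fl).
apply: poly_eq (poly_sum (f := fun i x => coord (vbasis {:g}) i x *: F (vbasis {:g})`_i)
  (f' := fun i x u => coord (vbasis {:g}) i u *: F (vbasis {:g})`_i +
     coord (vbasis {:g}) i x *: 0) _) _ _ => [i|x|x u].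
- by apply: poly_M; [exact: linearP|exact: poly_c].
- exact: FE.
- by rewrite FE; apply: eq_bigr => i _; rewrite scaler0 addr0.
Qed.

(** The derivative in a fixed direction is polynomial again, so smoothness to every order follows by
    iteration. *)
Lemma poly_dir (M : lmodType R) (f : g -> M) f' : poly f f' ->
  forall u, exists f'', poly (fun x => f' x u) f''.
Proof.
elim=> {f f'} [m|f f' h h' _ IH1 _ IH2|l f f' ll pf IH] u.
- by exists (fun _ _ => 0); exact: poly_c.
- have [a pa] := IH1 u; have [b pb] := IH2 u; eexists; exact: poly_D pa pb.
- have [a pa] := IH u; eexists.
  by apply: poly_D (poly_M ll pa); apply: poly_map pf => c x y; rewrite scalerDr !scalerA mulrC.
Qed.

Lemma is_derive_affine (W : normedModType R) (L : W -> R) (f : W -> R) y v :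
  (forall h, f (h *: v + y) = f y + h * L v) -> is_derive y v f (L v).
Proof.
move=> H; have lim : ((fun h : R => h^-1 *: ((f \o shift y) (h *: v) - f y)) @ (0 : R)^' --> L v)%classic.
  apply: cvg_near_cst; near=> h.
  have h0 : h != 0 by near: h; exact: nbhs_dnbhs_neq.
  by rewrite /= H addrAC subrr add0r /GRing.scale /= mulKf.
by split; [apply: cvgP lim|apply: cvg_lim].
Unshelve. all: by end_near. Qed.

Section affine_substitution.
Variables (W : normedModType R) (a L : W -> g).
Hypothesis aL : forall h v y, a (h *: v + y) = a y + h *: L v.

Lemma poly_is_derive (f : g -> R^o) f' : poly f f' -> forall y v,
  is_derive y v (fun w => f (a w) : R) (f' (a y) (L v)).
Proof.
elim=> {f f'} [m|f f' h h' _ IH1 _ IH2|l f f' ll _ IH] y v.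
- exact: is_derive_cst.
- by have := is_deriveD (IH1 y v) (IH2 y v).
have dl : is_derive y v (fun w => l (a w) : R) (l (L v)).
  by apply: (is_derive_affine (L := fun w => l (L w))) => h; rewrite aL (linfD ll) (linfZ ll).
have := is_deriveM dl (IH y v); set d := _ + _.
by rewrite (_ : d = l (L v) *: f (a y) + l (a y) *: f' (a y) (L v)) // /d addrC; congr (_ + _); exact: mulrC.
Qed.
End affine_substitution.

Local Notation lin_coord := (fun x : 'rV[R]_n => \sum_i x ord0 i *: (vbasis {:g})`_i : g).

Lemma poly_continuous (f : g -> R^o) f' : poly f f' ->
  continuous (fun x : 'rV[R]_n => f (lin_coord x) : R).
Proof.
elim=> {f f'} [m|f f' h h' _ IH1 _ IH2|l f f' ll _ IH] x.
- exact: cst_continuous.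
- exact: cvgD (IH1 x) (IH2 x).
have lE : (fun x : 'rV_n => l (lin_coord x) : R) = fun x : 'rV_n => \sum_i (x ord0 i * l (vbasis {:g})`_i).
  by apply: funext => y; rewrite (linf_sum ll); apply: eq_bigr => i _; rewrite (linfZ ll).
suff lc : continuous (fun x : 'rV_n => l (lin_coord x) : R) by apply: cvgM (lc x) (IH x).
rewrite lE; elim: (index_enum _) => [|i s IHs] y.
  rewrite (_ : (fun=> _) = fun=> 0); last by apply: funext => z; rewrite big_nil.
  exact: cst_continuous.
rewrite (_ : (fun=> _) = (fun y : 'rV[R]_n => y ord0 i * l (vbasis {:g})`_i +
   \sum_(i <- s) y ord0 i * l (vbasis {:g})`_i)); last by apply: funext => z; rewrite big_cons.
by apply: cvgD (IHs y); apply: cvgMr_tmp; exact: coord_continuous.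
Qed.

Fixpoint gCk (k : nat) (f : 'rV[R]_n -> R) : Prop :=
  continuous f /\
  if k is k'.+1 then
    forall v, (forall x, derivable f x v) /\ gCk k' (fun x => 'D_v f x)
  else True.

Lemma poly_Ck k (f : g -> R^o) f' : poly f f' -> gCk k (fun x => f (lin_coord x)).
Proof.
elim: k f f' => [|k IH] f f' pf /=; first by split=> //; exact: poly_continuous pf.
split=> [|v]; first exact: poly_continuous pf.
have aL (h : R) (w y : 'rV[R]_n) : lin_coord (h *: w + y) = lin_coord y + h *: lin_coord w.
  rewrite scaler_sumr -big_split; apply: eq_bigr => i _ /=.
  by rewrite !mxE scalerDl scalerA addrC.
have D := poly_is_derive aL pf; split=> [x|]; first exact: (D x v).(ex_derive).
have [f'' pf''] := poly_dir pf (lin_coord v).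
rewrite (_ : (fun x => _) = fun x => f' (lin_coord x) (lin_coord v)); first exact: IH pf''.
by apply: funext => x; exact: (D x v).(derive_val).
Qed.

Definition gdir (EC : lmodType R) (f : g -> EC) (v x : g) (w : EC) : Prop :=
  forall phi : {linear EC -> R^o},
    is_derive (0 : R) 1 (fun t : R => phi (f (x + t *: v))) (phi w).

Lemma poly_gdir (EC : lmodType R) (f : g -> EC) f' v x : poly f f' -> gdir f v x (f' x v).
Proof.
move=> pf phi; have aL (h w y : R) : x + (h *: w + y) *: v = x + y *: v + h *: (w *: v).
  by rewrite scalerDl -scalerA addrCA addrC.
have := poly_is_derive aL (poly_map (linearP phi) pf) 0 1.
by rewrite scale0r addr0 scale1r.
Qed.

(** Directional derivatives are defined by testing against linear forms; this makes them unique, so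
    that the chosen value is the expected one. *)
Definition separated (EC : lmodType R) : Prop :=
  forall w : EC, (forall phi : {linear EC -> R^o}, phi w = 0) -> w = 0.

Lemma gdir_xget (EC : lmodType R) (f : g -> EC) f' v x : separated EC -> poly f f' ->
  xget 0 (gdir f v x) = f' x v.
Proof.
move=> sep pf; have H := poly_gdir v x pf; have H' : gdir f v x (xget 0 (gdir f v x)) by apply: xgetPex; exists (f' x v).
apply/eqP; rewrite -subr_eq0; apply/eqP; apply: sep => phi; rewrite linearB.
by rewrite -(derive_val (is_derive := H phi)) -(derive_val (is_derive := H' phi)) subrr.
Qed.
End polynomial_maps.

Section exterior_derivative.
Variables (R : realType) (g : Type).

(* The exterior derivative at a fixed point, from the directional derivatives b
   of the form: iota_u d = L_u - d iota_u. *)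
Fixpoint ddl (M : lmodType R) (b : g -> seq g -> M) (v : seq g) : M :=
  if v is u :: v' then b u v' - ddl (fun w => arg u (b w)) v' else 0.

Lemma arg_ddl (M : lmodType R) (b : g -> seq g -> M) u :
  arg u (ddl b) = b u - ddl (fun w => arg u (b w)).
Proof. by []. Qed.

Lemma ddlD (M : lmodType R) (b c : g -> seq g -> M) : ddl (fun u => b u + c u) = ddl b + ddl c.
Proof.
apply: funext => v; rewrite ptE; elim: v b c => [|u v IH] b c /=; first by rewrite addr0.
rewrite (_ : (fun w => _) = fun w => arg u (b w) + arg u (c w)) // IH ptE.
by module_with R (M : lmodType R).
Qed.

Lemma ddlZ (M : lmodType R) k (b : g -> seq g -> M) : ddl (fun u => k *: b u) = k *: ddl b.
Proof.
apply: funext => v; rewrite ptE; elim: v b => [|u v IH] b /=; first by rewrite scaler0.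
by rewrite (_ : (fun w => _) = fun w => k *: arg u (b w)) // IH ptE; module_with R (M : lmodType R).
Qed.

Lemma ddl_tw (M : lmodType R) (b : g -> seq g -> M) : ddl (fun u => tw id (b u)) = - tw id (ddl b).
Proof.
apply: funext => v; rewrite ptE; elim: v b => [|u v IH] b /=; first by rewrite /tw /= scaler0 oppr0.
rewrite (_ : (fun w => _) = fun w => (-1) *: tw id (arg u (b w))); last first.
  by apply: funext => w; rewrite arg_tw scaleN1r.
rewrite ddlZ ptE IH /tw /=; rewrite exprS; by module_with R (M : lmodType R).
Qed.

Lemma ddl_sh (A B C : lmodType R) (op : A -> B -> C) a a' b b' : bilin op ->
  ddl (fun u => sh op (a' u) b + sh op a (b' u)) = sh op (ddl a') b + sh op (tw id a) (ddl b').
Proof.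
move=> ob; have sb := sh_bilin g ob; apply: funext => v.
elim: v a a' b b' => [|u v IH] a a' b b'.
  by rewrite ptE !sh_nil /= (bilin0l ob) (bilin0r ob) addr0.
rewrite /= -/(arg u _) (_ : (fun w => _) = fun w =>
   (sh op (arg u (a' w)) b + sh op (arg u a) (b' w)) +
   (sh op (tw id (a' w)) (arg u b) + sh op (tw id a) (arg u (b' w)))); last first.
  by apply: funext => w; rewrite addrACA.
rewrite ddlD !ptE !IH ddl_tw !ptE !sh_cons !arg_ddl !arg_tw !(bilinDl sb) !(bilinDr sb).
rewrite !(bilinNl sb) !(bilinNr sb) !ptE (@twK _ _ _ id) //.
by module_with R (C : lmodType R).
Qed.

Lemma ddl_cst (M : lmodType R) (f : g -> M) : ddl (fun u => cst (f u)) = lin1 f.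
Proof.
apply: funext => -[|u v] //=; rewrite (_ : (fun w => _) = fun w => 0 *: cst (f w)); last first.
  by apply: funext => w; rewrite scale0r.
by rewrite ddlZ ptE scale0r subr0; case: v.
Qed.

Lemma ddl_0 (M : lmodType R) : ddl (fun _ => 0 : seq g -> M) = 0.
Proof.
rewrite (_ : (fun _ => _) = fun _ : g => 0 *: (0 : seq g -> M)); last by apply: funext => w; rewrite scale0r.
by rewrite ddlZ scale0r.
Qed.
End exterior_derivative.

(** Unrolling the recursion gives the alternating sum that defines [form_diff]. *)
Lemma ddl_seq_of (R : realType) (g : vectType R) (M : lmodType R) k (b : g -> seq g -> M)
    (v : 'I_k.+1 -> g) :
  ddl b (seq_of v) = \sum_(i < k.+1) (-1) ^+ i *: b (v i) (seq_of (fun j => v (lift i j))).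
Proof.
elim: k b v => [|k IH] b v.
  rewrite seq_ofS big_ord1 /= scale1r (_ : seq_of _ = [::]) /= ?subr0 //.
  by apply/size0nil; rewrite size_seq_of.
rewrite seq_ofS [ddl _ _]/= IH [RHS]big_ord_recl /= scale1r -sumrN; congr (_ + _).
apply: eq_bigr => i _; rewrite exprS mulN1r scaleNr; congr (- (_ *: _)).
rewrite /arg; congr (b _ _); rewrite [RHS]seq_ofS; apply: (f_equal2 cons).
  by congr (v _); apply: val_inj.
congr seq_of.
by apply: funext => j; congr (v _); apply: val_inj; rewrite /= /bump /= !add1n ltnS addnS.
Qed.

Section differential_of_forms.
Variables (R : realType) (g : vectType R) (E : lmodType R).
Local Notation EC := (E * E)%type.
Local Notation pf := (forall k : nat, g -> ('I_k -> g) -> EC).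

Definition pf_diff (w : pf) : pf := fun k =>
  match k with
  | 0 => fun _ _ => 0
  | k'.+1 => fun x v => \sum_(i < k'.+1)
      (-1) ^+ i *: xget 0 (gdir (fun y => w k' y (fun j => v (lift i j))) (v i) x)
  end.

Definition pf0 (h : g -> E) : pf := fun k x _ => if k is 0 then (h x, 0) else 0.

Definition fpoly (a : g -> seq g -> E) (a' : g -> g -> seq g -> E) : Prop :=
  forall s, poly (fun x => a x s) (fun x u => a' x u s).

Lemma pf_real (w : pf) k x v : realform w -> w k x v = (ev w x (seq_of v), 0).
Proof. by move=> rw; apply: pair_ext => /=; [rewrite /ev evseq_of|exact: rw]. Qed.

Hypothesis sep : separated E.

Definition mk_linear (M N : lmodType R) (f : M -> N) (fl : linear f) : {linear M -> N} :=
  HB.pack f (GRing.isLinear.Build R M N *:%R f fl).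

Lemma separated_pair : separated (E * E)%type.
Proof.
move=> [w1 w2] H; apply: pair_ext; apply: sep => phi.
  have fl : linear (fun z : EC => phi z.1 : R^o) by move=> a x y; rewrite linearP.
  exact: (H (mk_linear fl)).
have fl : linear (fun z : EC => phi z.2 : R^o) by move=> a x y; rewrite linearP.
exact: (H (mk_linear fl)).
Qed.

Lemma pf_diff_ev (w : pf) a' : realform w -> fpoly (ev w) a' ->
  realform (pf_diff w) /\ forall x, ev (pf_diff w) x = ddl (a' x).
Proof.
move=> rw pw.
have H k x (v : 'I_k -> g) : pf_diff w x v = (ddl (a' x) (seq_of v), 0).
  case: k v => [|k] v; first by rewrite (_ : seq_of v = [::]) //; apply/size0nil; rewrite size_seq_of.
  pose T (y : E) : EC := (y, 0).
  have Tl : linear T by move=> c y z; apply: pair_ext; rewrite /= ?scaler0 ?addr0.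
  rewrite -[RHS]/(T _) ddl_seq_of (linf_sum Tl); apply: eq_bigr => i _; rewrite (linfZ Tl); congr (_ *: _).
  pose s := seq_of (fun j => v (lift i j)).
  have := gdir_xget (v i) x separated_pair (poly_map Tl (pw s)) => <-.
  congr (xget 0 (gdir _ _ _)); apply: funext => y; exact: pf_real.
split=> [k x v|x]; first by rewrite H.
apply: funext => s; rewrite /ev /evseq /pt H /=; congr (ddl _ _); exact: seq_ofP.
Qed.

Lemma pf0_ev (h : g -> E) : realform (pf0 h) /\ forall x, ev (pf0 h) x = cst (h x).
Proof. by split=> [[]|x] //; apply: funext => -[]. Qed.
End differential_of_forms.

(** * Values of a realization at a point *)

Section realizations.
Variables (R : realType) (A : gradedSpace R) (T : lalgType R) (gen : bool -> T).
Variables (brT : T -> T -> T) (val : A -> T) (xi gam : A).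
Hypothesis AS : A_spec gen brT val xi gam.
Variables (E : lalgType R) (inn : A -> E) (br : E -> E -> E) (dG : E -> E).
Hypotheses (ES : ext_spec inn) (BS : gis_ext_bracket inn br) (dG_xi : dG (inn xi) = inn gam).
Variables (g : lieAlgebra R) (E' : lalgType R) (inn' : deg0 g -> E') (br' : E' -> E' -> E').
Hypotheses (ES' : ext_spec inn') (BS' : gis_ext_bracket inn' br').
Local Notation pf := (forall k : nat, g -> ('I_k -> g) -> (E' * E')%type).
Hypothesis sep : separated E'.

Definition pf_bideg (p q : nat) (w : pf) : Prop :=
  forall k x v, if k == p then gbihom inn' 0 q (w k x v).1 /\ gbihom inn' 0 q (w k x v).2
                else w k x v = 0.

Record grealize (rho : E -> pf) : Prop := {
  gr_lin : forall (a : R) X Y, rho (a *: X + Y) =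
     (fun k x v => a *: rho X k x v + rho Y k x v);
  gr_1 : rho 1 = pf0 (fun=> 1);
  gr_deg : forall p q X, gbihom inn p q X -> pf_bideg p q (rho X);
  gr_M : forall X Y, rho (X * Y) = pf_op *%R (rho X) (rho Y);
  gr_br : forall X Y, rho (br X Y) = pf_op br' (rho X) (rho Y);
  gr_d : forall X, rho (dG X) = pf_diff (rho X);
  gr_xi : rho (inn xi) = pf0 (fun x => inn' x) }.

Variable rho : E -> pf.
Hypotheses (gr : grealize rho) (alt : forall X, altform (rho X)).

Let gam_form : realform (rho (inn gam)) /\ forall x, ev (rho (inn gam)) x = lin1 inn'.
Proof.
rewrite -dG_xi (gr_d gr) (gr_xi gr); have [r0 e0] := pf0_ev (fun x : g => inn' x).
have [|r1 e1] := @pf_diff_ev _ _ _ sep _ (fun _ u => cst (inn' u)) r0.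
  move=> [|u s].
    by apply: poly_eq (poly_lin (ext_lin ES')) _ _ => // x; rewrite e0.
  by apply: poly_eq (poly_c g 0) _ _ => // x; rewrite e0.
by split=> // x; rewrite e1 ddl_cst.
Qed.

(** The images of xi and gamma are real, and linear combinations, brackets and products preserve
    this. *)
Lemma gr_real X : realform (rho X).
Proof.
have L a Y Z : realform (rho Y) -> realform (rho Z) -> realform (rho (a *: Y + Z)).
  by move=> hY hZ k x v; rewrite (gr_lin gr) /= hY hZ scaler0 addr0.
elim/(ext_ind ES (gl_span (A_glie AS))): X => [|a Y Z|| p v X _ IH]; last 1 first.
- rewrite (gr_M gr); have [] // := pf_op_evr (ext_mul_bilin ES') _ IH (alt (inn v)) (alt X).
  elim/(AS_ind AS): v => [||c u w hu hw|u w hu hw].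
  + by rewrite (gr_xi gr); case: (pf0_ev (fun x : g => inn' x)).
  + by case: gam_form.
  + by rewrite (ext_lin ES); exact: L.
  + rewrite -(gbr_in BS) (gr_br gr).
    by case: (pf_op_evr (gbr_bilin BS') hu hw (alt _) (alt _)).
- rewrite -[0](addNr 1) -scaleN1r; have r1 : realform (rho 1).
    by rewrite (gr_1 gr); case: (pf0_ev (fun _ : g => 1 : E')).
  exact: L.
- exact: L.
- by rewrite (gr_1 gr); case: (pf0_ev (fun _ : g => 1 : E')).
Qed.

Lemma gr_point x : rpoint xi gam inn br inn' br' x (fun X => ev (rho X) x).
Proof.
have rr := gr_real; split.
- by move=> a X Y; apply: funext => s; rewrite /ev /evseq /pt (gr_lin gr).
- by rewrite (gr_1 gr); case: (pf0_ev (fun _ : g => 1 : E')) => _ ->.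
- move=> X Y; rewrite (gr_M gr).
  by case: (pf_op_evr (ext_mul_bilin ES') (rr X) (rr Y) (alt _) (alt _)) => _ ->.
- move=> X Y; rewrite (gr_br gr).
  by case: (pf_op_evr (gbr_bilin BS') (rr X) (rr Y) (alt _) (alt _)) => _ ->.
- by rewrite (gr_xi gr); case: (pf0_ev (fun x : g => inn' x)) => _ ->.
- by case: gam_form.
move=> p q X /(gr_deg gr) H; split=> s; have := H _ x (fun i : 'I_(size s) => nth 0 s i).
  by case: eqP => // _; rewrite /ev /evseq /pt => ->.
rewrite /ev /evseq /pt; case: eqP => [_ [h _]|_ ->]; first exact: (hasL_bihom ES' h).
by rewrite /hasL /s2 /= scaler0 (linf0 (sgop_lin ES' (deg0_glie g) _ _)).
Qed.
End realizations.

(** * Realizations over associative algebras *)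

Section ternary_shuffles.
Variables (R : realType) (g : Type) (A B C D : lmodType R).

(** The Leibniz rules of the bracket are identities between trilinear maps of the values. Nested
    products are rewritten as one shuffle of three forms, so that such an identity can be applied to
    the values. *)
Fixpoint sh3 (F : A -> B -> C -> D) (a : seq g -> A) (b : seq g -> B) (c : seq g -> C) (v : seq g) : D :=
  match v with
  | [::] => F (a [::]) (b [::]) (c [::])
  | u :: v' => sh3 F (arg u a) b c v' + sh3 F (tw id a) (arg u b) c v' +
               sh3 F (tw id a) (tw id b) (arg u c) v'
  end.

Lemma sh3_l (AB : lmodType R) (op1 : A -> B -> AB) (op2 : AB -> C -> D) a b c : bilin op1 -> bilin op2 ->
  sh op2 (sh op1 a b) c = sh3 (fun x y z => op2 (op1 x y) z) a b c.
Proof.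
move=> b1 b2; apply: funext => v; have g1 := sh_bilin g b1; have g2 := sh_bilin g b2.
elim: v a b c => [|u v IH] a b c //; rewrite sh_cons arg_sh (bilinDl g2) ptE !IH.
by rewrite /sh (@tw_gsh _ _ _ _ _ _ id id id) // -!/(sh _) IH.
Qed.

Lemma sh3_r (BC : lmodType R) (op3 : B -> C -> BC) (op4 : A -> BC -> D) a b c : bilin op3 -> bilin op4 ->
  sh op4 a (sh op3 b c) = sh3 (fun x y z => op4 x (op3 y z)) a b c.
Proof.
move=> b1 b2; apply: funext => v; have g1 := sh_bilin g b1; have g2 := sh_bilin g b2.
by elim: v a b c => [|u v IH] a b c //; rewrite sh_cons arg_sh (bilinDr g2) ptE !IH /= addrA.
Qed.

Lemma sh3D (F G : A -> B -> C -> D) a b c v :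
  sh3 (fun x y z => F x y z + G x y z) a b c v = sh3 F a b c v + sh3 G a b c v.
Proof.
elim: v a b c => [|u v IH] a b c //=; rewrite !IH; by module_with R (D : lmodType R).
Qed.

Lemma sh3Zl (F : A -> B -> C -> D) k a b c v : (forall k x y z, F (k *: x) y z = k *: F x y z) ->
  sh3 F (k *: a) b c v = k *: sh3 F a b c v.
Proof.
move=> FZ; elim: v a b c => [|u v IH] a b c /=; first by rewrite ptE FZ.
by rewrite (linfZ (tw_lin (@idl R A))) !scalerDr -!IH.
Qed.

Lemma sh3Zm (F : A -> B -> C -> D) k a b c v : (forall k x y z, F x (k *: y) z = k *: F x y z) ->
  sh3 F a (k *: b) c v = k *: sh3 F a b c v.
Proof.
move=> FZ; elim: v a b c => [|u v IH] a b c /=; first by rewrite ptE FZ.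
by rewrite (linfZ (tw_lin (@idl R B))) !scalerDr -!IH.
Qed.
End ternary_shuffles.

Lemma sh3_swap (R : realType) (g : Type) (A B C D : lmodType R) (F : A -> B -> C -> D) p a b c (v : seq g) :
  (forall k x y z, F (k *: x) y z = k *: F x y z) ->
  (forall k x y z, F x (k *: y) z = k *: F x y z) -> fpar p a ->
  sh3 F a b c v = sh3 (fun y x z => F x y z) (twn p b) a c v.
Proof.
move=> Fl Fm; elim: v p a b c => [|u v IH] p a b c ap /=; first by rewrite /twn muln0 scale1r.
have ta := fpar_tw ap; have atp : fpar p (tw id a) by rewrite ta => s; rewrite ptE [LHS]scalerA mulrC -scalerA ap.
rewrite (IH _ _ _ _ (fpar_arg u ap)) arg_twn tw_twn {1}ta sh3Zl // (IH _ _ _ _ ap) (IH _ _ _ _ atp) twn_tw.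
rewrite sh3Zl => [|k x y z]; last exact: Fm.
by module_with R (D : lmodType R).
Qed.

Section realization_at_a_point.
Variables (R : realType) (A : gradedSpace R) (T : lalgType R) (gen : bool -> T).
Variables (brT : T -> T -> T) (val : A -> T) (xi gam : A).
Hypothesis AS : A_spec gen brT val xi gam.
Variables (E : lalgType R) (inn : A -> E) (br : E -> E -> E).
Hypotheses (ES : ext_spec inn) (BS : gis_ext_bracket inn br).
Variables (g : lieAlgebra R) (E' : lalgType R) (inn' : deg0 g -> E') (br' : E' -> E' -> E').
Hypotheses (ES' : ext_spec inn') (BS' : gis_ext_bracket inn' br').
Variables (mu : g -> g -> g) (one : g).
Hypotheses (mub : bilin mu) (muA : associative mu) (mu1 : left_id one mu) (mur1 : right_id one mu).
Hypothesis lieE : forall a b : g, lie_br a b = mu a b - mu b a.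
Local Notation hom := (@gs_hom R A).
Local Notation s2 := (s2 inn').
Let FS := AS_free AS.
Let GL := A_glie AS.
Let GL' := deg0_glie g.
Let hsp := gl_span GL.
Let il' := ext_lin ES'.
Let mb' := ext_mul_bilin ES'.
Let bb' := gbr_bilin BS'.

Definition letter (x : g) (b : bool) : seq g -> g := if b then lin1 id else cst x.

(** [th] evaluates noncommutative polynomials at [x]: it is the algebra morphism to forms valued in
    (g, [mu]) that sends xi to [x] and gamma to the tautological 1-form. *)
Record theta_spec (x : g) (th : T -> seq g -> g) : Prop := {
  th_lin : linear th;
  th_1 : th 1 = cst one;
  th_gen : forall b t, th (gen b * t) = sh mu (letter x b) (th t);
  th_M : forall a b, th (a * b) = sh mu (th a) (th b) }.

Lemma theta_ex x : exists th, theta_spec x th.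
Proof.
have smb := sh_bilin g mub.
have [Act [Ab Aw Ag AM]] := free_act_ex FS (act := fun b m => sh mu (letter x b) m)
  (fun b => bilinr smb (letter x b)).
have A1 m : Act 1 m = m by rewrite -(gword_nil gen) Aw.
exists (fun t => Act t (cst one)); split.
- exact: bilinl Ab _.
- exact: A1.
- by move=> b t; rewrite AM Ag.
move=> a b; rewrite AM; move: {b}(Act b (cst one)) => m; move: a; apply: (word_lin_ext FS).
- exact: bilinl Ab _.
- by move=> c u v; rewrite (bilinl Ab) (bilinl smb).
elim=> [|b s IH].
  by rewrite gword_nil !A1; apply: funext => v; rewrite (sh_cstl mub) mu1.
rewrite gword_cons !AM !Ag IH; symmetry.
by apply: (gsh_assoc (op1 := mu) (op3 := mu)).
Qed.

Definition mulI (y : g) (m : E') : E' := inn' y * m.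
Lemma mulI_bilin : bilin mulI.
Proof.
split=> [y c a b|m c y y']; rewrite /mulI; first by rewrite (bilinr mb').
by rewrite il' (bilinl mb').
Qed.

Record real_spec (th : T -> seq g -> g) (r : E -> seq g -> E') : Prop := {
  re_lin : linear r;
  re_1 : r 1 = cst 1;
  re_inM : forall v X, r (inn v * X) = sh mulI (th (val v)) (r X) }.

Section at_point.
Variables (x : g) (th : T -> seq g -> g).
Hypothesis TH : theta_spec x th.
Let tl := th_lin TH.

Lemma th_genE b : th (gen b) = letter x b.
Proof.
rewrite -[gen b]mulr1 (th_gen TH) (th_1 TH); apply: funext => v.
by rewrite (sh_cstr mub) mur1.
Qed.

Lemma th_supp k t : Thom gen k t -> forall s, size s != k -> th t s = 0.
Proof.
elim/lin_span_ind: t / => [|c _ a [w <- ->] IH] s ns; first by rewrite (linf0 tl).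
rewrite tl !ptE (IH _ ns) addr0 (_ : th _ s = 0) ?scaler0 // {IH}.
elim: w s ns => [|b w IH] s ns; first by rewrite gword_nil (th_1 TH); case: s ns.
rewrite gword_cons (th_gen TH); apply: (sh_supp mub _ IH ns) => -[|u [|u' s']] //; by case: b {ns}.
Qed.

Lemma th_hom k v : hom k v -> fpar k (th (val v)).
Proof. by move=> /(AS_hom AS)/th_supp; apply: fpar_size. Qed.

(** Exchanging the two forms in the second term of the graded commutator absorbs its sign and leaves
    the commutator of [mu] on the values. *)
Lemma th_br u v : th (val (gs_br u v)) = sh (@lie_br R g) (th (val u)) (th (val v)).
Proof.
have lb := lie_brP g; have sl := sh_bilin g lb; have vl := AS_lin AS; have ab := A_br_bilin AS.
move: u; apply: (hom_ext GL).
- by move=> c u w; rewrite (bilinl ab) vl tl.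
- by move=> c u w; rewrite vl tl (bilinl sl).
move=> k u hu; move: v; apply: (hom_ext GL).
- by move=> c v w; rewrite (bilinr ab) vl tl.
- by move=> c v w; rewrite vl tl (bilinr sl).
move=> l v hv; rewrite (AS_br AS) (AS_brh AS (proj1 (AS_hom AS _ _) hu) (proj1 (AS_hom AS _ _) hv)).
rewrite (linfB tl) (linfZ tl) !(th_M TH).
have mub' : bilin (fun a b => mu b a) by split=> [a|a]; [exact: bilinl mub _|exact: bilinr mub _].
rewrite (sh_comm _ mub mub' _ (th_hom hv)) // (fpar_twn _ (th_hom hu)).
rewrite (bilinZl (sh_bilin g mub')) scalerA -exprD mulnC addnn -signr_odd odd_double scale1r.
apply: funext => s; rewrite !ptE; elim: s (th _) (th _) => [|z s IH] a b.
  by rewrite !sh_nil lieE.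
by rewrite !sh_cons -!IH opprD addrACA.
Qed.

Lemma real_ex : exists r, real_spec th r.
Proof.
have smb := sh_bilin g mulI_bilin.
have ab : bilin (fun v m => sh mulI (th (val v)) m).
  split=> [v|m c u w]; first exact: bilinr smb _.
  by rewrite (AS_lin AS) tl (bilinl smb).
have [p q u v m hu hv|Act [Ab A1 Ag AM]] := ext_act_ex ES ab.
  have op1 : bilin (fun (y : g) (m : E') => - mulI y m).
    by split=> [y c a b|a c y y']; rewrite ?(bilinr mulI_bilin) ?(bilinl mulI_bilin) opprD scalerN.
  rewrite (sh_lcomm _ _ mulI_bilin mulI_bilin op1 mulI_bilin _ (th_hom hu)).
    rewrite (fpar_twn _ (th_hom hv)) (bilinZl smb).
    rewrite (_ : sh (fun y m => - mulI y m) _ m = - sh mulI (th (val u)) m); last first.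
      apply: funext => s; rewrite ptE; elim: s (th _) m => [|z s IH] a b //.
      by rewrite !sh_cons !IH opprD.
    by rewrite (bilinNr smb) scalerN addNr.
  move=> y w n; rewrite /mulI mulrN !mulrA.
  have h0 z : gs_hom 0 (z : deg0 g) by left.
  by rewrite (ext_anticomm ES' (h0 y) (h0 w)) scale1r mulNr.
exists (fun X => Act X (cst 1)); split.
- exact: bilinl Ab _.
- exact: A1.
- by move=> v X; rewrite AM Ag.
Qed.

Variable r : E -> seq g -> E'.
Hypothesis RS : real_spec th r.
Let rl := re_lin RS.
Let rM := re_inM RS.

Lemma re_in v : r (inn v) = fun s => inn' (th (val v) s).
Proof.
rewrite -[inn v]mulr1 rM (re_1 RS); apply: funext => s.
by rewrite (sh_cstr mulI_bilin) /mulI mulr1.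
Qed.

Lemma re_M X Y : r (X * Y) = sh *%R (r X) (r Y).
Proof.
have sb := sh_bilin g mb'; move: X; apply: (ext_lin_ind ES hsp).
- by move=> c X Z; rewrite (bilinl (ext_mul_bilin ES)) rl.
- by move=> c X Z; rewrite rl (bilinl sb).
- by rewrite /= mul1r (re_1 RS); apply: funext => s; rewrite (sh_cstl mb') mul1r.
move=> k v X hv IH; rewrite -mulrA !rM IH; symmetry.
apply: (gsh_assoc _ _ _ mulI_bilin mb' mb' mulI_bilin) => // y a b.
by rewrite /mulI mulrA.
Qed.

Lemma re_deg p q X : gbihom inn p q X ->
  (forall s, size s != p -> r X s = 0) /\ forall s, gbihom inn' 0 q (r X s).
Proof.
move: p q X; apply: gbihom_ind.
- by move=> p q; rewrite (linf0 rl); split=> // s; apply: lin_span0.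
- move=> p q a X Y [h1 h2] [h3 h4]; split=> [s ns|s]; rewrite rl !ptE.
    by rewrite h1 // h3 // scaler0 addr0.
  exact: lin_spanP (h2 s) (h4 s).
- rewrite (re_1 RS); split=> [[]|[|u s]] //; [exact: gbihom1|exact: lin_span0].
move=> k p q v X hv _ [IH1 IH2]; rewrite rM; split.
  apply: (sh_supp mulI_bilin _ IH1); exact: (th_supp (proj1 (AS_hom AS _ _) hv)).
move=> s; elim: s (th (val v)) (r X) IH2 => [|z s IH] a b hb.
  rewrite sh_nil /mulI; have h0 : gs_hom 0 (a [::] : deg0 g) by left.
  exact: (gbihomM ES' (gbihom_in inn' h0) (hb [::])).
rewrite sh_cons; apply: lin_spanD; apply: IH => //; by move=> t; apply: hb.
Qed.

Let b2 (y : g) (m : E') : E' := br' (inn' y) m.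
Let b2b : bilin b2.
Proof.
split=> [y|m c y y']; first exact: bilinr bb' _.
by rewrite /b2 il' (bilinl bb').
Qed.

Let sh_b2 u (m : seq g -> E') : sh br' (r (inn u)) m = sh b2 (th (val u)) m.
Proof. by rewrite re_in; apply: funext => s; exact: (@sh_mapl _ _ _ _ _ _ br' inn'). Qed.

Let h0 z : gs_hom 0 (z : deg0 g). Proof. by left. Qed.

(** On values [y, .] is a derivation, so on v Y the shuffle of three forms splits in two. In the
    second part the forms of [u] and [v] change places, which gives the sign of the graded
    derivation. *)
Let re_br_in k u Y : hom k u -> r (br (inn u) Y) = sh br' (r (inn u)) (r Y).
Proof.
move=> hu; have sb := sh_bilin g bb'; have bb := gbr_bilin BS; move: Y; apply: (ext_lin_ind ES hsp).
- by move=> c X Z; rewrite (bilinr bb) rl.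
- by move=> c X Z; rewrite rl (bilinr sb).
- rewrite /= (gbr1r BS) (linf0 rl) (re_1 RS); apply: funext => s.
  by rewrite (sh_cstr bb') (gbr1r BS').
move=> l v Y hv IH; have [_ _ _ dM] := gbr_deriv ES GL BS hu.
rewrite dM (gbr_in BS) (sgop_in ES GL _ _ hv) addn0 -scalerAl (linfD rl) (linfZ rl) !rM IH.
rewrite !sh_b2 th_br (sh3_r _ _ _ mulI_bilin b2b) (sh3_l _ _ _ (lie_brP g) mulI_bilin).
apply: funext => s; rewrite !ptE.
rewrite (_ : (fun (y w : g) (m : E') => b2 y (mulI w m)) =
   (fun y w m => mulI (lie_br y w) m + mulI w (b2 y m))); last first.
  apply: funext => y; apply: funext => w; apply: funext => m.
  have [_ _ _ dM'] := gbr_deriv ES' GL' BS' (h0 y).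
  by rewrite /b2 /mulI dM' (gbr_in BS') (sgop_id ES' GL').
rewrite sh3D; congr (_ + _); rewrite (sh3_swap _ _ _ _ _ (th_hom hu)); last 2 first.
- by move=> *; rewrite (bilinZl b2b) (bilinZr mulI_bilin).
- by move=> *; rewrite (bilinZl mulI_bilin).
rewrite -(sh3_r _ _ _ b2b mulI_bilin) (fpar_twn _ (th_hom hv)).
rewrite (bilinZl (sh_bilin g mulI_bilin)) ptE; congr (_ *: _).
by apply: signr_eq; odds.
Qed.

Let re_sg k X : r (sgop inn (odd k) true X) = fun s => s2 (twn k (r X) s).
Proof.
have sl := sgop_lin ES' GL' false true.
move: X; apply: (bihom_lin_ext ES GL).
- by move=> c X Y; rewrite (sgop_lin ES GL) rl.
- by move=> c X Y; apply: funext => s; rewrite rl /twn !ptE /s2 -sl; congr (sgop _ _ _ _); module_with R (E' : lmodType R).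
move=> p q X hX; have [h1 h2] := re_deg hX; rewrite (sgop_bihom ES GL _ _ hX) (linfZ rl).
apply: funext => s; rewrite ptE /twn /s2 (linfZ sl) (sgop_bihom ES' GL' _ _ (h2 s)) scalerA -exprD.
have [<-|/h1 ->] := eqVneq (size s) p; last by rewrite !scaler0.
by congr (_ *: _); apply: signr_eq; odds.
Qed.

Lemma re_br X Y : r (br X Y) = sh br' (r X) (r Y).
Proof.
have sb := sh_bilin g bb'; have bb := gbr_bilin BS; move: X; apply: (ext_lin_ind ES hsp).
- by move=> c X Z; rewrite (bilinl bb) rl.
- by move=> c X Z; rewrite rl (bilinl sb).
- rewrite /= (gbr1l BS) (linf0 rl) (re_1 RS); apply: funext => s.
  by rewrite (sh_cstl bb') (gbr1l BS').
move=> k v X hv IH; rewrite (gbr_inM ES GL BS _ _ hv) (linfD rl) !rM re_M IH (re_br_in _ hv) sh_b2 re_sg.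
rewrite (sh3_l _ _ _ mulI_bilin bb') (sh3_r _ _ _ bb' mulI_bilin).
apply: funext => s; rewrite !ptE.
rewrite (_ : (fun (y : g) (m z : E') => br' (mulI y m) z) =
   (fun y m z => mulI y (br' m z) + s2 m * b2 y z)); last first.
  apply: funext => y; apply: funext => m; apply: funext => z.
  by rewrite /b2 /mulI (gbr_inM ES' GL' BS' _ _ (h0 y)).
have sl := sgop_lin ES' GL' false true.
rewrite sh3D; congr (_ + _); rewrite (sh3_swap _ _ _ _ _ (th_hom hv)); last 2 first.
- by move=> *; rewrite (bilinZl b2b) (bilinZr mb').
- by move=> *; rewrite /s2 (linfZ sl) (bilinZl mb').
have o4 : bilin (fun m w : E' => s2 m * w).
  by split=> [m|w c m m']; [exact: bilinr mb' _|rewrite /s2 sl (bilinl mb')].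
rewrite -(sh3_r _ _ _ b2b o4).
exact: (@sh_mapl _ _ _ _ _ _ *%R (fun m => s2 m)).
Qed.

Lemma th_alt t : aalt (th t) /\ mlin (th t).
Proof.
elim/(free_ind FS): t => [|c w t [IH1 IH2]].
  by rewrite (linf0 tl); split=> *; move=> *; rewrite !pt0 ?oppr0 // scaler0 addr0.
rewrite tl; suff [h1 h2] : aalt (th (gword gen w)) /\ mlin (th (gword gen w)).
  split; [apply: aaltD => //; exact: (aalt_map (f := fun y : g => c *: y) (linearP _))|].
  by apply: mlinD => //; exact: (mlin_map (f := fun y : g => c *: y) (linearP _)).
have C (M : lmodType R) (y : M) : aalt (cst y : seq g -> M) /\ mlin (cst y : seq g -> M).
  by split=> [[|u' s1]|[|u' s1]] *; rewrite /= ?oppr0 ?scaler0 ?addr0.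
elim: w {IH1 IH2} => [|b w [IH1 IH2]]; first by rewrite gword_nil (th_1 TH).
have [l1 l2] : aalt (letter x b) /\ mlin (letter x b).
  case: b; last exact: C.
  split; first by move=> [|u' [|u'' s1]] a1 a2 s /=; rewrite ?oppr0.
  move=> [|u' [|u'' s1]] d a1 a2 s /=; rewrite ?scaler0 ?addr0 //.
  by case: s => [|? ?]; rewrite ?scaler0 ?addr0.
rewrite gword_cons (th_gen TH); split; first exact: (aalt_gsh (sa := id)).
exact: (mlin_gsh (sa := id)).
Qed.

Lemma re_alt X : aalt (r X) /\ mlin (r X).
Proof.
elim/(ext_ind ES hsp): X => [|a X Y [h1 h2] [h3 h4]|| p v X _ [IH1 IH2]].
- by rewrite (linf0 rl); split=> *; move=> *; rewrite !pt0 ?oppr0 // scaler0 addr0.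
- rewrite rl; split; [apply: aaltD => //; exact: (aalt_map (f := fun y : E' => a *: y) (linearP _))|].
  by apply: mlinD => //; exact: (mlin_map (f := fun y : E' => a *: y) (linearP _)).
- rewrite (re_1 RS).
  by split=> [[|u' s1]|[|u' s1]] *; rewrite /= ?oppr0 ?scaler0 ?addr0.
have [t1 t2] := th_alt (val v); have mbl := mulI_bilin.
by rewrite rM; split; [apply: (aalt_gsh (sa := id))|apply: (mlin_gsh (sa := id))].
Qed.
End at_point.
End realization_at_a_point.

Section families.
Variables (R : realType) (g : vectType R).

Lemma fpoly_sh (A B C : lmodType R) (op : A -> B -> C) (a : g -> seq g -> A) a' (b : g -> seq g -> B) b' :
  bilin op ->
  (forall s : seq g, poly (fun x => a x s) (fun x u => a' x u s)) ->
  (forall s : seq g, poly (fun x => b x s) (fun x u => b' x u s)) ->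
  forall s : seq g, poly (fun x => sh op (a x) (b x) s)
    (fun x u => (sh op (a' x u) (b x) + sh op (a x) (b' x u)) s).
Proof.
move=> ob pa pb s; elim: s a a' b b' pa pb => [|z s IH] a a' b b' pa pb.
  exact: (poly_op ob (pa [::]) (pb [::])).
have pt : forall s, poly (fun x => tw id (a x) s) (fun x u => tw id (a' x u) s).
  by move=> t; apply: (poly_map (F := fun y : A => (-1) ^+ size t *: y)); [exact: linearP|exact: pa].
have h1 := IH (fun x => arg z (a x)) (fun x u => arg z (a' x u)) b b' (fun t => pa (z :: t)) pb.
have h2 := IH _ _ (fun x => arg z (b x)) (fun x u => arg z (b' x u)) pt (fun t => pb (z :: t)).
apply: (poly_eq (poly_D h1 h2)) => // x u; rewrite !ptE !sh_cons.
by module_with R (C : lmodType R).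
Qed.
End families.

(** * Global realizations for Lie algebras of associative algebras *)

Section matrix_realizations.
Variables (R : realType) (A : gradedSpace R) (T : lalgType R) (gen : bool -> T).
Variables (brT : T -> T -> T) (val : A -> T) (xi gam : A).
Hypothesis AS : A_spec gen brT val xi gam.
Variables (E : lalgType R) (inn : A -> E) (br : E -> E -> E) (dA : A -> A) (dG : E -> E).
Hypotheses (ES : ext_spec inn) (BS : gis_ext_bracket inn br).
Hypotheses (dAl : linear dA) (dAx : dA xi = gam) (dAg : dA gam = 0)
  (dAb : forall k X Y, gs_hom k X -> dA (gs_br X Y) = gs_br (dA X) Y + (-1) ^+ k *: gs_br X (dA Y)).
Hypothesis dGP : is_deriv inn true dA dG.
Variables (g : lieAlgebra R) (E' : lalgType R) (inn' : deg0 g -> E') (br' : E' -> E' -> E').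
Hypotheses (ES' : ext_spec inn') (BS' : gis_ext_bracket inn' br').
Hypothesis sep : separated E'.
Variables (mu : g -> g -> g) (one : g).
Hypotheses (mub : bilin mu) (muA : associative mu) (mu1 : left_id one mu) (mur1 : right_id one mu).
Hypothesis lieE : forall a b : g, lie_br a b = mu a b - mu b a.
Local Notation hom := (@gs_hom R A).
Let GL := A_glie AS.
Let hsp := gl_span GL.
Let il := ext_lin ES.
Let il' := ext_lin ES'.
Let mb' := ext_mul_bilin ES'.
Variables (th : g -> T -> seq g -> g) (r : g -> E -> seq g -> E').
Hypotheses (TH : forall x, theta_spec gen mu one x (th x)).
Hypothesis RS : forall x, real_spec val inn inn' (th x) (r x).
Let rl x := re_lin (RS x).
Let rM x := re_M AS ES ES' (RS x).
Let rb x := re_br AS ES BS ES' BS' mub lieE (TH x) (RS x).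

(** Polynomial dependence on the base point and compatibility with d are carried together, since the
    second refers to the derivative [a'] found in the first. *)
Definition diffable X := exists a', fpoly (fun x => r x X) a' /\ forall x, r x (dG X) = ddl (a' x).

Lemma diffable_lin c X Y : diffable X -> diffable Y -> diffable (c *: X + Y).
Proof.
have [dl _ _ _] := dGP.
move=> [a [pa ea]] [b [pb eb]]; exists (fun x u => c *: a x u + b x u); split.
  move=> s; apply: poly_eq (poly_D (poly_map (F := fun y : E' => c *: y) (linearP _) (pa s)) (pb s)) _ _ => //.
  by move=> x; rewrite rl.
by move=> x; rewrite dl rl ea eb ddlD ddlZ.
Qed.

Lemma diffable_op (op : E -> E -> E) (op' : E' -> E' -> E') k X Y : bilin op' ->
  (forall x X Y, r x (op X Y) = sh op' (r x X) (r x Y)) ->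
  (forall x, fpar k (r x X)) -> dG (op X Y) = op (dG X) Y + (-1) ^+ k *: op X (dG Y) ->
  diffable X -> diffable Y -> diffable (op X Y).
Proof.
move=> ob H fX e [a [pa ea]] [b [pb eb]].
exists (fun x u => sh op' (a x u) (r x Y) + sh op' (r x X) (b x u)); split.
  move=> s; apply: poly_eq (fpoly_sh ob pa pb s) _ _ => // x; by rewrite H.
move=> x; rewrite e (linfD (rl x)) (linfZ (rl x)) !H ea eb ddl_sh // (fpar_tw (fX x)).
by rewrite (bilinZl (sh_bilin g ob)).
Qed.

Let r_fpar p q X x : gbihom inn p q X -> fpar p (r x X).
Proof. by move=> hX; have [h _] := re_deg AS ES' mub (TH x) (RS x) hX; apply: fpar_size. Qed.

Lemma diffable_in v : diffable (inn v).
Proof.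
have [dl d1 di dM] := dGP.
have rE x b u : val u = gen b -> r x (inn u) = fun s => inn' (letter x b s).
  by move=> e; rewrite (re_in ES' (RS x)) e (th_genE mub mur1 (TH x)).
elim/(A_hom_ind AS): v => [||k u v hu IHu IHv|c u v IHu IHv].
- exists (fun _ u => cst (inn' u)); split=> [[|z s]|x].
  + by apply: poly_eq (poly_lin il') _ _ => // x; rewrite (rE _ _ _ (AS_xi AS)).
  + by apply: poly_eq (poly_c g 0) _ _ => // x; rewrite (rE _ _ _ (AS_xi AS)) /= (linf0 il').
  rewrite di dAx (rE _ _ _ (AS_gam AS)) ddl_cst; apply: funext => -[|z [|z' s]] //=; exact: linf0 il'.
- exists (fun _ _ => 0); split=> [s|x].
    by apply: poly_eq (poly_c g (inn' (lin1 id s))) _ _ => // x; rewrite (rE _ _ _ (AS_gam AS)).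
  by rewrite di dAg (linf0 il) (linf0 (rl x)) ddl_0.
- rewrite -(gbr_in BS); apply: (diffable_op (k := k) (gbr_bilin BS') rb) => //.
    by move=> x; apply: r_fpar (gbihom_in inn hu).
  by rewrite (gbr_in BS) !di !(gbr_in BS) (dAb _ hu) (linfD il) (linfZ il).
by rewrite il; apply: diffable_lin.
Qed.

Lemma diffable_all X : diffable X.
Proof.
have [dl d1 di dM] := dGP.
have one1 : diffable 1.
  exists (fun _ _ => 0); split=> [s|x]; last by rewrite d1 (linf0 (rl x)) ddl_0.
  by apply: poly_eq (poly_c g (cst 1 s)) _ _ => // x; rewrite (re_1 (RS x)).
elim/(ext_ind ES hsp): X => [|c X Y|| p v X hv IH] //.
- by rewrite -[0](addNr 1) -scaleN1r; apply: diffable_lin.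
- exact: diffable_lin.
apply: (diffable_op (k := p) mb' rM) => //; last exact: diffable_in.
  by move=> x; apply: r_fpar (gbihom_in inn hv).
by rewrite dM (sgop_in ES GL _ _ hv) addn0 mul1n -scalerAl.
Qed.

Definition real_form (X : E) : forall k : nat, g -> ('I_k -> g) -> (E' * E')%type :=
  fun k x v => (r x X (seq_of v), 0).

Lemma real_form_ev X : realform (real_form X) /\ forall x, ev (real_form X) x = r x X.
Proof.
split=> // x; apply: funext => s; rewrite /ev /evseq /pt /real_form /=; congr (r x X _).
exact: seq_ofP.
Qed.

Lemma real_form_alt X : altform (real_form X).
Proof.
split=> [k x v i c u w|k x v i j ne e].
  have [_ ml] := re_alt AS ES ES' mub (TH x) (RS x) X.
  have Ez z : seq_of (fun j => if j == i then z else v j) =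
     take i (seq_of v) ++ z :: drop i.+1 (seq_of v).
    apply: seq_ofP => [|j].
      by rewrite size_cat /= size_take size_drop size_seq_of ltn_ord; have := ltn_ord i; lia.
    rewrite nth_cat size_take size_seq_of ltn_ord; case: ltngtP => [lt|lt|eq].
    - by rewrite nth_take // nth_seq_of -val_eqE /= ltn_eqF.
    - rewrite -val_eqE /= gtn_eqF //.
      have -> : (j - i = (j - i.+1).+1)%N by lia.
      by rewrite /= nth_drop subnKC // nth_seq_of.
    by rewrite eq subnn /= -val_eqE /= eq eqxx.
  by rewrite /real_form !Ez; apply: pair_ext; rewrite /= ?scaler0 ?addr0 // ml.
have [aa _] := re_alt AS ES ES' mub (TH x) (RS x) X.
wlog lt : i j ne e / (i < j)%N.
  move=> W; case: (ltngtP i j) => [lt|lt|/val_inj eq]; first exact: (W i j ne e lt).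
    by apply: (W j i) => //; rewrite eq_sym.
  by rewrite eq eqxx in ne.
rewrite /real_form -(cat_take_drop i (seq_of v)) (drop_nth 0) ?size_seq_of // nth_seq_of.
rewrite (aalt_mem0 aa) // e -(nth_seq_of v j) -[X in nth 0 _ X](subnKC lt).
by rewrite -nth_drop mem_nth // size_drop size_seq_of; have := ltn_ord j; lia.
Qed.

Lemma real_form_poly X k (v : 'I_k -> g) : exists f', poly (fun x => real_form X x v) f'.
Proof.
have [a [pa _]] := diffable_all X; eexists.
apply: (poly_map (F := fun y : E' => (y, 0) : E' * E') _ (pa (seq_of v))).
by move=> c y z; apply: pair_ext; rewrite /= ?scaler0 ?addr0.
Qed.

Lemma real_form_realize : grealize xi inn br dG inn' br' real_form.
Proof.
have re X := (real_form_ev X).1; have ee X := (real_form_ev X).2; have al := real_form_alt.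
have PE (P Q : forall k : nat, g -> ('I_k -> g) -> (E' * E')%type) := @pf_ext _ _ _ P Q.
split.
- move=> c X Y; apply: functional_extensionality_dep => k; apply: funext => x; apply: funext => v.
  by rewrite /real_form rl; apply: pair_ext; rewrite /= ?scaler0 ?addr0.
- have [r1 e1] := pf0_ev (fun _ : g => 1 : E'); apply: PE => // x; by rewrite ee e1 (re_1 (RS x)).
- move=> p q X hX k x v; have [h1 h2] := re_deg AS ES' mub (TH x) (RS x) hX.
  rewrite /real_form; case: eqP => [_|ne] /=; first by split; [exact: h2|exact: lin_span0].
  by rewrite h1 // size_seq_of; apply/eqP.
- move=> X Y; have [r1 e1] := pf_op_evr mb' (re X) (re Y) (al X) (al Y).
  by apply: PE => // x; rewrite ee e1 !ee rM.
- move=> X Y; have [r1 e1] := pf_op_evr (gbr_bilin BS') (re X) (re Y) (al X) (al Y).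
  by apply: PE => // x; rewrite ee e1 !ee rb.
- move=> X; have [a [pa ea]] := diffable_all X.
  have [|r1 e1] := @pf_diff_ev _ _ _ sep (real_form X) a (re X).
    by move=> s; apply: poly_eq (pa s) _ _ => // x; rewrite ee.
  by apply: PE => // x; rewrite ee e1 ea.
- have [r1 e1] := pf0_ev (fun x : g => inn' x); apply: PE => // x; rewrite ee e1.
  rewrite (re_in ES' (RS x)) (AS_xi AS) (th_genE mub mur1 (TH x)).
  by apply: funext => -[|z s] //=; exact: linf0 il'.
Qed.
End matrix_realizations.

(** * Faithfulness of the matrix realizations *)

Section shuffles_of_positions.
Variables (R : realType) (g : Type).

Lemma sh_premap (g' : Type) (u : g' -> g) (A B C : lmodType R) (op : A -> B -> C) a b v :
  sh op a b (map u v) = sh op (fun s => a (map u s)) (fun s => b (map u s)) v.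
Proof. by elim: v a b => //= z v IH a b; rewrite !sh_cons !IH; congr (_ + sh _ _ _ _); apply: funext => s; rewrite /tw size_map. Qed.
End shuffles_of_positions.

Section delta_functions.
Variables (R : realType) (g : eqType) (A B C : lmodType R) (op : A -> B -> C).
Hypothesis ob : bilin op.
Let sb := sh_bilin g ob.

Lemma sh_congl a a' b (v : seq g) : (forall s, subseq s v -> a s = a' s) -> sh op a b v = sh op a' b v.
Proof.
elim: v a a' b => [|u v IH] a a' b H; first by rewrite !sh_nil H.
rewrite !sh_cons (IH _ (arg u a')) => [|s sv]; last by apply: H; rewrite /= eqxx.
congr (_ + _); apply: IH => s sv; rewrite /tw H //; exact: subseq_trans sv (subseq_cons v u).
Qed.

Lemma sh_congr a b b' (v : seq g) : (forall s, subseq s v -> b s = b' s) -> sh op a b v = sh op a b' v.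
Proof.
elim: v a b b' => [|u v IH] a b b' H; first by rewrite !sh_nil H.
rewrite !sh_cons [X in _ + X](IH _ _ (arg u b')) => [|s sv]; last by apply: H; rewrite /= eqxx.
congr (_ + _); apply: IH => s sv; rewrite H //; exact: subseq_trans sv (subseq_cons v u).
Qed.

Definition delta (M : lmodType R) (beta : seq g) (y : M) : seq g -> M := fun s => if s == beta then y else 0.

Lemma sh_delta0 beta y p b v : p \in beta -> p \notin v -> sh op (delta beta y) b v = 0.
Proof.
move=> pb pv; rewrite (@sh_congl _ 0) ?(bilin0l sb) // => s sv; rewrite /delta; case: eqP => // e.
by move: pv; rewrite (mem_subseq sv) // e.
Qed.

(** The first factor must receive exactly [beta], none of which occurs in [sigma]; only the shuffle
    that hands it the whole prefix survives, and nothing is moved across it. *)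
Lemma sh_delta beta y b tau sigma : uniq beta -> subseq tau beta ->
  (forall p, p \in beta -> p \notin sigma) ->
  sh op (delta beta y) b (tau ++ sigma) = if tau == beta then op y (b sigma) else 0.
Proof.
elim: tau beta b => [|u tau IH] [|p beta] b //.
- move=> _ _ _ /=; rewrite (_ : delta [::] y = cst y) ?(sh_cstl ob) //.
  by apply: funext => -[].
- by move=> _ _ /(_ p) H; rewrite (@sh_delta0 _ _ p) ?mem_head // H ?mem_head.
move=> /andP[pb ub] /=; case: eqP => [-> st dj|/eqP ne st dj].
  rewrite sh_cons (_ : arg p (delta (p :: beta) y) = delta beta y); last first.
    by apply: funext => s; rewrite /arg /delta eqseq_cons eqxx.
  rewrite IH => // [|q qb]; last by apply: dj; rewrite inE qb orbT.
  rewrite eqseq_cons eqxx /= [X in _ + X](_ : _ = 0) ?addr0 //.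
  rewrite (@sh_congl _ 0) ?(bilin0l sb) // => s ss; rewrite /tw /delta; case: eqP => [e|]; last by rewrite scaler0.
  have : p \in tau ++ sigma by rewrite (mem_subseq ss) // e mem_head.
  rewrite mem_cat => /orP[/(mem_subseq st)|]; first by rewrite (negbTE pb).
  by move: (dj p); rewrite mem_head => /(_ isT)/negbTE ->.
rewrite eqseq_cons (negbTE ne) /= (@sh_delta0 _ _ p) ?mem_head // inE negb_or eq_sym ne /= mem_cat negb_or.
rewrite dj ?mem_head // andbT; apply: contra pb => pt; apply: (mem_subseq st); by rewrite inE pt orbT.
Qed.

Lemma subseq_cat_split (s t1 t2 : seq g) : subseq s (t1 ++ t2) ->
  exists s1 s2, [/\ s = s1 ++ s2, subseq s1 t1 & subseq s2 t2].
Proof.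
case/subseqP => m sm ->; exists (mask (take (size t1) m) t1), (mask (drop (size t1) m) t2).
rewrite -mask_cat ?cat_take_drop; last by rewrite size_take sm size_cat; case: ltnP; lia.
by split=> //; exact: mask_subseq.
Qed.

(** The mirror case: the second factor must receive [beta], so each of its entries is moved across
    [a], of parity [k]. *)
Lemma sh_split (a : seq g -> A) (b b' : seq g -> B) k (beta tau sigma : seq g) : fpar k a -> uniq beta -> subseq tau beta ->
  (forall p, p \in beta -> p \notin sigma) ->
  (forall s1 s2, subseq s1 tau -> subseq s2 sigma -> b (s1 ++ s2) = if s1 == beta then b' s2 else 0) ->
  sh op a b (tau ++ sigma) = if tau == beta then (-1) ^+ (k * size beta) *: sh op a b' sigma else 0.
Proof.
move=> ka; elim: tau beta b => [|u tau IH] beta b ub st dj hb.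
  case: beta ub st dj hb => [|p beta] _ _ dj hb.
    by rewrite muln0 scale1r; apply: sh_congr => s ss; exact: (hb [::] s isT ss).
  rewrite (@sh_congr _ _ 0) ?(bilin0r sb) // => s ss; exact: (hb [::] s isT ss).
case: beta ub st dj hb => [//|p beta] /= /andP[pb ub].
have nin (q : g) (t s1 : seq g) : q \in p :: beta -> q \notin t -> subseq s1 t -> s1 == p :: beta = false.
  by move=> qb qt ss; apply/eqP => e; move: qt; rewrite (mem_subseq ss) // e.
case: eqP => [-> st dj hb|/eqP ne st dj hb].
  have pt : p \notin tau by apply: contra pb; exact: (mem_subseq st).
  rewrite sh_cons eqseq_cons eqxx [X in X + _](_ : _ = 0) ?add0r; last first.
    rewrite (@sh_congr _ _ 0) ?(bilin0r sb) // => s /subseq_cat_split[s1 [s2 [-> h1 h2]]].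
    rewrite hb //; last exact: subseq_trans h1 (subseq_cons _ _).
    by rewrite (nin p tau) ?mem_head.
  rewrite (fpar_tw ka) (bilinZl sb) ptE (IH beta) //=.
  - by case: eqP => _; rewrite ?scaler0 // scalerA -exprD mulnS.
  - by move=> q qb; apply: dj; rewrite inE qb orbT.
  move=> s1 s2 h1 h2; rewrite /arg -cat_cons hb //= ?eqxx //.
  by rewrite eqseq_cons eqxx.
rewrite eqseq_cons (negbTE ne) /= (@sh_congr _ _ 0) ?(bilin0r sb) //.
move=> s ss; have [s1 [s2 [-> h1 h2]]] := subseq_cat_split (t1 := u :: tau) ss.
rewrite hb // (nin p (u :: tau)) ?mem_head // inE negb_or eq_sym ne; apply: contra pb => pt.
by apply: (mem_subseq st); rewrite inE pt orbT.
Qed.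
End delta_functions.

(** * Matrix units along a path detect words *)

Section path_of_matrix_units.
Variables (R : realType) (T : lalgType R) (gen : bool -> T).
Hypothesis FS : free_spec gen.
Variables (K : nat) (c : nat -> bool).
Local Notation M := 'M[R]_K.+1.
Local Notation word := (gword gen).

(** Step i of the path 0 -> 1 -> ... -> K. When [c i] holds the step carries the letter gamma and
    the unit serves as a tangent vector; otherwise it carries xi and the unit is a summand of the
    base point [ex]. *)
Definition eu (i : nat) : M := delta_mx (inord i) (inord i.+1).
Definition ex : M := \sum_(i < K | ~~ c i) eu i.
Definition ent (m : M) a b : R^o := m (inord a) (inord b).

Lemma ent_lin a b : linear (fun m => ent m a b). Proof. by move=> k x y; rewrite /ent !mxE. Qed.

Lemma ent_eu i m a b : (i < K)%N -> (a <= K)%N ->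
  ent (eu i *m m) a b = if i == a then ent m a.+1 b else 0.
Proof.
move=> iK aK; rewrite /ent mxE (bigD1 (inord i.+1)) //= big1 ?addr0; last first.
  by move=> j ne; rewrite mxE (negbTE ne) andbF mul0r.
rewrite mxE eqxx andbT -val_eqE /= !inordK ?ltnS // 1?ltnW // eq_sym.
by case: eqP => [->|_]; rewrite ?mul1r ?mul0r.
Qed.

Lemma ent_ex m a b : (a <= K)%N ->
  ent (ex *m m) a b = if (a < K)%N && ~~ c a then ent m a.+1 b else 0.
Proof.
move=> aK; rewrite /ex mulmx_suml [LHS](linf_sum (ent_lin a b)).
under eq_bigr => i _ do rewrite ent_eu //.
case: ltnP => [lt|le]; last first.
  by rewrite big1 // => i _; case: eqP => // e; have := ltn_ord i; rewrite e ltnNge le.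
rewrite -big_mkcondr /=; case: (boolP (c a)) => ca /=.
  by rewrite big1 // => i /andP[nc /eqP e]; move: nc; rewrite e ca.
rewrite (bigD1 (Ordinal lt)) /= ?ca ?eqxx // big1 ?addr0 // => i /andP[/andP[_ /eqP e]].
by rewrite -val_eqE /= e eqxx.
Qed.

Definition seg a b : seq nat := iota a (b - a).

Lemma seg_cons a b : (a < b)%N -> seg a b = a :: seg a.+1 b.
Proof. by move=> lt; rewrite /seg (_ : (b - a = (b - a.+1).+1)%N) //; lia. Qed.
Lemma seg_nil a b : (b <= a)%N -> seg a b = [::].
Proof. by rewrite /seg -subn_eq0 => /eqP ->. Qed.

Variable th : T -> seq M -> M.
Hypotheses (thl : linear th) (th1 : th 1 = cst 1%:M).
Hypothesis thg : forall b t, th (gen b * t) = sh (@mulmx R _ _ _) (if b then lin1 id else cst ex) (th t).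

Let mmb : bilin (@mulmx R K.+1 K.+1 K.+1).
Proof.
split=> [m k x y|m k x y]; first by rewrite mulmxDr scalemxAr.
by rewrite mulmxDl scalemxAl.
Qed.

Let small (s : seq nat) := all (fun i => (i < K)%N && c i) s.

(** The 1-form picks one vector of [s], and row a forces it to be step a. If it is not the first of
    the increasing list, a smaller index is left to [f], which then vanishes. *)
Lemma ent_lin1 (f : seq nat -> M) a b s : (a <= K)%N -> sorted ltn s -> small s ->
  ((a < K)%N -> forall s', subseq s' s -> has (fun i => i <= a)%N s' -> ent (f s') a.+1 b = 0) ->
  ent (sh (@mulmx R _ _ _) (fun s => lin1 id (map eu s)) f s) a b =
  if s is i :: s' then if i == a then ent (f s') a.+1 b else 0 else 0.
Proof.
move=> aK; elim: s f => [|i s IH] f ss sm H.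
  by rewrite sh_nil /= mul0mx /ent mxE.
move: ss sm => /= ps /andP[/andP[iK _] sm]; rewrite sh_cons (linfD (ent_lin a b)).
have -> : arg i (fun s => lin1 id (map eu s)) = cst (eu i) by apply: funext => -[].
rewrite (sh_cstl mmb) ent_eu //.
have -> : tw id (fun s => lin1 id (map eu s)) = - (fun s => lin1 id (map eu s)).
  by apply: funext => -[|j [|j' t]]; rewrite /tw ptN /= ?scaler0 ?oppr0 // expr1 scaleN1r.
rewrite (bilinNl (sh_bilin _ mmb)) ptN (linfN (ent_lin a b)) IH //; last 2 first.
- exact: path_sorted ps.
- by move=> aK' s' hs hh; rewrite /arg H //= ?eqxx // hh orbT.
case: s ps sm H {IH} => [|j s]; first by move=> *; rewrite oppr0 addr0.
move=> /andP[ij _] /andP[/andP[jK _] _] H; rewrite [X in _ - X]/=; case: (eqVneq j a) => [ja|_]; last by rewrite oppr0 addr0.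
have ha : has (fun i => i <= a)%N (i :: s) by rewrite /= -ja (ltnW ij).
have aK' : (a < K)%N by rewrite -ja.
have sub : subseq (i :: s) (i :: j :: s) by exact: (@cat_subseq _ [:: i] s [:: i] (j :: s) (subseq_refl _) (subseq_cons s j)).
by rewrite /arg (H aK' _ sub ha) oppr0 addr0.
Qed.

(** A nonzero product of these units from row a to column b must walk through every step in order,
    so the word is spelled by the letters of the steps, and each gamma consumes its own tangent
    vector. *)
Lemma ent_word w a b s : (a <= K)%N -> (b <= K)%N -> sorted ltn s -> small s ->
  ent (th (word w) (map eu s)) a b =
  if [&& (a <= b)%N, w == map c (seg a b) & s == seq.filter c (seg a b)] then 1 else 0.
Proof.
elim: w a s => [|d w IH] a s aK bK ss sm.
  rewrite gword_nil th1; have [lt|le] := ltnP a b.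
    rewrite seg_cons //= ltnW //=; case: s {ss sm} => [|i s]; last by rewrite /ent mxE.
    rewrite /= /ent mxE -val_eqE /= !inordK ?ltnS // ltn_eqF //.
  case: s {ss sm} => [|i s]; last by rewrite /= /ent mxE seg_nil // andbF.
  rewrite seg_nil //= /ent mxE -val_eqE /= !inordK ?ltnS // andbT eqn_leq le andbT.
  by case: (a <= b)%N.
rewrite gword_cons thg; case: d; last first.
  rewrite (sh_cstl mmb) ent_ex //; have [lt|le] := ltnP a K; last first.
    by rewrite seg_nil ?andbF //; exact: leq_trans bK le.
  have [ab|ba] := ltnP a b; last first.
    rewrite seg_nil // andbF; case: ifP => // _; rewrite IH // leqNgt ltnS ba //.
  rewrite seg_cons //= eqseq_cons (ltnW ab) /=; case: (boolP (c a)) => ca //=.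
  by rewrite IH // ab.
rewrite sh_premap ent_lin1 //; last first.
  move=> lt s' s's hs; have ss' := subseq_sorted ltn_trans s's ss.
  rewrite IH //; last by apply/allP => i /(mem_subseq s's); exact: (allP sm).
  case: and3P => // -[_ _ /eqP e]; move: hs; rewrite e => /hasP[i].
  by rewrite mem_filter mem_iota => /andP[_ /andP[lt' _]]; rewrite leqNgt lt'.
case: s ss sm => [|i s] ss sm.
  have [ab|ba] := ltnP a b; last by rewrite seg_nil // andbF.
  rewrite seg_cons //= eqseq_cons; case: (c a) => //=; by rewrite !andbF.
move: ss sm => /= ps /andP[/andP[iK ci] sm]; have [ei|ne] := eqVneq i a; last first.
  have [ab|ba] := ltnP a b; last by rewrite seg_nil // andbF.
  rewrite seg_cons //= eqseq_cons; case: (c a) => //=; last by rewrite andbF.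
  by rewrite eqseq_cons (negbTE ne) !andbF.
rewrite ei in iK ci ps *; rewrite IH //; last exact: path_sorted ps.
have [ab|ba] := ltnP a b; last by rewrite [seg a b]seg_nil //= andbF.
by rewrite [seg a b]seg_cons //= (ltnW ab) eqseq_cons ci /= eqseq_cons eqxx.
Qed.
End path_of_matrix_units.

Section matrix_lie_algebra.
Variables (R : realType) (K : nat).
Local Notation M := 'M[R]_K.+1.
Definition mx_br (a b : M) : M := a *m b - b *m a.

Lemma mulmx_bilin : bilin (@mulmx R K.+1 K.+1 K.+1).
Proof.
split=> [m k x y|m k x y]; first by rewrite mulmxDr scalemxAr.
by rewrite mulmxDl scalemxAl.
Qed.

Lemma mx_br_bilin : bilin mx_br.
Proof.
have mb := mulmx_bilin; split=> [m k x y|m k x y]; rewrite /mx_br (bilinl mb) (bilinr mb);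
  by module_with R (M : lmodType R).
Qed.
Lemma mx_br_alt a : mx_br a a = 0. Proof. exact: subrr. Qed.
Lemma mx_br_jacobi a b c : mx_br a (mx_br b c) + mx_br b (mx_br c a) + mx_br c (mx_br a b) = 0.
Proof.
by rewrite /mx_br !(mulmxBr, mulmxBl) !mulmxA; module_with R (M : lmodType R).
Qed.

Definition mxlie : lieAlgebra R := @LieAlgebra R M mx_br mx_br_bilin mx_br_alt mx_br_jacobi.
Definition mxlie_mul : mxlie -> mxlie -> mxlie := @mulmx R K.+1 K.+1 K.+1.
Lemma mxlie_bilin : bilin mxlie_mul. Proof. exact: mulmx_bilin. Qed.
End matrix_lie_algebra.

Section detection.
Variables (R : realType) (A : gradedSpace R) (T : lalgType R) (gen : bool -> T).
Variables (brT : T -> T -> T) (val : A -> T) (xi gam : A).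
Hypothesis AS : A_spec gen brT val xi gam.
Variables (E : lalgType R) (inn : A -> E).
Hypothesis ES : ext_spec inn.
Let FS := AS_free AS.
Let GL := A_glie AS.
Let hsp := gl_span GL.
Local Notation word := (gword gen).
Local Notation hom := (@gs_hom R A).

Variable cf : seq bool -> T -> R^o.
Hypotheses (cfl : forall w, linear (cf w)) (cfE : forall w s, cf w (word s) = if s == w then 1 else 0).

Definition vcf (w : seq bool) (v : A) : R^o := cf w (val v).

Lemma vcf_homog w : homog_form (count id w) (vcf w).
Proof.
split=> [c u v|k v hv ne]; first by rewrite /vcf (AS_lin AS) cfl.
move: hv => /(AS_hom AS); rewrite /vcf; elim/lin_span_ind: (val v) / => [|c _ t [s cs ->] IH].
  exact: linf0 (cfl w).
rewrite cfl IH addr0 cfE; case: eqP => [e|_]; last by rewrite scaler0.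
by move: ne; rewrite -cs e eqxx.
Qed.

Definition wctr (w : seq bool) : E -> E := gctr inn (count id w) (vcf w).

Section path.
Variables (K : nat) (c : nat -> bool) (E' : lalgType R) (inn' : deg0 (mxlie R K) -> E').
Hypothesis ES' : ext_spec inn'.
Variables (th : T -> seq (mxlie R K) -> mxlie R K) (r : E -> seq (mxlie R K) -> E').
Hypotheses (TH : theta_spec gen (@mxlie_mul R K) (1%:M : 'M[R]_K.+1) (ex R K c) th)
  (RS : real_spec val inn inn' th r).
Local Notation eu := (eu R K : nat -> mxlie R K).
Let rl := re_lin RS.
Let rM := re_inM RS.

Let small (s : seq nat) := all (fun i => (i < K)%N && c i) s.

Lemma ent_coef t a b s : (a <= b)%N -> (b <= K)%N -> sorted ltn s -> small s ->
  ent (th t (map eu s)) a b = if s == seq.filter c (seg a b) then cf (map c (seg a b)) t else 0.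
Proof.
move=> ab bK ss sm; have tl := th_lin TH; move: t; apply: (word_lin_ext FS).
- by move=> k x y; rewrite tl; exact: ent_lin.
- by move=> k x y; case: eqP; rewrite ?cfl // scaler0 addr0.
move=> w; rewrite (ent_word (c := c) (th_1 TH)) //; last exact: leq_trans bK.
  by rewrite ab /= cfE andbC; case: (s == _).
by case; exact: (th_gen TH).
Qed.

Variables (a : nat) (w : seq bool).
Let e := (a + size w)%N.
Hypotheses (eK : (e <= K)%N) (wE : map c (seg a e) = w).
Variable J : E' -> E'.
Hypotheses (Jl : linear J) (J1 : J 1 = 0).
Hypothesis JM : forall (v : mxlie R K) X, J (inn' v * X) = ent v a e *: X - inn' v * J X.
Let beta := seq.filter c (seg a e).

(** On v X the contraction by the matrix entry (a, e) hits either v, where it reads the coefficient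
    of [w] by [ent_coef], or X, by induction. The sign of the second case is that of the contraction
    by the form [vcf w], since [beta] has as many entries as [w] has gammas. Proper subsequences
    [tau] are allowed because a shuffle may distribute [beta] over both factors. *)
Lemma wctr_block X tau sigma : subseq tau beta -> sorted ltn (tau ++ sigma) -> small (tau ++ sigma) ->
  (forall i, i \in sigma -> (e <= i)%N) ->
  J (r X (map eu (tau ++ sigma))) = if tau == beta then r (wctr w X) (map eu sigma) else 0.
Proof.
have [wl w1 wM] := gctrP ES GL (vcf_homog w); rewrite -/(wctr w) in wl w1 wM.
have sb : size beta = count id w by rewrite size_filter -[in RHS]wE count_map.
have ub : uniq beta by apply/filter_uniq/iota_uniq.
elim/(ext_ind ES hsp): X tau sigma => [|k X Y IHX IHY|| k v X hv IH] tau sigma st so sm he.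
- by rewrite (linf0 wl) (linf0 rl) !pt0 (linf0 Jl) if_same.
- rewrite rl ptD ptZ Jl IHX // IHY // wl rl ptD ptZ.
  by case: eqP => // _; rewrite scaler0 addr0.
- rewrite (re_1 RS) w1 (linf0 rl) pt0 if_same; case: (map _ _) => [|u s] /=; first exact: J1.
  exact: linf0 Jl.
have dj p : p \in beta -> p \notin sigma.
  rewrite mem_filter mem_iota => /andP[_ /andP[_ lt]]; apply/negP => /he.
  by rewrite leqNgt /e; move: lt; rewrite /e addKn => ->.
have mbl : bilin (mulI inn') := mulI_bilin ES'.
have scb : bilin (fun (x : R^o) (m : E') => x *: m).
  by split=> [x|m] d y z; [rewrite scalerDr !scalerA mulrC|rewrite scalerDl scalerA].
rewrite rM (@sh_map _ _ _ _ _ _ _ J _ _ _ Jl) sh_premap.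
set f := fun s => th (val v) (map eu s).
have -> : sh (fun x y => J (mulI inn' x y)) f (fun s => r X (map eu s)) (tau ++ sigma) =
    sh (fun (x : R^o) m => x *: m) (fun s => ent (f s) a e) (fun s => r X (map eu s)) (tau ++ sigma)
    - sh (mulI inn') f (fun s => J (r X (map eu s))) (tau ++ sigma).
  rewrite (@sh_mapl _ _ _ _ _ _ (fun (x : R^o) m => x *: m) (fun m : mxlie R K => ent m a e)); last exact: ent_lin.
  rewrite (@sh_mapr _ _ _ _ _ _ (mulI inn') J).
  move: (tau ++ sigma) {so sm} f (fun s => r X _) => l; elim: l => [|u l IHl] f' h'.
    by rewrite !sh_nil JM.
  by rewrite !sh_cons !IHl opprD addrACA.
have ok s : subseq s (tau ++ sigma) -> sorted ltn s /\ small s.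
  move=> ss; split; first by have := subseq_sorted ltn_trans ss so.
  by apply/allP => i /(mem_subseq ss); exact: (allP sm).
rewrite (@sh_congl _ _ _ _ _ _ _ (delta beta (vcf w v))); last first.
  by move=> s /ok[h1 h2]; rewrite ent_coef ?leq_addr // wE.
have kf : fpar k f by move=> s; have := th_hom AS (mxlie_bilin R K) TH hv (map eu s); rewrite size_map.
rewrite (sh_delta scb) // (sh_split mbl (b' := fun s => r (wctr w X) (map eu s)) kf ub st dj); last first.
  move=> s1 s2 h1 h2; have [|h3 h4] := ok (s1 ++ s2); first exact: cat_subseq.
  apply: IH => //; first exact: subseq_trans st.
  by move=> i /(mem_subseq h2)/he.
case: eqP => _; last by rewrite subr0.
rewrite (wM k) // (linfB rl) !(linfZ rl) rM !ptE sb mulnC; congr (_ - _ *: _).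
by rewrite sh_premap.
Qed.
End path.

Lemma cf_sep t : (forall w, cf w t = 0) -> t = 0.
Proof.
suff [L HL] : exists L : seq (seq bool), forall L', uniq L' -> {subset L <= L'} ->
    t = \sum_(w <- L') cf w t *: word w.
  move=> H; rewrite (HL (undup L)) ?undup_uniq // => [|w]; last by rewrite mem_undup.
  by rewrite big1 // => w _; rewrite H scale0r.
elim/(free_ind FS): t => [|k s y [L HL]].
  by exists [::] => L' _ _; rewrite big1 // => w _; rewrite (linf0 (cfl w)) scale0r.
exists (s :: L) => L' uL sL; rewrite {1}(HL L' uL) => [|w wL]; last by apply: sL; rewrite inE wL orbT.
under [RHS]eq_bigr do rewrite cfl scalerDl.
rewrite big_split /=; congr (_ + _); rewrite (bigD1_seq s) //=; last by apply: sL; rewrite mem_head.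
have kE (x : R^o) : k *: x = k * x :> R by [].
rewrite cfE eqxx kE mulr1 big1 ?addr0 // => w ne.
by rewrite cfE eq_sym (negbTE ne) scaler0 scale0r.
Qed.

Definition wforms (p : nat) : set (A -> R^o) := fun phi => exists2 w, count id w = p & phi = vcf w.

Lemma wforms_homog p phi : wforms p phi -> homog_form p phi.
Proof. by case=> w <- ->; exact: vcf_homog. Qed.

(** Gram-Schmidt: the new vector is replaced by its residue v' after the resolution already found.
    If v' is nonzero, some word has a nonzero coefficient in it and supplies the new dual form. *)
Lemma wforms_rep : @reproducing R A wforms.
Proof.
elim=> [|[k v] s IH] hs; first by exists [::].
have [|t [ht ts]] := IH; first by move=> u us; apply: hs; rewrite inE us orbT.
have hv : hom k v by apply: (hs (k, v)); rewrite mem_head.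
pose P u := \sum_(i <- t) i.2 u *: i.1.2; pose v' := v - P v.
have [v0|nv] := eqVneq v' 0.
  exists t; split=> // u; rewrite inE => /orP[/eqP -> /=|/ts //].
  by apply/eqP; rewrite -subr_eq0; apply/eqP.
have [w nw] : exists w, vcf w v' != 0.
  apply/not_existsP => H; move/eqP: nv; apply; apply: (AS_inj AS); rewrite (linf0 (AS_lin AS)).
  by apply: cf_sep => w; apply/eqP; apply: contrapT => ne; apply: (H w); apply/negP.
have i0 i : i \in t -> i.1.1 != k -> i.2 v = 0.
  by move=> /ht[_ /(span_homog_form ES GL wforms_homog)[_ H]] ne; apply: (H k) => //; rewrite eq_sym.
have sumhom (I : eqType) (l : seq I) (F : I -> A) : (forall i, i \in l -> hom k (F i)) -> hom k (\sum_(i <- l) F i).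
  elim: l => [|i l IHl] H; first by rewrite big_nil; exact: A_hom0 AS _.
  rewrite big_cons -[F i]scale1r; apply: (A_hom_lin AS); first by apply: H; rewrite mem_head.
  by apply: IHl => j jl; apply: H; rewrite inE jl orbT.
have hv' : hom k v'.
  rewrite /v' addrC -scaleN1r; apply: (A_hom_lin AS) => //; apply: sumhom => i it.
  have [e|ne] := eqVneq i.1.1 k; last by rewrite i0 // scale0r; exact: A_hom0 AS _.
  rewrite -[_ *: _]addr0; apply: (A_hom_lin AS); last exact: A_hom0 AS _.
  by rewrite -e; case: (ht i it).
have wk : count id w = k.
  apply/eqP; apply: contraNT nw => ne; have [_ H] := vcf_homog w.
  by rewrite (H k) // eq_sym.
(* Testing the residue makes [psi] vanish on the vectors already reproduced and take the value 1 on
   [v]. *)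
pose psi u : R^o := (vcf w v')^-1 *: (vcf w u - vcf w (P u)).
have vwl : linear (vcf w) by case: (vcf_homog w).
exists (((k, v'), psi) :: t); split=> [i|u].
  rewrite inE => /orP[/eqP -> /=|/ht //]; split=> //.
  have -> : psi = (vcf w v')^-1 *: (vcf w - \sum_(i <- t) vcf w i.1.2 *: i.2).
    apply: funext => u; rewrite /psi /P (linf_sum vwl) ptZ ptD ptN fct_sumE; congr (_ *: (_ - _)).
    by apply: eq_bigr => j _; rewrite (linfZ vwl) ptZ [LHS]mulrC.
  apply: lin_spanZ; apply: lin_spanB; first by apply: lin_span_in; exists w.
  apply: lin_span_sum => j jt; have [e|ne] := eqVneq j.1.1 k.
    by apply: lin_spanZ; have [_] := ht j jt; rewrite e.
  have -> : vcf w j.1.2 = 0; last by rewrite scale0r; exact: lin_span0.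
  by have [_ H] := vcf_homog w; apply: (H j.1.1); [case: (ht j jt)|rewrite wk].
rewrite inE => /orP[/eqP -> /=|us]; rewrite big_cons /=.
  have -> : psi v = 1 by rewrite /psi -(linfB vwl) [LHS]mulVf.
  by rewrite scale1r /v' subrK.
have -> : psi u.2 = 0 by rewrite /psi /P -(ts u us) subrr scaler0.
by rewrite scale0r add0r; exact: ts.
Qed.

Section faithful.
Variables (E' : nat -> lalgType R) (inn' : forall K, deg0 (mxlie R K) -> E' K).
Hypothesis ES' : forall K, ext_spec (@inn' K).

Lemma counit_nil K (th : T -> seq (mxlie R K) -> mxlie R K) r X : real_spec val inn (@inn' K) th r ->
  counit (@inn' K) (r X [::]) = counit inn X.
Proof.
move=> RS; have [cl c1 cM] := counitP (ES' K) (deg0_glie _); have [dl d1 dM] := counitP ES GL.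
move: X; apply: (ext_lin_ind ES hsp) => //.
- by move=> k X Y; rewrite (re_lin RS) cl.
- by rewrite (re_1 RS) c1 d1.
by move=> k v X hv _; rewrite (re_inM RS) sh_nil cM dM.
Qed.

(** The path is cut into blocks, one per word; each block of tangent vectors is removed by a
    contraction with the matrix entry joining its ends. At the end of the path only the counit
    remains. *)
Lemma path_counit K c (th : T -> seq (mxlie R K) -> mxlie R K) r ws a Z :
  theta_spec gen (@mxlie_mul R K) (1%:M : 'M[R]_K.+1) (ex R K c) th -> real_spec val inn (@inn' K) th r ->
  map c (seg a K) = flatten ws -> (a + size (flatten ws) = K)%N ->
  r Z (map (eu R K : nat -> mxlie R K) (seq.filter c (seg a K))) = 0 ->
  counit inn (foldl (fun X w => wctr w X) Z ws) = 0.
Proof.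
move=> TH RS; elim: ws a Z => [|w ws IH] a Z /= cE aK r0.
  rewrite -(counit_nil Z RS); move: r0; rewrite seg_nil /=; last by lia.
  move=> ->.
  by case: (counitP (ES' K) (deg0_glie _)) => cl _ _; exact: linf0 cl.
rewrite size_cat addnA in aK; set e := (a + size w)%N in aK.
have eK : (e <= K)%N by rewrite -aK leq_addr.
have sE : seg a K = seg a e ++ seg e K.
  have -> : seg e K = iota (a + (e - a)) (K - e) by congr iota; rewrite /e; lia.
  by rewrite -iotaD /seg; congr iota; rewrite /e in eK *; lia.
rewrite sE map_cat in cE; have sw : size (map c (seg a e)) = size w.
  by rewrite size_map size_iota /e addKn.
have cw : map c (seg a e) = w.
  by move: cE => /(congr1 (take (size w))); rewrite -{1}sw !take_size_cat.
have cws : map c (seg e K) = flatten ws.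
  by move: cE => /(congr1 (drop (size w))); rewrite -{1}sw !drop_size_cat.
apply: (IH e) => //.
have hf : homog_form (V := deg0 (mxlie R K)) 0 (fun m : mxlie R K => ent (m : 'M[R]_K.+1) a e).
  by split=> [|k v [->|->] // _]; [exact: ent_lin|rewrite /ent mxE].
have [Jl J1 JM] := gctrP (ES' K) (deg0_glie _) hf.
have JM' (v : mxlie R K) X : gctr (@inn' K) 0 (fun m : mxlie R K => ent (m : 'M[R]_K.+1) a e) (@inn' K v * X) =
    ent (v : 'M[R]_K.+1) a e *: X - @inn' K v * gctr (@inn' K) 0 (fun m : mxlie R K => ent (m : 'M[R]_K.+1) a e) X.
  by rewrite (JM 0%N) ?mul0n ?scale1r //; left.
have := @wctr_block K c (E' K) (@inn' K) (ES' K) th r TH RS a w eK cw _ Jl J1 JM' Z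
  (seq.filter c (seg a e)) (seq.filter c (seg e K)) (subseq_refl _).
rewrite eqxx -filter_cat -sE r0 (linf0 Jl) => <- //.
- apply: sorted_filter => //; [exact: ltn_trans|exact: iota_ltn_sorted].
- by apply/allP => i; rewrite mem_filter mem_iota => /andP[-> /andP[h1 h2]]; rewrite andbT; lia.
- by move=> i; rewrite mem_filter mem_iota => /andP[_ /andP[]].
Qed.
Lemma faithful Z : (forall K x, exists (th : T -> seq (mxlie R K) -> mxlie R K) r,
    [/\ theta_spec gen (@mxlie_mul R K) (1%:M : 'M[R]_K.+1) x th, real_spec val inn (@inn' K) th r &
    forall s, r Z s = 0]) -> Z = 0.
Proof.
move=> H; apply: (ext_sep ES GL wforms_homog wforms_rep) => l hl.
have [ws ->] : exists ws, foldr (fun i => gctr inn i.1 i.2) Z l = foldr wctr Z (rev ws).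
  elim: l hl => [|[p phi] l IH] /=; first by exists [::].
  move=> [[w <- ->] /IH[ws ->]]; exists (rcons ws w); by rewrite rev_rcons.
(* A single path spells all the words one after another; the matrices are taken large enough for its
   length. *)
rewrite -foldl_rev revK; set K := size (flatten ws); pose c := nth false (flatten ws).
have [th [r [TH RS rZ]]] := H K (ex R K c).
apply: (path_counit (a := 0%N) TH RS) => //.
by rewrite /seg subn0 /K map_nth_iota0 // take_size.
Qed.
End faithful.
End detection.

(** * The convolution on G *)

Section sign_commutation.
Variables (R : realType) (V : gradedSpace R) (E : lalgType R) (inn : V -> E).
Hypotheses (ES : ext_spec inn) (GL : glie V).
Let hsp := gl_span GL.
Let sA := scaleAr ES.
Let sl := sgop_lin ES GL.

(** A derivation changes [deg] by its parity and leaves [deg_w] alone. *)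
Lemma sgop_der s f D a b X : degree_shift s f -> is_deriv inn s f D ->
  sgop inn a b (D X) = (-1) ^+ (a && s) *: D (sgop inn a b X).
Proof.
move=> [fl fh] [Dl D1 Di DM]; move: X; apply: (ext_lin_ind ES hsp).
- exact: linear_comp_ub (sl a b) Dl.
- by move=> c x y; rewrite sl Dl; module_with R (E : lmodType R).
- by rewrite D1 (sgop1 ES GL) D1 (linf0 (sl _ _)) scaler0.
move=> k v X hv IH; have [k' ek hk'] := fh _ _ hv.
rewrite !(DM, sgopM ES GL, Di) (linfD (sl _ _)) !(sgopM ES GL) IH !(sgop_in ES GL _ _ hv) (sgop_in ES GL _ _ hk').
rewrite !(linfZ (sl _ _)) !(linfZ Dl) !(sgop_in ES GL _ _ hv) Di -!scalerAl -!sA scalerDr.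
rewrite -[(-1) ^+ (a * k' + b)]signr_odd -[(-1) ^+ (a * k + b)]signr_odd -[(-1) ^+ (s * k + 0)]signr_odd.
rewrite !oddD !oddM !oddb ek.
by case: (a) (b) (s) (odd k) => [] [] [] []; rewrite ?expr1 ?expr0; module_with R (E : lmodType R).
Qed.

Variables (br : E -> E -> E) (kz : E -> E).
Hypotheses (BS : gis_ext_bracket inn br) (KZ : gis_koszul inn br kz).

Lemma sgop_koszul a X : sgop inn a a (kz X) = (-1) ^+ a *: kz (sgop inn a a X).
Proof.
have [kl k1 ki kM] := KZ; move: X; apply: (ext_lin_ind ES hsp).
- exact: linear_comp_ub (sl a a) kl.
- by move=> c x y; rewrite sl kl; module_with R (E : lmodType R).
- by rewrite k1 (sgop1 ES GL) k1 (linf0 (sl _ _)) scaler0.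
move=> k v X hv IH; have gd := gbr_deriv ES GL BS hv.
have ds : degree_shift (odd k) (@gs_br R V v).
  split=> [|l w hw]; first exact: bilinr (gl_br GL) v.
  by exists (k + l)%N; [rewrite oddD addbC|exact: gl_hom GL _ _ _ _ hv hw].
rewrite kM (linfB (sl _ _)) !(sgopM ES GL) (sgop_der _ _ _ ds gd) IH (sgop_in ES GL _ _ hv).
rewrite -!scalerAl -!sA (linfZ kl) kM -[(-1) ^+ (a * k + a)]signr_odd oddD oddM oddb.
by case: (a) (odd k) => [] []; rewrite ?expr1 ?expr0; module_with R (E : lmodType R).
Qed.
End sign_commutation.

Section convolution_algebra.
Variables (R : realType) (A : gradedSpace R) (T : lalgType R) (gen : bool -> T).
Variables (brT : T -> T -> T) (val : A -> T) (xi gam : A).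
Hypothesis AS : A_spec gen brT val xi gam.
Variables (E : lalgType R) (inn : A -> E) (br : E -> E -> E) (dA : A -> A) (dG kz : E -> E).
Hypotheses (ES : ext_spec inn) (BS : gis_ext_bracket inn br).
Local Notation hom := (@gs_hom R A).
Hypotheses (dAl : linear dA) (dAh : forall k X, hom k X -> hom k.+1 (dA X))
  (dAx : dA xi = gam) (dAg : dA gam = 0)
  (dAb : forall k X Y, hom k X -> dA (gs_br X Y) = gs_br (dA X) Y + (-1) ^+ k *: gs_br X (dA Y)).
Hypotheses (dGP : is_deriv inn true dA dG) (KZ : gis_koszul inn br kz).
Let GL := A_glie AS.
Let hsp := gl_span GL.
Let il := ext_lin ES.
Let sA := scaleAr ES.
Let sl := sgop_lin ES GL.
Let ab := A_br_bilin AS.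
Let dl := let: And4 h _ _ _ := dGP in h.
Local Notation sg p := (sgop inn p p).

Record del_spec (p : nat) (z : A) (fA : A -> A) (f : E -> E) : Prop := {
  de_lin : linear fA;
  de_S : forall k X, hom k.+1 X -> hom (k + p)%N (fA X);
  de_0 : forall X, hom 0%N X -> fA X = 0;
  de_xi : fA xi = 0;
  de_gam : fA gam = gs_br z xi;
  de_br : forall k X Y, hom k X -> fA (gs_br X Y) = gs_br (fA X) Y + (-1) ^+ (p.+1 * k) *: gs_br X (fA Y);
  de_der : is_deriv inn (odd p.+1) fA f }.

Lemma de_shift p z fA f : del_spec p z fA f -> degree_shift (odd p.+1) fA.
Proof.
move=> d; split=> [|[|k] v hv]; first exact: de_lin d.
  by exists (odd p.+1); [rewrite oddb|rewrite (de_0 d hv); exact: A_hom0 AS _].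
by exists (k + p)%N; [rewrite oddD /=; case: (odd k) (odd p) => [] []|exact: de_S d _ _ hv].
Qed.

Lemma del_ex p z : hom p z -> exists fA f, del_spec p z fA f.
Proof.
move=> hz; have [fA [fl fS f0 [fx fg] fb]] := A_del_ex AS hz.
have ds : degree_shift (odd p.+1) fA.
  split=> // -[|k] v hv.
    by exists (odd p.+1); [rewrite oddb|rewrite (f0 _ hv); exact: A_hom0 AS _].
  by exists (k + p)%N; [rewrite oddD /=; case: (odd k) (odd p) => [] []|exact: fS].
by have [f fD] := der_ex ES GL (degree_parity_shift ES ds); exists fA, f.
Qed.

Section commutator.
Variables (p : nat) (z : A) (fA : A -> A) (f : E -> E) (fA' : A -> A) (f' : E -> E).
Hypotheses (hz : hom p z) (de : del_spec p z fA f) (de' : del_spec p.+1 (dA z) fA' f').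

Let hfA k u : hom k u -> exists2 k', odd k' = odd k (+) odd p.+1 & hom k' (fA u).
Proof. exact: (de_shift de).2. Qed.

(** Every term respects brackets with the same sign, the last one by the Jacobi identity. On xi the
    terms with [z, xi] cancel; on gamma the identity is the rule for d[z, xi]. *)
Lemma d_del_A v : dA (fA v) = (-1) ^+ p.+1 *: fA (dA v) + fA' v - (-1) ^+ p.+1 *: gs_br z v.
Proof.
have fl := de_lin de; have fl' := de_lin de'.
elim/(A_hom_ind AS): v => [||k u v hu IHu IHv|c u v IHu IHv].
- rewrite (de_xi de) (de_xi de') dAx (de_gam de) (linf0 dAl); by module_with R (A : lmodType R).
- rewrite dAg (linf0 fl) (de_gam de) (de_gam de') (dAb _ hz) dAx.
  by module_with R (A : lmodType R); rewrite exprS; ring.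
- have [k' ek hk'] := hfA hu.
  rewrite (de_br de _ hu) (linfD dAl) (linfZ dAl) (dAb _ hk') (dAb _ hu) IHu IHv.
  rewrite (dAb _ hu) (linfD fl) (linfZ fl) (de_br de _ (dAh hu)) (de_br de _ hu) (de_br de' _ hu).
  rewrite (A_jacobi AS v hz hu) !(bilinDl ab, bilinDr ab, bilinNl ab, bilinNr ab, bilinZl ab, bilinZr ab).
  rewrite -[(-1) ^+ k']signr_odd ek -(signr_odd R (p.+1 * k)) -(signr_odd R (p.+1 * k.+1)).
  rewrite -(signr_odd R (p.+2 * k)) -(signr_odd R (p * k)) -(signr_odd R p.+1) -(signr_odd R k).
  odds; by case: (odd p) (odd k) => [] []; rewrite /= ?expr1 ?expr0; module_with R (A : lmodType R).
- rewrite fl !dAl !fl fl' (bilinr ab) IHu IHv; by module_with R (A : lmodType R).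
Qed.

Lemma d_del X : dG (f X) = (-1) ^+ p.+1 *: f (dG X) + f' X - (-1) ^+ p.+1 *: br (inn z) X.
Proof.
have [fl f1 fi fM] := de_der de; have [fl' f1' fi' fM'] := de_der de'.
have [_ d1 di dM] := dGP; have [bl b1 bi bM] := gbr_deriv ES GL BS hz.
move: X; apply: (ext_lin_ind ES hsp).
- exact: linear_comp_ub dl fl.
- by move=> c x y; rewrite dl !fl fl' bl; module_with R (E : lmodType R).
- by rewrite f1 d1 f1' b1 (linf0 fl) (linf0 dl) !scaler0 subr0 addr0.
move=> k v X hv IH; have [k' ek hk'] := hfA hv.
rewrite !(fM, fM', dM, bM, fi, fi', di, bi) (linfD dl) (linfD fl) !(sgop_in ES GL _ _ hv).
rewrite -!scalerAl !(linfZ dl) !(linfZ fl) !(fM, dM, fi, di) !(sgop_in ES GL _ _ hv).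
rewrite (sgop_in ES GL _ _ hk') (sgop_in ES GL _ _ (dAh hv)) -!scalerAl IH d_del_A.
rewrite !(linfD il, linfN il, linfB il, linfZ il) !mulrDl !mulNr !mulrDr ?mulrN -!scalerAl -!sA.
have e1 : (-1) ^+ (true * k' + 0) = (-1) ^+ (odd k (+) odd p.+1) :> R by rewrite -ek signr_odd mul1n addn0.
have e2 : (-1) ^+ (odd p.+1 * k.+1 + 0) = (-1) ^+ (odd p.+1 && ~~ odd k) :> R.
  by rewrite -signr_odd addn0 oddM oddb.
have e3 (d : bool) : (-1) ^+ (d * k + 0) = (-1) ^+ (d && odd k) :> R.
  by rewrite -signr_odd addn0 oddM oddb.
rewrite e1 e2 !e3 -(signr_odd R p.+1) /=.
by case: (odd p) (odd k) => [] []; rewrite /= ?expr1 ?expr0; module_with R (E : lmodType R).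
Qed.
End commutator.

(** The factor (-1)^(Deg + 1) of D is minus the automorphism (-1)^Deg, so this form of D makes sense
    for inhomogeneous elements. *)
Definition Dp (X : E) : E := dG X - kz (sg true X).

Definition starz (p : nat) (z : A) (f : E -> E) (X : E) : E :=
  inn z * sg (odd p) X - f (sg (odd p.+1) X).

(** The Leibniz rule for a right factor in A. The bracket with z produced by the boundary of z Y
    cancels the one produced by commuting d with the derivation attached to z; the derivation
    commutes with the boundary operator by [der_koszul]. *)
Lemma Dp_starz p z fA f fA' f' X : hom p z -> del_spec p z fA f -> del_spec p.+1 (dA z) fA' f' ->
  Dp (starz p z f X) = starz p z f (Dp X) + starz p.+1 (dA z) f' (sg true X).
Proof.
move=> hz de de'; have [fl f1 fi fM] := de_der de; have [_ d1 di dM] := dGP; have [kl k1 ki kM] := KZ.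
have dS : degree_shift true dA by split=> // k v /dAh hv; exists k.+1 => //=; rewrite addbT.
have kd U : kz (f U) = f (kz U).
  by apply: (der_koszul ES GL BS (de_shift de) (de_der de) _ KZ) => k u v hu; rewrite (de_br de _ hu); congr (_ + _ *: _); apply: signr_eq; rewrite !oddM oddb.
have sgc a b W : sg a (sg b W) = sg (a (+) b) W by exact: sgop_comp.
have sgD a W : sg a (Dp W) = (-1) ^+ a *: (dG (sg a W) - kz (sg true (sg a W))).
  rewrite /Dp (linfB (sl a a)) (sgop_der ES GL a a W dS dGP) (sgop_koszul ES GL BS KZ) andbT.
  by rewrite !sgc addbC -scalerBr.
rewrite /starz (sgD (odd p)) (sgD (odd p.+1)) (sgc (odd p.+1) true) (sgc (odd p.+2) true).
have -> : odd p.+1 (+) true = odd p by rewrite /= addbT negbK.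
have -> : odd p.+2 (+) true = odd p.+1 by rewrite /= addbT negbK.
rewrite (sgc true (odd p)) (sgc true (odd p.+1)).
have -> : true (+) odd p = odd p.+1 by rewrite addTb.
have -> : true (+) odd p.+1 = odd p by rewrite addTb /= negbK.
have eY : sg true (sg (odd p) X) = sg (odd p.+1) X by rewrite sgc addTb.
have eU : sg true (sg (odd p.+1) X) = sg (odd p) X by rewrite sgc addTb /= negbK.
move: (sg (odd p) X) (sg (odd p.+1) X) eY eU => Y U eY eU.
rewrite /Dp (linfB (sl true true)) (sgopM ES GL) eY (sgop_in ES GL _ _ hz).
rewrite (sgop_der ES GL _ _ _ (de_shift de) (de_der de)) eU -scalerAl (linfB kl) !(linfZ kl) kM kd.
rewrite (linfB dl) dM di (sgop_in ES GL _ _ hz) (d_del hz de de').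
rewrite (linfZ fl) (linfB fl) -(sA _ (inn z)) mulrBr -scalerAl.
have e1 : (-1) ^+ (true * p + 0) = (-1) ^+ odd p :> R by rewrite signr_odd mul1n addn0.
have e2 : (-1) ^+ (true * p + true) = (-1) ^+ (~~ odd p) :> R by rewrite -signr_odd mul1n addn1.
rewrite e1 e2 -(signr_odd R p.+1) /=.
by case: (odd p); rewrite /= ?expr1 ?expr0; module_with R (E : lmodType R).
Qed.
End convolution_algebra.

Lemma signz_sub (R : realType) (m n : nat) : (-1) ^ (m%:Z - n%:Z) = (-1) ^+ (m + n) :> R.
Proof.
rewrite expfzDr ?oppr_eq0 ?oner_eq0 // -exprnN -exprnP exprD; congr (_ * _).
by rewrite -signr_odd; case: odd; rewrite ?expr1 ?expr0 ?invrN invr1.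
Qed.

Section star_product.
Variables (R : realType) (A : gradedSpace R) (T : lalgType R) (gen : bool -> T).
Variables (brT : T -> T -> T) (val : A -> T) (xi gam : A).
Hypothesis AS : A_spec gen brT val xi gam.
Variables (E : lalgType R) (inn : A -> E) (br : E -> E -> E) (dA : A -> A) (dG kz : E -> E).
Hypotheses (ES : ext_spec inn) (BS : gis_ext_bracket inn br).
Local Notation hom := (@gs_hom R A).
Hypotheses (dAl : linear dA) (dAh : forall k X, hom k X -> hom k.+1 (dA X))
  (dAx : dA xi = gam) (dAg : dA gam = 0)
  (dAb : forall k X Y, hom k X -> dA (gs_br X Y) = gs_br (dA X) Y + (-1) ^+ k *: gs_br X (dA Y)).
Hypotheses (dGP : is_deriv inn true dA dG) (KZ : gis_koszul inn br kz).
Let GL := A_glie AS.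
Let il := ext_lin ES.
Let mb := ext_mul_bilin ES.
Let sA := scaleAr ES.
Let sl := sgop_lin ES GL.
Local Notation sg p := (sgop inn p p).
Local Notation del_spec := (del_spec xi gam inn).
Local Notation starz := (starz inn).
Local Notation Dp := (Dp inn dG kz).

(* rep X Y Z: the image of Z in every realization is the convolution of the
   images of X and Y. *)
Variable rep : E -> E -> E -> Prop.
Hypotheses (rep_linl : forall c X X' Y Z Z', rep X Y Z -> rep X' Y Z' -> rep (c *: X + X') Y (c *: Z + Z'))
  (rep_linr : forall c X Y Y' Z Z', rep X Y Z -> rep X Y' Z' -> rep X (c *: Y + Y') (c *: Z + Z'))
  (rep_fun : forall X Y Z Z', rep X Y Z -> rep X Y Z' -> Z = Z')
  (rep_assoc : forall X Y U Z W V, rep X Y U -> rep Y Z W -> rep U Z V -> rep X W V)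
  (rep_1 : forall X, rep X 1 X)
  (rep_in : forall p z fA f X, hom p z -> del_spec p z fA f -> rep X (inn z) (starz p z f X)).

(** The bound c is 0 for the whole of G and 1 for H, so that one induction also shows that H is
    closed under convolution. *)
Definition good (c : nat) (s : seq (nat * A)) : Prop :=
  forall t, t \in s -> hom t.1 t.2 /\ (c <= t.1)%N.
Definition deg (s : seq (nat * A)) : int := \sum_(t <- s) (t.1%:Z - 1).
Definition wpr (s : seq (nat * A)) : E := \prod_(t <- s) inn t.2.
Definition filt (c : nat) (d : int) (n : nat) : set E :=
  lin_span [set X | exists s, [/\ good c s, deg s = d, (size s < n)%N & X = wpr s]]%classic.

Lemma good_cons c t s : good c (t :: s) -> (hom t.1 t.2 /\ (c <= t.1)%N) /\ good c s.
Proof. by move=> H; split=> [|u us]; apply: H; rewrite inE ?eqxx // us orbT. Qed.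

Lemma good_cat c s t : good c s -> good c t -> good c (s ++ t).
Proof. by move=> H1 H2 u; rewrite mem_cat => /orP[/H1|/H2]. Qed.

Lemma wpr_cons t s : wpr (t :: s) = inn t.2 * wpr s. Proof. by rewrite /wpr big_cons. Qed.
Lemma wpr_cat s t : wpr (s ++ t) = wpr s * wpr t. Proof. by rewrite /wpr big_cat. Qed.
Lemma deg_cons t s : deg (t :: s) = t.1%:Z - 1 + deg s. Proof. by rewrite /deg big_cons. Qed.
Lemma deg_cat s t : deg (s ++ t) = deg s + deg t. Proof. by rewrite /deg big_cat. Qed.

Lemma filt_le c d n m X : (n <= m)%N -> filt c d n X -> filt c d m X.
Proof.
move=> le; apply: lin_span_sub => Y [s [h1 h2 h3 ->]]; apply: lin_span_in; exists s; split=> //.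
exact: leq_trans le.
Qed.

Lemma filt_wpr c s n : good c s -> (size s < n)%N -> filt c (deg s) n (wpr s).
Proof. by move=> g lt; apply: lin_span_in; exists s. Qed.

Lemma filt_in c d n k v X : hom k v -> (c <= k)%N -> filt c d n X ->
  filt c (k%:Z - 1 + d) n.+1 (inn v * X).
Proof.
move=> hv ck; apply: (lin_span_map (f := fun X => inn v * X)); first exact: bilinr mb _.
move=> Y [s [gs <- lt ->]]; apply: lin_span_in; exists ((k, v) :: s); split=> //.
- by move=> t; rewrite inE => /orP[/eqP ->|/gs].
- by rewrite deg_cons.
- by rewrite wpr_cons.
Qed.

(** The derivation changes one factor at a time, from degree k + 1 to k + p, which is at least p and
    hence at least c; factors of degree 0 are killed. *)
Lemma del_filt c p z fA f s : del_spec p z fA f -> (c <= p)%N -> good c s ->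
  filt c (deg s + (p%:Z - 1)) (size s).+1 (f (wpr s)).
Proof.
move=> de cp; have [fl f1 fi fM] := de_der de; elim: s => [|[k v] s IH].
  by move=> _; rewrite /wpr big_nil f1; apply: lin_span0.
move=> /good_cons[[/= hv ck] gs]; rewrite wpr_cons fM fi (sgop_in ES GL _ _ hv) -scalerAl.
apply: lin_spanD; last apply: lin_spanZ.
  case: k hv ck => [|k] hv ck; first by rewrite (de_0 de hv) (linf0 il) mul0r; apply: lin_span0.
  rewrite (_ : _ + _ = (k + p)%N%:Z - 1 + deg s); last by rewrite deg_cons /=; lia.
  apply: filt_in; [exact: de_S de _ _ hv|exact: leq_trans cp (leq_addl _ _)|exact: filt_wpr].
rewrite deg_cons -addrA; apply: filt_in => //; exact: IH.
Qed.

Lemma wpr_gbihom s : (forall t, t \in s -> hom t.1 t.2) ->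
  gbihom inn (\sum_(t <- s) t.1)%N (size s) (wpr s).
Proof. by move=> H; apply: lin_span_in; exists s. Qed.

(* By induction on the number of factors on the right: X * (z Y) is, up to sign,
   (X * z) * Y minus X * W, where W = z * Y -+ z Y has fewer factors than z Y. *)
Lemma star_wpr c n : forall s t, (size t < n)%N -> good c s -> good c t ->
  exists (b : bool) Z, rep (wpr s) (wpr t) Z /\
    filt c (deg s + deg t) (size s + size t) (Z - (-1) ^+ b *: (wpr s * wpr t)).
Proof.
elim: n => // n IH s t lt gs gt.
have IHX d m X t' : (size t' < n)%N -> good c t' -> filt c d m X ->
    exists Z, rep X (wpr t') Z /\ filt c (d + deg t') (m + size t') Z.
  move=> lt' gt'; elim/lin_span_ind => [|k _ X' [u [gu <- lu ->]] [Z' [r' f']]].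
    exists 0; split; last exact: lin_span0.
    (* The relation for a zero factor is obtained by subtracting one of its instances from
       itself. *)
    have [b [Z [r _]]] := IH [::] t' lt' (fun _ => ltac:(by [])) gt'.
    by have := rep_linl (-1) r r; rewrite !scaleN1r !addNr.
  have [b [Z [r f]]] := IH u t' lt' gu gt'; exists (k *: Z + Z'); split; first exact: rep_linl.
  apply: lin_spanP => //; rewrite -[Z](subrK ((-1) ^+ b *: (wpr u * wpr t'))); apply: lin_spanD.
    by apply: filt_le f; rewrite leq_add2r ltnW.
  apply: lin_spanZ; rewrite -wpr_cat -deg_cat; apply: filt_wpr; first exact: good_cat.
  by rewrite size_cat ltn_add2r.
case: t lt gt => [|[p z] t] lt gt.
  exists false, (wpr s); rewrite [wpr [::]]big_nil scale1r mulr1 subrr; split; first exact: rep_1.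
  exact: lin_span0.
have [[/= hz cp] gt'] := good_cons gt; rewrite ltnS in lt.
have g1 : good c [:: (p, z)] by move=> u; rewrite inE => /eqP ->.
have w1 : wpr [:: (p, z)] = inn z by rewrite /wpr big_seq1.
have d1 : deg [:: (p, z)] = p%:Z - 1 by rewrite /deg big_seq1.
have [b1 [Z1 [r1 f1]]] := IH [:: (p, z)] t lt g1 gt'; rewrite w1 d1 in r1 f1.
(* The lower terms of z * Y; they have no more factors than Y, so the induction hypothesis applies
   to X * W. *)
set W := Z1 - _ in f1.
have [fA [f de]] := del_ex AS ES hz; have [fl _ _ _] := de_der de.
have hs : forall u, u \in s -> hom u.1 u.2 by move=> u /gs[].
have hS := wpr_gbihom hs.
pose m := (\sum_(u <- s) u.1)%N.
have [b2 eb2] : exists b2 : bool, inn z * sg (odd p) (wpr s) = (-1) ^+ b2 *: (wpr (s ++ [:: (p, z)])).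
  exists (odd (odd p * m + odd p * size s + (p * m + 1 * size s))).
  rewrite (sgop_bihom ES GL _ _ hS) -sA wpr_cat w1 (gbihom_comm ES (gbihom_in inn hz) hS).
  by rewrite scalerA -exprD signr_odd.
have [b3 [Z3 [r3 f3]]] := IH (s ++ [:: (p, z)]) t lt (good_cat gs g1) gt'.
pose Y2 := - f (sg (odd p.+1) (wpr s)).
have fY2 : filt c (deg s + (p%:Z - 1)) (size s).+1 Y2.
  rewrite /Y2 (sgop_bihom ES GL _ _ hS) (linfZ fl) -scaleN1r; apply/lin_spanZ/lin_spanZ.
  exact: del_filt de cp gs.
have [Z4 [r4 f4]] := IHX _ _ _ t lt gt' fY2.
have [Z5 [r5 f5]] : exists Z5, rep (wpr s) W Z5 /\
    filt c (deg s + (p%:Z - 1 + deg t)) (size s + (size t).+1) Z5.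
  elim/lin_span_ind: W / f1 => [|k _ X' [u [gu <- lu ->]] [Z' [r' f']]].
    exists 0; split; last exact: lin_span0.
    have [b [Z [r _]]] := IH s [::] (leq_ltn_trans (leq0n _) lt) gs (fun _ => ltac:(by [])).
    by have := rep_linr (-1) r r; rewrite !scaleN1r !addNr.
  have [b [Z [r ff]]] := IH s u (leq_trans lu lt) gs gu.
  exists (k *: Z + Z'); split; first exact: rep_linr.
  apply: lin_spanP => //; rewrite -[Z](subrK ((-1) ^+ b *: (wpr s * wpr u))); apply: lin_spanD.
    by apply: filt_le ff; rewrite leq_add2l ltnW // -add1n.
  apply: lin_spanZ; rewrite -wpr_cat -deg_cat; apply: filt_wpr; first exact: good_cat.
  by rewrite size_cat ltn_add2l -add1n.
have rz := rep_in (wpr s) hz de; rewrite /starz eb2 -/Y2 in rz.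
have rV := rep_linl ((-1) ^+ b2) r3 r4.
have r6 := rep_assoc rz r1 rV.
(* Up to the sign [b1], z Y is z * Y minus [W]. The last instance is the zero term that completes
   the linear combination. *)
have r7 := rep_linr ((-1) ^+ b1) (rep_linr (-1) r5 r6) (rep_linr (-1) r6 r6).
exists (b1 (+) b2 (+) b3), ((-1) ^+ b1 *: ((-1) *: Z5 + ((-1) ^+ b2 *: Z3 + Z4))).
split.
  move: r7; rewrite [X in rep _ X]( _ : _ = wpr ((p, z) :: t)); last first.
    rewrite /W wpr_cons /=; case: (b1); rewrite ?expr1 ?expr0; module_with R (E : lmodType R).
  by rewrite !scaleN1r addNr addr0.
rewrite size_cat /= addn1 deg_cat d1 wpr_cat w1 -mulrA -(wpr_cons (p, z) t) in f3.
rewrite deg_cons /= (_ : _ + (_ + deg t) = deg s + (p%:Z - 1) + deg t) in f5 *; last by rewrite addrA.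
rewrite [size _]/= addnS -addSn.
set Q := wpr s * wpr _ in f3 *.
rewrite (_ : _ - _ = (-1) ^+ b1 *: ((-1) ^+ b2 *: (Z3 - (-1) ^+ b3 *: Q) + (Z4 - Z5))); last first.
  by case: (b1) (b2) (b3) => [] [] []; rewrite /= ?expr1 ?expr0; module_with R (E : lmodType R).
apply: lin_spanZ; apply: lin_spanD; first by apply: lin_spanZ; move: f3; rewrite addrA.
apply: lin_spanB => //; by move: f5; rewrite addnS -addSn.
Qed.

Definition spanD (c : nat) (d : int) : set E :=
  lin_span [set X | exists s, [/\ good c s, deg s = d & X = wpr s]]%classic.

Lemma filt_spanD c d n X : filt c d n X -> spanD c d X.
Proof. by apply: lin_span_sub => Y [s [h1 h2 _ ->]]; apply: lin_span_in; exists s. Qed.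

Lemma wpr_span X : lin_span [set Y | exists2 s, good 0 s & Y = wpr s]%classic X.
Proof.
have [q] := ext_filt_ex ES GL X; apply: lin_span_sub => Y [s [hs _ ->]].
by apply: lin_span_in; exists s => // t /hs.
Qed.

Lemma good_nil c : good c [::]. Proof. by []. Qed.

Lemma rep_ex X Y : exists Z, rep X Y Z.
Proof.
have Q t : good 0 t -> exists Z, rep X (wpr t) Z.
  move=> gt; elim/lin_span_ind: X / (wpr_span X) => [|k _ X' [s gs ->] [Z' r']].
    have [b [Z [r _]]] := star_wpr (ltnSn _) (good_nil 0) gt.
    by exists 0; have := rep_linl (-1) r r; rewrite !scaleN1r !addNr.
  have [b [Z [r _]]] := star_wpr (ltnSn _) gs gt; exists (k *: Z + Z'); exact: rep_linl.
elim/lin_span_ind: Y / (wpr_span Y) => [|k _ Y' [t /Q[Z r] ->] [Z' r']].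
  by exists 0; have := rep_linr (-1) (rep_1 X) (rep_1 X); rewrite !scaleN1r !addNr.
by exists (k *: Z + Z'); exact: rep_linr.
Qed.

Variable star : E -> E -> E.
Hypothesis starP : forall X Y, rep X Y (star X Y).

Lemma star_bilin : bilin star.
Proof.
by split=> [X c Y Y'|Y c X X']; apply: rep_fun (starP _ _) _; [exact: rep_linr|exact: rep_linl].
Qed.

Lemma star_assoc X Y Z : star X (star Y Z) = star (star X Y) Z.
Proof.
by apply: rep_fun (starP _ _) _; apply: rep_assoc (starP X Y) (starP Y Z) (starP _ _).
Qed.

Lemma star_1 X : star X 1 = X. Proof. exact: rep_fun (starP _ _) (rep_1 X). Qed.

Lemma star_in p z fA f X : hom p z -> del_spec p z fA f -> star X (inn z) = starz p z f X.
Proof. by move=> hz de; apply: rep_fun (starP _ _) (rep_in X hz de). Qed.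

Lemma star_wprE c s t : good c s -> good c t -> exists b : bool,
  filt c (deg s + deg t) (size s + size t) (star (wpr s) (wpr t) - (-1) ^+ b *: (wpr s * wpr t)).
Proof.
move=> gs gt; have [b [Z [r h]]] := star_wpr (ltnSn _) gs gt; exists b.
by rewrite (rep_fun (starP _ _) r).
Qed.

(** A generates G under convolution: z * Y has leading term z Y up to sign, and the difference has
    fewer factors than z Y. *)
Lemma star_gen (S : E -> Prop) : (forall c X Y, S X -> S Y -> S (c *: X + Y)) -> S 1 ->
  (forall p z, hom p z -> S (inn z)) -> (forall X Y, S X -> S Y -> S (star X Y)) -> forall X, S X.
Proof.
move=> SL S1 Sin SM; have S0 : S 0 by rewrite -[0](addNr 1) -scaleN1r; exact: SL.
have H n t : (size t < n)%N -> good 0 t -> S (wpr t).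
  elim: n t => // n IH [|[p z] t] lt gt; first by rewrite /wpr big_nil.
  have [[/= hz _] gt'] := good_cons gt; rewrite ltnS in lt.
  have g1 : good 0 [:: (p, z)] by move=> u; rewrite inE => /eqP ->.
  have [b fb] := star_wprE g1 gt'; rewrite /wpr big_seq1 -/(wpr t) in fb.
  have SW X d : filt 0 d (1 + size t) X -> S X.
    rewrite /filt => fX; elim/lin_span_ind: X / fX => [|k _ X' [u [gu _ lu ->]] SX'] //; apply: SL => //.
    by apply: IH => //; exact: leq_trans lu lt.
  rewrite wpr_cons /=; set W := _ - _ in fb.
  rewrite (_ : inn z * _ = (-1) ^+ b *: star (inn z) (wpr t) + ((- (-1) ^+ b) *: W + 0)).
    apply: (SL); [apply: SM|apply: (SL)] => //; [exact: Sin hz|exact: IH|exact: SW fb].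
  by rewrite /W; case: (b); rewrite ?expr1 ?expr0; module_with R (E : lmodType R).
move=> X; elim/lin_span_ind: X / (wpr_span X) => // k _ X' [s gs ->] SX'.
by apply: SL => //; exact: H (ltnSn _) gs.
Qed.

Lemma star_spanD c d d' X Y : spanD c d X -> spanD c d' Y -> spanD c (d + d') (star X Y).
Proof.
apply: (bilin_span star_bilin) => _ _ [s [gs <- ->]] [t [gt <- ->]].
have [b fb] := star_wprE gs gt; rewrite -[star _ _](subrK ((-1) ^+ b *: (wpr s * wpr t))).
apply: lin_spanD; first exact: filt_spanD fb.
apply/lin_spanZ/lin_span_in; exists (s ++ t); rewrite wpr_cat deg_cat; split=> //; exact: good_cat.
Qed.

Definition gDeg (d : int) : set E :=
  lin_span [set X | exists p q, p%:Z - q%:Z = d /\ gbihom inn p q X]%classic.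

Lemma deg_sum s : deg s = (\sum_(t <- s) t.1)%N%:Z - (size s)%:Z.
Proof.
elim: s => [|t s IH]; first by rewrite /deg !big_nil.
by rewrite deg_cons IH big_cons /=; lia.
Qed.

Lemma gDeg_spanD d X : gDeg d X <-> spanD 0 d X.
Proof.
split; apply: lin_span_sub => Y.
  move=> [p [q [<- hY]]]; apply: lin_span_sub hY => _ [s [hs <- <- ->]].
  apply: lin_span_in; exists s; split=> //; first by move=> t /hs.
  exact: deg_sum.
move=> [s [gs <- ->]]; apply: lin_span_in; exists (\sum_(t <- s) t.1)%N, (size s).
by rewrite deg_sum; split=> //; apply: wpr_gbihom => t /gs[].
Qed.

Lemma sg_gDeg d X : gDeg d X -> sg true X = (-1) ^ d *: X.
Proof.
rewrite /gDeg => gX; elim/lin_span_ind: X / gX => [|k X0 X' [p [q [ed hX]]] IH]; first by rewrite (linf0 (sl _ _)) scaler0.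
rewrite sl IH scalerDr (sgop_bihom ES GL _ _ hX) !mul1n !scalerA [_ * k]mulrC; congr (_ *: _ + _).
by rewrite -ed signz_sub.
Qed.

Lemma star_gDeg a b X Y : gDeg a X -> gDeg b Y -> gDeg (a + b) (star X Y).
Proof. by move=> /gDeg_spanD hX /gDeg_spanD hY; apply/gDeg_spanD; exact: star_spanD. Qed.

Lemma gDeg_span X : lin_span [set Y | exists d, gDeg d Y]%classic X.
Proof.
apply: lin_span_sub (wpr_span X) => _ [s gs ->]; apply: lin_span_in; exists (deg s).
by apply/gDeg_spanD; apply: lin_span_in; exists s.
Qed.

Lemma sg_star X Y : sg true (star X Y) = star (sg true X) (sg true Y).
Proof.
have sb := star_bilin.
elim/lin_span_ind: X / (gDeg_span X) => [|c X X' [a hX] IH].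
  by rewrite (bilin0l sb) !(linf0 (sl _ _)) (bilin0l sb).
rewrite (bilinl sb) !sl (bilinl sb) IH; congr (_ *: _ + _) => {X' IH}.
elim/lin_span_ind: Y / (gDeg_span Y) => [|k Y Y' [b hY] IH].
  by rewrite (bilin0r sb) !(linf0 (sl _ _)) (bilin0r sb).
rewrite (bilinr sb) !sl (bilinr sb) IH; congr (_ *: _ + _).
rewrite (sg_gDeg (star_gDeg hX hY)) (sg_gDeg hX) (sg_gDeg hY) (bilinZl sb) (bilinZr sb) scalerA.
by rewrite expfzDr // oppr_eq0 oner_eq0.
Qed.

Lemma star_leibniz X Y : Dp (star X Y) = star (Dp X) Y + star (sg true X) (Dp Y).
Proof.
have [dl d1 di dM] := dGP; have [kl k1 ki kM] := KZ; have sb := star_bilin.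
have Dl : linear Dp.
  by move=> c U W; rewrite /Dp dl sl kl; module_with R (E : lmodType R).
move: Y X; apply: star_gen.
- move=> c Y Y' H H' X; rewrite (bilinr sb) !Dl H H' !(bilinr sb); by module_with R (E : lmodType R).
- by move=> X; rewrite !star_1 /Dp (sgop1 ES GL) d1 k1 subr0 (bilin0r sb) addr0.
- move=> p z hz X; have [fA [f de]] := del_ex AS ES hz; have [fA' [f' de']] := del_ex AS ES (dAh hz).
  have -> : Dp (inn z) = inn (dA z).
    by rewrite /Dp di (sgop_in ES GL _ _ hz) (linfZ kl) ki scaler0 subr0.
  rewrite !(star_in _ hz de) (star_in _ (dAh hz) de').
  exact: (Dp_starz AS ES BS dAl dAh dAx dAg dAb dGP KZ X hz de de').
(* The right factors that obey the rule against every X are closed under convolution: X * (Y * Z) is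
   regrouped as (X * Y) * Z. *)
move=> Y Z HY HZ X.
have e1 : Dp (star X (star Y Z)) = star (Dp (star X Y)) Z + star (sg true (star X Y)) (Dp Z).
  by rewrite star_assoc HZ.
rewrite e1 (HY X) (HZ Y) sg_star (bilinDl sb) [star (sg true X) (_ + _)](bilinDr sb).
by rewrite -!star_assoc -addrA.
Qed.

Definition gpos : set A := lin_span [set v | exists2 j, (0 < j)%N & hom j v]%classic.
Definition gH : set E :=
  lin_span [set X | exists s : seq A, (forall v, v \in s -> gpos v) /\ X = \prod_(v <- s) inn v]%classic.

Lemma gH_wpr X : gH X <-> lin_span [set Y | exists2 s, good 1 s & Y = wpr s]%classic X.
Proof.
split; apply: lin_span_sub => Y.
  move=> [s [hs ->]]; elim: s hs => [|v s IH] hs.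
    by apply: lin_span_in; exists [::]; rewrite // /wpr !big_nil.
  rewrite big_cons; have hv : gpos v by apply: hs; rewrite mem_head.
  have {}IH := IH (fun u us => hs u (mem_behead (s := v :: s) us)).
  rewrite /gpos in hv; elim/lin_span_ind: v / hv {hs} => [|c v v' [j j0 hv] IHv]; first by rewrite (linf0 il) mul0r; exact: lin_span0.
  rewrite il mulrDl -scalerAl; apply: lin_spanD IHv; apply: lin_spanZ.
  apply: (lin_span_map (f := fun X => inn v * X)) IH; first exact: bilinr mb _.
  move=> _ [t gt ->]; apply: lin_span_in; exists ((j, v) :: t); last by rewrite wpr_cons.
  by move=> u; rewrite inE => /orP[/eqP -> //|/gt].
move=> [s gs ->]; apply: lin_span_in; exists [seq t.2 | t <- s]; rewrite /wpr big_map; split=> // v.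
by move=> /mapP[t /gs[h1 h2] ->]; apply: lin_span_in; exists t.1.
Qed.

Lemma star_gH X Y : gH X -> gH Y -> gH (star X Y).
Proof.
move=> /gH_wpr hX /gH_wpr hY; apply/gH_wpr; move: hX hY.
apply: (bilin_span star_bilin) => _ _ [s gs ->] [t gt ->].
have : spanD 1 (deg s + deg t) (star (wpr s) (wpr t)).
  by apply: star_spanD; apply: lin_span_in; [exists s|exists t].
by apply: lin_span_sub => _ [u [gu _ ->]]; apply: lin_span_in; exists u.
Qed.
End star_product.

(** The separating linear forms are iterated contractions by forms on g followed by the counit. *)
Lemma ext_separated (R : realType) (g : lieAlgebra R) (E : lalgType R) (inn : deg0 g -> E) :
  ext_spec inn -> separated E.
Proof.
move=> ES w H; have GL := deg0_glie g.
pose Phi (p : nat) : set (deg0 g -> R^o) := fun phi => p = 0%N /\ linear phi.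
have PhiH p phi : Phi p phi -> homog_form p phi.
  by move=> [-> pl]; split=> // k v [->|->] // _; exact: linf0 pl.
apply: (ext_sep ES GL PhiH) => [s _|l hl].
  exists [seq ((0%N, (vbasis {:g})`_i : deg0 g), (fun v : deg0 g => coord (vbasis {:g}) i v : R^o)) | i : 'I_(\dim {:g}) <- enum 'I_(\dim {:g})].
  split=> [i /mapP[j _ ->] /=|u _]; last first.
    by rewrite big_map big_enum /= [LHS](coord_vbasis (memvf (u.2 : g))).
  by split; [left|apply: lin_span_in; split=> // a x y; rewrite linearP].
have fL : linear (fun X => foldr (fun i => gctr inn i.1 i.2) X l).
  elim: l hl => [|i l IH] //= [hi /IH{}IH] c x y.
  by have [gl _ _] := gctrP ES GL (PhiH _ _ hi); rewrite IH gl.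
have fl : linear (fun X => counit inn (foldr (fun i => gctr inn i.1 i.2) X l) : R^o).
  by have [cl _ _] := counitP ES GL => c x y; rewrite fL cl.
exact: (H (mk_linear fl)).
Qed.

Section differentials.
Variables (R : realType) (V : gradedSpace R) (E : lalgType R) (inn : V -> E).
Hypotheses (ES : ext_spec inn) (GL : glie V).

Definition gis_diff (dA : V -> V) (f : E -> E) : Prop :=
  [/\ linear f, forall v, f (inn v) = inn (dA v) &
      forall p q X Y, gbihom inn p q X -> f (X * Y) = f X * Y + (-1) ^+ p *: (X * f Y)].

Lemma gis_diffP dA f : gis_diff dA f <-> is_deriv inn true dA f.
Proof.
split=> [[fl fi fM]|[fl f1 fi fM]].
  split=> // [|X Y].
    have := fM _ _ 1 1 (gbihom1 inn); rewrite mulr1 mul1r expr0 scale1r mulr1 => /eqP.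
    by rewrite -subr_eq0 opprD addrA subrr add0r oppr_eq0 => /eqP.
  move: X; apply: (bihom_lin_ext ES GL).
  - by move=> c X X'; rewrite (bilinl (ext_mul_bilin ES)) fl.
  - move=> c X X'; rewrite fl (sgop_lin ES GL) !(bilinl (ext_mul_bilin ES)).
    by module_with R (E : lmodType R).
  move=> p q X hX; rewrite (fM _ _ _ _ hX) (sgop_bihom ES GL _ _ hX) mul1n addn0 -scalerAl //.
split=> // p q X Y hX; rewrite fM (sgop_bihom ES GL _ _ hX) mul1n addn0 -scalerAl //.
Qed.

Definition gis_D (dG kz f : E -> E) : Prop :=
  linear f /\ forall k X, gDeg inn k X -> f X = dG X + (-1) ^ (k + 1) *: kz X.
End differentials.

(** * The convolution relation tested on a family of points *)

Section family_of_points.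
Variables (R : realType) (A : gradedSpace R) (T : lalgType R) (gen : bool -> T).
Variables (brT : T -> T -> T) (val : A -> T) (xi gam : A).
Hypothesis AS : A_spec gen brT val xi gam.
Variables (E : lalgType R) (inn : A -> E) (br : E -> E -> E).
Hypotheses (ES : ext_spec inn) (BS : gis_ext_bracket inn br).
Let GL := A_glie AS.

Lemma gis_DP dG kz : linear dG -> linear kz -> gis_D inn dG kz (Dp inn dG kz).
Proof.
move=> dl kl; split=> [c X Y|k X hX].
  by rewrite /Dp dl (sgop_lin ES GL) kl; module_with R (E : lmodType R).
rewrite /Dp (sg_gDeg AS ES hX) (linfZ kl) expfzDr ?oppr_eq0 ?oner_eq0 // expr1z.
by module_with R (E : lmodType R).
Qed.

Lemma gis_D_uniq dG kz f f' : gis_D inn dG kz f -> gis_D inn dG kz f' -> f =1 f'.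
Proof.
move=> [fl fD] [fl' fD'] X; elim/lin_span_ind: X / (gDeg_span AS ES X) => [|c Y Y' [d hY] IH].
  by rewrite !linf0.
by rewrite fl fl' IH (fD _ _ hY) (fD' _ _ hY).
Qed.

(* A point of a Lie algebra, with a basis for the convolution and the values at
   that point of a realization. *)
Record gpoint : Type := GPoint {
  gp_g : lieAlgebra R;
  gp_E : lalgType R;
  gp_inn : deg0 gp_g -> gp_E;
  gp_br : gp_E -> gp_E -> gp_E;
  gp_e : (\dim {:gp_g}).-tuple gp_g;
  gp_J : 'I_(\dim {:gp_g}) -> gp_E -> gp_E;
  gp_x : gp_g;
  gp_r : E -> seq gp_g -> gp_E;
  gp_ES : ext_spec gp_inn;
  gp_BS : gis_ext_bracket gp_inn gp_br;
  gp_eb : basis_of {:gp_g} gp_e;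
  gp_JC : forall i, [/\ linear (gp_J i), gp_J i 1 = 0 &
      forall v X, gp_J i (gp_inn v * X) = coord gp_e i v *: X - gp_inn v * gp_J i X];
  gp_rp : rpoint xi gam inn br gp_inn gp_br gp_x gp_r;
  gp_alt : forall X, aalt (gp_r X) }.

Definition gp_cv (P : gpoint) := fcv (@gp_inn P) (@gp_J P) (fun i => lie_br (gp_e P)`_i (gp_x P)).

Variables (I : Type) (pt : I -> gpoint).
Definition prep (X Y Z : E) : Prop :=
  forall i, @gp_r (pt i) Z = @gp_cv (pt i) (@gp_r (pt i) X) (@gp_r (pt i) Y).

Let cvb i : bilin (@gp_cv (pt i)).
Proof. exact: (fcv_bilin (gp_ES (pt i)) (@gp_JC (pt i))). Qed.

Lemma prep_linl c X X' Y Z Z' : prep X Y Z -> prep X' Y Z' -> prep (c *: X + X') Y (c *: Z + Z').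
Proof. by move=> H H' i; rewrite !(rp_lin (gp_rp (pt i))) (bilinl (cvb i)) -H -H'. Qed.

Lemma prep_linr c X Y Y' Z Z' : prep X Y Z -> prep X Y' Z' -> prep X (c *: Y + Y') (c *: Z + Z').
Proof. by move=> H H' i; rewrite !(rp_lin (gp_rp (pt i))) (bilinr (cvb i)) -H -H'. Qed.

Hypothesis inj : forall Z, (forall i, @gp_r (pt i) Z = 0) -> Z = 0.

Lemma prep_fun X Y Z Z' : prep X Y Z -> prep X Y Z' -> Z = Z'.
Proof.
move=> H H'; apply/eqP; rewrite -subr_eq0; apply/eqP/inj => i.
by rewrite (linfB (rp_lin (gp_rp (pt i)))) H H' subrr.
Qed.

Lemma prep_assoc X Y U Z W V : prep X Y U -> prep Y Z W -> prep U Z V -> prep X W V.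
Proof.
move=> H1 H2 H3 i; rewrite H3 H1 H2 /gp_cv.
by apply: (fcvA (gp_ES (pt i)) (@gp_JC (pt i))); apply: gp_alt.
Qed.

(** Contractions kill the constant 1, so only the empty index set contributes. *)
Lemma prep_1 X : prep X 1 X.
Proof.
move=> i; have rp := gp_rp (pt i); have JC := @gp_JC (pt i); have ES' := gp_ES (pt i).
rewrite (rp_1 rp); move: X; apply: (bihom_lin_ext ES GL).
- exact: rp_lin rp.
- by move=> c X Y; rewrite (rp_lin rp) (bilinl (cvb i)).
move=> k l X hX; have [_ lX] := rp_deg rp hX.
have l1 : fhasL (@gp_inn (pt i)) 0 (cst 1).
  by move=> [|u s]; rewrite /hasL /= scale1r ?(s21 ES') // /s2 (linf0 (sgop_lin ES' (deg0_glie _) _ _)).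
rewrite /gp_cv (fcv_sum ES' JC _ (rp_fpar rp hX) lX (fpar_cst _) l1).
rewrite (bigD1 finset.set0) //= big1 ?addr0; last first.
  move=> K; rewrite -cards_eq0 cardE; case/lastP: (enum K) => // s j _.
  have J0 : Jop (@gp_J (pt i)) j (cst 1) = 0.
    by apply: funext => -[|u t]; rewrite /Jop /= ?(con1 JC) // (linf0 (con_lin JC _)).
  have F0 : foldr (Jop (@gp_J (pt i))) 0 s = 0.
    by elim: s => //= j' s ->; apply: funext => t; rewrite /Jop (linf0 (con_lin JC _)).
  by rewrite [X in sh _ _ X](_ : _ = 0) ?(bilin0r (sh_bilin _ (ext_mul_bilin ES'))) ?scaler0 // foldr_rcons -[RHS]F0 -J0.
rewrite finset.enum_set0 cards0 /= addn0 scale1r; apply: funext => s.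
by rewrite (sh_cstr (ext_mul_bilin ES')) mulr1.
Qed.

Lemma prep_in p z fA f X : gs_hom p z -> del_spec xi gam inn p z fA f ->
  prep X (inn z) (starz inn p z f X).
Proof.
move=> hz de i; have rp := gp_rp (pt i).
have [zeta0 ez0] := rp_in AS ES BS (gp_ES (pt i)) (gp_BS (pt i)) rp z.
(* [rp_in] gives no degree condition on the form it provides; cutting it off outside degree [p]
   gives it a parity without changing its image. *)
pose zeta (s : seq (gp_g (pt i))) : gp_g (pt i) := if size s == p then zeta0 s else 0.
have ez : @gp_r (pt i) (inn z) = fun s => @gp_inn (pt i) (zeta s).
  apply: funext => s; rewrite /zeta; have [hs _] := rp_deg rp (gbihom_in inn hz).
  case: eqP => [_|/eqP ne]; first by rewrite ez0.
  by rewrite (hs _ ne) (linf0 (ext_lin (gp_ES (pt i)))).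
have zp : fpar p zeta by apply: fpar_size => s ne; rewrite /zeta (negbTE ne).
symmetry; exact: (fcv_in AS ES BS (gp_ES (pt i)) (gp_BS (pt i)) rp (gp_eb (pt i)) (@gp_JC (pt i)) hz ez zp (de_lin de)
  (de_xi de) (de_gam de) (de_br de) (de_der de) X).
Qed.
End family_of_points.

Section convolution_at_points.
Variables (R : realType) (A : gradedSpace R) (T : lalgType R) (gen : bool -> T).
Variables (brT : T -> T -> T) (val : A -> T) (xi gam : A).
Hypothesis AS : A_spec gen brT val xi gam.
Variables (E : lalgType R) (inn : A -> E) (br : E -> E -> E) (dG : E -> E).
Hypotheses (ES : ext_spec inn) (BS : gis_ext_bracket inn br) (dG_xi : dG (inn xi) = inn gam).
Variables (g : lieAlgebra R) (E' : lalgType R) (inn' : deg0 g -> E') (br' : E' -> E' -> E').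
Hypotheses (ES' : ext_spec inn') (BS' : gis_ext_bracket inn' br').
Local Notation n := (\dim {:g}).
Variables (e : n.-tuple g) (J : 'I_n -> E' -> E') (wp : nat -> E' -> E').
Hypotheses (eb : basis_of {:g} e)
  (JC : forall i, [/\ linear (J i), J i 1 = 0 &
      forall v X, J i (inn' v * X) = coord e i v *: X - inn' v * J i X])
  (WP : forall l, gis_wedge_proj inn' l (wp l)).
Variable rho : E -> forall k : nat, g -> ('I_k -> g) -> (E' * E')%type.
Hypotheses (gr : grealize xi inn br dG inn' br' rho) (alt : forall X, altform (rho X)).

Definition point_of (x : g) : gpoint xi gam inn br :=
  @GPoint R A xi gam E inn br g E' inn' br' e J x (fun X => ev (rho X) x) ES' BS' eb JC
    (gr_point AS ES BS dG_xi ES' BS' (ext_separated ES') gr alt x)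
    (fun X => altform_aalt x (alt X)).

Lemma pf_conv_points X Y Z :
  rho Z = pf_conv J wp (fun i x => lie_br e`_i x) (rho X) (rho Y) <->
  forall x, @gp_r _ _ _ _ _ _ _ (point_of x) Z = @gp_cv _ _ _ _ _ _ _ (point_of x) (@gp_r _ _ _ _ _ _ _ (point_of x) X) (@gp_r _ _ _ _ _ _ _ (point_of x) Y).
Proof.
have rr := gr_real AS ES BS dG_xi ES' BS' (ext_separated ES') gr alt.
rewrite (pf_convE ES' JC WP _ (alt X) (alt Y) (rr X) (rr Y)); split=> [eZ x|H].
  change (ev (rho Z) x = fcv inn' J (fun i => lie_br e`_i x) (ev (rho X) x) (ev (rho Y) x)).
  by rewrite eZ; apply: funext => s; rewrite /ev /evseq /pt /=; congr (fcv _ _ _ _ _ _); exact: seq_ofP.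
apply: functional_extensionality_dep => k; apply: funext => x; apply: funext => v.
by rewrite (pf_real _ _ (rr Z)); congr (_, _); have := congr1 (fun f => f (seq_of v)) (H x).
Qed.
End convolution_at_points.

(** * The concrete algebras and realizations meet the specifications *)

Section concrete_operations.
Variables (R : realType) (V : gradedSpace R).
Hypothesis GL : glie V.
Local Notation ES := (ext_alg_spec V).

Lemma ext_bracketP : gis_ext_bracket (@ext_in R V) (@ext_bracket R V).
Proof.
suff H : is_ext_bracket (@ext_bracket R V) by exact: H.
by apply: xgetPex; exact: (bracket_ex ES GL).
Qed.

Lemma wedge_projP l : gis_wedge_proj (@ext_in R V) l (@wedge_proj R V l).
Proof.
suff H : is_wedge_proj l (@wedge_proj R V l) by exact: H.
by apply: xgetPex; have [f fP] := wedge_proj_ex ES l; exists f; exact: fP.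
Qed.
End concrete_operations.

Lemma lie_contractionP (R : realType) (g : lieAlgebra R) (phi : g -> R) : linear (phi : g -> R^o) ->
  Defs.is_contraction (V := deg0 g) phi (@Defs.contraction R (deg0 g) phi).
Proof.
move=> pl; apply: xgetPex.
have [k v [->|->] // _|f [fl f1 fM]] := gcontr_ex (ext_alg_spec (deg0 g)) (deg0_glie g) (p := 0%N) pl.
  exact: linf0 pl.
exists f; split=> // v X; have h0 : gs_hom 0 (v : deg0 g) by left.
by rewrite (fM _ _ _ h0) mul0n scale1r.
Qed.

Section concrete.
Variable R : realType.
Local Notation inn := (@ext_in R (algA R)).
Let AS := algA_spec R.
Let ES : ext_spec inn := ext_alg_spec (algA R).
Let GL := A_glie AS.
Let BS := ext_bracketP GL.

Lemma A_diffP : is_A_diff (@A_diff R).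
Proof. by apply: xgetPex; exact: (A_diff_ex AS). Qed.

Lemma G_diffP : is_deriv inn true (@A_diff R) (@G_diff R).
Proof.
have [dl dh dx dg db] := A_diffP.
apply/(gis_diffP ES GL).
suff H : is_G_diff (@G_diff R) by exact: H.
apply: xgetPex.
have ds : degree_shift true (@A_diff R) by split=> // k v /dh hv; exists k.+1; rewrite //= addbT.
have [D DP] := der_ex ES GL (degree_parity_shift ES ds).
by exists D; exact: (proj2 (gis_diffP ES GL _ _) DP).
Qed.

Lemma koszulP : gis_koszul inn (@ext_bracket R (algA R)) (@koszul R).
Proof.
suff H : is_koszul (@koszul R) by exact: H.
by apply: xgetPex; exact: (koszul_ex ES GL BS).
Qed.

Lemma DopE X : Dop X = Dp inn (@G_diff R) (@koszul R) X.
Proof.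
have [dl _ _ _] := G_diffP; have [kl _ _ _] := koszulP.
have DP := gis_DP AS ES dl kl.
apply: (gis_D_uniq AS ES _ DP).
suff H : is_D (@Dop R) by exact: H.
by apply: xgetPex; exists (Dp inn (@G_diff R) (@koszul R)); exact: DP.
Qed.

Let dG_xi : G_diff (inn (xi R)) = inn (gam R).
Proof. by have [_ _ di _] := G_diffP; have [_ _ dx _ _] := A_diffP; rewrite di dx. Qed.

Section lie_algebra.
Variable g : lieAlgebra R.
Local Notation inn' := (@ext_in R (deg0 g)).
Local Notation n := (\dim {:g}).
Let ES' : ext_spec inn' := ext_alg_spec (deg0 g).
Let BS' := ext_bracketP (deg0_glie g).

Lemma realizationP (rho : algG R -> Defs.form g) : is_realization rho <->
  grealize (xi R) inn (@ext_bracket R (algA R)) (@G_diff R) inn' (@ext_bracket R (deg0 g))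
    (fun X => form_val (rho X)).
Proof.
split=> [[h1 [h2 [h3 [h4 [h5 [h6 h7]]]]]]|[h1 h2 h3 h4 h5 h6 h7]].
  by split; [exact: h1|exact: h2|exact: h3|exact: h4|exact: h5|exact: h6|exact: h7].
by split; [exact: h1|split; [exact: h2|split; [exact: h3|split; [exact: h4|split; [exact: h5|split; [exact: h6|exact: h7]]]]]].
Qed.

Lemma form_alt (w : Defs.form g) : altform (form_val w).
Proof. by have [h1 h2 _] := form_valP w; split; [exact: h1|exact: h2]. Qed.

Lemma contraction_coord (e : n.-tuple g) i : [/\ linear (@Defs.contraction R (deg0 g) (coord e i)),
   @Defs.contraction R (deg0 g) (coord e i) 1 = 0 &
   forall v X, @Defs.contraction R (deg0 g) (coord e i) (inn' v * X) =
     coord e i v *: X - inn' v * @Defs.contraction R (deg0 g) (coord e i) X].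
Proof. by apply: lie_contractionP => a x y; rewrite linearP. Qed.

Definition point_at (e : n.-tuple g) (eb : basis_of {:g} e) (rho : algG R -> Defs.form g)
    (rr : is_realization rho) (x : g) :=
  point_of AS ES BS dG_xi ES' BS' eb (contraction_coord e) (proj1 (realizationP rho) rr)
    (fun X => form_alt (rho X)) x.

Lemma form_conv_points (e : n.-tuple g) (eb : basis_of {:g} e) (rho : algG R -> Defs.form g)
    (rr : is_realization rho) X Y Z :
  rho Z = form_conv e (rho X) (rho Y) :> preform g <->
  forall x, @gp_r _ _ _ _ _ _ _ (point_at eb rr x) Z =
    @gp_cv _ _ _ _ _ _ _ (point_at eb rr x) (@gp_r _ _ _ _ _ _ _ (point_at eb rr x) X)
      (@gp_r _ _ _ _ _ _ _ (point_at eb rr x) Y).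
Proof.
have H := pf_conv_points AS ES BS dG_xi ES' BS' eb (contraction_coord e)
  (wedge_projP (deg0 g)) (proj1 (realizationP rho) rr) (fun X => form_alt (rho X)) X Y Z.
(* The abstract convolution mirrors the concrete one, so the two agree by unfolding. *)
have E : form_conv e (rho X) (rho Y) = pf_conv (fun i => @Defs.contraction R (deg0 g) (coord e i))
    (fun l => @wedge_proj R (deg0 g) l) (fun i x => lie_br e`_i x) (form_val (rho X)) (form_val (rho Y)) :> preform g.
  by [].
split=> [h|h]; first by apply: (proj1 H); rewrite -[RHS]E.
by rewrite E; apply: (proj2 H).
Qed.
End lie_algebra.

(** Indexing by every point of every realization of every Lie algebra makes one relation express the
    whole of [is_convolution]. *)
Record index : Type := Index {
  ix_g : lieAlgebra R;
  ix_e : (\dim {:ix_g}).-tuple ix_g;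
  ix_eb : basis_of {:ix_g} ix_e;
  ix_rho : algG R -> Defs.form ix_g;
  ix_real : is_realization ix_rho;
  ix_x : ix_g }.

Definition ix_pt (i : index) := point_at (ix_eb i) (ix_real i) (ix_x i).

Lemma matrix_realization K : exists (th : mxlie R K -> freeT R -> seq (mxlie R K) -> mxlie R K) r
    (rho : algG R -> Defs.form (mxlie R K)),
  [/\ forall x, theta_spec (@T_letter R) (@mxlie_mul R K) (1%:M : 'M[R]_K.+1) x (th x),
      forall x, real_spec (@A_val R : algA R -> _) inn (@ext_in R (deg0 (mxlie R K))) (th x) (r x),
      is_realization rho & forall X x, ev (form_val (rho X)) x = r x X].
Proof.
pose g := mxlie R K; have ES' : ext_spec (@ext_in R (deg0 g)) := ext_alg_spec (deg0 g).
have BS' := ext_bracketP (deg0_glie g); have mb := mxlie_bilin R K.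
have mA : associative (@mxlie_mul R K) := @mulmxA R _ _ _ _.
have m1 : left_id (1%:M : 'M[R]_K.+1) (@mxlie_mul R K) := @mul1mx R _ _.
have mr1 : right_id (1%:M : 'M[R]_K.+1) (@mxlie_mul R K) := @mulmx1 R _ _.
have lieE (a b : g) : lie_br a b = mxlie_mul a b - mxlie_mul b a by [].
have [th TH] := boolp.choice (theta_ex AS mb mA m1).
have [r RS] := boolp.choice (fun x => real_ex AS ES ES' mb (TH x)).
have [dl dh dx dg db] := A_diffP; have sep := ext_separated ES'.
have isf X : is_form (real_form r X : preform g).
  have [h1 h2] := real_form_alt AS ES ES' mb TH RS X.
  split; [exact: h1|exact: h2|move=> k v phi m].
  have [f' pf] := real_form_poly AS ES BS dx dg db G_diffP ES' BS' mb mr1 lieE TH RS X v.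
  exact: (poly_Ck m (poly_map (linearP phi) pf)).
exists th, r, (fun X => Defs.Form (isf X)); split=> //; last by move=> X x; exact: (real_form_ev r X).2.
apply/realizationP.
exact: (real_form_realize AS ES BS dx dg db G_diffP ES' BS' sep mb mr1 lieE TH RS).
Qed.

(** The matrix Lie algebras are among the indices and already separate the elements of G. *)
Lemma points_inj Z : (forall i, @gp_r _ _ _ _ _ _ _ (ix_pt i) Z = 0) -> Z = 0.
Proof.
move=> H.
have cfe (w : seq bool) : exists f : freeT R -> R^o, linear f /\
    forall s : seq bool, f (gword (@T_letter R) s) = (if s == w then 1 else 0).
  exact: (free_ext (AS_free AS) (M := R^o) (fun s : seq bool => if s == w then 1 else 0)).
have [cf cfP] := boolp.choice cfe.
apply: (faithful AS ES (cf := cf) (fun w => (cfP w).1) (fun w => (cfP w).2)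
  (inn' := fun K => @ext_in R (deg0 (mxlie R K)))) => [K|K x]; first exact: ext_alg_spec.
have [th [r [rho [TH RS rr re]]]] := matrix_realization K.
exists (th x), (r x); split=> // s; rewrite -re.
by have := H (Index (vbasisP {:mxlie R K}) rr x) => /(congr1 (fun f => f s)).
Qed.

Definition repG : algG R -> algG R -> algG R -> Prop := prep ix_pt.

Lemma convolution_rep star : is_convolution star <-> bilin star /\ forall X Y, repG X Y (star X Y).
Proof.
split=> [[sb H]|[sb H]]; split=> //.
  by move=> X Y [g e eb rho rr x]; exact: (proj1 (form_conv_points eb rr X Y _) (H g e rho eb rr X Y) x).
move=> g e rho eb rr X Y; apply/(form_conv_points eb rr X Y) => x.
exact: (H X Y (Index eb rr x)).
Qed.

End concrete.

Theorem theorem2 (R : realType) :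
  exists star : algG R -> algG R -> algG R,
    is_convolution star /\
    (forall star' : algG R -> algG R -> algG R,
        is_convolution star' -> forall X Y, star' X Y = star X Y) /\
    (forall X Y Z, star X (star Y Z) = star (star X Y) Z) /\
    (forall (a b : int) X Y, Deg_hom a X -> Deg_hom b Y ->
        Deg_hom (a + b) (star X Y)) /\
    (forall (a : int) X Y, Deg_hom a X ->
        Dop (star X Y) = star (Dop X) Y + (-1) ^ a *: star X (Dop Y)) /\
    (is_submodule (@DTC R) /\
     forall X Y, DTC X -> DTC Y -> DTC (star X Y)).
Proof.
have AS := algA_spec R; have GL := A_glie AS.
have ES : ext_spec (@ext_in R (algA R)) := ext_alg_spec (algA R); have BS := ext_bracketP GL.
have [dl dh dx dg db] := A_diffP R; have dG := G_diffP R; have KZ := koszulP R.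
have L1 := @prep_linl _ _ _ _ _ _ _ _ (@ix_pt R); have L2 := @prep_linr _ _ _ _ _ _ _ _ (@ix_pt R).
have F := @prep_fun _ _ _ _ _ _ _ _ (@ix_pt R) (@points_inj R).
have As := @prep_assoc _ _ _ _ _ _ _ _ (@ix_pt R).
have R1 := prep_1 AS ES (@ix_pt R); have Rin := prep_in AS ES BS (@ix_pt R).
have ex := rep_ex AS ES L1 L2 As R1 Rin.
have [star sP] : exists star : algG R -> algG R -> algG R, forall X Y, repG X Y (star X Y).
  have [f fP] := boolp.choice (P := fun XY Z => repG XY.1 XY.2 Z) (fun XY => ex XY.1 XY.2).
  by exists (fun X Y => f (X, Y)) => X Y; exact: fP (X, Y).
have sb : bilin star := star_bilin L1 L2 F sP.
have sG := star_gDeg AS ES L1 L2 F As R1 Rin sP.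
have sH := star_gH AS ES L1 L2 F As R1 Rin sP.
have D0 : linear (@Dop R).
  have [dGl _ _ _] := dG; have [kl _ _ _] := KZ.
  by move=> c X Y; rewrite !DopE; case: (gis_DP AS ES dGl kl) => Dl _; exact: Dl.
have leib (a : int) X Y : Deg_hom a X -> Dop (star X Y) = star (Dop X) Y + (-1) ^ a *: star X (Dop Y).
  move=> hX; rewrite !DopE (star_leibniz AS ES BS dl dh dx dg db dG KZ L1 L2 F As R1 Rin sP).
  by rewrite (sg_gDeg AS ES hX) (bilinZl sb).
exists star; split; first by apply/convolution_rep.
split; first by move=> star' /convolution_rep[_ H'] X Y; exact: F (H' X Y) (sP X Y).
split; first exact: (star_assoc F As sP).
split; first exact: sG.
split; first exact: leib.
split.
  split; first by split; [exact: lin_span0|exact: lin_span0|exact: (linf0 D0)].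
  move=> c X Y [hX gX dX] [hY gY dY]; split.
  - by apply: lin_spanD => //; exact: lin_spanZ.
  - by apply: lin_spanD => //; exact: lin_spanZ.
  - by rewrite D0 dX dY scaler0 addr0.
move=> X Y [hX gX dX] [hY gY dY]; split; first exact: sH.
  by rewrite -[0]addr0; exact: sG.
by rewrite (leib 0) // dX dY (bilin0l sb) (bilin0r sb) scaler0 addr0.
Qed.
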